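(* In the smooth-front model described in the context, let conditions $\mathscr{R}_1$–$\mathscr{R}_4$ be fulfilled: ($\mathscr{R}_1$) for all $i=1,2$ and $k=1,\dots,K$, $s_{i,k}(t)=0$ for $t\le 0$ and $s_{i,k}(t)>0$ for $t>0$; ($\mathscr{R}_2$) $s_{i,k}\in\mathcal C^2$ for $i=1,2$, $k=1,\dots,K$, and the set $\Theta\subset\mathbb R^4$ is open, bounded and convex; ($\mathscr{R}_3$) $\inf_{\vartheta\in\Theta}\inf_{e\in\mathbb R^4,\|e\|_4=1}e^\top \mathrm I(\vartheta)e>0$; ($\mathscr{R}_4$) for any $\varepsilon>0$, $$\inf_{\vartheta_0\in\Theta}\ \inf_{\vartheta\in\Theta,\ \|\vartheta-\vartheta_0\|_4>\varepsilon}\ \sum_{k=1}^K\int_0^T\Bigl[s_{1,k}(t-\tau_k(\vartheta^{(1)}))+s_{2,k}(t-\tau_k(\vartheta^{(2)}))-s_{1,k}(t-\tau_k(\vartheta_0^{(1)}))-s_{2,k}(t-\tau_k(\vartheta_0^{(2)}))\Bigr]^2dt>0 .$$ Then, uniformly in $\vartheta_0\in\mathbb K$ for every compact $\mathbb K\subset\Theta$, the MLE $\hat\vartheta_n$ and the Bayesian estimators $\tilde\vartheta_n$ are consistent and asymptotically normal under $\mathbf P^{(n)}_{\vartheta_0}$ as $n\to\infty$: $$\sqrt n\,(\hat\vartheta_n-\vartheta_0)\Longrightarrow\zeta,\qquad \sqrt n\,(\tilde\vartheta_n-\vartheta_0)\Longrightarrow\zeta,\qquad \zeta\sim\mathcal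 N\bigl(0,\mathrm I(\vartheta_0)^{-1}\bigr);$$ for any $p>0$ the moments converge: $$n^{p/2}\,\mathbf E_{\vartheta_0}\|\hat\vartheta_n-\vartheta_0\|_4^p\to\mathbf E_{\vartheta_0}\|\zeta\|_4^p,\qquad n^{p/2}\,\mathbf E_{\vartheta_0}\|\tilde\vartheta_n-\vartheta_0\|_4^p\to\mathbf E_{\vartheta_0}\|\zeta\|_4^p;$$ and both the MLE and the Bayesian estimators are asymptotically efficient.
   Context: **Geometry.** $K\ge4$ detectors are at known, pairwise distinct points $D_k=(x_k,y_k)^\top\in\mathbb R^2$, $k=1,\dots,K$. Two sources are at unknown points. The unknown parameter is $\vartheta=(\vartheta_1,\dots,\vartheta_4)^\top\in\Theta\subset\mathbb R^4$, also written $\vartheta=(\vartheta^{(1)},\vartheta^{(2)})$, where $\vartheta^{(1)}=(\vartheta_1,\vartheta_2)^\top$ and $\vartheta^{(2)}=(\vartheta_3,\vartheta_4)^\top$ are the positions of the first and second source. The true value is $\vartheta_0=(\vartheta_0^{(1)},\vartheta_0^{(2)})$. For $\vartheta\in\Theta$ a position of a source never coincides with a position of a detector. $\|\cdot\|_2,\|\cdot\|_4$ are the Euclidean norms of $\mathbb R^2,\mathbb R^4$. The arrival time at detector $k$ of the signal of source $i$ is $\tau_k(\vartheta^{(i)})=\nu^{-1}\|D_k-\vartheta^{(i)}\|_2$, with known speed $\nu>0$. **Observations (smooth fronts).** Let $T>0$, $\lambda_0>0$ be known. One observes $K$ independent inhomogeneous Poisson processes $X^K=(X_1,\dots,X_K)$,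 $X_k=(X_k(t),0\le t\le T)$, with intensity functions $\lambda_{k,n}(\vartheta,t)=n\lambda_k(\vartheta,t)$, where $$\lambda_k(\vartheta,t)=s_{1,k}\bigl(t-\tau_k(\vartheta^{(1)})\bigr)+s_{2,k}\bigl(t-\tau_k(\vartheta^{(2)})\bigr)+\lambda_0,\qquad 0\le t\le T,$$ for known functions $s_{i,k}:\mathbb R\to[0,\infty)$. $\mathbf P^{(n)}_\vartheta$ is the law of $X^K$, $\mathbf E_\vartheta$ the expectation. The asymptotics is $n\to\infty$. **Fisher information.** $\displaystyle \mathrm I(\vartheta)=\sum_{k=1}^K\int_0^T\frac{\dot\lambda_k(\vartheta,t)\,\dot\lambda_k(\vartheta,t)^\top}{\lambda_k(\vartheta,t)}\,dt$, a $4\times4$ matrix, where $\dot\lambda_k$ is the (column) gradient of $\lambda_k$ with respect to $\vartheta$. **Estimators.** The likelihood ratio is $$L(\vartheta,X^K)=\exp\Bigl\{\sum_{k=1}^K\int_0^T\ln\frac{\lambda_{k,n}(\vartheta,t)}{n\lambda_0}\,dX_k(t)-\sum_{k=1}^K\int_0^T[\lambda_{k,n}(\vartheta,t)-n\lambda_0]\,dt\Bigr\}.$$ The MLE $\hat\vartheta_n$ is defined by $L(\hat\vartheta_n,X^K)=\sup_{\vartheta\in\Theta}L(\vartheta,X^K)$. The Bayesian estimator (quadratic loss) is $\tilde\vartheta_n=\int_\Theta\vartheta p(\vartheta)L(\vartheta,X^K)d\vartheta\big/\int_\Theta p(\vartheta)L(\vartheta,X^K)d\vartheta$, where $p$ is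 a strictly positive continuous prior density on $\Theta$ (the assertions are for every such $p$). **Efficiency.** Under the conditions, every estimator $\bar\vartheta_n$ satisfies, for each $\vartheta_0\in\Theta$, $$\lim_{\varepsilon\to0}\liminf_{n\to\infty}\sup_{\|\vartheta-\vartheta_0\|_4\le\varepsilon}n\,\mathbf E_\vartheta\|\bar\vartheta_n-\vartheta\|_4^2\ \ge\ \mathbf E_{\vartheta_0}\|\zeta\|_4^2,\qquad\zeta\sim\mathcal N(0,\mathrm I(\vartheta_0)^{-1}).$$ An estimator is called asymptotically efficient if equality holds in this inequality for all $\vartheta_0\in\Theta$. *)

(* Defs.v *)
From HB Require Import structures.
From mathcomp Require Import all_boot all_order all_algebra.
From mathcomp Require Import all_classical all_reals all_analysis.

Set Implicit Arguments.
Unset Strict Implicit.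
Unset Printing Implicit Defensive.

Import Order.TTheory GRing.Theory Num.Theory.
Import numFieldNormedType.Exports.

Local Open Scope classical_set_scope.
Local Open Scope ring_scope.

(* Points of R^2 and R^4 are row vectors: the transposes of the columns that
   are usual in statistics. *)

(* The norm `|x| of 'rV[R]_n in the library is the sup norm. *)
Definition enorm (R : realType) (n : nat) (x : 'rV[R]_n) : R :=
  Num.sqrt (\sum_(i < n) x ord0 i ^+ 2).

Definition vec4 (R : realType) (z : R * R * R * R) : 'rV[R]_4 :=
  \row_i tnth [tuple z.1.1.1; z.1.1.2; z.1.2; z.2] i.

(* Integration over R^4: 'rV[R]_4 has no measurable structure, hence the detour
   through the product of four copies of the Lebesgue measure. *)
Notation lebesgue4 R :=
  (@lebesgue_measure R \x @lebesgue_measure R \x @lebesgue_measure R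
   \x @lebesgue_measure R)%E.

Definition int4 (R : realType) (A : set 'rV[R]_4) (g : 'rV[R]_4 -> R) : R :=
  \int[lebesgue4 R]_(z in @vec4 R @^-1` A) g (vec4 z).

Record network (R : realType) (K : nat) := Network {
  detector : 'I_K -> 'rV[R]_2 ;
  speed : R ;                         (* nu *)
  horizon : R ;                       (* T *)
  noise : R ;                         (* lambda_0 *)
  front : 'I_2 -> 'I_K -> R -> R ;    (* s_{i,k} *)
  param : set 'rV[R]_4                (* Theta *)
}.

Definition source (R : realType) (th : 'rV[R]_4) (i : 'I_2) : 'rV[R]_2 :=
  if i == ord0 then @lsubmx R 1 2 2 th else @rsubmx R 1 2 2 th.

Definition arrival (R : realType) (K : nat) (N : network R K) (k : 'I_K)
    (x : 'rV[R]_2) : R :=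
  (speed N)^-1 * enorm (detector N k - x).

Definition signal (R : realType) (K : nat) (N : network R K) (k : 'I_K)
    (th : 'rV[R]_4) (t : R) : R :=
  \sum_(i < 2) front N i k (t - arrival N k (source th i)).

Definition intensity (R : realType) (K : nat) (N : network R K) (k : 'I_K)
    (th : 'rV[R]_4) (t : R) : R :=
  signal N k th t + noise N.

Definition grad_intensity (R : realType) (K : nat) (N : network R K) (k : 'I_K)
    (th : 'rV[R]_4) (t : R) : 'rV[R]_4 :=
  \row_a 'D_(delta_mx ord0 a) (fun x : 'rV[R]_4 => intensity N k x t) th.

Definition fisher (R : realType) (K : nat) (N : network R K) (th : 'rV[R]_4) :
    'M[R]_4 :=
  \matrix_(a, b) \sum_(k < K) \int[@lebesgue_measure R]_(t in `[0, horizon N])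
    (((grad_intensity N k th t)^T *m grad_intensity N k th t) a b
       / intensity N k th t).

(* All infima are taken in the extended reals, so that the infimum over an empty
   set is +oo. *)

Definition cond_R1 (R : realType) (K : nat) (N : network R K) : Prop :=
  forall (i : 'I_2) (k : 'I_K) (t : R),
    (t <= 0 -> front N i k t = 0) /\ (0 < t -> 0 < front N i k t).

Definition class_C2 (R : realType) (f : R -> R) : Prop :=
  [/\ forall t : R, derivable f t 1,
      forall t : R, derivable (derive1 f) t 1 &
      continuous (derive1 (derive1 f))].

Definition cond_R2 (R : realType) (K : nat) (N : network R K) : Prop :=
  [/\ forall (i : 'I_2) (k : 'I_K), class_C2 (front N i k),
      open (param N),
      bounded_set (param N) &
      convex_set (param N : set (convex_lmodType 'rV[R]_4))].

Definition cond_R3 (R : realType) (K : nat) (N : network R K) : Prop :=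
  (0 < ereal_inf [set
     ereal_inf [set ((e *m fisher N th *m e^T) ord0 ord0)%:E
               | e in [set e : 'rV[R]_4 | enorm e = 1%R]]
     | th in param N])%E.

Definition cond_R4 (R : realType) (K : nat) (N : network R K) : Prop :=
  forall eps : R, 0 < eps ->
  (0 < ereal_inf [set
     ereal_inf [set
       (\sum_(k < K) \int[@lebesgue_measure R]_(t in `[0%R, horizon N])
          (signal N k th t - signal N k th0 t) ^+ 2)%R%:E
       | th in [set th | param N th /\ (eps < enorm (th - th0))%R]]
     | th0 in param N])%E.

(* A trajectory of a counting process is an element of [cumulative R R]; only
   its values on [0, T] matter. [poisson_prob r _] is the Poisson law of mean r,
   its second argument being unused; at r = 0 it is the Dirac mass at 0, unlike
   [poisson_pmf]. *)
Definition poisson_process (R : realType) (d : measure_display)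
    (Om : measurableType d) (P : probability Om R) (T : R) (lam : R -> R)
    (X : Om -> cumulative R R) : Prop :=
  [/\ forall om : Om, X om 0 = 0 /\
        forall t : R, 0 <= t <= T -> X om t \is a Num.nat,
      forall t : R, 0 <= t <= T -> measurable_fun setT (fun om => X om t : R),
      forall (u v : R) (j : nat), 0 <= u -> u <= v -> v <= T ->
        P [set om | X om v - X om u = j%:R] =
        poisson_prob (\int[@lebesgue_measure R]_(t in `[u, v]) lam t) j
                     [set j] &
      (* independent increments *)
      forall (m : nat) (t : nat -> R) (B : 'I_m -> set R),
        0 <= t 0%N -> t m <= T -> {homo t : a b / (a <= b)%N >-> a <= b} ->
        (forall j : 'I_m, measurable (B j)) ->
        P (\bigcap_(j in [set: 'I_m])
             [set om | B j (X om (t j.+1) - X om (t j))]) =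
        (\prod_(j < m) P [set om | B j (X om (t j.+1) - X om (t j))%R])%E].

(* The sigma-algebra generated by the trajectory on [0, T]. *)
Definition process_sigma (R : realType) (Om : Type) (T : R)
    (X : Om -> cumulative R R) : set (set Om) :=
  <<s [set A | exists (t : R) (B : set R),
        [/\ 0 <= t <= T, measurable B & A = [set om | B (X om t)]]] >>.

Definition independent_processes (R : realType) (d : measure_display)
    (Om : measurableType d) (P : probability Om R) (T : R) (K : nat)
    (X : 'I_K -> Om -> cumulative R R) : Prop :=
  forall A : 'I_K -> set Om, (forall k : 'I_K, process_sigma T (X k) (A k)) ->
    P (\bigcap_(k in [set: 'I_K]) A k) = (\prod_(k < K) P (A k))%E.

Definition observation (R : realType) (K : nat) (N : network R K)
    (d : measure_display) (Om : measurableType d) (n : nat) (th : 'rV[R]_4)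
    (P : probability Om R) (X : 'I_K -> Om -> cumulative R R) : Prop :=
  (forall k : 'I_K, poisson_process P (horizon N)
     (fun t => n%:R * intensity N k th t) (X k)) /\
  independent_processes P (horizon N) X.

(* The integral against dX_k is the Lebesgue-Stieltjes integral over ]0, T],
   i.e. the sum of the integrand over the jump times of X_k. *)
Definition likelihood (R : realType) (K : nat) (N : network R K) (n : nat)
    (X : 'I_K -> cumulative R R) (th : 'rV[R]_4) : R :=
  expR (\sum_(k < K) (\int[lebesgue_stieltjes_measure (X k)]_(t in
            `]0, horizon N])
          ln (n%:R * intensity N k th t / (n%:R * noise N)))
        - \sum_(k < K) (\int[@lebesgue_measure R]_(t in `[0, horizon N])
            (n%:R * intensity N k th t - n%:R * noise N))).

(* As Theta is open, the supremum over Theta may be attained only on the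
   boundary: an estimator takes its values in the closure of Theta, where the
   same formula defines the likelihood. *)
Definition is_mle (R : realType) (K : nat) (N : network R K)
    (d : measure_display) (Om : measurableType d) (n : nat)
    (X : 'I_K -> Om -> cumulative R R) (est : Om -> 'rV[R]_4) : Prop :=
  (forall a : 'I_4, measurable_fun setT (fun om => est om ord0 a)) /\
  forall om : Om, closure (param N) (est om) /\
    (likelihood N n (fun k => X k om) (est om))%:E =
    ereal_sup [set (likelihood N n (fun k => X k om) th)%:E | th in param N].

Definition prior_density (R : realType) (A : set 'rV[R]_4)
    (q : 'rV[R]_4 -> R) : Prop :=
  [/\ forall th : 'rV[R]_4, A th -> 0 < q th,
      {within A, continuous q} &
      (\int[lebesgue4 R]_(z in @vec4 R @^-1` A) (q (vec4 z))%:E = 1)%E].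

Definition bayes (R : realType) (K : nat) (N : network R K)
    (q : 'rV[R]_4 -> R) (n : nat) (X : 'I_K -> cumulative R R) : 'rV[R]_4 :=
  \row_a (int4 (param N) (fun th => th ord0 a * q th * likelihood N n X th)
          / int4 (param N) (fun th => q th * likelihood N n X th)).

(* Density of N(0, S) for a positive definite S. *)
Definition gauss_pdf (R : realType) (S : 'M[R]_4) (x : 'rV[R]_4) : R :=
  (Num.sqrt ((2 * pi) ^+ 4 * \det S))^-1
  * expR (- (x *m invmx S *m x^T) ord0 ord0 / 2).

(* E g(zeta) for zeta ~ N(0, S). *)
Definition gauss_mean (R : realType) (S : 'M[R]_4) (g : 'rV[R]_4 -> R) :
    \bar R :=
  (\int[lebesgue4 R]_z (g (vec4 z) * gauss_pdf S (vec4 z))%:E)%E.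

Definition consistent_on (R : realType)
    (d : nat -> measure_display) (Om : forall n : nat, measurableType (d n))
    (P : forall n : nat, 'rV[R]_4 -> probability (Om n) R)
    (est : forall n : nat, Om n -> 'rV[R]_4)
    (KK : set 'rV[R]_4) : Prop :=
  forall del eps : R, 0 < del -> 0 < eps ->
  \forall n \near \oo, forall th : 'rV[R]_4, KK th ->
    (P n th [set om | (del < enorm (est n om - th))%R] < eps%:E)%E.

(* Convergence in distribution, uniformly over KK. *)
Definition asymptotically_normal_on (R : realType) (K : nat) (N : network R K)
    (d : nat -> measure_display) (Om : forall n : nat, measurableType (d n))
    (P : forall n : nat, 'rV[R]_4 -> probability (Om n) R)
    (est : forall n : nat, Om n -> 'rV[R]_4)
    (KK : set 'rV[R]_4) : Prop :=
  forall f : 'rV[R]_4 -> R, continuous f ->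
  (exists M : R, forall x : 'rV[R]_4, `|f x| <= M) ->
  forall eps : R, 0 < eps ->
  \forall n \near \oo, forall th : 'rV[R]_4, KK th ->
    (`| \int[P n th]_om (f (Num.sqrt n%:R *: (est n om - th)))%:E
        - gauss_mean (invmx (fisher N th)) f | < eps%:E)%E.

Definition moments_converge_on (R : realType) (K : nat) (N : network R K)
    (d : nat -> measure_display) (Om : forall n : nat, measurableType (d n))
    (P : forall n : nat, 'rV[R]_4 -> probability (Om n) R)
    (est : forall n : nat, Om n -> 'rV[R]_4)
    (p : R) (KK : set 'rV[R]_4) : Prop :=
  forall eps : R, 0 < eps ->
  \forall n \near \oo, forall th : 'rV[R]_4, KK th ->
    (`| (n%:R `^ (p / 2))%R%:E
          * \int[P n th]_om (enorm (est n om - th) `^ p)%R%:E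
        - gauss_mean (invmx (fisher N th)) (fun x => enorm x `^ p)%R |
     < eps%:E)%E.

Definition asymptotically_efficient (R : realType) (K : nat) (N : network R K)
    (d : nat -> measure_display) (Om : forall n : nat, measurableType (d n))
    (P : forall n : nat, 'rV[R]_4 -> probability (Om n) R)
    (est : forall n : nat, Om n -> 'rV[R]_4) : Prop :=
  forall th0 : 'rV[R]_4, param N th0 ->
  (fun eps : R => limn_einf (fun n : nat =>
     ereal_sup [set (n%:R%:E * \int[P n th]_om
                       ((enorm (est n om - th) ^+ 2)%:E))%E
               | th in [set th | param N th /\ enorm (th - th0) <= eps]]))
    @ 0^'+ --> gauss_mean (invmx (fisher N th0)) (fun x => enorm x ^+ 2).

Definition asymptotic_properties (R : realType) (K : nat) (N : network R K)
    (d : nat -> measure_display) (Om : forall n : nat, measurableType (d n))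
    (P : forall n : nat, 'rV[R]_4 -> probability (Om n) R)
    (est : forall n : nat, Om n -> 'rV[R]_4) : Prop :=
  (forall KK : set 'rV[R]_4, compact KK -> KK `<=` param N ->
    [/\ consistent_on P est KK,
        asymptotically_normal_on N P est KK &
        forall p : R, 0 < p -> moments_converge_on N P est p KK]) /\
  asymptotically_efficient N P est.

(* Main.v *)
(* Idea. On every trajectory, integration by parts writes the log-likelihood ratio at th against th0 as the sum
   over the detectors of the integrals of ln (lambda_k th / lambda_k th0) against the compensated paths, minus n
   times a Kullback divergence. The divergence is at least c |th - th0|^2 on the closure of Theta (R3 near th0, R4
   far from it), so with W a functional of the paths of bounded exponential moments, the ratio is at most
   C sqrt n |h| W - c n |h|^2 at th0 + h; and for |h| small it is sqrt n D.h - n h.I(th0)h / 2 up to an error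
   e (sqrt n |h| W + n |h|^2), where D is the normalized score. Both bounds are uniform over compact sets of th0.
   They imply deterministically, for the maximum likelihood estimator and for the posterior mean alike, that
   U = sqrt n (est - th0) satisfies |U| <= A W, and that |U - D I(th0)^-1| <= e once n is large and W bounded: no
   tightness in function spaces is needed. The characteristic function of D is computed from the independent
   Poisson increments of the paths over a grid of n cells, with an explicit error. Convolution with a Gaussian
   kernel turns closeness of characteristic functions, with bounded moments, into closeness of the means of
   continuous functions of polynomial growth, uniformly over the laws involved. Efficiency is the convergence of
   second moments, uniform on a ball, together with the continuity of th |-> I(th). *)

Require Import Defs.
From HB Require Import structures.
From mathcomp Require Import all_boot all_order all_algebra.
From mathcomp Require Import all_classical all_reals all_analysis.
From mathcomp Require Import measurable_realfun.
From mathcomp Require Import ring lra.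

Set Implicit Arguments.
Unset Strict Implicit.
Unset Printing Implicit Defensive.

Import Order.TTheory GRing.Theory Num.Theory.
Import numFieldNormedType.Exports.

Local Open Scope classical_set_scope.
Local Open Scope ring_scope.

(** * Measurability and integration *)

(** The demand that shapes the proof is uniformity over compact sets of th0: the laws for different
    n live on unrelated spaces, so every limit is replaced by an inequality whose constants depend
    on the compact set only. The two derivatives of the fronts are spent separately. Integration by
    parts costs one derivative in time; it makes a stochastic integral a linear functional of the
    path, bounded by the C^1 size of its integrand. Applied to differences and to Taylor remainders
    in th, this bound controls the random field without any supremum over th of random variables.
    The second derivative makes the time derivative of ln lambda differentiable in th as well. The
    size W of the paths is a mean over grid points rather than an integral or a supremum, so that
    Jensen's inequality reduces its exponential moment to those of single Poisson variables. Errors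
    in characteristic functions may grow like (1 + |v|)^4 in the frequency v, since the Gaussian
    factor of the smoothing kernel integrates this growth. *)

Lemma lt_mx_norm (R : realType) n (x : 'rV[R]_n) (r : R) : 0 < r ->
  (forall i, `|x ord0 i| < r) -> `|x| < r.
Proof.
move=> r0 xr; rewrite [`|x|]mx_normrE.
by apply/bigmax_ltP; split => // -[i j] _ /=; rewrite (ord1 i).
Qed.

Lemma ge_coord_norm (R : realType) n (x : 'rV[R]_n) i : `|x ord0 i| <= `|x|.
Proof.
rewrite [`|x|]mx_normrE.
by apply/bigmax_geP; right => /=; exists (ord0, i).
Qed.

(** An open set is the union of the rational cubes inside it, a countable family; the preimage of a
    cube is a finite intersection of preimages of intervals by the coordinates. *)
Lemma open_preimage_measurable d (T : measurableType d) (R : realType) n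
    (Y : T -> 'rV[R]_n) (A : set 'rV[R]_n) :
  (forall i, measurable_fun setT (fun x => Y x ord0 i)) -> open A ->
  measurable (Y @^-1` A).
Proof.
move=> mY oA.
pose C (p : 'rV[rat]_n * nat) := [set y : 'rV[R]_n |
  forall i, `|ratr (p.1 ord0 i) - y ord0 i| < p.2.+1%:R^-1].
pose F (p : 'rV[rat]_n * nat) := if `[< C p `<=` A >] then Y @^-1` C p else set0.
have -> : Y @^-1` A = \bigcup_p F p.
  apply/seteqP; split => [x /= Ax|x [p _]]; last first.
    by rewrite /F; case: asboolP => //= pA; apply: pA.
  have := oA; rewrite openE => /(_ _ Ax) /nbhs_ballP[e /= e0 eA].
  (* A cube of radius 1/(m+1) whose centre is that close to [Y x] stays within 2/(m+1) < e of
     [Y x]. *)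
  pose m := Num.trunc (2 / e).
  have m1 : m.+1%:R^-1 + m.+1%:R^-1 < e.
    have : 2 / e < m.+1%:R by rewrite truncnS_gt.
    rewrite ltr_pdivrMr// => h.
    by rewrite -[X in X + X]mul1r -mulrDl ltr_pdivrMr ?ltr0n// mulrC.
  have mp : (0 : R) < m.+1%:R^-1 by rewrite invr_gt0 ltr0n.
  have ex (i : 'I_n) : exists q : rat, `|ratr q - Y x ord0 i| < m.+1%:R^-1.
    have : Y x ord0 i < Y x ord0 i + m.+1%:R^-1 by rewrite ltrDl.
    move/rat_in_itvoo => [q]; rewrite in_itv/= => /andP[q1 q2].
    by exists q; rewrite gtr0_norm ?subr_gt0// ltrBlDl.
  pose c := \row_i sval (cid (ex i)).
  exists (c, m) => //; rewrite /F; case: asboolP => [_ i|].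
    by rewrite /c /= mxE; case: cid.
  case; move=> y yC; apply: eA; rewrite mx_norm_ball /ball_/=.
  apply: lt_mx_norm => // i; rewrite mxE mxE.
  have h1 := yC i; have : `|ratr (c ord0 i) - Y x ord0 i| < m.+1%:R^-1.
    by rewrite /c mxE; case: cid.
  move: h1; rewrite /=; set u := ratr _; set v := _ ord0 i; set w := _^-1.
  move=> h1 h2; apply: le_lt_trans m1.
  rewrite -(subrKA u); apply: (le_trans (ler_normD _ _)).
  by rewrite distrC lerD// ltW.
apply: countable_bigcupT_measurable => [|p]; first exact: countableP.
rewrite /F; case: asboolP => // _.
have -> : Y @^-1` C p = \bigcap_(i in [set: 'I_n])
   (fun x => `|ratr (p.1 ord0 i) - Y x ord0 i|) @^-1` [set r | r < p.2.+1%:R^-1].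
  by apply/seteqP; split => [x /= h i _|x h i]; [exact: h|apply: (h i)].
apply: fin_bigcap_measurable => [|i _]; first exact: finite_finset.
rewrite -[X in measurable X]setTI.
have -> : [set r : R | r < p.2.+1%:R^-1] = [set` `]-oo, p.2.+1%:R^-1[].
  by apply/seteqP; split => r /=; rewrite in_itv.
have : measurable_fun setT (fun x => `|ratr (p.1 ord0 i) - Y x ord0 i|).
  by apply: measurableT_comp => //; apply: measurable_funB.
by apply=> //; exact: measurable_itv.
Qed.

Lemma continuous_on_measurable d (T : measurableType d) (R : realType) n
    (Y : T -> 'rV[R]_n) (A : set 'rV[R]_n) (g : 'rV[R]_n -> R) :
  (forall i, measurable_fun setT (fun x => Y x ord0 i)) -> open A ->
  (forall x, A x -> {for x, continuous g}) ->
  measurable_fun (Y @^-1` A) (g \o Y).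
Proof.
move=> mY oA cg.
apply: (measurability _ (RGenOInfty.measurableE R)) => _ [_ [r ->] <-].
rewrite (_ : _ `&` _ = Y @^-1` (A `&` g @^-1` `]r, +oo[)); last first.
  by apply/seteqP; split.
apply: open_preimage_measurable => //.
rewrite openE => x [Ax gx]; apply: filterI.
  by move: oA; rewrite openE => /(_ _ Ax).
apply: (cg _ Ax); exact: open_nbhs_nbhs.
Qed.

Lemma continuous_measurable_comp d (T : measurableType d) (R : realType) n
    (Y : T -> 'rV[R]_n) (g : 'rV[R]_n -> R) :
  (forall i, measurable_fun setT (fun x => Y x ord0 i)) -> continuous g ->
  measurable_fun setT (g \o Y).
Proof.
move=> mY cg; rewrite -(preimage_setT Y).
by apply: continuous_on_measurable => // [|x _]; [exact: openT|exact: cg].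
Qed.

(* Right continuity makes (x, t) |-> Z x t the limit of Z x (t_m), where t_m is
   the right end point of the cell of t in the grid of mesh 1/(m+1). *)
Lemma right_continuous_jointly_measurable d (T : measurableType d)
    (R : realType) (Z : T -> R -> R) :
  (forall t, measurable_fun setT (Z ^~ t)) ->
  (forall x t, Z x s @[s --> t^'+] --> Z x t) ->
  measurable_fun [set: T * measurableTypeR R] (fun p => Z p.1 p.2).
Proof.
move=> mZ rcZ.
pose h (m : nat) (t : R) : R := (Num.floor (t * m.+1%:R) + 1)%:~R / m.+1%:R.
apply: (@measurable_fun_cvg _ _ _ _ (fun m p => Z p.1 (h m p.2))) => [m|[x t] _].
  move=> _ B mB; rewrite setTI.
  pose F (z : int) := ((fun x => Z x ((z + 1)%:~R / m.+1%:R)) @^-1` B) `*`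
     ((fun t : R => t * m.+1%:R) @^-1` `[z%:~R, (z + 1)%:~R[).
  have -> : (fun p : T * R => Z p.1 (h m p.2)) @^-1` B = \bigcup_z F z.
    apply/seteqP; split => [[x t] /= Bx|[x t] [z _ [/= h1 h2]]].
      exists (Num.floor (t * m.+1%:R)) => //; split => //=.
      by rewrite in_itv/= floor_le_tmp floorD1_gt.
    rewrite /h (_ : Num.floor _ = z)//; apply: floor_def.
    by move: h2; rewrite /= in_itv.
  apply: countable_bigcupT_measurable => [|z]; first exact: countableP.
  apply: measurableX.
    by rewrite -[X in measurable X]setTI; exact: mZ.
  rewrite -[X in measurable X]setTI.
  have : measurable_fun setT (fun t : measurableTypeR R => t * m.+1%:R).
    exact: mulrr_measurable.
  by apply => //; exact: measurable_itv.
have /cvg_at_rightP := rcZ x t; apply; split => [m|].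
  by rewrite /h ltr_pdivlMr ?ltr0n// floorD1_gt.
apply: (@squeeze_cvgr _ _ _ _ (cst t) (fun m => t + m.+1%:R^-1)).
- near=> m; rewrite /h /cst; apply/andP; split.
    by rewrite ler_pdivlMr ?ltr0n// ltW// floorD1_gt.
  by rewrite ler_pdivrMr ?ltr0n// mulrDl mulVf ?pnatr_eq0// intrD lerD2r floor_le_tmp.
- exact: cvg_cst.
- rewrite -[X in _ --> X]addr0; apply: cvgD; first exact: cvg_cst.
  by have := @cvg_harmonic R.
Unshelve. all: by end_near. Qed.

Lemma bounded_integrable d (T : measurableType d) (R : realType)
    (mu : {measure set T -> \bar R}) (A : set T) (f : T -> R) (M : R) :
  measurable A -> (mu A < +oo)%E -> measurable_fun A f ->
  (forall x, A x -> `|f x| <= M) -> mu.-integrable A (EFin \o f).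
Proof.
move=> mA Afin mf fM; apply: measurable_bounded_integrable => //.
exists M; split; first exact: num_real.
by move=> M' MM' x Ax; apply: le_trans (ltW MM'); exact: fM.
Qed.

Lemma stieltjes_itv_oc (R : realType) (F : cumulative R R) (a b : R) : a <= b ->
  lebesgue_stieltjes_measure F `]a, b]%classic = (F b - F a)%:E.
Proof.
move=> ab; rewrite /lebesgue_stieltjes_measure /= /measure_extension.
rewrite measurable_mu_extE/=; last exact: is_ocitv.
by rewrite wlength_itv_bnd.
Qed.

Lemma is_derive_continuous (R : realType) (g g' : R -> R) :
  (forall t : R, is_derive t 1 g (g' t)) -> continuous g.
Proof.
move=> dg t; apply: differentiable_continuous; apply/derivable1_diffP.
by have [] := dg t.
Qed.

Lemma is_derive_oo_LR (R : realType) (g g' : R -> R) (a b : R) :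
  (forall t : R, is_derive t 1 g (g' t)) -> derivable_oo_LRcontinuous g a b.
Proof.
move=> dg; have cg := is_derive_continuous dg; split.
- by move=> t _; have [] := dg t.
- by apply: cvg_at_right_filter; exact: cg.
- by apply: cvg_at_left_filter; exact: cg.
Qed.

Lemma FTC2 (R : realType) (g g' : R -> R) (a b : R) : a <= b ->
  (forall t : R, is_derive t 1 g (g' t)) -> continuous g' ->
  (\int[@lebesgue_measure R]_(t in `[a, b]) (g' t)%:E = (g b - g a)%:E)%E.
Proof.
rewrite le_eqVlt => /predU1P[<- _ _|ab dg cg'].
  by rewrite set_itv1 integral_set1 subrr.
rewrite (@continuous_FTC2 _ _ g _ _ ab) ?EFinB//.
- exact: continuous_subspaceT.
- exact: is_derive_oo_LR dg.
- by move=> t _; rewrite derive1E; have [] := dg t.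
Qed.

Lemma RFTC2 (R : realType) (g g' : R -> R) (a b : R) : a <= b ->
  (forall t : R, is_derive t 1 g (g' t)) -> continuous g' ->
  \int[@lebesgue_measure R]_(t in `[a, b]) g' t = g b - g a.
Proof. by move=> ab dg cg'; rewrite /Rintegral (FTC2 ab dg cg'). Qed.

Lemma continuous_itv_integrable (R : realType) (f : R -> R) (a b : R) :
  continuous f -> (@lebesgue_measure R).-integrable `[a, b] (EFin \o f).
Proof.
move=> cf; apply: continuous_compact_integrable; first exact: segment_compact.
exact: continuous_subspaceT.
Qed.

Lemma continuous_itv_bounded (R : realType) (f : R -> R) (a b : R) :
  continuous f -> exists2 M : R, 0 <= M & forall t, a <= t <= b -> `|f t| <= M.
Proof.
move=> cf; have [ab|ba] := leP a b; last first.
  by exists 0 => // t /andP[at_ tb]; have := le_trans at_ tb; rewrite leNgt ba.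
have cnf : {within `[a, b], continuous (fun t => `|f t|)}.
  apply: continuous_subspaceT => t.
  by apply: cvg_norm; exact: cf.
have [c _ cmax] := EVT_max ab cnf; by exists `|f c|.
Qed.

(** Fubini for g'(y) on the triangle 0 < x <= y <= T under dF(x) dy. Integrating in y leaves g(T) -
    g(x); integrating in x leaves g'(y) F(y), because ]0, y] has mass F(y) - F(0). *)
Lemma stieltjes_parts (R : realType) (F : cumulative R R) (T : R)
    (g g' : R -> R) : F 0 = 0 -> 0 <= T ->
  (forall t : R, is_derive t 1 g (g' t)) -> continuous g' ->
  \int[lebesgue_stieltjes_measure F]_(t in `]0, T]) g t =
  g T * F T - \int[@lebesgue_measure R]_(t in `[0, T]) (g' t * F t).
Proof.
move=> F0 T0 dg cg'.
set mu := lebesgue_stieltjes_measure F; set leb := @lebesgue_measure R.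
have cg := is_derive_continuous dg.
pose D : set (measurableTypeR R * measurableTypeR R) :=
  [set p | ((0 < p.1) && (p.1 <= p.2)) && (p.2 <= T)].
have mD : measurable D.
  have : measurable_fun [set: measurableTypeR R * measurableTypeR R]
      (fun p => ((0 < p.1) && (p.1 <= p.2)) && (p.2 <= T)).
    apply: measurable_and; first apply: measurable_and.
    - exact: measurable_fun_ltr.
    - exact: measurable_fun_ler.
    - exact: measurable_fun_ler.
  by move=> /(_ measurableT [set true]); rewrite setTI; apply.
have DE x y : \1_D (x, y) = (((0 < x) && (x <= y)) && (y <= T))%:R :> R.
  rewrite indicE; case: (boolP ((0 < x <= y) && (y <= T))) => h.
    by rewrite mem_set.
  by rewrite memNset//; exact/negP.
have mg' : measurable_fun setT (g' : measurableTypeR R -> R).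
  exact: continuous_measurable_fun.
pose phi (p : measurableTypeR R * measurableTypeR R) : R := g' p.2 * \1_D p.
have mphi : measurable_fun setT phi.
  apply: measurable_funM; first exact: measurableT_comp.
  exact: measurable_indic.
have mufin : (mu `]0%R, T]%classic < +oo)%E by rewrite /mu stieltjes_itv_oc// ltry.
have lebfin : (leb `[0%R, T]%classic < +oo)%E.
  by rewrite /leb lebesgue_measure_itv/=; case: ifP; rewrite ?ltry.
have [M M0 g'M] := @continuous_itv_bounded _ _ 0 T cg'.
have iphi : (mu \x leb)%E.-integrable setT (EFin \o phi).
  rewrite (_ : phi = phi \_ (`]0, T] `*` `[0, T])); last first.
    apply/funext => -[x y]; rewrite patchE; case: ifPn => // xyN.
    rewrite /phi indicE memNset ?mulr0// => /andP[/andP[/= x0 xy] yT].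
    move/negP : xyN; apply; rewrite inE; split => /=; rewrite in_itv/=.
      by rewrite x0 (le_trans xy yT).
    by rewrite yT (le_trans (ltW x0) xy).
  rewrite -restrict_EFin; apply/(integrable_mkcond _ _).1; first exact: measurableX.
  apply: (@bounded_integrable _ _ _ _ _ _ M).
  - exact: measurableX.
  - rewrite [X in (X < _)%E](_ : _ = mu `]0%R, T]%classic * leb `[0%R, T]%classic)%E;
      last exact: product_measure1E.
    rewrite /mu stieltjes_itv_oc// /leb lebesgue_measure_itv/=.
    by case: ifP => _; rewrite ?mule0 -?EFinB -?EFinM ltry.
  - exact: measurable_funTS.
  move=> [x y] [/= _]; rewrite in_itv/= => yT; rewrite /phi normrM indicE.
  apply: le_trans (g'M y yT); rewrite ler_piMr//.
  by case: (_ \in _); rewrite ?normr0 ?normr1.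
have := Fubini iphi; rewrite /=.
under eq_integral => x _.
  rewrite (_ : (\int[leb]_y _)%E = (((fun x => g T - g x) \_ `]0, T]) x)%:E); last first.
    rewrite patchE; case: ifPn => [|xT].
      rewrite inE/= in_itv/= => /andP[x0 xT].
      rewrite -(FTC2 xT dg cg') [RHS]integral_mkcond; apply: eq_integral => y _.
      rewrite patchE /phi DE mem_setE in_itv/= x0/=.
      by case: ifP; rewrite ?mulr1 ?mulr0.
    apply: integral0_eq => y _; rewrite /phi indicE memNset ?mulr0//.
    move=> /andP[/andP[x0 xy] yT]; move: xT; rewrite notin_setE/= in_itv/=; apply.
    by rewrite x0 (le_trans xy yT).
  over.
under [X in _ = X -> _]eq_integral => y _.
  rewrite (_ : (\int[mu]_x _)%E = (((fun y => g' y * F y) \_ `[0, T]) y)%:E); last first.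
    rewrite patchE; case: ifPn => [|yT].
      rewrite inE/= in_itv/= => /andP[y0 yT].
      transitivity (\int[mu]_(x in `]0%R, y]) (g' y)%:E)%E.
        rewrite [RHS]integral_mkcond; apply: eq_integral => x _.
        rewrite patchE /phi/= DE mem_setE in_itv/= yT andbT.
        by case: ifP; rewrite ?mulr1 ?mulr0.
      by rewrite integral_cst// [X in (_ * X)%E](stieltjes_itv_oc F y0) F0 subr0.
    apply: integral0_eq => x _; rewrite /phi indicE memNset ?mulr0//.
    move=> /andP[/andP[/= x0 xy] yT']; move: yT; rewrite notin_setE/= in_itv/=; apply.
    by rewrite yT' (le_trans (ltW x0) xy).
  over.
move=> h.
have ig : mu.-integrable `]0, T] (EFin \o g).
  have [Mg Mg0 gM] := @continuous_itv_bounded _ _ 0 T cg.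
  apply: (@bounded_integrable _ _ _ mu _ _ Mg).
  - exact: measurable_itv.
  - exact: mufin.
  - by apply: measurable_funTS; exact: continuous_measurable_fun.
  by move=> x /=; rewrite in_itv/= => /andP[x0 xT]; apply: gM; rewrite (ltW x0).
have ic : mu.-integrable `]0, T] (EFin \o cst (g T)) 
  by apply: (@bounded_integrable _ _ _ mu _ _ `|g T|).
have mi : measurable (`]0, T]%classic : set (measurableTypeR R)).
  exact: measurable_itv.
have muE : mu `]0, T]%classic = (F T)%:E.
  by have := stieltjes_itv_oc F T0; rewrite F0 subr0.
have e : \int[mu]_(x in `]0, T]) (g T - g x) = \int[leb]_(x in `[0, T]) (g' x * F x).
  rewrite [LHS]Rintegral_mkcond [RHS]Rintegral_mkcond.
  by move: h => /(congr1 fine).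
have ec : \int[mu]_(x in `]0, T]) (cst (g T)) x = g T * F T.
  rewrite (Rintegral_cst _ mi); congr (_ * _).
  by have /(congr1 fine) := muE.
move: e; rewrite (RintegralB mi ic ig) ec => <-.
by rewrite opprB addrCA subrr addr0.
Qed.

(** * Integrability of real-valued functions *)

Section real_integrable.
Context d (T : measurableType d) (R : realType).
Variables (mu : {measure set T -> \bar R}) (D : set T).
Hypothesis mD : measurable D.
Implicit Types f g : T -> R.

Lemma integrable_scale k f : mu.-integrable D (EFin \o f) ->
  mu.-integrable D (EFin \o (fun x => k * f x)).
Proof. by move=> fi; apply: eq_integrable (integrableZl mD k fi). Qed.

Lemma integrable_add f g : mu.-integrable D (EFin \o f) ->
  mu.-integrable D (EFin \o g) ->
  mu.-integrable D (EFin \o (fun x => f x + g x)).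
Proof. by move=> fi gi; apply: eq_integrable (integrableD mD fi gi). Qed.

Lemma integrable_sub f g : mu.-integrable D (EFin \o f) ->
  mu.-integrable D (EFin \o g) ->
  mu.-integrable D (EFin \o (fun x => f x - g x)).
Proof. by move=> fi gi; apply: eq_integrable (integrableB mD fi gi). Qed.

Lemma integrable_norm f : mu.-integrable D (EFin \o f) ->
  mu.-integrable D (EFin \o (fun x => `|f x|)).
Proof. by move=> fi; apply: eq_integrable (integrable_abse fi). Qed.

Lemma integrable_dominated f g : measurable_fun D f ->
  mu.-integrable D (EFin \o g) -> (forall x, D x -> `|f x| <= g x) ->
  mu.-integrable D (EFin \o f).
Proof.
move=> mf gi fg; apply: le_integrable gi => //; first exact/measurable_EFinP.
by move=> x Dx; rewrite lee_fin (le_trans (fg _ Dx))// ler_norm.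
Qed.

End real_integrable.

(** * Linear changes of variables and Fubini *)

(** The identity is required of nonnegative extended-real functions, so it passes to products by
    Tonelli with no integrability condition; the affine maps of R^4 used below are products of four
    affine maps of the line. *)
Definition scales_measure d (T : measurableType d) (R : realType)
    (mu : {measure set T -> \bar R}) (phi : T -> T) (c : {nonneg R}) :=
  measurable_fun setT phi /\ forall F : T -> \bar R, measurable_fun setT F ->
    (forall x, 0 <= F x)%E ->
    (\int[mu]_x F (phi x) = c%:num%:E * \int[mu]_x F x)%E.

Lemma scales_measure_integrable d (T : measurableType d) (R : realType)
    (mu : {measure set T -> \bar R}) (phi : T -> T) c (F : T -> R) :
  scales_measure mu phi c -> mu.-integrable setT (EFin \o F) ->
  mu.-integrable setT (EFin \o (F \o phi)).
Proof.
move=> [mphi sc] /integrableP[/= mF iF]; apply/integrableP; split.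
  by rewrite compA; exact: measurableT_comp.
rewrite (sc (fun x => `|(F x)%:E|%E))//; last exact: measurableT_comp.
exact: lte_mul_pinfty.
Qed.

Lemma scales_measure_Rintegral d (T : measurableType d) (R : realType)
    (mu : {measure set T -> \bar R}) (phi : T -> T) c (F : T -> R) :
  scales_measure mu phi c -> mu.-integrable setT (EFin \o F) ->
  \int[mu]_x F (phi x) = c%:num * \int[mu]_x F x.
Proof.
move=> sc iF; have [mphi scE] := sc.
have iFp := scales_measure_integrable sc iF.
rewrite /Rintegral [X in fine X]integralE [X in _ = _ * fine X]integralE.
have mF : measurable_fun setT (EFin \o F) by case/integrableP : iF.
have pE : (\int[mu]_x (fun x => (F (phi x))%:E)^\+ x =
    c%:num%:E * \int[mu]_x (EFin \o F)^\+ x)%E.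
  rewrite -(scE _ (measurable_funepos mF)) => [|x]; last exact: funepos_ge0.
  by apply: eq_integral => x _; rewrite !funeposE.
have nE : (\int[mu]_x (fun x => (F (phi x))%:E)^\- x =
    c%:num%:E * \int[mu]_x (EFin \o F)^\- x)%E.
  rewrite -(scE _ (measurable_funeneg mF)) => [|x]; last exact: funeneg_ge0.
  by apply: eq_integral => x _; rewrite !funenegE.
have p1 : (\int[mu]_x (EFin \o F)^\+ x)%E \is a fin_num.
  by have := integrable_pos_fin_num measurableT iF.
have n1 : (\int[mu]_x (EFin \o F)^\- x)%E \is a fin_num.
  by have := integrable_neg_fin_num measurableT iF.
rewrite pE nE [X in _ = _ * X](_ : _ = fine (\int[mu]_x (EFin \o F)^\+ x
  - \int[mu]_x (EFin \o F)^\- x)%E)//.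
by rewrite -(fineK p1) -(fineK n1) -!EFinM -!EFinB /= mulrBr.
Qed.

Lemma scales_measure_prod d1 d2 (T1 : measurableType d1)
    (T2 : measurableType d2) (R : realType)
    (m1 : {sigma_finite_measure set T1 -> \bar R})
    (m2 : {sigma_finite_measure set T2 -> \bar R}) phi1 phi2 c1 c2 :
  scales_measure m1 phi1 c1 -> scales_measure m2 phi2 c2 ->
  scales_measure (m1 \x m2)%E (fun p => (phi1 p.1, phi2 p.2))
    (c1%:num * c2%:num)%:nng.
Proof.
move=> [m1p s1] [m2p s2].
have mp : measurable_fun setT (fun p : T1 * T2 => (phi1 p.1, phi2 p.2)).
  by apply: measurable_fun_pair; exact: measurableT_comp.
split=> // F mF F0.
have m12 : measurable_fun setT (fun p : T1 * T2 => F (phi1 p.1, phi2 p.2)).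
  exact: (measurableT_comp mF mp).
rewrite (fubini_tonelli1 (fun p => F (phi1 p.1, phi2 p.2)))//.
rewrite (fubini_tonelli1 F)// /fubini_F/=.
under eq_integral => x _.
  rewrite (s2 (fun y => F (phi1 x, y)))//; last exact: measurableT_comp.
  over.
have mF2 := @measurable_fun_fubini_tonelli_F _ _ _ _ _ m2 F mF F0.
rewrite ge0_integralZl; [|by []|exact: (measurableT_comp mF2 m1p)|by move=> x _; exact: integral_ge0|by []].
rewrite (s1 (fubini_F m2 F))//; last first.
  by move=> x; exact: integral_ge0.
by rewrite muleA -EFinM mulrC.
Qed.

Lemma pushforward_measure_ex d1 d2 (T1 : measurableType d1)
    (T2 : measurableType d2) (R : realType) (mu : {measure set T1 -> \bar R})
    (phi : T1 -> T2) : measurable_fun setT phi ->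
  exists nu : {measure set T2 -> \bar R}, (forall A, nu A = mu (phi @^-1` A)) /\
    forall F : T2 -> \bar R, measurable_fun setT F -> (forall x, 0 <= F x)%E ->
    (\int[nu]_x F x = \int[mu]_x F (phi x))%E.
Proof.
move=> mphi; unshelve eexists (pushforward mu phi) => //; split=> // F mF F0.
by rewrite ge0_integral_pushforward.
Qed.

Lemma lebesgue_itv_oc (R : realType) (x y : R) :
  (@lebesgue_measure R) `]x, y]%classic = (Num.max (y - x) 0)%:E.
Proof.
have [xy|yx] := leP x y.
  rewrite max_l ?subr_ge0//.
  rewrite (lebesgue_measure_itv `]x, y])/= lte_fin.
  by move: xy; rewrite le_eqVlt => /predU1P[->|->]; rewrite ?ltxx ?subrr.
rewrite max_r ?subr_le0 ?ltW// set_itv_ge ?measure0//.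
by rewrite -leNgt bnd_simp ltW.
Qed.

Lemma lebesgue_itv_co (R : realType) (x y : R) :
  (@lebesgue_measure R) `[x, y[%classic = (Num.max (y - x) 0)%:E.
Proof.
have [xy|yx] := leP x y.
  rewrite max_l ?subr_ge0//.
  rewrite (lebesgue_measure_itv `[x, y[)/= lte_fin.
  by move: xy; rewrite le_eqVlt => /predU1P[->|->]; rewrite ?ltxx ?subrr.
rewrite max_r ?subr_le0 ?ltW// set_itv_ge ?measure0//.
by rewrite -leNgt bnd_simp ltW.
Qed.

(** Uniqueness of Lebesgue measure: |s| times the image measure agrees with it on the intervals ]a,
    b]. For s < 0 the preimage of such an interval is closed on the left instead. *)
Lemma lebesgue_affine (R : realType) (s c : R) : s != 0 ->
  scales_measure (@lebesgue_measure R) (fun x => s * x + c) `|s^-1|%:nng.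
Proof.
move=> s0.
have mphi : measurable_fun setT (fun x : measurableTypeR R => s * x + c).
  apply: measurable_funD => //; exact: mulrl_measurable.
split => // F mF F0.
have [nu [nuE nuF]] := @pushforward_measure_ex _ _ (measurableTypeR R)
  (measurableTypeR R) R lebesgue_measure _ mphi.
pose k : {nonneg R} := NngNum (normr_ge0 s).
have mE : forall A : set (measurableTypeR R), measurable A ->
   (@lebesgue_measure R) A = mscale k nu A.
  apply: lebesgue_measure_unique => _ [[a b] _ <-] /=.
  rewrite /mscale/= nuE.
  have [sgt|slt|/esym/eqP] := ltgtP 0 s; last by rewrite (negPf s0).
    rewrite (_ : _ @^-1` _ = `](a - c) / s, (b - c) / s]%classic); last first.
      apply/seteqP; split => x /=; rewrite !in_itv/= ltr_pdivrMr// ler_pdivlMr//;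
      by rewrite ltrBlDr lerBrDr (mulrC x).
    apply: (eq_trans (lebesgue_itv_oc _ _)).
    rewrite [X in (_ * X)%E](lebesgue_itv_oc _ _) -EFinM; congr EFin.
    rewrite gtr0_norm// maxr_pMr ?ltW// mulr0; congr (Num.max _ _).
    by field; rewrite gt_eqF.
  rewrite (_ : _ @^-1` _ = `[(b - c) / s, (a - c) / s[%classic); last first.
    apply/seteqP; split => x /=; rewrite !in_itv/= ltr_ndivlMr// ler_ndivrMr//;
    by rewrite ltrBlDr lerBrDr (mulrC x) andbC.
  apply: (eq_trans (lebesgue_itv_oc _ _)).
  rewrite [X in (_ * X)%E](lebesgue_itv_co _ _) -EFinM; congr EFin.
  rewrite ltr0_norm// maxr_pMr ?oppr_ge0 ?ltW// mulr0; congr (Num.max _ _).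
  by field; rewrite lt_eqF.
have -> : (\int[@lebesgue_measure R]_x F x = \int[mscale k nu]_x F x)%E.
  by apply: eq_measure_integral => A mA _; exact: mE.
rewrite ge0_integral_mscale// nuF//= muleA -EFinM /=.
by rewrite normfV mulVf ?normr_eq0// mul1e.
Qed.

Lemma prod_integrable d1 d2 (T1 : measurableType d1)
    (T2 : measurableType d2) (R : realType)
    (m1 : {sigma_finite_measure set T1 -> \bar R})
    (m2 : {sigma_finite_measure set T2 -> \bar R}) (f : T1 -> R) (g : T2 -> R) :
  m1.-integrable setT (EFin \o f) -> m2.-integrable setT (EFin \o g) ->
  (m1 \x m2)%E.-integrable setT (EFin \o (fun p => f p.1 * g p.2)).
Proof.
move=> /integrableP[/= /measurable_EFinP mf fi] /integrableP[/= /measurable_EFinP mg gi].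
apply/integrable12ltyP.
  apply/measurable_EFinP/measurable_funM; exact: measurableT_comp.
under eq_integral => x _.
  under eq_integral => y _ do rewrite /= normrM EFinM.
  rewrite ge0_integralZl//; last first.
    by apply/measurable_EFinP; exact: measurableT_comp.
  over.
rewrite ge0_integralZr//.
- by apply: lte_mul_pinfty => //; [exact: integral_ge0|rewrite ge0_fin_numE//; exact: integral_ge0].
- by apply/measurable_EFinP; exact: measurableT_comp.
- exact: integral_ge0.
Qed.

Section gauss1.
Context {R : realType}.
Local Notation leb := (@lebesgue_measure R).

Lemma gauss1_integrable (c : R) : 0 < c ->
  leb.-integrable setT (EFin \o (fun x => expR (- c * x ^+ 2))).
Proof.
move=> c0.
have -> : (fun x : R => expR (- c * x ^+ 2)) = gauss_fun \o (fun x => Num.sqrt c * x + 0).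
  apply/funext => x; rewrite /gauss_fun/= addr0 exprMn sqr_sqrtr ?mulNr// ltW//.
apply: scales_measure_integrable; last exact: integrableT_gauss.
by apply: lebesgue_affine; rewrite gt_eqF// sqrtr_gt0.
Qed.

Lemma gauss1_integral : \int[leb]_x expR (- x ^+ 2 / 2) = Num.sqrt (2 * pi).
Proof.
have := @integral_normal_pdf R 0 1.
have -> : normal_pdf 0 1 = fun x : R => (Num.sqrt (2 * pi))^-1 * expR (- x ^+ 2 / 2).
  apply/funext => x; rewrite normal_pdfE ?oner_eq0//.
  by rewrite /normal_peak /normal_fun subr0 expr1n mul1r -[pi *+ 2]mulr_natl.
move=> h.
have i1 : leb.-integrable setT (EFin \o (fun x => expR (- x ^+ 2 / 2))).
  have := @gauss1_integrable (2^-1) ltac:(by rewrite invr_gt0); congr (integrable _ _ _).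
  by apply/funext => x /=; congr (expR _)%:E; field.
have : \int[leb]_x ((Num.sqrt (2 * pi))^-1 * expR (- x ^+ 2 / 2)) = 1.
  by rewrite /Rintegral h.
rewrite RintegralZl// => /(congr1 (fun z => Num.sqrt (2 * pi) * z)).
by rewrite mulrA mulfV ?mul1r ?mulr1// gt_eqF// sqrtr_gt0 mulr_gt0// pi_gt0.
Qed.

End gauss1.

(** * Gaussian integrals on the line *)

Section real_derivatives.
Context {R : realType}.
Implicit Types (f g h : R -> R) (x : R) (df dg dh : R).

Lemma Dcst x (c : R) : is_derive x 1 (fun _ : R => c) 0.
Proof. exact: is_derive_cst. Qed.

Lemma Did x : is_derive x 1 (fun y : R => y) 1.
Proof. exact: is_derive_id. Qed.

Lemma Dadd f g x df dg : is_derive x 1 f df -> is_derive x 1 g dg ->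
  is_derive x 1 (fun y => f y + g y) (df + dg).
Proof. exact: is_deriveD. Qed.

Lemma Dopp f x df : is_derive x 1 f df -> is_derive x 1 (fun y => - f y) (- df).
Proof. exact: is_deriveN. Qed.

Lemma Dmul f g x df dg : is_derive x 1 f df -> is_derive x 1 g dg ->
  is_derive x 1 (fun y => f y * g y) (df * g x + f x * dg).
Proof.
move=> fD gD; rewrite (_ : (fun y => f y * g y) = f * g)//.
apply: (is_derive_eq (is_deriveM fD gD)).
by rewrite /GRing.scale/= addrC; congr (_ + _); rewrite mulrC.
Qed.

Lemma Dcomp h f x dh df : is_derive (f x) 1 h dh -> is_derive x 1 f df ->
  is_derive x 1 (fun y => h (f y)) (dh * df).
Proof. by move=> hD fD; have := is_derive1_comp hD fD. Qed.

Lemma Dexp f x df : is_derive x 1 f df ->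
  is_derive x 1 (fun y => expR (f y)) (expR (f x) * df).
Proof. by move=> fD; apply: Dcomp. Qed.

Lemma Dcos f x df : is_derive x 1 f df ->
  is_derive x 1 (fun y => cos (f y)) (- sin (f x) * df).
Proof. by move=> fD; apply: Dcomp. Qed.

Lemma Dsin f x df : is_derive x 1 f df ->
  is_derive x 1 (fun y => sin (f y)) (cos (f x) * df).
Proof. by move=> fD; apply: Dcomp. Qed.

Lemma Deq f x a b : is_derive x 1 f a -> a = b -> is_derive x 1 f b.
Proof. by move=> + <-. Qed.

Lemma Dexpn f x df n : is_derive x 1 f df ->
  is_derive x 1 (fun y => f y ^+ n) (n%:R * f x ^+ n.-1 * df).
Proof.
move=> fD; elim: n => [|n ih].
  by notypeclasses refine (Deq _ _); [exact: Dcst|rewrite !mul0r].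
rewrite (_ : (fun y => f y ^+ n.+1) = (fun y => f y * f y ^+ n)); last first.
  by apply/funext => y; rewrite exprS.
notypeclasses refine (Deq _ _); first exact: (Dmul fD ih).
by case: n {ih} => [|n] /=; rewrite ?expr0 ?exprS; ring.
Qed.

End real_derivatives.

(** The rules leave the value of the derivative to unification; [notypeclasses refine] keeps
    instance search from supplying a value of another shape. The first case eta-expands a partially
    applied product. *)
Ltac deriv := repeat match goal with
  | |- is_derive ?x ?d (@GRing.mul ?T ?v) ?l => change (is_derive x d (fun y => v * y) l)
  | |- is_derive _ _ (fun y => y) _ => notypeclasses refine (Did _)
  | |- is_derive _ _ (fun y => ?c) _ => notypeclasses refine (Dcst _ _)
  | |- is_derive _ _ (fun y => _ + _) _ => notypeclasses refine (Dadd _ _)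
  | |- is_derive _ _ (fun y => - _) _ => notypeclasses refine (Dopp _)
  | |- is_derive _ _ (fun y => _ * _) _ => notypeclasses refine (Dmul _ _)
  | |- is_derive _ _ (fun y => expR _) _ => notypeclasses refine (Dexp _)
  | |- is_derive _ _ (fun y => cos _) _ => notypeclasses refine (Dcos _)
  | |- is_derive _ _ (fun y => sin _) _ => notypeclasses refine (Dsin _)
  | |- is_derive _ _ (fun y => _ ^+ _) _ => notypeclasses refine (Dexpn _ _)
  end.

Section gauss_cos.
Context {R : realType}.
Local Notation leb := (@lebesgue_measure R).

(** The integral of f' over [-n, n] is f(n) - f(-n); dominated convergence passes to the whole
    line. *)
Lemma integral_derivative0 (f f' : R -> R) :
  (forall x : R, is_derive x 1 f (f' x)) -> continuous f' ->
  leb.-integrable setT (EFin \o f') ->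
  f n%:R @[n --> \oo] --> (0 : R) -> f (- n%:R) @[n --> \oo] --> (0 : R) ->
  \int[leb]_x f' x = 0.
Proof.
move=> df cf' if' fp fm.
pose F n x := (((f' \_ `[- n%:R, n%:R]) x)%:E : \bar R).
have mf' : measurable_fun setT (EFin \o f') by case/integrableP : if'.
have FE n : (\int[leb]_x F n x = (f n%:R - f (- n%:R))%:E)%E.
  rewrite -(FTC2 _ df cf')//; last by rewrite (@le_trans _ _ 0)// oppr_le0.
  rewrite [RHS]integral_mkcond; apply: eq_integral => x _.
  by rewrite /F restrict_EFin.
have lim0 : (f n%:R - f (- n%:R))%:E @[n --> \oo] --> (0 : \bar R)%E.
  apply/fine_cvgP; split; first exact: nearW.
  by rewrite -(subrr 0); apply: cvgB.
have mF n : measurable_fun setT (F n).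
  rewrite /F; apply/measurable_EFinP/(measurable_restrictT _ _).1 => //.
  by apply: measurable_funTS; apply/measurable_EFinP.
have Fcvg : {ae leb, forall x, setT x -> F ^~ x @ \oo --> (EFin \o f') x}.
  apply/aeW => x _; apply: cvg_near_cst; near=> n.
  rewrite /F patchE mem_set//= in_itv/= -ler_norml.
  by near: n; exact: nbhs_infty_ger.
have Fdom : {ae leb, forall x n, setT x -> (`|F n x| <= `|(f' x)%:E|)%E}.
  apply/aeW => x n _; rewrite /F patchE; case: ifPn => // _.
  by rewrite abse0 abse_ge0.
have [_ _ lim1] := @dominated_convergence _ _ R leb setT measurableT F (EFin \o f')
  (fun x => `|(f' x)%:E|%E) mF mf' Fcvg (integrable_abse if') Fdom.
have e : (\int[leb]_x (f' x)%:E)%E = 0%E.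
  apply: (cvg_unique (@ereal_hausdorff R) lim1).
  rewrite (_ : (fun n => _) = (fun n => (f n%:R - f (- n%:R))%:E))//.
  by apply/funext => n; exact: FE.
by rewrite /Rintegral e.
Unshelve. all: by end_near. Qed.

Lemma gauss1_bound (x : R) : `|x| * expR (- x ^+ 2 / 2) <= expR (- (1/4) * x ^+ 2).
Proof.
have : `|x| <= expR (x ^+ 2 / 4).
  apply: (le_trans _ (expR_ge1Dx _)); rewrite -(real_normK (num_real x)).
  by have := sqr_ge0 (`|x| / 2 - 1); rewrite !expr2; lra.
move/(ler_wpM2r (expR_ge0 (- x ^+ 2 / 2)))/le_trans; apply.
by rewrite -expRD ler_expR; lra.
Qed.

Let G (v x : R) : R := expR (- x ^+ 2 / 2) * cos (v * x).
Let psi (v : R) := \int[leb]_x G v x.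

Lemma gauss1_dominated (f : R -> R) : continuous f ->
  (forall x, `|f x| <= expR (- (1/4) * x ^+ 2)) ->
  leb.-integrable setT (EFin \o f).
Proof.
move=> cf fb; have h := @gauss1_integrable R (1/4) ltac:(lra).
apply: le_integrable h => //=.
  by apply/measurable_EFinP; exact: continuous_measurable_fun.
by move=> x _; rewrite lee_fin (le_trans (fb x))// ler_norm.
Qed.

Lemma expR_half_le (x : R) : expR (- x ^+ 2 / 2) <= expR (- (1/4) * x ^+ 2).
Proof. by rewrite ler_expR; have := sqr_ge0 x; lra. Qed.

Lemma DG (v x : R) : is_derive v 1 (G ^~ x) (expR (- x ^+ 2 / 2) * (- sin (v * x) * x)).
Proof. by rewrite /G; notypeclasses refine (Deq _ _); [deriv|rewrite /=; ring]. Qed.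

(** The derivative of exp(-x^2/2) sin(v x) has integral zero; its two terms are the integrand here
    and v times the integrand of [psi]. *)
Lemma gauss1_parts v : \int[leb]_x (expR (- x ^+ 2 / 2) * (- sin (v * x) * x)) = - v * psi v.
Proof.
pose f (x : R) : R := expR (- x ^+ 2 / 2) * sin (v * x).
pose f' (x : R) : R := expR (- x ^+ 2 / 2) * (- sin (v * x) * x) + v * G v x.
have df (x : R) : is_derive x 1 f (f' x).
  rewrite /f /f' /G; notypeclasses refine (Deq _ _); first by deriv.
  by rewrite /=; field.
have c1 : continuous (fun x : R => expR (- x ^+ 2 / 2) * (- sin (v * x) * x)).
  by apply: is_derive_continuous => x; deriv.
have c2 : continuous (G v).
  by apply: is_derive_continuous => x; rewrite /G; deriv.
have i1 : leb.-integrable setT (EFin \o (fun x : R => expR (- x ^+ 2 / 2) * (- sin (v * x) * x))).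
  apply: gauss1_dominated => // x; apply: le_trans (gauss1_bound x).
  rewrite normrM ger0_norm ?expR_ge0// mulrC ler_wpM2r ?expR_ge0//.
  by rewrite normrM normrN ler_piMl// ler_norml sin_geN1 sin_le1.
have i2 : leb.-integrable setT (EFin \o G v).
  apply: gauss1_dominated => // x; apply: le_trans (expR_half_le x).
  by rewrite normrM ger0_norm ?expR_ge0// ler_piMr ?expR_ge0// ler_norml cos_geN1 cos_le1.
have i3 : leb.-integrable setT (EFin \o (fun x => v * G v x)).
  exact: integrable_scale.
(* From (n - 1)^2 >= 0 one gets - n^2/2 <= 1/2 - n, and exp(-n) tends to 0. *)
have fb n : `|f n%:R| <= expR (1/2) * expR (- n%:R) /\ `|f (- n%:R)| <= expR (1/2) * expR (- n%:R).
  rewrite /f sqrrN -expRD; split; rewrite normrM ger0_norm ?expR_ge0//;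
  (apply: (@le_trans _ _ (expR (- n%:R ^+ 2 / 2)));
    [by rewrite ler_piMr ?expR_ge0// ler_norml sin_geN1 sin_le1|]);
  by rewrite ler_expR; have := sqr_ge0 (n%:R - 1 : R); rewrite !expr2; lra.
have : \int[leb]_x f' x = 0.
  apply: (@integral_derivative0 f).
  - by move=> x; apply: cvgD; [exact: c1|apply: cvgM; [exact: cvg_cst|exact: c2]].
  - exact: (integrable_add measurableT i1 i3).
  - apply: (@squeeze_cvgr _ _ _ _ (fun n => - (expR (1/2) * expR (- n%:R)))
        (fun n => expR (1/2) * expR (- n%:R))).
    + near=> n; rewrite -ler_norml; by have [] := fb n.
    + rewrite -[X in _ --> X]oppr0; apply: cvgN.
      by rewrite -[X in _ --> X](mulr0 (expR (1/2))); apply: cvgM; [exact: cvg_cst|exact: cvgn_expR].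
    + by rewrite -[X in _ --> X](mulr0 (expR (1/2))); apply: cvgM; [exact: cvg_cst|exact: cvgn_expR].
  - apply: (@squeeze_cvgr _ _ _ _ (fun n => - (expR (1/2) * expR (- n%:R)))
        (fun n => expR (1/2) * expR (- n%:R))).
    + near=> n; rewrite -ler_norml; by have [] := fb n.
    + rewrite -[X in _ --> X]oppr0; apply: cvgN.
      by rewrite -[X in _ --> X](mulr0 (expR (1/2))); apply: cvgM; [exact: cvg_cst|exact: cvgn_expR].
    + by rewrite -[X in _ --> X](mulr0 (expR (1/2))); apply: cvgM; [exact: cvg_cst|exact: cvgn_expR].
rewrite /f' RintegralD// RintegralZl// => /eqP; rewrite addr_eq0 => /eqP ->.
by rewrite mulNr.
Unshelve. all: by end_near. Qed.

(** Differentiation under the integral and [gauss1_parts] give psi' = - v psi, so that psi(v)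
    exp(v^2/2) is constant. *)
Lemma gauss1_cos v : psi v = Num.sqrt (2 * pi) * expR (- v ^+ 2 / 2).
Proof.
have iG w : leb.-integrable setT (EFin \o G w).
  apply: gauss1_dominated => [|x].
    by apply: is_derive_continuous => x; rewrite /G; deriv.
  apply: le_trans (expR_half_le x).
  by rewrite normrM ger0_norm ?expR_ge0// ler_piMr ?expR_ge0// ler_norml cos_geN1 cos_le1.
have dpsi (w : R) : is_derive w 1 psi (- w * psi w).
  have [w1 w2] : w - 1 < w /\ w < w + 1 by split; lra.
  have Iw : `]w - 1, w + 1[%classic w by rewrite /= in_itv/= w1 w2.
  have der1 x y : `]w - 1, w + 1[%classic x -> setT y -> derivable (G ^~ y) x 1.
    by move=> _ _; have [] := DG x y.
  have ub x y : `]w - 1, w + 1[%classic x -> setT y ->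
      `|partial1of2 G x y| <= expR (- (1/4) * y ^+ 2).
    move=> _ _; rewrite partial1of2E; have [_ ->] := DG x y.
    apply: le_trans (gauss1_bound y).
    rewrite normrM ger0_norm ?expR_ge0// mulrC ler_wpM2r ?expR_ge0//.
    by rewrite normrM normrN ler_piMl// ler_norml sin_geN1 sin_le1.
  have ige := @gauss1_integrable R (1/4) ltac:(lra).
  apply: DeriveDef.
    exact: (derivable_under_integral measurableT Iw (fun x _ => iG x) der1
      (fun y => expR_ge0 _) ige ub).
  rewrite -derive1E (differentiation_under_integral measurableT Iw (fun x _ => iG x) der1
      (fun y => expR_ge0 _) ige ub).
  rewrite -gauss1_parts; apply: eq_Rintegral => x _.
  by rewrite partial1of2E; have [_ ->] := DG w x.
have D0 (w : R) : is_derive w 1 (fun w : R => psi w * expR (w ^+ 2 / 2)) 0.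
  notypeclasses refine (Deq _ _); first by notypeclasses refine (Dmul _ _); [exact: dpsi|deriv].
  by rewrite /=; field.
have := is_derive_0_is_cst v 0 D0.
rewrite expr0n/= mul0r expR0 mulr1 => e.
have p0 : psi 0 = Num.sqrt (2 * pi).
  rewrite -gauss1_integral; apply: eq_Rintegral => x _.
  by rewrite /G mul0r cos0 mulr1.
by rewrite -p0 -e -[RHS]mulrA -expRD mulNr addrN expR0 mulr1.
Qed.

(** The integrand is odd. *)
Lemma gauss1_sin v : \int[leb]_x (expR (- x ^+ 2 / 2) * sin (v * x)) = 0.
Proof.
pose f (x : R) : R := expR (- x ^+ 2 / 2) * sin (v * x).
have if_ : leb.-integrable setT (EFin \o f).
  apply: gauss1_dominated => [|x].
    by apply: is_derive_continuous => x; rewrite /f; deriv.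
  apply: le_trans (expR_half_le x).
  by rewrite normrM ger0_norm ?expR_ge0// ler_piMr ?expR_ge0// ler_norml sin_geN1 sin_le1.
have s1 : (- 1 : R) != 0 by rewrite oppr_eq0 oner_eq0.
have := scales_measure_Rintegral (@lebesgue_affine R (-1) 0 s1) if_.
rewrite /= invrN1 normrN1 mul1r => e.
have : \int[leb]_x f (-1 * x + 0) = - \int[leb]_x f x.
  rewrite -[RHS]mulN1r -(RintegralZl (-1) measurableT if_); apply: eq_Rintegral => x _.
  by rewrite /f addr0 !mulN1r sqrrN mulrN sinN mulrN.
rewrite e -/f => h; have : 2 * \int[leb]_x f x = 0 by rewrite mulr_natl mulr2n {1}h addNr.
by move/eqP; rewrite mulf_eq0 pnatr_eq0 /= => /eqP.
Qed.

(* The completed square is kept as a (y + c) ^+ 2 so that the formula can be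
   iterated over the coordinates of a quadratic form. *)
Lemma gauss1_shift (a c w b : R) : 0 < a ->
  \int[leb]_y (expR (- (a * (y + c) ^+ 2) / 2) * cos (a * w * (y + c) + b)) =
  Num.sqrt (2 * pi / a) * expR (- (a * w ^+ 2) / 2) * cos b.
Proof.
move=> a0; pose q := Num.sqrt a.
have q0 : 0 < q by rewrite sqrtr_gt0.
have qq : q ^+ 2 = a by rewrite sqr_sqrtr// ltW.
pose f (x : R) : R := expR (- x ^+ 2 / 2) * cos (q * w * x + b).
pose f1 (x : R) : R := expR (- x ^+ 2 / 2) * cos (q * w * x).
pose f2 (x : R) : R := expR (- x ^+ 2 / 2) * sin (q * w * x).
have i1 : leb.-integrable setT (EFin \o f1).
  apply: gauss1_dominated => [|x].
    by apply: is_derive_continuous => x; rewrite /f1; deriv.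
  apply: le_trans (expR_half_le x).
  by rewrite normrM ger0_norm ?expR_ge0// ler_piMr ?expR_ge0// ler_norml cos_geN1 cos_le1.
have i2 : leb.-integrable setT (EFin \o f2).
  apply: gauss1_dominated => [|x].
    by apply: is_derive_continuous => x; rewrite /f2; deriv.
  apply: le_trans (expR_half_le x).
  by rewrite normrM ger0_norm ?expR_ge0// ler_piMr ?expR_ge0// ler_norml sin_geN1 sin_le1.
have fE x : f x = cos b * f1 x - sin b * f2 x by rewrite /f cosD /f1 /f2; ring.
have i3 : leb.-integrable setT (EFin \o (fun x => cos b * f1 x)).
  exact: integrable_scale.
have i4 : leb.-integrable setT (EFin \o (fun x => sin b * f2 x)).
  exact: integrable_scale.
have if_ : leb.-integrable setT (EFin \o f).
  rewrite (_ : f = fun x => cos b * f1 x - sin b * f2 x); last exact/funext.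
  exact: (integrable_sub measurableT i3 i4).
have := scales_measure_Rintegral (@lebesgue_affine R q (q * c) (lt0r_neq0 q0)) if_.
rewrite /= => e.
transitivity (\int[leb]_x f (q * x + q * c)).
  apply: eq_Rintegral => x _; rewrite /f -qq; congr (expR _ * cos _); ring.
rewrite e; have -> : \int[leb]_x f x = cos b * psi (q * w).
  under eq_Rintegral do rewrite fE.
  by rewrite RintegralB// !RintegralZl// gauss1_sin mulr0 subr0.
rewrite gauss1_cos gtr0_norm ?invr_gt0// exprMn qq.
rewrite [Num.sqrt (2 * pi / a)]sqrtrM ?mulr_ge0 ?pi_ge0// sqrtrV ?ltW// -/q; ring.
Qed.

Lemma gauss1_shift_integrable (a c w b : R) : 0 < a ->
  leb.-integrable setT
    (EFin \o (fun y : R => expR (- (a * (y + c) ^+ 2) / 2) * cos (a * w * (y + c) + b))).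
Proof.
move=> a0; pose q := Num.sqrt a.
have q0 : 0 < q by rewrite sqrtr_gt0.
have qq : q ^+ 2 = a by rewrite sqr_sqrtr// ltW.
pose f (x : R) : R := expR (- x ^+ 2 / 2) * cos (q * w * x + b).
have if_ : leb.-integrable setT (EFin \o f).
  apply: gauss1_dominated => [|x].
    by apply: is_derive_continuous => x; rewrite /f; deriv.
  apply: le_trans (expR_half_le x).
  by rewrite normrM ger0_norm ?expR_ge0// ler_piMr ?expR_ge0// ler_norml cos_geN1 cos_le1.
have := scales_measure_integrable (@lebesgue_affine R q (q * c) (lt0r_neq0 q0)) if_.
apply: eq_integrable => // x _ /=.
rewrite /f -qq; congr (expR _ * cos _)%:E; ring.
Qed.

End gauss_cos.

(** * Gaussian integrals on R^4 *)

Section bilinear.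
Context {R : realType}.

Definition bil n (A : 'M[R]_n) (u v : 'rV[R]_n) : R := (u *m A *m v^T) ord0 ord0.
Definition dotv n (u v : 'rV[R]_n) : R := (u *m v^T) ord0 ord0.

Lemma dotvE n (u v : 'rV[R]_n) : dotv u v = \sum_i u ord0 i * v ord0 i.
Proof. by rewrite /dotv mxE; apply: eq_bigr => i _; rewrite mxE. Qed.

Lemma dotvC n (u v : 'rV[R]_n) : dotv u v = dotv v u.
Proof. by rewrite !dotvE; apply: eq_bigr => i _; rewrite mulrC. Qed.

Lemma bil_dotv n (A : 'M[R]_n) u v : bil A u v = dotv (u *m A) v.
Proof. by []. Qed.

Lemma bilE n (A : 'M[R]_n) u v :
  bil A u v = \sum_j (\sum_i u ord0 i * A i j) * v ord0 j.
Proof.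
by rewrite bil_dotv dotvE; apply: eq_bigr => j _; rewrite mxE.
Qed.

Lemma bilC n (A : 'M[R]_n) u v : A^T = A -> bil A u v = bil A v u.
Proof.
by move=> sA; rewrite /bil -[LHS](mxE trmx_key (fun i j => (u *m A *m v^T) j i)) -/(trmx _) !trmx_mul trmxK sA mulmxA.
Qed.

Lemma dotvDl n (u v w : 'rV[R]_n) : dotv (u + v) w = dotv u w + dotv v w.
Proof. by rewrite /dotv mulmxDl mxE. Qed.
Lemma dotvDr n (u v w : 'rV[R]_n) : dotv w (u + v) = dotv w u + dotv w v.
Proof. by rewrite dotvC dotvDl !(dotvC w). Qed.
Lemma dotvZl n k (u w : 'rV[R]_n) : dotv (k *: u) w = k * dotv u w.
Proof. by rewrite /dotv -scalemxAl mxE. Qed.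
Lemma dotvZr n k (u w : 'rV[R]_n) : dotv w (k *: u) = k * dotv w u.
Proof. by rewrite dotvC dotvZl dotvC. Qed.
Lemma dotvNl n (u w : 'rV[R]_n) : dotv (- u) w = - dotv u w.
Proof. by rewrite -scaleN1r dotvZl mulN1r. Qed.
Lemma dotvNr n (u w : 'rV[R]_n) : dotv w (- u) = - dotv w u.
Proof. by rewrite dotvC dotvNl dotvC. Qed.
Lemma dotvBr n (u v w : 'rV[R]_n) : dotv w (u - v) = dotv w u - dotv w v.
Proof. by rewrite dotvDr dotvNr. Qed.
Lemma bilDr n (A : 'M[R]_n) (u v w : 'rV[R]_n) : bil A w (u + v) = bil A w u + bil A w v.
Proof. by rewrite !bil_dotv dotvDr. Qed.
Lemma bilDl n (A : 'M[R]_n) (u v w : 'rV[R]_n) : bil A (u + v) w = bil A u w + bil A v w.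
Proof. by rewrite !bil_dotv mulmxDl dotvDl. Qed.
Lemma bilZr n (A : 'M[R]_n) k (u w : 'rV[R]_n) : bil A w (k *: u) = k * bil A w u.
Proof. by rewrite !bil_dotv dotvZr. Qed.
Lemma bilZl n (A : 'M[R]_n) k (u w : 'rV[R]_n) : bil A (k *: u) w = k * bil A u w.
Proof. by rewrite !bil_dotv -scalemxAl dotvZl. Qed.
Lemma bilNr n (A : 'M[R]_n) (u w : 'rV[R]_n) : bil A w (- u) = - bil A w u.
Proof. by rewrite !bil_dotv dotvNr. Qed.
Lemma bilNl n (A : 'M[R]_n) (u w : 'rV[R]_n) : bil A (- u) w = - bil A u w.
Proof. by rewrite !bil_dotv mulNmx dotvNl. Qed.

Definition schur n (A : 'M[R]_(1 + n)) : 'M[R]_n :=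
  drsubmx A - (A ord0 ord0)^-1 *: ((ursubmx A)^T *m ursubmx A).

Lemma mul11 (A B : 'M[R]_1) : (A *m B) ord0 ord0 = A ord0 ord0 * B ord0 ord0.
Proof. by rewrite mxE big_ord_recl big_ord0 addr0. Qed.

Lemma sym_block n (A : 'M[R]_(1 + n)) : A^T = A ->
  A = block_mx (A ord0 ord0)%:M (ursubmx A) (ursubmx A)^T (drsubmx A).
Proof.
move=> sA; rewrite -{1}[A]submxK; congr block_mx.
  by rewrite [LHS]mx11_scalar !mxE; congr (A _ _)%:M; exact/val_inj.
by rewrite trmx_ursub sA.
Qed.

(** Completion of the square in the first coordinate. The polarized form is there because the phase
    of the Gaussian integral is [bil A w x], which has to split together with [bil A x x]. *)
Lemma bil_schur n (A : 'M[R]_(1 + n)) (y z : R) (x t : 'rV[R]_n) : A^T = A ->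
  let a := A ord0 ord0 in let r := ursubmx A in a != 0 ->
  bil A (row_mx y%:M x) (row_mx z%:M t) =
  a * (y + dotv r x / a) * (z + dotv r t / a) + bil (schur A) x t.
Proof.
move=> sA a r a0.
have sc c : (c%:M : 'M[R]_1) ord0 ord0 = c by rewrite mxE eqxx.
have xr : (x *m r^T) ord0 ord0 = dotv r x by rewrite dotvC.
have -> : bil (schur A) x t = bil (drsubmx A) x t - dotv r x * dotv r t / a.
  rewrite /bil /schur mulmxBr mulmxBl [LHS]mxE; congr (_ + _).
  rewrite [LHS]mxE -scalemxAr -scalemxAl [X in - X]mxE -/a -/r; congr (- _).
  rewrite mulmxA -(mulmxA (x *m r^T)) mul11 xr /dotv; ring.
rewrite /bil {1}(sym_block sA) -/a -/r mul_row_block tr_row_mx mul_row_col [LHS]mxE.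
have -> : ((y%:M *m a%:M + x *m r^T) *m (z%:M : 'M[R]_1)^T) ord0 ord0 =
    (y * a + dotv r x) * z :> R.
  by rewrite mul11 tr_scalar_mx sc [X in X * _]mxE mul11 !sc xr.
have -> : ((y%:M *m r + x *m drsubmx A) *m t^T) ord0 ord0 =
    y * dotv r t + bil (drsubmx A) x t :> R.
  by rewrite mulmxDl [LHS]mxE mul_scalar_mx -scalemxAl [X in X + _]mxE.
rewrite -/(bil (drsubmx A) x t); by field.
Qed.

Lemma det_schur n (A : 'M[R]_(1 + n)) : A^T = A -> A ord0 ord0 != 0 ->
  \det A = A ord0 ord0 * \det (schur A).
Proof.
move=> sA a0; set a := A ord0 ord0; set r := ursubmx A.
(* Right multiplication by this unipotent matrix clears the upper right block and leaves the Schur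
   complement in the lower right one. *)
pose U : 'M[R]_(1 + n) := block_mx 1%:M (- a^-1 *: r) 0 1%:M.
have dU : \det U = 1 by rewrite det_ublock !det1 mulr1.
rewrite -[LHS]mulr1 -dU -det_mulmx {1}(sym_block sA) mulmx_block -/a -/r.
rewrite !mulmx1 !mulmx0 !addr0 mul_scalar_mx scalerA mulrN mulfV// scaleN1r addNr.
by rewrite det_lblock det_scalar1 /schur -/a -/r -scalemxAr scaleNr addrC.
Qed.

Definition posdef n (A : 'M[R]_n) := A^T = A /\ forall x, x != 0 -> 0 < bil A x x.

Lemma row_mx_neq0l n (y : R) (x : 'rV[R]_n) : y != 0 -> (row_mx y%:M x : 'rV[R]_(1 + n)) != 0.
Proof.
apply: contraNneq => /(congr1 (fun M : 'rV[R]_(1 + n) => lsubmx M ord0 ord0)).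
by rewrite row_mxKl linear0 !mxE eqxx mulr1n => ->.
Qed.

Lemma row_mx_neq0r n (y : R) (x : 'rV[R]_n) : x != 0 -> (row_mx y%:M x : 'rV[R]_(1 + n)) != 0.
Proof.
apply: contraNneq => /(congr1 (fun M : 'rV[R]_(1 + n) => rsubmx M)).
by rewrite row_mxKr linear0 => ->.
Qed.

Lemma posdef_corner n (A : 'M[R]_(1 + n)) : posdef A -> 0 < A ord0 ord0.
Proof.
move=> [sA pA]; have := pA _ (@row_mx_neq0l n 1 0 (oner_neq0 _)).
rewrite /bil {1}(sym_block sA) mul_row_block tr_row_mx mul_row_col !mul0mx !addr0.
rewrite trmx0 mulmx0 addr0 !mul1mx tr_scalar_mx mulmx1 mxE eqxx mulr1n; exact.
Qed.

Lemma posdef_schur n (A : 'M[R]_(1 + n)) : posdef A -> posdef (schur A).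
Proof.
move=> pA; have a0 := posdef_corner pA; have [sA pA'] := pA; split.
  rewrite /schur linearB linearZ /= trmx_mul trmxK; congr (_ - _).
  by rewrite trmx_drsub sA.
move=> x x0; set r := ursubmx A; set a := A ord0 ord0 in a0 *.
have := pA' _ (@row_mx_neq0r n (- (dotv r x / a)) _ x0).
by rewrite bil_schur ?gt_eqF// -/a -/r addNr mulr0 add0r.
Qed.

(** The first coordinate is integrated innermost, with the others fixed: this is the order in which
    [schur] eliminates them. *)
Fixpoint iter_int n : ('rV[R]_n -> R) -> R :=
  match n with
  | 0 => fun f => f 0
  | m.+1 => fun f => iter_int
      (fun x : 'rV[R]_m => \int[@lebesgue_measure R]_y f (row_mx y%:M x))
  end.

(** Induction on the dimension: the integral in the first coordinate is [gauss1_shift], and what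
    remains is the same integral for the Schur complement, with the factor just produced absorbed in
    [k]. Writing the phase as [bil A w x] makes exponent and phase complete to the same square; a
    linear form v is recovered with w = v A^-1. *)
Lemma iter_gauss n (A : 'M[R]_n) (w : 'rV[R]_n) (b k : R) : posdef A ->
  0 < \det A /\
  iter_int (fun x => k * (expR (- bil A x x / 2) * cos (bil A w x + b))) =
  k * (Num.sqrt ((2 * pi) ^+ n / \det A) * expR (- bil A w w / 2) * cos b).
Proof.
elim: n A w b k => [|n ih] A w b k pA.
  rewrite det_mx00 ltr01 /= !bilE !big_ord0 oppr0 mul0r expR0 add0r.
  by rewrite expr0 divr1 sqrtr1 !mul1r.
have a0 := posdef_corner pA; have [sA pA'] := pA.
have [dS ihS] := ih (schur A) (rsubmx (w : 'rV[R]_(1 + n))) b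
  (k * (Num.sqrt (2 * pi / A ord0 ord0) * expR (- (A ord0 ord0 *
    (w ord0 ord0 + dotv (ursubmx (A : 'M[R]_(1 + n))) (rsubmx (w : 'rV[R]_(1 + n))) / A ord0 ord0) ^+ 2) / 2)))
  (posdef_schur pA).
set a := A ord0 ord0 in a0 ihS *; set r := ursubmx (A : 'M[R]_(1 + n)) in ihS *.
set w' := rsubmx (w : 'rV[R]_(1 + n)) in ihS *; set w0 := w ord0 ord0 in ihS *.
have an : a != 0 by rewrite gt_eqF.
have wE : w = row_mx w0%:M w' :> 'rV[R]_(1 + n).
  transitivity (row_mx (lsubmx (w : 'rV[R]_(1 + n))) w'); first by rewrite hsubmxK.
  congr row_mx; by rewrite [LHS]mx11_scalar !mxE; congr (w _ _)%:M; exact/val_inj.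
rewrite (det_schur sA an) mulr_gt0//; split => //.
transitivity (iter_int (fun x : 'rV[R]_n =>
   k * (Num.sqrt (2 * pi / a) * expR (- (a * (w0 + dotv r w' / a) ^+ 2) / 2)) *
   (expR (- bil (schur A) x x / 2) * cos (bil (schur A) w' x + b)))).
  rewrite [LHS]/=; congr iter_int; apply/funext => x.
  transitivity (\int[@lebesgue_measure R]_y ((k * expR (- bil (schur A) x x / 2)) *
     (expR (- (a * (y + dotv r x / a) ^+ 2) / 2) *
      cos (a * (w0 + dotv r w' / a) * (y + dotv r x / a) + (bil (schur A) w' x + b))))).
    apply: eq_Rintegral => y _; rewrite -[in RHS]mulrA; congr (k * _).
    rewrite [RHS]mulrA -expRD; congr (expR _ * cos _).
      by rewrite bil_schur// -/a -/r; move: (y : R) => {}y; field.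
    by rewrite wE bil_schur// -/a -/r; ring.
  rewrite RintegralZl//; last exact: gauss1_shift_integrable.
  by rewrite gauss1_shift//; ring.
have -> : bil A w w = a * (w0 + dotv r w' / a) ^+ 2 + bil (schur A) w' w'.
  by rewrite wE bil_schur// -/a -/r expr2 mulrA.
rewrite ihS -/a.
have -> : Num.sqrt ((2 * pi) ^+ n.+1 / (a * \det (schur A))) =
   Num.sqrt (2 * pi / a) * Num.sqrt ((2 * pi) ^+ n / \det (schur A)).
  rewrite -sqrtrM ?divr_ge0 ?mulr_ge0 ?pi_ge0 ?ltW//; congr Num.sqrt.
  by rewrite exprS; field; rewrite an gt_eqF.
rewrite [in RHS]opprD [X in k * (_ * expR X * _)]mulrDl expRD; ring.
Qed.

End bilinear.

(** * Products of sigma-finite measures and Fubini under a product majorant *)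

Section sigma_finite_product.
Context d1 d2 (T1 : measurableType d1) (T2 : measurableType d2) (R : realType).
Variables (m1 : {sigma_finite_measure set T1 -> \bar R})
  (m2 : {sigma_finite_measure set T2 -> \bar R}).

(* The library declares a sigma-finite structure on [m1 \x m2] only for finite
   factors. *)
Definition sprod : set (T1 * T2) -> \bar R := (m1 \x m2)%E.
HB.instance Definition _ := Measure.copy sprod (m1 \x m2)%E.

Let sprod_sigma_finite : sigma_finite setT sprod.
Proof.
have /sigma_finiteP[F [TF ndF Foo]] := sigma_finiteT m1.
have /sigma_finiteP[G [TG ndG Goo]] := sigma_finiteT m2.
exists (fun n => F n `*` G n) => [|n].
  apply/seteqP; split=> // -[x y] _.
  have [n _ Fx] : (\bigcup_n F n) x by rewrite -TF.
  have [k _ Gy] : (\bigcup_n G n) y by rewrite -TG.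
  exists (n + k)%N => //; split.
    exact: (subsetPset _ _ (ndF _ _ (leq_addr k n))).
  exact: (subsetPset _ _ (ndG _ _ (leq_addl n k))).
have [mF Fn] := Foo n; have [mG Gn] := Goo n; split; first exact: measurableX.
by rewrite /sprod product_measure1E// lte_mul_pinfty// ge0_fin_numE.
Qed.

HB.instance Definition _ := Measure_isSigmaFinite.Build _ _ _ sprod sprod_sigma_finite.

End sigma_finite_product.

Section fubini_dominated.
Context d1 d2 (T1 : measurableType d1) (T2 : measurableType d2) (R : realType).
Variables (m1 : {sigma_finite_measure set T1 -> \bar R})
  (m2 : {sigma_finite_measure set T2 -> \bar R}).
Variables (F : T1 * T2 -> R) (g1 : T1 -> R) (g2 : T2 -> R).
Hypotheses (mF : measurable_fun setT F) (ig1 : m1.-integrable setT (EFin \o g1))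
  (ig2 : m2.-integrable setT (EFin \o g2))
  (Fg : forall p, `|F p| <= g1 p.1 * g2 p.2).

Lemma dominated_prod_integrable : (m1 \x m2)%E.-integrable setT (EFin \o F).
Proof.
exact: (integrable_dominated measurableT mF (prod_integrable ig1 ig2) (fun p _ => Fg p)).
Qed.

Lemma dominated_section1 y : m1.-integrable setT (EFin \o (fun x => F (x, y))).
Proof.
apply: (@integrable_dominated _ _ _ m1 setT measurableT _ (fun x => g2 y * g1 x)).
- exact: measurableT_comp.
- exact: integrable_scale.
- by move=> x _; rewrite mulrC; exact: (Fg (x, y)).
Qed.

Lemma dominated_section2 x : m2.-integrable setT (EFin \o (fun y => F (x, y))).
Proof.
apply: (@integrable_dominated _ _ _ m2 setT measurableT _ (fun y => g1 x * g2 y)).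
- exact: measurableT_comp.
- exact: integrable_scale.
- by move=> y _; exact: (Fg (x, y)).
Qed.

Lemma Rfubini21 : \int[(m1 \x m2)%E]_p F p = \int[m2]_y \int[m1]_x F (x, y).
Proof.
rewrite {1}/Rintegral -(integral21_prod_meas1 dominated_prod_integrable) /Rintegral.
congr fine; apply: eq_integral => y _; rewrite /fubini_G fineK//.
exact: (integrable_fin_num measurableT (dominated_section1 y)).
Qed.

Lemma Rfubini12 : \int[(m1 \x m2)%E]_p F p = \int[m1]_x \int[m2]_y F (x, y).
Proof.
rewrite {1}/Rintegral -(integral12_prod_meas1 dominated_prod_integrable) /Rintegral.
congr fine; apply: eq_integral => x _; rewrite /fubini_F fineK//.
exact: (integrable_fin_num measurableT (dominated_section2 x)).
Qed.

Lemma Rfubini_integrable1 :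
  m1.-integrable setT (EFin \o (fun x => \int[m2]_y F (x, y))).
Proof.
have := integrable_fubini_F dominated_prod_integrable.
apply: eq_integrable => // x _; rewrite /fubini_F /Rintegral/= fineK//.
exact: (integrable_fin_num measurableT (dominated_section2 x)).
Qed.

End fubini_dominated.

(** * Lebesgue measure on R^4 *)

Section lebesgue4.
Context {R : realType}.
Local Notation leb := (@lebesgue_measure R).
Local Notation TR := (measurableTypeR R).

Definition leb2 : {sigma_finite_measure set (TR * TR)%type -> \bar R} := sprod leb leb.
Definition leb3 : {sigma_finite_measure set (TR * TR * TR)%type -> \bar R} := sprod leb2 leb.
Definition leb4 : {sigma_finite_measure set (TR * TR * TR * TR)%type -> \bar R} := sprod leb3 leb.


Lemma row_mx_head n (y : R) (x : 'rV[R]_n) :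
  (row_mx y%:M x : 'rV[R]_(1 + n)) ord0 ord0 = y.
Proof.
have -> : ord0 = lshift n (ord0 : 'I_1) by exact/val_inj.
by rewrite row_mxEl mxE eqxx.
Qed.

Lemma row_mx_tail n (y : R) (x : 'rV[R]_n) i :
  (row_mx y%:M x : 'rV[R]_(1 + n)) ord0 (lift ord0 i) = x ord0 i.
Proof.
have -> : lift ord0 i = rshift 1 i by exact/val_inj.
by rewrite row_mxEr.
Qed.

Lemma vec4E (a b c e : R) : vec4 (a, b, c, e) =
  row_mx a%:M (row_mx b%:M (row_mx c%:M (row_mx e%:M (0 : 'rV[R]_0)))) :> 'rV[R]_4.
Proof.
apply/rowP => i; rewrite mxE (tnth_nth 0).
case: (unliftP ord0 i) => [j ->|->]; last by rewrite row_mx_head.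
rewrite row_mx_tail; case: (unliftP ord0 j) => [k ->|->]; last by rewrite row_mx_head.
rewrite row_mx_tail; case: (unliftP ord0 k) => [l ->|->]; last by rewrite row_mx_head.
rewrite row_mx_tail; case: (unliftP ord0 l) => [m ->|->]; last by rewrite row_mx_head.
by case: m.
Qed.

Lemma vec4_surj (x : 'rV[R]_4) :
  vec4 (x ord0 (inord 0), x ord0 (inord 1), x ord0 (inord 2), x ord0 (inord 3)) = x.
Proof.
apply/rowP => i; rewrite mxE (tnth_nth 0).
by case: i => [[|[|[|[|//]]]] i4] /=; congr (x _ _); apply/val_inj; rewrite /= inordK.
Qed.

Lemma measurable_vec4 (i : 'I_4) :
  measurable_fun setT (fun z : TR * TR * TR * TR => vec4 z ord0 i).
Proof.
under eq_fun do rewrite mxE (tnth_nth 0).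
case: i => [[|[|[|[|//]]]] i4] /=; repeat apply: measurableT_comp => //.
Qed.

Lemma measurable_continuous4 (f : 'rV[R]_4 -> R) : continuous f ->
  measurable_fun setT (fun z : TR * TR * TR * TR => f (vec4 z)).
Proof.
by move=> cf; exact: (continuous_measurable_comp measurable_vec4 cf).
Qed.

Definition gauss4 (c : R) (z : R * R * R * R) : R :=
  expR (- c * z.1.1.1 ^+ 2) * expR (- c * z.1.1.2 ^+ 2) *
  expR (- c * z.1.2 ^+ 2) * expR (- c * z.2 ^+ 2).

Lemma gauss4_ge0 c z : 0 <= gauss4 c z.
Proof. by rewrite /gauss4 !mulr_ge0// expR_ge0. Qed.

Lemma gauss2_integrable (c : R) : 0 < c ->
  leb2.-integrable setT (EFin \o (fun z : TR * TR =>
  expR (- c * z.1 ^+ 2) * expR (- c * z.2 ^+ 2))).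
Proof.
by move=> c0; exact: (prod_integrable (gauss1_integrable c0) (gauss1_integrable c0)).
Qed.

Lemma gauss3_integrable (c : R) : 0 < c ->
  leb3.-integrable setT (EFin \o (fun z : TR * TR * TR =>
  expR (- c * z.1.1 ^+ 2) * expR (- c * z.1.2 ^+ 2) * expR (- c * z.2 ^+ 2))).
Proof.
by move=> c0; exact: (@prod_integrable _ _ _ _ R leb2 leb _ _
  (gauss2_integrable c0) (gauss1_integrable c0)).
Qed.

Lemma gauss4_integrable (c : R) : 0 < c ->
  leb4.-integrable setT (EFin \o gauss4 c).
Proof.
by move=> c0; exact: (@prod_integrable _ _ _ _ R leb3 leb _ _
  (gauss3_integrable c0) (gauss1_integrable c0)).
Qed.

(** A Gaussian majorant is a product over the coordinates, so each of the three applications of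
    Fubini leaves a majorant of the same kind. *)
Lemma lebesgue4_iter (f : 'rV[R]_4 -> R) (M c : R) : 0 < c ->
  measurable_fun setT (fun z : TR * TR * TR * TR => f (vec4 z)) ->
  (forall z, `|f (vec4 z)| <= M * gauss4 c z) ->
  \int[leb4]_z f (vec4 z) = iter_int f.
Proof.
move=> c0 mf fM.
pose e1 (x : TR) := expR (- c * x ^+ 2).
have i1 : leb.-integrable setT (EFin \o e1) by exact: gauss1_integrable.
have M0 : 0 <= M.
  have := fM (0, 0, 0, 0); rewrite /gauss4/= !expr0n/= !mulr0 expR0 !mulr1.
  exact: le_trans.
have i3 := integrable_scale measurableT M (gauss3_integrable c0).
rewrite (@Rfubini21 _ _ _ _ R leb3 leb _ _ _ mf i3 i1); last first.
  by move=> p; rewrite -mulrA; exact: fM.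
rewrite /= ; apply: eq_Rintegral => z4 _.
have m3 : measurable_fun setT (fun z : TR * TR * TR => f (vec4 (z, z4))).
  exact: (measurable_fun_pair1 z4 mf).
have i2 := integrable_scale measurableT (M * e1 z4) (gauss2_integrable c0).
rewrite (@Rfubini21 _ _ _ _ R leb2 leb _ _ _ m3 i2 i1); last first.
  by move=> p; apply: le_trans (fM _) _; rewrite /gauss4 /e1 /= le_eqVlt; apply/orP; left; apply/eqP; ring.
apply: eq_Rintegral => z3 _.
have m2 : measurable_fun setT (fun z : TR * TR => f (vec4 (z, z3, z4))).
  exact: (measurable_fun_pair1 z3 m3).
have i1' := integrable_scale measurableT (M * e1 z4 * e1 z3) i1.
rewrite (Rfubini21 m2 i1' i1); last first.
  by move=> p; apply: le_trans (fM _) _; rewrite /gauss4 /e1 /= le_eqVlt; apply/orP; left; apply/eqP; ring.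
apply: eq_Rintegral => z2 _; apply: eq_Rintegral => z1 _.
by rewrite vec4E.
Qed.

End lebesgue4.

(** * Continuity of real functions and norms of vectors *)

Section continuity.
Context {R : realType} {T : topologicalType}.
Implicit Types f g : T -> R.

Lemma continuousC (k : R) : continuous (fun _ : T => k).
Proof. by move=> x; exact: cvg_cst. Qed.

Lemma continuousD f g : continuous f -> continuous g ->
  continuous (fun x => f x + g x).
Proof. by move=> cf cg x; apply: cvgD; [exact: cf|exact: cg]. Qed.

Lemma continuousN f : continuous f -> continuous (fun x => - f x).
Proof. by move=> cf x; apply: cvgN; exact: cf. Qed.

Lemma continuousM f g : continuous f -> continuous g ->
  continuous (fun x => f x * g x).
Proof. by move=> cf cg x; apply: cvgM; [exact: cf|exact: cg]. Qed.

Lemma continuousMin f g : continuous f -> continuous g ->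
  continuous (fun x => Num.min (f x) (g x)).
Proof. by move=> cf cg x; exact: (continuous_min (cf x) (cg x)). Qed.

Lemma continuousMax f g : continuous f -> continuous g ->
  continuous (fun x => Num.max (f x) (g x)).
Proof. by move=> cf cg x; exact: (continuous_max (cf x) (cg x)). Qed.

Lemma continuous1 (h : R -> R) f : continuous h -> continuous f ->
  continuous (fun x => h (f x)).
Proof. by move=> ch cf x; apply: continuous_comp; [exact: cf|exact: ch]. Qed.

Lemma continuous_sum (I : Type) (r : seq I) (f : I -> T -> R) :
  (forall i, continuous (f i)) -> continuous (fun x => \sum_(i <- r) f i x).
Proof.
move=> fl; elim: r => [|i r ih].
  by under eq_fun do rewrite big_nil; exact: continuousC.
by under eq_fun do rewrite big_cons; exact: continuousD.
Qed.

End continuity.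

Section norms.
Context {R : realType}.
Implicit Types x u v : 'rV[R]_4.

Lemma norm_sq_le_dotv n (x : 'rV[R]_n.+1) : `|x| ^+ 2 <= dotv x x.
Proof.
rewrite dotvE; have [i ->] : exists i, `|x| = `|x ord0 i|.
  change (exists i, mx_norm x = `|x ord0 i|); have [x0|/mx_norm_neq0[[a i] ->]] := eqVneq (mx_norm x) 0.
    by exists ord0; rewrite x0 (mx_norm_eq0 x0) mxE normr0.
  by exists i; rewrite (ord1 a).
rewrite real_normK ?num_real// (bigD1 i)//= -expr2 lerDl sumr_ge0// => j _.
by rewrite -expr2 sqr_ge0.
Qed.

Lemma dotv_bound n (u' v' : 'rV[R]_n) : `|dotv u' v'| <= n%:R * (`|u'| * `|v'|).
Proof.
rewrite dotvE (le_trans (ler_norm_sum _ _ _))//.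
rewrite -[X in _ <= X%:R * _]card_ord mulr_natl -sumr_const ler_sum// => i _.
by rewrite normrM ler_pM// ge_coord_norm.
Qed.

Lemma dotv_le x : dotv x x <= 4 * `|x| ^+ 2.
Proof. exact: le_trans (ler_norm _) (dotv_bound x x). Qed.

Lemma enorm_sq n (x : 'rV[R]_n) : enorm x ^+ 2 = dotv x x.
Proof.
rewrite sqr_sqrtr ?dotvE//; last by apply: sumr_ge0 => i _; exact: sqr_ge0.
Qed.

Lemma norm_le_enorm n (x : 'rV[R]_n.+1) : `|x| <= enorm x.
Proof.
by rewrite -(@ler_pXn2r _ 2)// ?nnegrE ?sqrtr_ge0// enorm_sq norm_sq_le_dotv.
Qed.

Lemma enorm_le x : enorm x <= 2 * `|x|.
Proof.
rewrite -(@ler_pXn2r _ 2)// ?nnegrE ?sqrtr_ge0 ?mulr_ge0//.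
by rewrite enorm_sq exprMn (le_trans (dotv_le x))// -natrX.
Qed.

(** For q > 0, raise x/q <= exp(x/q) to the power q. *)
Lemma expr_le_expR (q : nat) (x : R) : 0 <= x -> x ^+ q <= q%:R ^+ q * expR x.
Proof.
case: q => [|q] x0; first by rewrite !expr0 mul1r -expR0 ler_expR.
have q0 : 0 < q.+1%:R :> R by [].
have -> : expR x = expR (x / q.+1%:R) ^+ q.+1.
  by rewrite -expRM_natl mulrC mulfVK// gt_eqF.
rewrite -exprMn ler_pXn2r// ?nnegrE ?mulr_ge0 ?expR_ge0//.
rewrite -ler_pdivrMl// mulrC (le_trans _ (expR_ge1Dx _))// lerDr//.
Qed.

(** After [expr_le_expR] it remains to see that r <= 1/(4c) + c r^2, where the difference is a
    square. *)
Lemma poly_gauss_le (q : nat) (c r : R) : 0 < c -> 0 <= r ->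
  (1 + r) ^+ q <= q%:R ^+ q * expR (1 + (4 * c)^-1) * expR (c * r ^+ 2).
Proof.
move=> c0 r0; apply: (le_trans (expr_le_expR _ _)); first by rewrite addr_ge0.
rewrite -mulrA -expRD ler_wpM2l ?exprn_ge0// ler_expR -addrA lerD2l.
rewrite -subr_ge0 (_ : _ - _ = c * (r - (2 * c)^-1) ^+ 2).
  by rewrite mulr_ge0 ?sqr_ge0// ltW.
by field; rewrite gt_eqF.
Qed.

End norms.

Section gauss4.
Context {R : realType}.
Local Notation leb := (@lebesgue_measure R).
Local Notation TR := (measurableTypeR R).

Lemma gauss4E (c : R) z : gauss4 c z = expR (- c * dotv (vec4 z) (vec4 z)).
Proof.
rewrite /gauss4 -!expRD dotvE !big_ord_recl big_ord0 !mxE /tnth/=; congr expR; ring.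
Qed.

Lemma expR_norm_le_gauss4 (c : R) z : 0 <= c ->
  expR (- c * `|vec4 z| ^+ 2) <= gauss4 (c / 4) z.
Proof.
move=> c0; rewrite gauss4E ler_expR; have := dotv_le (vec4 z); nra.
Qed.

Lemma bil_lower (A : 'M[R]_4) c x : (forall x, c * `|x| ^+ 2 <= bil A x x) ->
  expR (- bil A x x / 2) <= expR (- (c / 2) * `|x| ^+ 2).
Proof. by move=> cA; rewrite ler_expR; have := cA x; nra. Qed.

Lemma gauss_dominated_integrable (f : 'rV[R]_4 -> R) M c : 0 < c ->
  measurable_fun setT (fun z : TR * TR * TR * TR => f (vec4 z)) ->
  (forall x, `|f x| <= M * expR (- c * `|x| ^+ 2)) ->
  leb4.-integrable setT (EFin \o (fun z => f (vec4 z))).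
Proof.
move=> c0 mf fM; have M0 : 0 <= M.
  by have := fM 0; rewrite normr0 expr0n mulr0 expR0 mulr1; exact: le_trans.
have c40 : 0 < c / 4 by rewrite divr_gt0.
have gi := integrable_scale measurableT M (gauss4_integrable c40).
apply: (integrable_dominated measurableT mf gi) => z _.
by rewrite (le_trans (fM _))// ler_wpM2l// expR_norm_le_gauss4// ltW.
Qed.

Lemma leb4_iter (f : 'rV[R]_4 -> R) M c : 0 < c -> continuous f ->
  (forall x, `|f x| <= M * expR (- c * `|x| ^+ 2)) ->
  \int[leb4]_z f (vec4 z) = iter_int f.
Proof.
move=> c0 cf fM; have M0 : 0 <= M.
  by have := fM 0; rewrite normr0 expr0n mulr0 expR0 mulr1; exact: le_trans.
apply: (@lebesgue4_iter _ _ M (c / 4)); first by rewrite divr_gt0.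
  exact: measurable_continuous4.
by move=> z; rewrite (le_trans (fM _))// ler_wpM2l// expR_norm_le_gauss4// ltW.
Qed.

Lemma dotv_continuous n (v : 'rV[R]_n) : continuous (dotv v).
Proof.
rewrite (_ : dotv v = fun x => \sum_i v ord0 i * x ord0 i); last first.
  by apply/funext => y; rewrite dotvE.
apply: continuous_sum => i; apply: continuousM; first exact: continuousC.
exact: coord_continuous.
Qed.

Lemma bil_continuous (A : 'M[R]_4) : continuous (fun x => bil A x x).
Proof.
rewrite (_ : (fun x => bil A x x) =
   fun x => \sum_j (\sum_i x ord0 i * A i j) * x ord0 j); last first.
  by apply/funext => y; rewrite bilE.
apply: continuous_sum => i; apply: continuousM; last exact: coord_continuous.
apply: continuous_sum => j; apply: continuousM; last exact: continuousC.
exact: coord_continuous.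
Qed.

Lemma gauss_continuous (A : 'M[R]_4) : continuous (fun x => expR (- bil A x x / 2)).
Proof.
apply: continuous1; first exact: continuous_expR.
apply: continuousM; last exact: continuousC.
apply: continuousN; exact: bil_continuous.
Qed.

Lemma coercive_posdef (A : 'M[R]_4) c : A^T = A -> 0 < c ->
  (forall x, c * `|x| ^+ 2 <= bil A x x) -> posdef A.
Proof.
move=> sA c0 cA; split => // x x0; apply: lt_le_trans (cA x).
by rewrite mulr_gt0// exprn_gt0// normr_gt0.
Qed.

Lemma gauss_cos4 (A : 'M[R]_4) (w : 'rV[R]_4) (b c : R) : A^T = A -> 0 < c ->
  (forall x, c * `|x| ^+ 2 <= bil A x x) ->
  0 < \det A /\
  \int[leb4]_z (expR (- bil A (vec4 z) (vec4 z) / 2) * cos (bil A w (vec4 z) + b)) =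
  Num.sqrt ((2 * pi) ^+ 4 / \det A) * expR (- bil A w w / 2) * cos b.
Proof.
move=> sA c0 cA; have pA := coercive_posdef sA c0 cA.
have [dA iA] := iter_gauss w b 1 pA; split => //.
rewrite mul1r in iA; rewrite -iA.
rewrite (@leb4_iter (fun x => expR (- bil A x x / 2) * cos (bil A w x + b)) 1 (c / 2)).
- by congr iter_int; apply/funext => x; rewrite mul1r.
- by rewrite divr_gt0.
- apply: continuousM; first exact: gauss_continuous.
  apply: continuous1; first exact: continuous_cos.
  apply: continuousD; last exact: continuousC.
  exact: dotv_continuous.
move=> x; rewrite mul1r normrM ger0_norm ?expR_ge0//.
rewrite -[leRHS]mulr1 ler_pM ?expR_ge0// ?bil_lower//.
by rewrite ler_norml cos_geN1 cos_le1.
Qed.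

Lemma leb4_affine (s : R) (c : 'rV[R]_4) : s != 0 ->
  exists k : {nonneg R}, k%:num = `|s^-1| ^+ 4 /\
  exists phi, (forall z, vec4 (phi z) = s *: vec4 z + c) /\
  scales_measure (@leb4 R) phi k.
Proof.
move=> s0; pose a i := lebesgue_affine (c ord0 (inord i)) s0.
have h := scales_measure_prod (m1 := leb3) (m2 := leb)
  (scales_measure_prod (m1 := leb2) (m2 := leb)
    (scales_measure_prod (m1 := leb) (m2 := leb) (a 0%N) (a 1%N)) (a 2%N)) (a 3%N).
eexists; split; last first.
  eexists; split; last exact: h.
  move=> z /=; rewrite -[RHS]vec4_surj; congr (vec4 (_, _, _, _));
    by rewrite !mxE (tnth_nth 0) /= inordK.
by rewrite /=; ring.
Qed.

Lemma leb4_affine_integral (s : R) (c : 'rV[R]_4) (F : 'rV[R]_4 -> R) : s != 0 ->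
  leb4.-integrable setT (EFin \o (fun z => F (vec4 z))) ->
  leb4.-integrable setT (EFin \o (fun z => F (s *: vec4 z + c))) /\
  \int[leb4]_z F (s *: vec4 z + c) = `|s^-1| ^+ 4 * \int[leb4]_z F (vec4 z).
Proof.
move=> s0 iF; have [k [kE [phi [phiE sc]]]] := leb4_affine c s0.
split.
  have := scales_measure_integrable sc iF; apply: eq_integrable => //.
  by move=> z _ /=; rewrite phiE.
rewrite -kE -(scales_measure_Rintegral sc iF); apply: eq_Rintegral => z _.
by rewrite phiE.
Qed.

End gauss4.

(** * From characteristic functions to means *)

Section laws.
Context {R : realType}.
Local Notation leb := (@lebesgue_measure R).
Local Notation TR := (measurableTypeR R).

(* A random vector [V] under the probability with density [p]: this covers both
   a probability space ([p = 1]) and a Gaussian law ([V = vec4] on R^4). *)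
Definition is_law d (T : measurableType d)
    (m : {sigma_finite_measure set T -> \bar R}) (p : T -> R) (V : T -> 'rV[R]_4) :=
  [/\ m.-integrable setT (EFin \o p), \int[m]_t p t = 1, forall t, 0 <= p t &
      forall i, measurable_fun setT (fun t => V t ord0 i)].

Definition mean d (T : measurableType d)
    (m : {sigma_finite_measure set T -> \bar R}) (p : T -> R) (V : T -> 'rV[R]_4)
    (f : 'rV[R]_4 -> R) := \int[m]_t (p t * f (V t)).

Definition moment_bound d (T : measurableType d)
    (m : {sigma_finite_measure set T -> \bar R}) (p : T -> R) (V : T -> 'rV[R]_4)
    (q : nat) (B : R) :=
  m.-integrable setT (EFin \o (fun t => p t * (1 + `|V t|) ^+ q)) /\
  mean m p V (fun x => (1 + `|x|) ^+ q) <= B.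

Lemma Rintegral_ge0 d (T : measurableType d) (m : {measure set T -> \bar R}) (D : set T) (f : T -> R) :
  (forall x, D x -> 0 <= f x) -> 0 <= \int[m]_(x in D) f x.
Proof. by move=> f0; rewrite fine_ge0// integral_ge0// => x Dx; rewrite lee_fin f0. Qed.

Lemma Rintegral_scale d (T : measurableType d) (m : {measure set T -> \bar R}) (D : set T)
    (k : R) (f : T -> R) : measurable D -> m.-integrable D (EFin \o f) ->
  \int[m]_(x in D) (k * f x) = k * \int[m]_(x in D) f x.
Proof. by move=> mD fi; rewrite RintegralZl. Qed.

Lemma continuous_subr (y : 'rV[R]_4) (g : 'rV[R]_4 -> R) : continuous g ->
  continuous (fun x : 'rV[R]_4 => g (x - y)) /\ continuous (fun x : 'rV[R]_4 => g (y - x)).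
Proof.
move=> cg; split=> x.
  apply: (@continuous_comp _ _ _ (fun x : 'rV[R]_4 => x - y)); last exact: cg.
  exact: (cvgB cvg_id (cvg_cst _)).
apply: (@continuous_comp _ _ _ (fun x : 'rV[R]_4 => y - x)); last exact: cg.
exact: (cvgB (cvg_cst _) cvg_id).
Qed.

Lemma Rintegral_norm_le d (T : measurableType d) (m : {measure set T -> \bar R}) (f g : T -> R) :
  measurable_fun setT f -> m.-integrable setT (EFin \o g) ->
  (forall x, `|f x| <= g x) -> `|\int[m]_x f x| <= \int[m]_x g x.
Proof.
move=> mf gi fg.
have fi : m.-integrable setT (EFin \o f).
  exact: (integrable_dominated measurableT mf gi (fun x _ => fg x)).
apply: (le_trans (le_normr_Rintegral measurableT fi)).
apply: le_Rintegral => //; exact: (integrable_norm measurableT fi).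
Qed.

Section one_law.
Context d (T : measurableType d) (m : {sigma_finite_measure set T -> \bar R}).
Variables (p : T -> R) (V : T -> 'rV[R]_4).
Hypothesis L : is_law m p V.

Lemma law_measurable f : continuous f -> measurable_fun setT (fun t => p t * f (V t)).
Proof.
case: L => /integrableP[/measurable_EFinP mp _] _ _ mV cf.
apply: measurable_funM => //; exact: (continuous_measurable_comp mV cf).
Qed.

Lemma law_integrable f M : continuous f -> (forall x, `|f x| <= M) ->
  m.-integrable setT (EFin \o (fun t => p t * f (V t))).
Proof.
move=> cf fM; case: (L) => ip _ p0 _.
apply: (integrable_dominated measurableT (law_measurable cf)
  (integrable_scale measurableT M ip)) => t _.
by rewrite normrM ger0_norm// mulrC ler_wpM2r.
Qed.

Lemma law_integrable_poly f q B C : moment_bound m p V q B -> continuous f ->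
  (forall x, `|f x| <= C * (1 + `|x|) ^+ q) ->
  m.-integrable setT (EFin \o (fun t => p t * f (V t))).
Proof.
move=> [iq _] cf fC; case: (L) => _ _ p0 _.
apply: (integrable_dominated measurableT (law_measurable cf)
  (integrable_scale measurableT C iq)) => t _.
by rewrite normrM ger0_norm// mulrCA ler_wpM2l.
Qed.

End one_law.

(** In the frequency variable: up to a constant factor, [gk s] is the Fourier transform of the
    Gaussian density of standard deviation s (see [gk_cos]). *)
Definition gk (s : R) (v : 'rV[R]_4) := expR (- bil ((s ^+ 2)%:M) v v / 2).

Lemma bil_scalar (a : R) (u v : 'rV[R]_4) : bil (a%:M) u v = a * dotv u v.
Proof. by rewrite /bil mul_mx_scalar -scalemxAl mxE. Qed.

Lemma gk_le s v : gk s v <= expR (- (s ^+ 2 / 2) * `|v| ^+ 2).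
Proof.
by apply: bil_lower => x; rewrite bil_scalar ler_wpM2l ?sqr_ge0// norm_sq_le_dotv.
Qed.

Lemma gk_continuous s : continuous (gk s).
Proof. exact: gauss_continuous. Qed.

Lemma gk_integrable s : 0 < s -> leb4.-integrable setT (EFin \o (fun z => gk s (vec4 z))).
Proof.
move=> s0; apply: (@gauss_dominated_integrable _ _ 1 (s ^+ 2 / 2)).
- by rewrite divr_gt0// exprn_gt0.
- exact: (measurable_continuous4 (@gk_continuous s)).
- by move=> x; rewrite mul1r ger0_norm ?expR_ge0// gk_le.
Qed.

Lemma gk_cos s (y : 'rV[R]_4) : 0 < s ->
  \int[leb4]_z (gk s (vec4 z) * cos (dotv (vec4 z) y)) =
  (2 * pi) ^+ 2 / s ^+ 4 * gk (s^-1) y.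
Proof.
move=> s0; have s20 : 0 < s ^+ 2 by rewrite exprn_gt0.
have hb (x : 'rV[R]_4) : s ^+ 2 * `|x| ^+ 2 <= bil (s ^+ 2)%:M x x.
  by rewrite bil_scalar ler_wpM2l ?sqr_ge0// norm_sq_le_dotv.
have [_ h] := gauss_cos4 ((s ^+ 2)^-1 *: y) 0 (tr_scalar_mx _ _) s20 hb.
transitivity (\int[leb4]_z (gk s (vec4 z) * cos (bil (s ^+ 2)%:M ((s ^+ 2)^-1 *: y) (vec4 z) + 0))).
  apply: eq_Rintegral => z _; congr (_ * cos _).
  by rewrite addr0 bil_scalar dotvZl mulrA mulfV ?gt_eqF// mul1r dotvC.
rewrite h det_scalar cos0 mulr1; congr (_ * expR (- _ / 2)).
  rewrite -exprM (_ : (2 * pi) ^+ 4 / s ^+ 8 = ((2 * pi) ^+ 2 / s ^+ 4) ^+ 2).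
    by rewrite sqrtr_sqr ger0_norm// divr_ge0// ?exprn_ge0// ?mulr_ge0 ?pi_ge0// ltW.
  by field; rewrite gt_eqF.
by rewrite !bil_scalar dotvZl dotvZr; field; rewrite gt_eqF.
Qed.

Section smoothing.
Variables (f : 'rV[R]_4 -> R) (M s : R).
Hypotheses (s0 : 0 < s) (cf : continuous f)
  (fM : forall x, `|f x| <= M * expR (- `|x| ^+ 2)).

Let fM' x : `|f x| <= M * expR (- 1 * `|x| ^+ 2).
Proof. by rewrite mulN1r. Qed.

Let M0 : 0 <= M.
Proof. by have := fM 0; rewrite normr0 expr0n oppr0 expR0 mulr1; exact: le_trans. Qed.

Let fb x : `|f x| <= M.
Proof.
by rewrite (le_trans (fM x))// -[leRHS]mulr1 ler_wpM2l// -expR0 ler_expR oppr_le0 sqr_ge0.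
Qed.

Let fi : leb4.-integrable setT (EFin \o (fun z => f (vec4 z))).
Proof. exact: gauss_dominated_integrable ltr01 (measurable_continuous4 cf) fM'. Qed.

(* Up to a constant factor, the convolution of [f] with a Gaussian density of scale [s], written as a
   superposition of characters: closeness of characteristic functions bounds the difference of its means. *)
Definition smooth (y : 'rV[R]_4) : R := \int[(leb4 \x leb4)%E]_z
  (f (vec4 z.1) * gk s (vec4 z.2) * cos (dotv (vec4 z.2) (y - vec4 z.1))).

Lemma smooth_integrand_measurable d (T : measurableType d) (V : T -> 'rV[R]_4) :
  (forall i, measurable_fun setT (fun t => V t ord0 i)) ->
  measurable_fun setT (fun w : T * (TR * TR * TR * TR * (TR * TR * TR * TR)) =>
  f (vec4 w.2.1) * gk s (vec4 w.2.2) * cos (dotv (vec4 w.2.2) (V w.1 - vec4 w.2.1))).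
Proof.
move=> mV; apply: measurable_funM.
  apply: measurable_funM.
    apply: (measurableT_comp (measurable_continuous4 cf)).
    exact: measurableT_comp.
  apply: (measurableT_comp (measurable_continuous4 (@gk_continuous s))).
  exact: measurableT_comp.
apply: measurableT_comp; first by apply: continuous_measurable_fun; exact: continuous_cos.
under eq_fun do rewrite dotvE.
apply: measurable_sum => i; apply: measurable_funM.
  apply: (measurableT_comp (measurable_vec4 i)); exact: measurableT_comp.
under eq_fun do rewrite mxE [X in _ + X]mxE.
apply: measurable_funB; first exact: (measurableT_comp (mV i) measurable_fst).
by apply: (measurableT_comp (measurable_vec4 i)); exact: measurableT_comp.
Qed.

Lemma smooth_integrand_measurable1 (y : 'rV[R]_4) :
  measurable_fun setT (fun z : (TR * TR * TR * TR) * (TR * TR * TR * TR) =>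
  f (vec4 z.1) * gk s (vec4 z.2) * cos (dotv (vec4 z.2) (y - vec4 z.1))).
Proof.
have h := @smooth_integrand_measurable _ TR (fun _ => y) (fun i => measurable_cst _).
exact: (measurable_fun_pair2 (0 : TR) h).
Qed.

Let bound12 : (sprod leb4 leb4).-integrable setT (EFin \o
  (fun z : (TR * TR * TR * TR) * (TR * TR * TR * TR) => `|f (vec4 z.1)| * gk s (vec4 z.2))).
Proof.
exact: (prod_integrable (m1 := leb4) (m2 := leb4) (integrable_norm measurableT fi) (gk_integrable s0)).
Qed.

Let cos_bound (x : R) : `|cos x| <= 1.
Proof. by rewrite ler_norml cos_geN1 cos_le1. Qed.

Lemma smooth_bound y z : `|f (vec4 z.1) * gk s (vec4 z.2) * cos (dotv (vec4 z.2) (y - vec4 z.1))|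
  <= `|f (vec4 z.1)| * gk s (vec4 z.2).
Proof.
rewrite normrM [`|_ * gk _ _|]normrM [`|gk _ _|]ger0_norm ?expR_ge0//.
by rewrite -[leRHS]mulr1 ler_wpM2l// mulr_ge0// expR_ge0.
Qed.

(** Integrating out the frequency with [gk_cos] leaves the convolution of f with [gk (s^-1)]; an
    affine substitution then gives the kernel a fixed width. As [gk 1] has mass (2 pi)^2, [smooth]
    approximates (2 pi)^4 f. *)
Lemma smoothE y : smooth y =
  (2 * pi) ^+ 2 * \int[leb4]_z (f (y + s *: vec4 z) * gk 1 (vec4 z)).
Proof.
have mF : measurable_fun setT (fun z : (TR * TR * TR * TR) * (TR * TR * TR * TR) =>
   f (vec4 z.1) * gk s (vec4 z.2) * cos (dotv (vec4 z.2) (y - vec4 z.1))).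
  exact: smooth_integrand_measurable1.
rewrite /smooth (Rfubini12 (m1 := leb4) (m2 := leb4) mF (integrable_norm measurableT fi) (gk_integrable s0) (smooth_bound y)).
transitivity (\int[leb4]_z ((2 * pi) ^+ 2 / s ^+ 4 * (f (vec4 z) * gk (s^-1) (y - vec4 z)))).
  apply: eq_Rintegral => z _ /=.
  transitivity (\int[leb4]_v (f (vec4 z) * (gk s (vec4 v) * cos (dotv (vec4 v) (y - vec4 z))))).
    by apply: eq_Rintegral => v _; rewrite mulrA.
  have cv : continuous (fun v => gk s v * cos (dotv v (y - vec4 z))).
    apply: continuousM; first exact: gk_continuous.
    apply: continuous1; first exact: continuous_cos.
    by under eq_fun do rewrite dotvC; exact: dotv_continuous.
  have iv : leb4.-integrable setT (EFin \o
      (fun v => gk s (vec4 v) * cos (dotv (vec4 v) (y - vec4 z)))).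
    apply: (integrable_dominated measurableT (measurable_continuous4 cv) (gk_integrable s0)).
    by move=> v _; rewrite normrM ger0_norm ?expR_ge0// -[leRHS]mulr1 ler_wpM2l// expR_ge0.
  by rewrite (Rintegral_scale _ measurableT iv) gk_cos//; ring.
have i1 : leb4.-integrable setT (EFin \o (fun z => f (vec4 z) * gk (s^-1) (y - vec4 z))).
  have gN x : gk (s^-1) (y - x) = gk (s^-1) (x - y).
    by rewrite /gk -opprB bilNl bilNr opprK.
  have cg : continuous (fun x => f x * gk (s^-1) (y - x)).
    apply: continuousM => //.
    exact: (continuous_subr _ (@gk_continuous _)).2.
  apply: (integrable_dominated measurableT (measurable_continuous4 cg) (integrable_norm measurableT fi)).
  move=> z _; rewrite normrM -[leRHS]mulr1 ler_wpM2l// ger0_norm ?expR_ge0//.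
  rewrite -expR0 ler_expR mulNr oppr_le0 divr_ge0// bil_scalar mulr_ge0 ?sqr_ge0//.
  exact: le_trans (sqr_ge0 _) (norm_sq_le_dotv _).
rewrite (Rintegral_scale _ measurableT i1).
have [_ h] := leb4_affine_integral (F := fun x => f x * gk (s^-1) (y - x)) y (lt0r_neq0 s0) i1.
rewrite -mulrA; congr (_ * _).
rewrite [LHS](_ : _ = `|s^-1| ^+ 4 * \int[leb4]_z (f (vec4 z) * gk (s^-1) (y - vec4 z))).
  rewrite -h; apply: eq_Rintegral => z _; rewrite addrC; congr (_ * _).
  rewrite /gk !bil_scalar (_ : y - (y + s *: vec4 z) = - (s *: vec4 z)); last first.
    by rewrite opprD addrA subrr add0r.
  rewrite dotvNl dotvNr opprK dotvZl dotvZr.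
  by congr expR; field; rewrite gt_eqF.
by rewrite ger0_norm ?invr_ge0 ?ltW// exprVn mulrC.
Qed.

Lemma gk1_total : \int[leb4]_z gk 1 (vec4 z) = (2 * pi) ^+ 2.
Proof.
have := @gk_cos 1 0 ltr01; rewrite expr1n divr1 invr1.
have z0 : dotv (0 : 'rV[R]_4) 0 = 0 :> R by rewrite /dotv mul0mx mxE.
rewrite {2}/gk bil_scalar z0 mulr0 oppr0 mul0r expR0 mulr1 => <-.
apply: eq_Rintegral => z _.
by rewrite (_ : dotv _ 0 = 0) ?cos0 ?mulr1// dotvC /dotv mul0mx mxE.
Qed.

(** Fubini brings the mean inside the superposition, where it meets characters only. *)
Lemma smooth_mean d (T : measurableType d) (m : {sigma_finite_measure set T -> \bar R}) p V :
  is_law m p V ->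
  \int[m]_t (p t * smooth (V t)) =
  \int[(leb4 \x leb4)%E]_z (f (vec4 z.1) * gk s (vec4 z.2) *
    mean m p V (fun x => cos (dotv (vec4 z.2) (x - vec4 z.1)))) /\
  (sprod leb4 leb4).-integrable setT (EFin \o (fun z : (TR * TR * TR * TR) * (TR * TR * TR * TR) => 
   f (vec4 z.1) * gk s (vec4 z.2) *
    mean m p V (fun x => cos (dotv (vec4 z.2) (x - vec4 z.1))))) /\
  m.-integrable setT (EFin \o (fun t => p t * smooth (V t))).
Proof.
move=> L; have [ip p1 p0 mV] := L.
pose F (w : T * ((TR * TR * TR * TR) * (TR * TR * TR * TR))) := p w.1 *
  (f (vec4 w.2.1) * gk s (vec4 w.2.2) * cos (dotv (vec4 w.2.2) (V w.1 - vec4 w.2.1))).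
have mF : measurable_fun setT F.
  apply: measurable_funM; last exact: smooth_integrand_measurable.
  have /integrableP[/measurable_EFinP mp _] := ip; exact: measurableT_comp.
have Fb w : `|F w| <= p w.1 * (`|f (vec4 w.2.1)| * gk s (vec4 w.2.2)).
  by rewrite normrM ger0_norm// ler_wpM2l// smooth_bound.
have e1 t : p t * smooth (V t) = \int[sprod leb4 leb4]_z F (t, z).
  rewrite /smooth -RintegralZl//.
  have := dominated_section2 mF bound12 Fb t; rewrite /F/=.
  have mS : measurable_fun setT (fun z : (TR * TR * TR * TR) * (TR * TR * TR * TR) =>
   f (vec4 z.1) * gk s (vec4 z.2) * cos (dotv (vec4 z.2) (V t - vec4 z.1))).
    exact: smooth_integrand_measurable1.
  move=> _; exact: (integrable_dominated measurableT mS bound12 (fun z _ => smooth_bound (V t) z)).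
have e2 z : f (vec4 z.1) * gk s (vec4 z.2) *
    mean m p V (fun x => cos (dotv (vec4 z.2) (x - vec4 z.1))) = \int[m]_t F (t, z).
  have ic : continuous (fun x : 'rV[R]_4 => cos (dotv (vec4 z.2) (x - vec4 z.1))).
    apply: continuous1; first exact: continuous_cos.
    exact: (continuous_subr _ (@dotv_continuous R _ _)).1.
  rewrite /mean -(Rintegral_scale _ measurableT (law_integrable L ic (fun x => cos_bound _))).
  by apply: eq_Rintegral => t _; rewrite /F/=; ring.
split.
  transitivity (\int[m]_t \int[sprod leb4 leb4]_z F (t, z)).
    by apply: eq_Rintegral => t _; exact: e1.
  rewrite -(Rfubini12 (m2 := sprod leb4 leb4) mF ip bound12 Fb).
  rewrite (Rfubini21 (m2 := sprod leb4 leb4) mF ip bound12 Fb).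
  by apply: eq_Rintegral => z _; rewrite e2.
split; last first.
  apply: eq_integrable (Rfubini_integrable1 (m2 := sprod leb4 leb4) mF ip bound12 Fb) => // t _.
  by rewrite /= e1.
have e2' := funext e2; rewrite e2'.
have mG := measurable_fubini_G (dominated_prod_integrable (m2 := sprod leb4 leb4) mF ip bound12 Fb).
have mI : measurable_fun setT (fun z => \int[m]_t F (t, z)).
  apply/measurable_EFinP; apply: eq_measurable_fun mG => z _.
  rewrite /fubini_G /Rintegral/= fineK//.
  exact: (integrable_fin_num measurableT (dominated_section1
    (g2 := fun z => `|f (vec4 z.1)| * gk s (vec4 z.2)) mF ip Fb z)).
apply: (integrable_dominated measurableT mI bound12) => z _.
rewrite -[leRHS]mul1r -p1 -RintegralZr//.
apply: Rintegral_norm_le.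
- exact: (measurable_fun_pair1 z mF).
- by under eq_fun do rewrite mulrC; exact: integrable_scale.
- by move=> t; exact: (Fb (t, z)).
Qed.

(** The phase [b] covers the real and imaginary parts of the characteristic function at once. The
    weight (1 + |v|)^4 is the growth in the frequency of the error in [clt_bound]. *)
Definition charfun_close d (T : measurableType d) (m : {sigma_finite_measure set T -> \bar R}) p V
    d' (T' : measurableType d') (m' : {sigma_finite_measure set T' -> \bar R}) p' V' (eta : R) :=
  forall (v : 'rV[R]_4) (b : R),
  `|mean m p V (fun x => cos (dotv v x + b)) - mean m' p' V' (fun x => cos (dotv v x + b))|
  <= eta * (1 + `|v|) ^+ 4.

Definition fq (z : (TR * TR * TR * TR) * (TR * TR * TR * TR)) : R :=
  `|f (vec4 z.1)| * (gk s (vec4 z.2) * (1 + `|vec4 z.2|) ^+ 4).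

Lemma poly_continuous q : continuous (fun x : 'rV[R]_4 => (1 + `|x|) ^+ q).
Proof.
apply: (continuous1 (h := fun y => y ^+ q)); first by move=> x; exact: exprn_continuous.
by apply: continuousD; [exact: continuousC|exact: norm_continuous].
Qed.

Lemma fq_integrable : (sprod leb4 leb4).-integrable setT (EFin \o fq).
Proof.
apply: (prod_integrable (m1 := leb4) (m2 := leb4) (integrable_norm measurableT fi)
  (g := fun z => gk s (vec4 z) * (1 + `|vec4 z|) ^+ 4)).
have s4 : 0 < s ^+ 2 / 4 by rewrite divr_gt0 ?exprn_gt0.
apply: (@gauss_dominated_integrable _ (fun x => gk s x * (1 + `|x|) ^+ 4)
  (4%:R ^+ 4 * expR (1 + (4 * (s ^+ 2 / 4))^-1)) (s ^+ 2 / 4)) => //.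
  apply: (measurable_continuous4 (f := fun x => gk s x * (1 + `|x|) ^+ 4)).
  by apply: continuousM; [exact: gk_continuous|exact: poly_continuous].
move=> x; rewrite normrM ger0_norm ?expR_ge0// ger0_norm ?exprn_ge0 ?addr_ge0//.
have p0 : 0 <= (1 + `|x|) ^+ 4 by rewrite exprn_ge0 ?addr_ge0.
apply: (le_trans (ler_pM (expR_ge0 _) p0 (gk_le s x) (poly_gauss_le 4 s4 (normr_ge0 x)))).
rewrite mulrCA ler_wpM2l//.
by rewrite -expRD ler_expR; lra.
Qed.

Lemma smooth_mean_diff d (T : measurableType d) (m : {sigma_finite_measure set T -> \bar R}) p V
    d' (T' : measurableType d') (m' : {sigma_finite_measure set T' -> \bar R}) p' V' eta :
  is_law m p V -> is_law m' p' V' -> charfun_close m p V m' p' V' eta ->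
  `|\int[m]_t (p t * smooth (V t)) - \int[m']_t (p' t * smooth (V' t))| <=
  eta * \int[sprod leb4 leb4]_z fq z.
Proof.
move=> L L' cc; have [-> [i1 _]] := smooth_mean L; have [-> [i2 _]] := smooth_mean L'.
rewrite -(RintegralB (mu := sprod leb4 leb4) measurableT i1 i2).
rewrite -(Rintegral_scale eta measurableT fq_integrable).
apply: Rintegral_norm_le.
- by apply/measurable_EFinP; have /integrableP[] := integrable_sub measurableT i1 i2.
- exact: (integrable_scale measurableT eta fq_integrable).
move=> z; rewrite -mulrBr !normrM [`|gk _ _|]ger0_norm ?expR_ge0// /fq.
rewrite [leRHS](_ : _ = `|f (vec4 z.1)| * gk s (vec4 z.2) * (eta * (1 + `|vec4 z.2|) ^+ 4)).
  rewrite ler_wpM2l// ?mulr_ge0 ?expR_ge0//.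
  have := cc (vec4 z.2) (- dotv (vec4 z.2) (vec4 z.1)).
  have e : (fun x => cos (dotv (vec4 z.2) x - dotv (vec4 z.2) (vec4 z.1))) =
           (fun x => cos (dotv (vec4 z.2) (x - vec4 z.1))).
    by apply/funext => x; rewrite dotvBr.
  by rewrite e.
by ring.
Qed.

Let n1 : leb4.-integrable setT (EFin \o (fun u => `|vec4 u| * gk 1 (vec4 u))).
Proof.
apply: (@gauss_dominated_integrable _ (fun x => `|x| * gk 1 x)
  (1%:R ^+ 1 * expR (1 + (4 * (1/4))^-1)) (1 / 4)) => //.
  apply: (measurable_continuous4 (f := fun x => `|x| * gk 1 x)).
  by apply: continuousM; [exact: norm_continuous|exact: gk_continuous].
move=> x; rewrite normrM normr_id ger0_norm ?expR_ge0//.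
have h : `|x| <= 1%:R ^+ 1 * expR (1 + (4 * (1/4))^-1) * expR (1 / 4 * `|x| ^+ 2).
  by apply: le_trans (poly_gauss_le 1 _ (normr_ge0 x)); rewrite ?expr1 ?lerDr.
rewrite (le_trans (ler_pM _ _ h (gk_le _ _)))// ?expR_ge0//.
rewrite -[leLHS]mulrA ler_wpM2l ?mulr_ge0 ?expR_ge0// -expRD ler_expR expr1n; lra.
Qed.

(** Where |s u| < del the modulus of continuity applies; elsewhere the trivial bound 2 M is at most
    2 M s |u| / del, which is integrable against the kernel and of order s. *)
Lemma smooth_close e del : 0 <= e -> 0 < del ->
  (forall x y, `|x - y| < del -> `|f x - f y| <= e) -> forall y,
  `|smooth y - (2 * pi) ^+ 4 * f y| <= (2 * pi) ^+ 2 *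
    (e * (2 * pi) ^+ 2 + 2 * M / del * s * \int[leb4]_u (`|vec4 u| * gk 1 (vec4 u))).
Proof.
move=> e0 d0 uc y.
have pi0 : 0 <= (2 * pi) ^+ 2 :> R by rewrite sqr_ge0.
rewrite smoothE (_ : (2 * pi) ^+ 4 * f y = (2 * pi) ^+ 2 * (f y * (2 * pi) ^+ 2)); last by ring.
rewrite -mulrBr normrM ger0_norm// ler_wpM2l// -gk1_total.
have ig1 := gk_integrable ltr01.
have icy : continuous (fun x : 'rV[R]_4 => f (y + s *: x) * gk 1 x).
  apply: continuousM; last exact: gk_continuous.
  move=> x; apply: (@continuous_comp _ _ _ (fun x : 'rV[R]_4 => y + s *: x)); last exact: cf.
  exact: (cvgD (cvg_cst _) (cvgZr cvg_id)).
have iy : leb4.-integrable setT (EFin \o (fun u => f (y + s *: vec4 u) * gk 1 (vec4 u))).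
  apply: (integrable_dominated measurableT (measurable_continuous4 icy)
    (integrable_scale measurableT M ig1)) => u _.
  by rewrite normrM [`|gk _ _|]ger0_norm ?expR_ge0// ler_wpM2r// expR_ge0.
have ify := integrable_scale measurableT (f y) ig1.
have i3 := integrable_scale measurableT e ig1.
have i4 := integrable_scale measurableT (2 * M / del * s) n1.
rewrite -(Rintegral_scale (f y) measurableT ig1) -(RintegralB (mu := leb4) measurableT iy ify).
rewrite -(Rintegral_scale e measurableT ig1) -(Rintegral_scale _ measurableT n1).
rewrite -(RintegralD (mu := leb4) measurableT i3 i4).
apply: Rintegral_norm_le.
- by apply/measurable_EFinP; have /integrableP[] := integrable_sub measurableT iy ify.
- exact: (integrable_add measurableT i3 i4).
move=> u; rewrite -mulrBl normrM [`|gk _ _|]ger0_norm ?expR_ge0//.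
rewrite mulrA -mulrDl ler_wpM2r ?expR_ge0//.
have [ud|ud] := ltP `|s *: vec4 u| del.
  rewrite (le_trans (uc _ _ _))//; first by rewrite addrC addKr.
  by rewrite lerDl !mulr_ge0// ?invr_ge0 ?(ltW d0) ?(ltW s0).
apply: (@le_trans _ _ (2 * M)).
  by rewrite (le_trans (ler_normB _ _))// mulr2n mulrDl mul1r lerD.
rewrite -[leLHS]add0r lerD//.
rewrite normrZ (ger0_norm (ltW s0)) in ud.
rewrite (_ : 2 * M / del * s * _ = 2 * M * ((s * `|vec4 u|) / del)); last by ring.
by rewrite -[leLHS]mulr1 ler_wpM2l ?mulr_ge0// ler_pdivlMr// mul1r.
Qed.

Lemma mean_smooth_diff d (T : measurableType d) (m : {sigma_finite_measure set T -> \bar R}) p V e :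
  is_law m p V -> (forall y, `|smooth y - (2 * pi) ^+ 4 * f y| <= e) ->
  `|\int[m]_t (p t * smooth (V t)) - (2 * pi) ^+ 4 * mean m p V f| <= e.
Proof.
move=> L se; have [_ [_ i1]] := smooth_mean L; have [ip p1 p0 _] := L.
have i2 := law_integrable L cf fb.
have i3 := integrable_scale measurableT ((2 * pi) ^+ 4) i2.
rewrite /mean -(Rintegral_scale _ measurableT i2) -(RintegralB measurableT i1 i3).
rewrite (_ : e = e * \int[m]_t p t); last by rewrite p1 mulr1.
rewrite -(Rintegral_scale _ measurableT ip); apply: Rintegral_norm_le.
- by apply/measurable_EFinP; have /integrableP[] := integrable_sub measurableT i1 i3.
- exact: (integrable_scale measurableT e ip).
by move=> t; rewrite mulrCA -mulrBr normrM ger0_norm// mulrC ler_wpM2r.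
Qed.

End smoothing.

Lemma compact_support_unif (f : 'rV[R]_4 -> R) r : continuous f ->
  (forall x, r < `|x| -> f x = 0) -> forall e, 0 < e ->
  exists2 del, 0 < del & forall x y, `|x - y| < del -> `|f x - f y| <= e.
Proof.
move=> cf f0 e e0.
(* The unit margin makes both values zero when x is outside this ball and |x - y| < del <= 1. *)
pose K : set 'rV[R]_4 := [set x | `|x| <= r + 1].
have cK : compact K.
  apply: bounded_closed_compact.
    exists (r + 1); split; first exact: num_real.
    by move=> x rx y Ky; exact: le_trans Ky (ltW rx).
  rewrite (_ : K = (fun x => `|x|) @^-1` [set x | x <= r + 1])//.
  by apply: closed_comp; [move=> x _; exact: norm_continuous|exact: closed_le].
have nc := near_covering_withinP K; move: cK => /compact_near_coveringP nK.
pose P (del : R) (x : 'rV[R]_4) := forall y, `|x - y| < del -> `|f x - f y| <= e.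
have h : \forall del \near 0^'+, K `<=` P del.
  apply: nK => x Kx.
  have e2 : 0 < e / 2 by rewrite divr_gt0.
  have /cvgrPdist_lt/(_ _ e2)/nbhs_ballP[d0 /= d00 dx] := cf x.
  near=> z del => y zy.
  have xz : ball x (d0 / 2) z by near: z; apply: nbhsx_ballx; rewrite divr_gt0.
  have ed : del <= d0 / 2.
    by near: del; apply: nbhs_right_le; rewrite divr_gt0.
  have xz' : `|x - z| < d0 / 2 by move: xz; rewrite -ball_normE.
  have h1 : `|f x - f z| < e / 2.
    by apply: dx; rewrite -ball_normE/= (lt_trans xz')// ltr_pdivrMr// ltr_pMr// ltr1n.
  have h2 : `|f x - f y| < e / 2.
    apply: dx; rewrite -ball_normE/= -(subrK z x) -addrA.
    rewrite (le_lt_trans (ler_normD _ _))// [ltRHS]splitr ltrD//.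
    exact: lt_le_trans zy ed.
  rewrite (_ : f z - f y = (f x - f y) - (f x - f z)); last by ring.
  rewrite (le_trans (ler_normB _ _))// [leRHS]splitr lerD// ltW//.
have [del [d0 d1 Kd]] : exists del, [/\ 0 < del, del <= 1 & K `<=` P del].
  near (0 : R)^'+ => del; exists del; split.
  - by near: del; exact: nbhs_right_gt.
  - by near: del; exact: nbhs_right_le.
  - by near: del.
exists del => // x y xy; have [Kx|Kx] := leP `|x| (r + 1); first exact: Kd.
have yr : r < `|y|.
  have : `|x| <= `|y| + `|x - y| by rewrite -{1}(subrK y x) addrC (le_trans (ler_normD _ _))// addrC.
  by move: (lt_le_trans xy d1) Kx; lra.
have xr : r < `|x| by move: Kx; lra.
by rewrite !f0// subrr normr0 ltW.
Unshelve. all: by end_near.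
Qed.

(** Three choices, in this order: del from the uniform continuity of f, then the scale s of the
    smoothing, then eta from the integral [G], which depends on s. The final inequality is
    multiplied by Z^2 = (2 pi)^4. *)
Lemma weak_close (f : 'rV[R]_4 -> R) M r : continuous f ->
  (forall x, `|f x| <= M) -> (forall x, r < `|x| -> f x = 0) -> forall e, 0 < e ->
  exists2 eta, 0 < eta &
  forall d (T : measurableType d) (m : {sigma_finite_measure set T -> \bar R}) p V
    d' (T' : measurableType d') (m' : {sigma_finite_measure set T' -> \bar R}) p' V',
  is_law m p V -> is_law m' p' V' -> charfun_close m p V m' p' V' eta ->
  `|mean m p V f - mean m' p' V' f| <= e.
Proof.
move=> cf fM f0 e e0.
(* f vanishes where |x| > r, and exp(r^2) exp(-|x|^2) >= 1 elsewhere. *)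
pose M1 := M * expR (r ^+ 2) + 1.
have M0 : 0 <= M by apply: le_trans (fM 0).
have M10 : 0 <= M1 by rewrite /M1 addr_ge0// mulr_ge0// expR_ge0.
have fM1 x : `|f x| <= M1 * expR (- `|x| ^+ 2).
  have [xr|xr] := leP `|x| r; last by rewrite f0// normr0 mulr_ge0// expR_ge0.
  rewrite mulrDl (@le_trans _ _ (M * expR (r ^+ 2) * expR (- `|x| ^+ 2)))//; last first.
    by rewrite lerDl mul1r expR_ge0.
  rewrite (le_trans (fM x))// -mulrA -expRD -[leLHS]mulr1 ler_wpM2l// -expR0 ler_expR.
  by rewrite subr_ge0 ler_pXn2r// nnegrE// (le_trans (normr_ge0 x)).
have [Z [ZE Z0 Z2]] : exists Z : R,
    [/\ (2 * pi) ^+ 2 = Z, 0 < Z & (2 * pi) ^+ 4 = Z ^+ 2].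
  exists ((2 * pi) ^+ 2); split => //; last by rewrite -exprM.
  by rewrite exprn_gt0// mulr_gt0// pi_gt0.
pose W := \int[leb4]_u (`|vec4 u| * gk 1 (vec4 u)).
have W0 : 0 <= W by apply: Rintegral_ge0 => u _; rewrite mulr_ge0// expR_ge0.
have [del d0 uc] := compact_support_unif cf f0 (divr_gt0 e0 (ltr0n R 8)).
(* Makes the second term of [smooth_close] at most e Z / 8. *)
pose s := e / 8 * Z / (2 * M1 / del * W + 1).
have D0 : 0 < 2 * M1 / del * W + 1 by rewrite ltr_wpDl// !mulr_ge0// invr_ge0 ltW.
have s0 : 0 < s by rewrite /s divr_gt0// mulr_gt0// divr_gt0.
pose G := \int[sprod leb4 leb4]_z fq f s z.
have G0 : 0 <= G.
  apply: Rintegral_ge0 => z _; rewrite /fq mulr_ge0// mulr_ge0 ?expR_ge0//.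
exists (e / 2 * Z ^+ 2 / (G + 1)).
  by rewrite divr_gt0// ?ltr_wpDl// mulr_gt0 ?divr_gt0 ?exprn_gt0.
move=> d T m p V d' T' m' p' V' L L' cc.
have sc y : `|smooth f s y - (2 * pi) ^+ 4 * f y| <= Z * (e / 4 * Z).
  apply: (le_trans (smooth_close s0 cf fM1 _ d0 uc y)).
    by rewrite ltW// divr_gt0.
  rewrite ZE -/W ler_wpM2l ?(ltW Z0)//.
  have -> : 2 * M1 / del * s * W = e / 8 * Z * ((2 * M1 / del * W) / (2 * M1 / del * W + 1)).
    by rewrite /s; ring.
  have h : 2 * M1 / del * W / (2 * M1 / del * W + 1) <= 1.
    by rewrite ler_pdivrMr// mul1r lerDl.
  have e8 : 0 <= e / 8 * Z by rewrite mulr_ge0 ?ltW// divr_gt0.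
  move: (ler_wpM2l e8 h); clear; lra.
have h1 := mean_smooth_diff s0 cf fM1 L sc.
have h2 := mean_smooth_diff s0 cf fM1 L' sc.
have h3 := smooth_mean_diff s0 cf fM1 L L' cc.
have h4 : e / 2 * Z ^+ 2 / (G + 1) * G <= e / 2 * Z ^+ 2.
  rewrite -mulrA -[leRHS]mulr1 ler_wpM2l ?mulr_ge0 ?exprn_ge0 ?divr_ge0 ?(ltW e0) ?(ltW Z0)//.
  by rewrite mulrC ler_pdivrMr ?ltr_wpDl// mul1r lerDl.
rewrite -/G in h3.
rewrite Z2 in h1 h2.
have : Z ^+ 2 * `|mean m p V f - mean m' p' V' f| <= Z ^+ 2 * e.
  rewrite -[X in X * `|_|](ger0_norm (sqr_ge0 Z)) -normrM.
  move: h1 h2 h3 h4; rewrite !ler_norml; clear => /andP[? ?] /andP[? ?] /andP[? ?] ?.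
  by apply/andP; split; lra.
by rewrite ler_pM2l// exprn_gt0.
Qed.

(** Cut-off at radius r: beyond it f is at most C/r times (1 + |x|)^(q+1), so a moment of one order
    more controls what the cut-off loses. *)
Lemma weak_poly (f : 'rV[R]_4 -> R) C q : continuous f ->
  (forall x, `|f x| <= C * (1 + `|x|) ^+ q) -> forall B e, 0 < e ->
  exists2 eta, 0 < eta &
  forall d (T : measurableType d) (m : {sigma_finite_measure set T -> \bar R}) p V
    d' (T' : measurableType d') (m' : {sigma_finite_measure set T' -> \bar R}) p' V',
  is_law m p V -> is_law m' p' V' -> moment_bound m p V q.+1 B ->
  moment_bound m' p' V' q.+1 B -> charfun_close m p V m' p' V' eta ->
  `|mean m p V f - mean m' p' V' f| <= e.
Proof.
move=> cf fC B e e0.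
have C0 : 0 <= C.
  by have := fC 0; rewrite normr0 addr0 expr1n mulr1; exact: le_trans.
(* Makes C |B| / r at most e/4, the loss allowed to each of the two laws. *)
pose r := 4 * C * `|B| / e + 1.
have r0 : 0 < r by rewrite ltr_wpDl// divr_ge0 ?(ltW e0)// !mulr_ge0.
pose chi (x : 'rV[R]_4) : R := Num.min 1 (Num.max 0 (2 - `|x| / r)).
have chi0 x : 0 <= chi x by rewrite /chi le_min ler01 le_max lexx.
have chi1 x : chi x <= 1 by rewrite /chi ge_min lexx.
have cchi : continuous chi.
  apply: continuousMin; first exact: continuousC.
  apply: continuousMax; first exact: continuousC.
  apply: continuousD; first exact: continuousC.
  apply: continuousN; apply: continuousM; last exact: continuousC.
  exact: norm_continuous.
have chi2 x : 2 * r < `|x| -> chi x = 0.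
  move=> xr; have h : 2 - `|x| / r <= 0 by rewrite subr_le0 ler_pdivlMr// ltW.
  by rewrite /chi (max_l h) min_r.
pose g x := f x * chi x.
have cg : continuous g by exact: continuousM.
have ch : continuous (fun x => f x * (1 - chi x)).
  by apply: continuousM => //; apply: continuousD; [exact: continuousC|exact: continuousN].
have gM x : `|g x| <= C * (1 + 2 * r) ^+ q.
  have [xr|xr] := leP `|x| (2 * r).
    rewrite /g normrM -[leRHS]mulr1 ler_pM// ?[`|chi _|]ger0_norm//.
    rewrite (le_trans (fC x))// ler_wpM2l// lerXn2r// ?nnegrE ?addr_ge0// ?lerD2l//.
    by rewrite mulr_ge0// ltW.
  by rewrite /g chi2// mulr0 normr0 mulr_ge0// exprn_ge0// addr_ge0// mulr_ge0// ltW.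
have g0 x : 2 * r < `|x| -> g x = 0.
  by move=> xr; rewrite /g chi2// mulr0.
have e2 : 0 < e / 2 by rewrite divr_gt0.
have [eta eta0 H] := weak_close cg gM g0 e2.
exists eta => // d T m p V d' T' m' p' V' L L' mb mb' cc.
have key d1 (T1 : measurableType d1) (m1 : {sigma_finite_measure set T1 -> \bar R}) p1 V1 :
    is_law m1 p1 V1 -> moment_bound m1 p1 V1 q.+1 B ->
    `|mean m1 p1 V1 f - mean m1 p1 V1 g| <= e / 4.
  move=> L1 mb1; have [_ _ p10 _] := L1; have [iq qB] := mb1.
  have fC' x : `|f x| <= C * (1 + `|x|) ^+ q.+1.
    by rewrite (le_trans (fC x))// ler_wpM2l// ler_weXn2l// lerDl.
  have i1 := law_integrable_poly L1 mb1 cf fC'.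
  have i2 := law_integrable L1 cg gM.
  rewrite /mean -(RintegralB measurableT i1 i2).
  apply: (@le_trans _ _ (C / r * mean m1 p1 V1 (fun x => (1 + `|x|) ^+ q.+1))).
    rewrite /mean -(Rintegral_scale _ measurableT iq); apply: Rintegral_norm_le.
    - by apply/measurable_EFinP; have /integrableP[] := integrable_sub measurableT i1 i2.
    - exact: (integrable_scale measurableT (C / r) iq).
    move=> t; rewrite -mulrBr normrM ger0_norm// mulrCA ler_wpM2l//.
    rewrite /g -{1}[f _]mulr1 -mulrBr normrM.
    have [xr|xr] := leP `|V1 t| r.
      rewrite /chi min_l ?subrr ?normr0 ?mulr0.
        apply: mulr_ge0; first exact: (divr_ge0 C0 (ltW r0)).
        by apply: exprn_ge0; exact: addr_ge0.
      by rewrite le_max lerBrDr -lerBrDl ler_pdivrMr// (_ : 2 - 1 = 1) ?mul1r ?xr ?orbT//; lra.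
    rewrite (@le_trans _ _ (C * (1 + `|V1 t|) ^+ q * 1))//.
      rewrite ler_pM// ler_norml; move: (chi0 (V1 t)) (chi1 (V1 t)); clear => ? ?; apply/andP; split; lra.
    rewrite exprSr -!mulrA ler_wpM2l// mulrCA ler_wpM2l ?exprn_ge0 ?addr_ge0//.
    by rewrite mulrC ler_pdivlMr// mul1r ltW// (lt_le_trans xr)// lerDr.
  have CrB : C / r * `|B| <= e / 4.
    rewrite mulrAC ler_pdivrMr// /r mulrDr mulr1 (_ : e / 4 * _ = C * `|B|).
      by rewrite lerDl ltW// divr_gt0.
    by field; rewrite gt_eqF.
  apply: le_trans CrB; rewrite ler_wpM2l ?divr_ge0 ?(ltW r0)//.
  exact: le_trans qB (ler_norm _).
have := H _ _ _ _ _ _ _ _ _ _ L L' cc.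
have := key _ _ _ _ _ L mb; have := key _ _ _ _ _ L' mb'.
rewrite !ler_norml; clear => /andP[? ?] /andP[? ?] /andP[? ?]; apply/andP; split; lra.
Qed.

End laws.

(** * Gaussian laws *)

Section gaussian_law.
Context {R : realType}.
Local Notation TR := (measurableTypeR R).

Definition gdens (A : 'M[R]_4) (z : TR * TR * TR * TR) : R := gauss_pdf (invmx A) (vec4 z).

Section one_matrix.
Variables (A : 'M[R]_4) (c : R).
Hypotheses (sA : A^T = A) (c0 : 0 < c) (cA : forall x, c * `|x| ^+ 2 <= bil A x x).

Lemma coercive_unit : A \in unitmx.
Proof. by rewrite unitmxE unitfE gt_eqF//; have [] := gauss_cos4 0 0 sA c0 cA. Qed.

Definition gnorm : R := (Num.sqrt ((2 * pi) ^+ 4 / \det A))^-1.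

Lemma gnorm_gt0 : 0 < gnorm.
Proof.
have [dA _] := gauss_cos4 0 0 sA c0 cA.
by rewrite invr_gt0 sqrtr_gt0 divr_gt0// exprn_gt0// mulr_gt0// pi_gt0.
Qed.

Lemma gauss_pdfE x : gauss_pdf (invmx A) x = gnorm * expR (- bil A x x / 2).
Proof. by rewrite /gauss_pdf invmxK det_inv. Qed.

Lemma gauss_poly_integrable (f : 'rV[R]_4 -> R) C q : continuous f ->
  (forall x, `|f x| <= C * (1 + `|x|) ^+ q) ->
  leb4.-integrable setT (EFin \o (fun z => gdens A z * f (vec4 z))) /\
  `|mean leb4 (gdens A) (@vec4 R) f| <= gnorm *
    (C * (q%:R ^+ q * expR (1 + (4 * (c / 4))^-1)) *
     \int[leb4]_z gauss4 (c / 4 / 4) z).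
Proof.
move=> cf fC; have C0 : 0 <= C.
  by have := fC 0; rewrite normr0 addr0 expr1n mulr1; exact: le_trans.
have c4 : 0 < c / 4 by rewrite divr_gt0.
have c44 : 0 < c / 4 / 4 by rewrite divr_gt0.
set M := C * _.
have ig := integrable_scale measurableT (gnorm * M) (gauss4_integrable c44).
have mf : measurable_fun setT (fun z : TR * TR * TR * TR => gdens A z * f (vec4 z)).
  apply: (measurable_continuous4 (f := fun x => gauss_pdf (invmx A) x * f x)).
  apply: continuousM => //; rewrite (funext gauss_pdfE).
  by apply: continuousM; [exact: continuousC|exact: gauss_continuous].
have fb z : `|gdens A z * f (vec4 z)| <= gnorm * M * gauss4 (c / 4 / 4) z.
  rewrite normrM /gdens gauss_pdfE ger0_norm; last first.
    by rewrite mulr_ge0 ?expR_ge0// ltW// gnorm_gt0.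
  rewrite -[leLHS]mulrA -[leRHS]mulrA ler_wpM2l ?(ltW gnorm_gt0)//.
  apply: (@le_trans _ _ (expR (- (c / 2) * `|vec4 z| ^+ 2) * (C * (1 + `|vec4 z|) ^+ q))).
    by rewrite ler_pM ?expR_ge0// bil_lower.
  rewrite mulrCA /M -[leRHS]mulrA ler_wpM2l//.
  have p0 : 0 <= (1 + `|vec4 z|) ^+ q by rewrite exprn_ge0 ?addr_ge0.
  apply: le_trans (ler_pM (expR_ge0 _) p0 (lexx _) (poly_gauss_le q c4 (normr_ge0 (vec4 z)))) _.
  rewrite mulrCA ler_wpM2l ?mulr_ge0 ?exprn_ge0 ?expR_ge0// -expRD.
  apply: le_trans (expR_norm_le_gauss4 _ (ltW c4)).
  by rewrite ler_expR; lra.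
split; first exact: (integrable_dominated measurableT mf ig (fun z _ => fb z)).
rewrite mulrA -(Rintegral_scale (gnorm * M) measurableT (gauss4_integrable c44)).
exact: Rintegral_norm_le.
Qed.

Lemma gauss_charfun v b :
  mean leb4 (gdens A) (@vec4 R) (fun x => cos (dotv v x + b)) =
  expR (- bil (invmx A) v v / 2) * cos b.
Proof.
have [dA h] := gauss_cos4 (v *m invmx A) b sA c0 cA.
have uA := coercive_unit.
have e x : bil A (v *m invmx A) x = dotv v x by rewrite bil_dotv -mulmxA mulVmx// mulmx1.
have iA : leb4.-integrable setT (EFin \o
    (fun z => expR (- bil A (vec4 z) (vec4 z) / 2) * cos (bil A (v *m invmx A) (vec4 z) + b))).
  have c20 : 0 < c / 2 by rewrite divr_gt0.
  apply: (@gauss_dominated_integrable _ (fun x => expR (- bil A x x / 2) * cos (bil A (v *m invmx A) x + b)) 1 (c / 2)) => //.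
    apply: (measurable_continuous4 (f := fun x => expR (- bil A x x / 2) * cos (bil A (v *m invmx A) x + b))).
    apply: continuousM; first exact: gauss_continuous.
    apply: continuous1; first exact: continuous_cos.
    by apply: continuousD; [exact: dotv_continuous|exact: continuousC].
  move=> x; rewrite mul1r normrM ger0_norm ?expR_ge0// -[leRHS]mulr1 ler_pM ?expR_ge0//.
    exact: bil_lower.
  by rewrite ler_norml cos_geN1 cos_le1.
transitivity (gnorm * \int[leb4]_z (expR (- bil A (vec4 z) (vec4 z) / 2) *
    cos (bil A (v *m invmx A) (vec4 z) + b))).
  rewrite -(Rintegral_scale _ measurableT iA); apply: eq_Rintegral => z _.
  by rewrite e /gdens gauss_pdfE mulrA.
rewrite h e !mulrA mulVf ?mul1r; last first.
  by rewrite gt_eqF// sqrtr_gt0 divr_gt0// exprn_gt0// mulr_gt0// pi_gt0.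
by rewrite (bil_dotv (invmx A)) (dotvC v).
Qed.

Lemma gauss_is_law : is_law leb4 (gdens A) (@vec4 R).
Proof.
have c1 : continuous ((fun=> 1) : 'rV[R]_4 -> R) by exact: continuousC.
have b1 (x : 'rV[R]_4) : `|1 : R| <= 1 * (1 + `|x|) ^+ 0 by rewrite expr0 normr1 mulr1.
have [i1 _] := gauss_poly_integrable (f := fun=> 1) c1 b1.
have dv z : dotv (0 : 'rV[R]_4) z = 0 by rewrite /dotv mul0mx mxE.
split.
- by apply: eq_integrable i1 => // z _; rewrite /= mulr1.
- have := gauss_charfun 0 0; rewrite cos0 bil_dotv mul0mx dv oppr0 mul0r expR0 mul1r => <-.
  by apply: eq_Rintegral => z _; rewrite dv addr0 cos0 mulr1.
- by move=> z; rewrite /gdens gauss_pdfE mulr_ge0 ?expR_ge0// ltW// gnorm_gt0.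
- exact: measurable_vec4.
Qed.

Lemma gauss_meanE f C q : continuous f ->
  (forall x, `|f x| <= C * (1 + `|x|) ^+ q) ->
  gauss_mean (invmx A) f = (mean leb4 (gdens A) (@vec4 R) f)%:E.
Proof.
move=> cf fC; have [i1 _] := gauss_poly_integrable cf fC.
rewrite /mean /Rintegral fineK; last exact: (integrable_fin_num measurableT i1).
by apply: eq_integral => z _; rewrite /= mulrC.
Qed.

End one_matrix.

Lemma gnorm_le (A : 'M[R]_4) c c' : A^T = A -> 0 < c -> 0 < c' ->
  (forall x, c * `|x| ^+ 2 <= bil A x x) -> (forall x, bil A x x <= c' * `|x| ^+ 2) ->
  gnorm A <= gnorm (c'%:M).
Proof.
move=> sA c0 c'0 cA Ac'.
have cI (x : 'rV[R]_4) : c' * `|x| ^+ 2 <= bil c'%:M x x.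
  by rewrite bil_scalar ler_wpM2l ?(ltW c'0)// norm_sq_le_dotv.
have sI := tr_scalar_mx 4 c'.
have [dA hA] := gauss_cos4 0 0 sA c0 cA; have [dI hI] := gauss_cos4 0 0 sI c'0 cI.
have pg (x : R) : 0 < x -> 0 < Num.sqrt ((2 * pi) ^+ 4 / x).
  by move=> x0; rewrite sqrtr_gt0 divr_gt0// exprn_gt0// mulr_gt0// pi_gt0.
rewrite /gnorm lef_pV2 ?posrE ?pg//.
have b0 (B : 'M[R]_4) x : bil B 0 x = 0 by rewrite /bil !mul0mx mxE.
rewrite !b0 oppr0 mul0r expR0 cos0 !mulr1 in hA hI.
rewrite -hA -hI.
have ii (B : 'M[R]_4) k : 0 < k -> (forall x, k * `|x| ^+ 2 <= bil B x x) ->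
  leb4.-integrable setT (EFin \o (fun z => expR (- bil B (vec4 z) (vec4 z) / 2) * cos (bil B 0 (vec4 z) + 0))).
  move=> k0 kB; have k20 : 0 < k / 2 by rewrite divr_gt0.
  under eq_fun do rewrite b0 addr0 cos0 mulr1.
  apply: (@gauss_dominated_integrable _ (fun x => expR (- bil B x x / 2)) 1 (k / 2)) => //.
    exact: (measurable_continuous4 (@gauss_continuous _ B)).
  by move=> x; rewrite mul1r ger0_norm ?expR_ge0//; exact: bil_lower.
apply: le_Rintegral => //; [exact: (ii _ c')|exact: (ii _ c)|].
move=> z _; rewrite !b0 addr0 cos0 !mulr1 ler_expR ler_wpM2r// lerN2.
rewrite (le_trans (Ac' _)).
  by [].
exact: cI.
Qed.

(** The bound depends on the form only through c and c', hence is uniform over the informations at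
    the points of a compact set. *)
Lemma gauss_moments c c' q : 0 < c -> 0 < c' -> exists B, forall A : 'M[R]_4,
  A^T = A -> (forall x, c * `|x| ^+ 2 <= bil A x x) ->
  (forall x, bil A x x <= c' * `|x| ^+ 2) ->
  moment_bound leb4 (gdens A) (@vec4 R) q B.
Proof.
move=> c0 c'0.
exists (gnorm (c'%:M) * (1 * (q%:R ^+ q * expR (1 + (4 * (c / 4))^-1)) *
     \int[leb4]_z gauss4 (c / 4 / 4) z)) => A sA cA Ac'.
have qb (x : 'rV[R]_4) : `|(1 + `|x|) ^+ q| <= 1 * (1 + `|x|) ^+ q.
  by rewrite mul1r ger0_norm// exprn_ge0// addr_ge0.
have [iq qB] := gauss_poly_integrable sA c0 cA (@poly_continuous R q) qb.
split => //; rewrite (le_trans (ler_norm _))// (le_trans qB)// ler_wpM2r//.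
  rewrite mul1r !mulr_ge0 ?expR_ge0 ?exprn_ge0//.
  by apply: Rintegral_ge0 => z _; exact: gauss4_ge0.
exact: (gnorm_le sA c0 c'0 cA Ac').
Qed.

Lemma inverse_bound (A : 'M[R]_4) c (v : 'rV[R]_4) : A^T = A -> 0 < c ->
  (forall x, c * `|x| ^+ 2 <= bil A x x) -> `|v *m invmx A| <= 4 / c * `|v|.
Proof.
move=> sA c0 cA; set x := v *m invmx A.
have uA := coercive_unit sA c0 cA.
have vE : v = x *m A by rewrite /x -mulmxA mulVmx// mulmx1.
have h : c * `|x| ^+ 2 <= 4 * (`|v| * `|x|).
  by rewrite (le_trans (cA x))// bil_dotv -vE (le_trans (ler_norm _))// dotv_bound.
have [->|x0] := eqVneq `|x| 0; first by rewrite mulr_ge0// divr_ge0// ltW.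
rewrite mulrAC ler_pdivlMr// mulrC -(@ler_pM2r _ `|x|); last by rewrite lt_def x0 normr_ge0.
by rewrite -mulrA -expr2 -mulrA.
Qed.

(** With x = v A^-1 and y = v A'^-1, the two quantities are [bil A' x y] and [bil A x y]. *)
Lemma inverse_close (A A' : 'M[R]_4) c eta (v : 'rV[R]_4) : A^T = A -> A'^T = A' -> 0 < c ->
  (forall x, c * `|x| ^+ 2 <= bil A x x) -> (forall x, c * `|x| ^+ 2 <= bil A' x x) ->
  (forall x y, `|bil A x y - bil A' x y| <= eta * (`|x| * `|y|)) ->
  `|bil (invmx A) v v - bil (invmx A') v v| <= eta * (4 / c) ^+ 2 * `|v| ^+ 2.
Proof.
move=> sA sA' c0 cA cA' AA'.
have uA := coercive_unit sA c0 cA; have uA' := coercive_unit sA' c0 cA'.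
pose x := v *m invmx A; pose y := v *m invmx A'.
have -> : bil (invmx A) v v = bil A' x y.
  rewrite (bilC _ _ sA') [RHS]bil_dotv /y -mulmxA mulVmx// mulmx1 bil_dotv -/x.
  by rewrite dotvC.
have -> : bil (invmx A') v v = bil A x y.
  by rewrite [RHS]bil_dotv /x -mulmxA mulVmx// mulmx1 bil_dotv -/y dotvC.
have e0 : 0 <= eta.
  have v1 : 0 < `|const_mx 1 : 'rV[R]_4|.
    rewrite normr_gt0; apply/eqP => /(congr1 (fun u : 'rV[R]_4 => u ord0 ord0)).
    by rewrite !mxE => /eqP; rewrite oner_eq0.
  have := AA' (const_mx 1) (const_mx 1).
  move=> /(le_trans (normr_ge0 _)); rewrite pmulr_lge0// mulr_gt0//.
rewrite distrC (le_trans (AA' x y))// -mulrA ler_wpM2l//.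
rewrite (_ : _ * `|v| ^+ 2 = (4 / c * `|v|) * (4 / c * `|v|)); last by ring.
by apply: ler_pM => //; exact: inverse_bound.
Qed.

Lemma expR_lip (a b : R) : 0 <= a -> 0 <= b -> `|expR (- a) - expR (- b)| <= `|a - b|.
Proof.
wlog ab : a b / a <= b => [h a0 b0|a0 b0].
  have [ab|/ltW ba] := leP a b; first exact: h.
  by rewrite distrC [leRHS]distrC; exact: h.
rewrite ger0_norm ?subr_ge0 ?ler_expR ?lerN2// distrC ger0_norm ?subr_ge0//.
rewrite (_ : - b = - a - (b - a)); last by ring.
rewrite expRD -{1}[expR (- a)]mulr1 -mulrBr.
apply: (@le_trans _ _ (1 * (b - a))); last by rewrite mul1r.
rewrite ler_pM ?expR_ge0//.
- by rewrite subr_ge0 -expR0 ler_expR oppr_le0 subr_ge0.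
- by rewrite -expR0 ler_expR oppr_le0.
by have := expR_ge1Dx (- (b - a)); lra.
Qed.

Lemma gauss_charfun_close (A A' : 'M[R]_4) c eta : A^T = A -> A'^T = A' -> 0 < c ->
  (forall x, c * `|x| ^+ 2 <= bil A x x) -> (forall x, c * `|x| ^+ 2 <= bil A' x x) ->
  0 <= eta -> (forall x y, `|bil A x y - bil A' x y| <= eta * (`|x| * `|y|)) ->
  charfun_close leb4 (gdens A) (@vec4 R) leb4 (gdens A') (@vec4 R) (eta * (4 / c) ^+ 2).
Proof.
move=> sA sA' c0 cA cA' e0 AA' v b.
rewrite (gauss_charfun sA c0 cA) (gauss_charfun sA' c0 cA') -mulrBl normrM.
have pos (B : 'M[R]_4) : B^T = B -> (forall x, c * `|x| ^+ 2 <= bil B x x) ->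
    0 <= bil (invmx B) v v.
  move=> sB cB; have uB := coercive_unit sB c0 cB.
  have := cB (v *m invmx B); rewrite [X in _ <= X]bil_dotv -mulmxA mulVmx// mulmx1 dotvC.
  by apply: le_trans; rewrite mulr_ge0 ?sqr_ge0// ltW.
apply: (@le_trans _ _ (`|bil (invmx A) v v - bil (invmx A') v v| * 1)).
  rewrite ler_pM//; last by rewrite ler_norml cos_geN1 cos_le1.
  rewrite !mulNr.
  rewrite (le_trans (expR_lip _ _))// ?divr_ge0 ?pos//.
  rewrite -mulrBl normrM ler_piMr// ger0_norm// ?invr_ge0// invf_le1// ler1n//.
rewrite mulr1 (le_trans (inverse_close v sA sA' c0 cA cA' AA'))//.
apply: ler_wpM2l; first by apply: mulr_ge0 => //; exact: sqr_ge0.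
apply: (@le_trans _ _ ((1 + `|v|) ^+ 2)); first by rewrite lerXn2r ?nnegrE ?addr_ge0// lerDr.
by rewrite ler_weXn2l// lerDl.
Qed.

End gaussian_law.

(** * Poisson laws *)

Section poisson_series.
Context {R : realType}.

Lemma derive_ge0_le (f f' : R -> R) (a b : R) : a <= b ->
  (forall y, a <= y -> y <= b -> is_derive y 1 f (f' y)) ->
  (forall y, a <= y -> y <= b -> 0 <= f' y) -> f a <= f b.
Proof.
move=> ab fD f'0.
have fc : {within `[a, b], continuous f}.
  apply: derivable_within_continuous => y; rewrite in_itv/= => /andP[ay yb].
  by have [] := fD y ay yb.
have fD' x : x \in `]a, b[ -> is_derive x 1 f (f' x).
  by rewrite in_itv/= => /andP[/ltW ax /ltW xb]; exact: fD.
have [c] := MVT_segment ab fD' fc.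
rewrite in_itv/= => /andP[ac cb] h.
by rewrite -subr_ge0 h mulr_ge0 ?f'0// subr_ge0.
Qed.

(** Differentiation shifts the coefficients by one place. They are 1 for the exponential series and
    cos(x + b m) for the real part of exp(i x + mu exp(i b)); in the latter case the shift replaces
    the phase x by x + b. *)
Lemma Dpolysum (M : nat) (u : nat -> R) (x : R) :
  is_derive x 1 (fun y => \sum_(m < M.+1) y ^+ m / m`!%:R * u m)
    (\sum_(m < M) x ^+ m / m`!%:R * u m.+1).
Proof.
elim: M => [|M ih].
  rewrite big_ord0; under eq_fun do rewrite big_ord_recr big_ord0 /= add0r.
  by under eq_fun do rewrite expr0; exact: Dcst.
rewrite big_ord_recr /=; under eq_fun do rewrite big_ord_recr /=.
apply: Dadd => //.
apply: (Deq (Dmul (Dmul (Dexpn M.+1 (Did x)) (Dcst x _)) (Dcst x _))).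
rewrite /= !mulr0 !addr0 mulr1 factS natrM.
have m0 : M.+1%:R != 0 :> R by rewrite pnatr_eq0.
have f0 : M`!%:R != 0 :> R by rewrite pnatr_eq0 -lt0n fact_gt0.
by field; rewrite addrC natr1 m0 f0.
Qed.

Lemma expR_partial_sum (M : nat) (x : R) : 0 <= x ->
  \sum_(m < M) x ^+ m / m`!%:R <= expR x.
Proof.
elim: M x => [|M ih] x x0; first by rewrite big_ord0 expR_ge0.
have h0 : expR 0 - \sum_(m < M.+1) 0 ^+ m / m`!%:R * 1 = 0 :> R.
  rewrite big_ord_recl expr0 fact0 divr1 mulr1 expR0 big1 ?addr0 ?subrr// => i _.
  by rewrite exprS mul0r mul0r mul0r.
have D1 (y : R) : 0 <= y -> y <= x -> is_derive y 1
    (fun y => expR y - \sum_(m < M.+1) y ^+ m / m`!%:R * 1)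
    (expR y * 1 - \sum_(m < M) y ^+ m / m`!%:R * 1).
  by move=> _ _; exact: Dadd (Dexp (Did y)) (Dopp (Dpolysum M (fun=> 1) y)).
have P1 (y : R) : 0 <= y -> y <= x -> 0 <= expR y * 1 - \sum_(m < M) y ^+ m / m`!%:R * 1.
  move=> y0 _; rewrite mulr1 subr_ge0 (le_trans _ (ih y y0))//.
  by rewrite le_eqVlt (eq_bigr _ (fun i _ => mulr1 _)) eqxx.
have := derive_ge0_le x0 D1 P1; rewrite h0 subr_ge0.
by rewrite (eq_bigr _ (fun i _ => mulr1 _)).
Qed.

(** Real part of the Taylor remainder of exp(i x + mu exp(i b)) in mu, at order M. Induction on M:
    the derivative in mu is the remainder of the preceding order at phase x + b, and the right-hand
    side grows at least as fast. *)
Lemma poisson_taylor (M : nat) (b x mu : R) : 0 <= mu ->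
  `|expR (mu * cos b) * cos (x + mu * sin b) -
    \sum_(m < M) mu ^+ m / m`!%:R * cos (x + b * m%:R)| <= expR mu * (mu ^+ M / M`!%:R).
Proof.
elim: M x mu => [|M ih] x mu mu0.
  rewrite big_ord0 subr0 expr0 fact0 divr1 mulr1 normrM ger0_norm ?expR_ge0//.
  rewrite -[leRHS]mulr1 ler_pM ?expR_ge0//.
    by rewrite ler_expR ler_piMr// cos_le1.
  by rewrite ler_norml cos_geN1 cos_le1.
pose h (y : R) := expR (y * cos b) * cos (x + y * sin b) -
    \sum_(m < M.+1) y ^+ m / m`!%:R * cos (x + b * m%:R).
pose h' (y : R) := expR (y * cos b) * cos ((x + b) + y * sin b) -
    \sum_(m < M) y ^+ m / m`!%:R * cos ((x + b) + b * m%:R).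
pose g (y : R) := expR y * (y ^+ M.+1 / M.+1`!%:R).
pose g' (y : R) := expR y * (y ^+ M.+1 / M.+1`!%:R) + expR y * (y ^+ M / M`!%:R).
have hD (y : R) : is_derive y 1 h (h' y).
  apply: Dadd; last first.
    apply: Dopp; apply: (Deq (Dpolysum M (fun m => cos (x + b * m%:R)) y)).
    by apply: eq_bigr => i _; congr (_ * cos _); rewrite -natr1; ring.
  apply: (Deq (Dmul (Dexp (Dmul (Did y) (Dcst y (cos b))))
    (Dcos (Dadd (Dcst y x) (Dmul (Did y) (Dcst y (sin b))))))).
  rewrite /= (_ : x + b + y * sin b = (x + y * sin b) + b); last by ring.
  by rewrite [in RHS]cosD; ring.
have gD (y : R) : is_derive y 1 g (g' y).
  apply: (Deq (Dmul (Dexp (Did y)) (Dmul (Dexpn M.+1 (Did y)) (Dcst y _)))).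
  rewrite /= !mulr0 addr0 mulr1 factS natrM.
  have m0 : M.+1%:R != 0 :> R by rewrite pnatr_eq0.
  have f0 : M`!%:R != 0 :> R by rewrite pnatr_eq0 -lt0n fact_gt0.
  by rewrite /g' factS natrM; field; rewrite addrC natr1 m0 f0.
have h0 : h 0 = 0.
  rewrite /h !mul0r expR0 addr0 mul1r big_ord_recl expr0 fact0 divr1 mul1r mulr0 addr0.
  by rewrite big1 ?addr0 ?subrr// => i _; rewrite exprS !mul0r.
have g0 : g 0 = 0 by rewrite /g exprS !mul0r mulr0.
have hg y : 0 <= y -> `|h' y| <= g' y.
  move=> y0; rewrite (le_trans (ih (x + b) y y0))// lerDr.
  by rewrite mulr_ge0 ?expR_ge0// divr_ge0// exprn_ge0.
rewrite -/(h mu) -/(g mu) ler_norml; apply/andP; split.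
  have D1 (y : R) : 0 <= y -> y <= mu -> is_derive y 1 (fun y => h y + g y) (h' y + g' y).
    by move=> _ _; exact: Dadd (hD y) (gD y).
  have P1 (y : R) : 0 <= y -> y <= mu -> 0 <= h' y + g' y.
    by move=> y0 _; have := hg y y0; rewrite ler_norml => /andP[]; lra.
  have := derive_ge0_le mu0 D1 P1; rewrite h0 g0; lra.
have D2 (y : R) : 0 <= y -> y <= mu -> is_derive y 1 (fun y => g y - h y) (g' y - h' y).
  by move=> _ _; exact: Dadd (gD y) (Dopp (hD y)).
have P2 (y : R) : 0 <= y -> y <= mu -> 0 <= g' y - h' y.
  by move=> y0 _; have := hg y y0; rewrite ler_norml => /andP[]; lra.
have := derive_ge0_le mu0 D2 P2; rewrite h0 g0; lra.
Qed.

Lemma exp_coeff_small (mu e : R) : 0 < e -> 0 <= mu -> exists M : nat, mu ^+ M / M`!%:R <= e.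
Proof.
move=> e0 mu0.
have /cvgrPdist_lt/(_ _ e0) := cvg_series_cvg_0 (is_cvg_series_exp_coeff mu).
move=> -[M _ /(_ M (leqnn M))] /=; rewrite sub0r normrN => /ltW h; exists M.
exact: le_trans (ler_norm _) h.
Qed.

(** Also correct at mu = 0, where 0^0 = 1 makes it the Dirac mass at 0, in agreement with
    [poisson_prob]. *)
Definition pois (mu : R) (m : nat) : R := mu ^+ m / m`!%:R * expR (- mu).

Lemma pois_ge0 mu m : 0 <= mu -> 0 <= pois mu m.
Proof. by move=> mu0; rewrite /pois mulr_ge0 ?expR_ge0// divr_ge0// exprn_ge0. Qed.

Lemma pois_cos M b x mu : 0 <= mu ->
  `|expR (mu * (cos b - 1)) * cos (x + mu * sin b) -
    \sum_(m < M) pois mu m * cos (x + b * m%:R)| <= mu ^+ M / M`!%:R.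
Proof.
move=> mu0; have h := poisson_taylor M b x mu0.
have e0 : expR mu * expR (- mu) = 1 by rewrite -expRD subrr expR0.
rewrite (_ : _ - _ = expR (- mu) * (expR (mu * cos b) * cos (x + mu * sin b) -
    \sum_(m < M) mu ^+ m / m`!%:R * cos (x + b * m%:R))).
  rewrite normrM ger0_norm ?expR_ge0// (le_trans (ler_wpM2l (expR_ge0 _) h))//.
  by rewrite -[leRHS]mul1r -e0 le_eqVlt; apply/orP; left; apply/eqP; ring.
rewrite [RHS]mulrBr mulr_sumr mulrA -expRD; congr (expR _ * _ - _); first by ring.
by apply: eq_bigr => i _; rewrite /pois; ring.
Qed.

Lemma poisson_probE (mu : R) (k j : nat) : 0 <= mu ->
  poisson_prob mu k [set j] = (pois mu j)%:E.
Proof.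
rewrite le_eqVlt /poisson_prob => /predU1P[<-|mu0].
  rewrite ltxx diracE /pois; case: j => [|j].
    by rewrite mem_set//= expr0 fact0 divr1 oppr0 expR0 mul1r.
  by rewrite memNset// exprS !mul0r.
by rewrite mu0 esum_set1 ?lee_fin ?poisson_pmf_ge0// /poisson_pmf mu0.
Qed.

End poisson_series.

(** * Independent Poisson variables *)

Section poisson_family.
Context d (Om : measurableType d) (R : realType) (P : probability Om R).

Lemma prob_fin (A : set Om) : measurable A -> P A = (fine (P A))%:E.
Proof. by move=> mA; rewrite fineK// fin_num_measure. Qed.

Lemma fine_prob_ge0 (A : set Om) : 0 <= fine (P A).
Proof. exact: fine_ge0. Qed.

Lemma fine_prob_le (A B : set Om) : measurable A -> measurable B -> A `<=` B ->
  fine (P A) <= fine (P B).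
Proof.
by move=> mA mB AB; apply: fine_le; rewrite ?fin_num_measure// le_measure ?inE.
Qed.

Lemma fine_prob_le1 (A : set Om) : measurable A -> fine (P A) <= 1.
Proof. by move=> mA; rewrite -lee_fin -prob_fin// probability_le1. Qed.

Lemma prob_bounded_integrable (f : Om -> R) M (A : set Om) : measurable A ->
  measurable_fun setT f -> (forall x, `|f x| <= M) -> P.-integrable A (EFin \o f).
Proof.
move=> mA mf fM; apply: (@bounded_integrable _ _ _ P _ _ M) => //.
  by rewrite (le_lt_trans (probability_le1 P mA))// ltry.
exact: measurable_funTS.
Qed.

(** The integral is a series over the values of N, and an upper bound follows from its partial sums
    by [expR_partial_sum]. *)
Lemma poisson_mgf (N : Om -> R) (mu s : R) : 0 <= mu ->
  measurable_fun setT N -> (forall om, N om \is a Num.nat) ->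
  (forall j : nat, P [set om | N om = j%:R] = (pois mu j)%:E) ->
  (\int[P]_om (expR (s * N om))%:E <= (expR (mu * (expR s - 1)))%:E)%E.
Proof.
move=> mu0 mN natN pN; pose F j := [set om | N om = j%:R].
have mF j : measurable (F j).
  rewrite (_ : F j = N @^-1` [set j%:R])//.
  by rewrite -[X in measurable X]setTI; exact: mN.
have UF : \bigcup_j F j = setT.
  by apply/seteqP; split => // om _; have /natrP[j jE] := natN om; exists j.
have mE : measurable_fun setT (fun om => expR (s * N om)).
  apply: measurableT_comp => //; exact: measurable_funM.
rewrite -UF (ge0_integral_bigcup P); last 4 first.
- exact: mF.
- by rewrite UF; exact/measurable_EFinP.
- by move=> x _; rewrite lee_fin expR_ge0.
- by move=> i j _ _ [om [/= h1 h2]]; apply/eqP; rewrite -(eqr_nat R) -h1 h2.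
have e j : (\int[P]_(x in F j) (expR (s * N x))%:E = (expR (s * j%:R) * pois mu j)%:E)%E.
  transitivity (\int[P]_(x in F j) (expR (s * j%:R))%:E)%E.
    by apply: eq_integral => x; rewrite inE => ->.
  by rewrite integral_cst// [X in (_ * X)%E](pN j).
under eq_eseriesr do rewrite e.
apply: lime_le.
  by apply: is_cvg_nneseries => j _ _; rewrite lee_fin mulr_ge0 ?expR_ge0 ?pois_ge0.
near=> M; rewrite sumEFin lee_fin big_mkord.
have -> : \sum_(i < M) expR (s * i%:R) * pois mu i =
  expR (- mu) * \sum_(i < M) (mu * expR s) ^+ i / i`!%:R.
  rewrite mulr_sumr; apply: eq_bigr => i _.
  by rewrite exprMn -expRM_natl mulrC /pois [s * _]mulrC; ring.
rewrite (_ : mu * (expR s - 1) = - mu + mu * expR s); last by ring.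
rewrite expRD ler_wpM2l ?expR_ge0//; apply: expR_partial_sum.
by rewrite mulr_ge0 ?expR_ge0.
Unshelve. all: by end_near.
Qed.

Section independent.
Variables (I : finType) (N : I -> Om -> R) (mu : I -> R).
Hypotheses (mu0 : forall i, 0 <= mu i) (mN : forall i, measurable_fun setT (N i))
  (natN : forall i om, N i om \is a Num.nat)
  (pN : forall i (j : nat), P [set om | N i om = j%:R] = (pois (mu i) j)%:E)
  (indN : forall B : I -> set R, (forall i, measurable (B i)) ->
     P (\bigcap_(i in setT) (N i @^-1` B i)) = (\prod_i P (N i @^-1` B i))%E).

Let mpre i (B : set R) : measurable B -> measurable (N i @^-1` B).
Proof. by move=> mB; rewrite -[X in measurable X]setTI; exact: mN. Qed.

Let mcap (B : I -> set R) : (forall i, measurable (B i)) ->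
  measurable (\bigcap_(i in [set: I]) (N i @^-1` B i)).
Proof.
move=> mB; apply: fin_bigcap_measurable => [|i _]; first exact: finite_finset.
exact: mpre.
Qed.

Let pr i (B : set R) := fine (P (N i @^-1` B)).

Let indN' (B : I -> set R) : (forall i, measurable (B i)) ->
  fine (P (\bigcap_(i in setT) (N i @^-1` B i))) = \prod_i pr i (B i).
Proof.
move=> mB; rewrite indN//.
rewrite (eq_bigr (fun i => (pr i (B i))%:E)); last by move=> i _; exact/prob_fin/mpre.
by rewrite prodEFin.
Qed.

Lemma pois_tail i M : fine (P [set om | M%:R <= N i om]) = 1 - \sum_(m < M) pois (mu i) m.
Proof.
have mge m : measurable [set om | (m%:R : R) <= N i om].
  have := mpre i (measurable_itv `[m%:R, +oo[); rewrite (_ : _ @^-1` _ = [set om | m%:R <= N i om])//.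
  by apply/seteqP; split => x /=; rewrite in_itv/= andbT.
elim: M => [|M ih].
  rewrite big_ord0 subr0 (_ : [set om | _] = setT) ?probability_setT//.
  by apply/seteqP; split => // om _ /=; exact: natr_ge0.
rewrite big_ord_recr/= opprD addrA -ih.
have -> : [set om | (M%:R : R) <= N i om] =
    [set om | N i om = M%:R] `|` [set om | M.+1%:R <= N i om].
  apply/seteqP; split => om /=; have /natrP[j ->] := natN i om; rewrite !ler_nat.
    by rewrite leq_eqVlt => /predU1P[->|]; [left|right].
  by move=> [/eqP|/ltnW//]; rewrite eqr_nat => /eqP ->.
have mA : measurable [set om | N i om = M%:R].
  exact: (mpre i (measurable_set1 (M%:R : R))).
have mU : P ([set om | N i om = M%:R] `|` [set om | M.+1%:R <= N i om]) =
    (P [set om | N i om = M%:R] + P [set om | (M.+1%:R <= N i om)%R])%E.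
  apply: measureU => //.
  by apply/seteqP; split => // om /= [h1]; rewrite h1 ler_nat ltnn.
by rewrite mU pN fineD ?fin_num_measure//= addrAC subrr add0r.
Qed.

(** Independence is given for events only. The induction removes one variable from [s] at a time by
    slicing the event along {N i = m}: this replaces [B i] by {m} and leaves the sum over the other
    variables of [s], whence the general events [B i] for the variables already removed. *)
Lemma poisson_charfun_ind (s : seq I) (b : I -> R) : uniq s ->
  forall beta (B : I -> set R), (forall i, measurable (B i)) ->
  (forall i, i \in s -> B i = setT) ->
  \int[P]_(om in \bigcap_(i in setT) (N i @^-1` B i))
     cos (beta + \sum_(i <- s) b i * N i om) =
  expR (\sum_(i <- s) mu i * (cos (b i) - 1)) *
  cos (beta + \sum_(i <- s) mu i * sin (b i)) * \prod_i pr i (B i).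
Proof.
elim: s => [|i s ih] /=.
  move=> _ beta B mB _; rewrite !big_nil expR0 mul1r addr0.
  under eq_Rintegral do rewrite big_nil addr0.
  by rewrite Rintegral_cst ?indN'//; exact: mcap.
move=> /andP[iNs us] beta B mB Bs.
have Bi : B i = setT by apply: Bs; rewrite mem_head.
pose Bm (m : nat) j := if j == i then [set m%:R] else B j.
have mBm m j : measurable (Bm m j) by rewrite /Bm; case: ifP.
pose D := \bigcap_(j in [set: I]) (N j @^-1` B j).
pose Dm m := \bigcap_(j in [set: I]) (N j @^-1` Bm m j).
pose T M := D `&` [set om | (M%:R : R) <= N i om].
have mge m : measurable [set om | (m%:R : R) <= N i om].
  have := mpre i (measurable_itv `[m%:R, +oo[); rewrite (_ : _ @^-1` _ = [set om | m%:R <= N i om])//.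
  by apply/seteqP; split => x /=; rewrite in_itv/= andbT.
have mD : measurable D by exact: mcap.
have mT M : measurable (T M) by exact: measurableI.
have mDm m : measurable (Dm m) by exact: mcap.
pose phi om := cos (beta + \sum_(j <- i :: s) b j * N j om).
have mphi : measurable_fun setT phi.
  apply: measurableT_comp; first by apply: continuous_measurable_fun; exact: continuous_cos.
  apply: measurable_funD => //; apply: measurable_sum => j.
  exact: measurable_funM.
have phi1 om : `|phi om| <= 1 by rewrite ler_norml cos_geN1 cos_le1.
have DmE m : Dm m = D `&` [set om | N i om = m%:R].
  apply/seteqP; split => om.
    move=> h; split; last by have := h i Logic.I; rewrite /Bm /= eqxx.
    by move=> j _; have := h j Logic.I; rewrite /Bm; case: eqP => // ->; rewrite Bi.
  move=> [h1 /= h2] j _; rewrite /Bm /=; case: eqP => [->//|_]; exact: h1.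
(* Peels the slice {N i = M} off the tail {N i >= M}. The tail left after M slices has small mass,
   so finite sums suffice. *)
have TS M : \int[P]_(om in T M) phi om = \int[P]_(om in Dm M) phi om + \int[P]_(om in T M.+1) phi om.
  have -> : T M = Dm M `|` T M.+1.
    rewrite DmE /T -setIUr; congr (_ `&` _).
    apply/seteqP; split => om /=; have /natrP[j ->] := natN i om; rewrite !ler_nat.
      by rewrite leq_eqVlt => /predU1P[->|]; [left|right].
    by move=> [/eqP|/ltnW//]; rewrite eqr_nat => /eqP ->.
  rewrite Rintegral_setU//.
    exact: (prob_bounded_integrable (measurableU _ _ (mDm M) (mT M.+1)) mphi phi1).
  apply/disj_setPS => om [h1 h2]; move: h1 h2; rewrite DmE => -[_ /= h1] [_ /=].
  by rewrite h1 ler_nat ltnn.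
have DE M : \int[P]_(om in D) phi om = \sum_(m < M) \int[P]_(om in Dm m) phi om + \int[P]_(om in T M) phi om.
  elim: M => [|M IH].
    rewrite big_ord0 add0r; congr (Rintegral _ _ _); rewrite /T.
    by apply/seteqP; split => [om h|om []//]; split => //=; exact: natr_ge0.
  by rewrite IH TS big_ord_recr/= addrA.
(* At b = x = 0, [pois_cos] is a bound on the Poisson tail. *)
have Tsmall M : `|\int[P]_(om in T M) phi om| <= mu i ^+ M / M`!%:R.
  apply: (@le_trans _ _ (fine (P [set om | (M%:R : R) <= N i om]))).
    apply: (@le_trans _ _ (\int[P]_(om in T M) 1)).
      have ip := prob_bounded_integrable (mT M) mphi phi1.
      apply: (le_trans (le_normr_Rintegral (mT M) ip)).
      apply: le_Rintegral => //; first exact: integrable_norm.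
      have n1 (om : Om) : `|1 : R| <= 1 by rewrite normr1.
      exact: (prob_bounded_integrable (f := fun=> 1) (mT M) (measurable_cst _) n1).
    by rewrite Rintegral_cst// mul1r; apply: fine_prob_le => // om [].
  have := pois_cos M 0 0 (mu0 i).
  rewrite cos0 sin0 subrr !mulr0 addr0 expR0 cos0 mulr1 pois_tail => h.
  apply: le_trans (ler_norm _) (le_trans _ h).
  rewrite le_eqVlt; apply/orP; left; apply/eqP; congr (`|_ - _|).
  by apply: eq_bigr => m _; rewrite mul0r addr0 cos0 mulr1.
pose Pi := \prod_(j | j != i) pr j (B j).
have Pi0 : 0 <= Pi by apply: prodr_ge0 => j _; exact: fine_prob_ge0.
have Pi1 : Pi <= 1.
  apply: prodr_ile1 => j _; rewrite fine_prob_ge0/=; exact/fine_prob_le1/mpre.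
have PiB : \prod_j pr j (B j) = Pi.
  by rewrite (bigD1 i)//= Bi /pr preimage_setT probability_setT /= mul1r.
pose E := expR (\sum_(j <- s) mu j * (cos (b j) - 1)).
have E1 : E <= 1.
  rewrite -expR0 ler_expR; apply: sumr_le0 => j _.
  by rewrite mulr_ge0_le0// subr_le0 cos_le1.
pose x := beta + \sum_(j <- s) mu j * sin (b j).
have DmI m : \int[P]_(om in Dm m) phi om = E * Pi * (pois (mu i) m * cos (x + b i * m%:R)).
  transitivity (\int[P]_(om in Dm m) cos ((beta + b i * m%:R) + \sum_(j <- s) b j * N j om)).
    apply: eq_Rintegral => om; rewrite inE DmE => -[_ /= Nm].
    by rewrite /phi big_cons Nm addrA.
  rewrite ih// => [|j js]; last first.
    by rewrite /Bm; case: eqP => [ji|_]; [rewrite -ji js in iNs|apply: Bs; rewrite inE js orbT].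
  rewrite (bigD1 i)//= {1}/Bm eqxx.
  have -> : pr i [set m%:R] = pois (mu i) m.
    by rewrite /pr (_ : _ @^-1` _ = [set om | N i om = m%:R])// pN.
  rewrite [\prod_(i0 | _) _](eq_bigr (fun j => pr j (B j))); last by move=> j ji; rewrite /Bm (negPf ji).
  rewrite -/Pi -/E /x (_ : beta + b i * m%:R + _ = beta + \sum_(j <- s) mu j * sin (b j) + b i * m%:R); last by ring.
  by ring.
rewrite -/D -/phi PiB !big_cons expRD -/E.
set tgt := RHS.
(* The tail event and the truncation of the Poisson series cost one remainder each. *)
have key M : `|\int[P]_(om in D) phi om - tgt| <= 2 * (mu i ^+ M / M`!%:R).
  rewrite (DE M); under eq_bigr do rewrite DmI; rewrite -mulr_sumr.
  have h := pois_cos M (b i) x (mu0 i).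
  have EP : 0 <= E * Pi <= 1.
    by rewrite mulr_ge0 ?expR_ge0//= mulr_ile1 ?expR_ge0.
  have tE : tgt = E * Pi * (expR (mu i * (cos (b i) - 1)) * cos (x + mu i * sin (b i))).
    by rewrite /tgt /x [mu i * sin _ + _]addrC addrA; ring.
  rewrite tE (_ : _ - _ = \int[P]_(om in T M) phi om - E * Pi *
     (expR (mu i * (cos (b i) - 1)) * cos (x + mu i * sin (b i)) -
     \sum_(m < M) pois (mu i) m * cos (x + b i * m%:R))); last by ring.
  rewrite (le_trans (ler_normB _ _))// mulr2n mulrDl mul1r lerD// normrM.
  have /andP[EP0 EP1] := EP; rewrite (ger0_norm EP0).
  by apply: le_trans h; rewrite ler_piMl.
apply/eqP; rewrite -subr_eq0 -normr_le0; apply/ler_addgt0Pr => e e0; rewrite add0r.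
have [M hM] := exp_coeff_small (divr_gt0 e0 (ltr0n R 2)) (mu0 i).
apply: le_trans (key M) _; lra.
Qed.

Lemma poisson_charfun (b : I -> R) beta :
  \int[P]_om cos (beta + \sum_i b i * N i om) =
  expR (\sum_i mu i * (cos (b i) - 1)) * cos (beta + \sum_i mu i * sin (b i)).
Proof.
have := @poisson_charfun_ind (index_enum I) b (index_enum_uniq _) beta (fun=> setT)
  (fun=> measurableT) (fun _ _ => erefl).
rewrite [\prod_i _]big1 ?mulr1 => [<-|i _]; last by rewrite /pr preimage_setT probability_setT.
congr (Rintegral _ _ _); apply/esym/seteqP; split => // om _ i _; by rewrite preimage_setT.
Qed.

End independent.
End poisson_family.

(** * Compensated paths *)

Section paths.
Context {R : realType}.
Local Notation leb := (@lebesgue_measure R).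
Local Notation TR := (measurableTypeR R).

Lemma Rintegral_itv_split (g : R -> R) (a b c : R) : a <= b -> b <= c ->
  leb.-integrable `[a, c] (EFin \o g) ->
  \int[leb]_(t in `[a, c]) g t = \int[leb]_(t in `[a, b]) g t + \int[leb]_(t in `[b, c]) g t.
Proof.
move=> ab bc gi.
have gi' : leb.-integrable `]b, c] (EFin \o g).
  apply: (integrableS _ _ _ gi) => //; apply: subset_itvr => /=.
  by rewrite bnd_simp.
have <- := Rintegral_itv_obnd_cbnd gi'.
have <- := Rintegral_itvB gi (x := b); rewrite ?bnd_simp//.
by rewrite addrC subrK.
Qed.

Lemma lebesgue_itv_cc (a b : R) : a <= b -> leb `[a, b]%classic = (b - a)%:E.
Proof.
rewrite le_eqVlt => /predU1P[<-|ab]; first by rewrite set_itv1 lebesgue_measure_set1 subrr.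
by rewrite lebesgue_measure_itv/= lte_fin ab EFinB.
Qed.

Lemma itv_bounded_integrable (g : R -> R) (a b B : R) : measurable_fun `[a, b] (g : TR -> R) ->
  (forall t, a <= t <= b -> `|g t| <= B) -> leb.-integrable `[a, b] (EFin \o g).
Proof.
move=> mg gB; apply: (@bounded_integrable _ _ _ leb _ _ B) => //.
  have [ab|ba] := leP a b; first by rewrite [X in (X < _)%E](lebesgue_itv_cc ab) ltry.
  by rewrite set_itv_ge ?measure0// bnd_simp -ltNge.
Qed.

Lemma Rintegral_itv_bound (g : R -> R) (a b B : R) : a <= b ->
  measurable_fun `[a, b] (g : TR -> R) ->
  (forall t, a <= t <= b -> `|g t| <= B) -> `|\int[leb]_(t in `[a, b]) g t| <= B * (b - a).
Proof.
move=> ab mg gB.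
have mab : measurable (`[a, b]%classic : set TR) by exact: measurable_itv.
have gi := itv_bounded_integrable mg gB.
apply: (le_trans (le_normr_Rintegral mab gi)).
have -> : B * (b - a) = \int[leb]_(t in `[a, b]) (cst B) t.
  rewrite (Rintegral_cst _ mab); congr (_ * _).
  by have /(congr1 fine) /= := lebesgue_itv_cc ab.
apply: le_Rintegral => //.
- exact: (integrable_norm mab gi).
- apply: (@itv_bounded_integrable _ a b `|B|) => //; exact: measurable_cst.
Qed.

Definition cum (lam : R -> R) (t : R) : R := \int[leb]_(s in `[0, t]) lam s.

Section cum.
Variables (lam : R -> R) (T L : R).
Hypotheses (clam : continuous lam) (lam0 : forall t, 0 <= lam t)
  (lamL : forall t, 0 <= t <= T -> lam t <= L).

Lemma cum_diff u v : 0 <= u -> u <= v -> cum lam v - cum lam u = \int[leb]_(s in `[u, v]) lam s.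
Proof.
move=> u0 uv; rewrite /cum (@Rintegral_itv_split lam 0 u v)//.
  by rewrite addrAC subrr add0r.
exact: continuous_itv_integrable.
Qed.

Lemma cum0 : cum lam 0 = 0.
Proof. by rewrite /cum set_itv1 Rintegral_set1. Qed.

Lemma cum_homo : {homo cum lam : u v / u <= v}.
Proof.
move=> u v uv; have [u0|u0] := leP 0 u.
  by rewrite -subr_ge0 cum_diff// Rintegral_ge0.
rewrite {1}/cum set_itv_ge ?Rintegral_set0 ?Rintegral_ge0//.
by rewrite bnd_simp -ltNge.
Qed.

Lemma cum_lip u v : 0 <= u -> u <= v -> v <= T -> cum lam v - cum lam u <= L * (v - u).
Proof.
move=> u0 uv vT; rewrite cum_diff//; apply: le_trans (ler_norm _) _.
apply: Rintegral_itv_bound => //; first by apply: measurable_funTS; exact: continuous_measurable_fun.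
move=> t /andP[ut tv]; rewrite ger0_norm//; apply: lamL.
by rewrite (le_trans u0 ut) (le_trans tv vT).
Qed.

Variables (F : R -> R) (r c : R) (f f' : R -> R).
Hypotheses (T0 : 0 < T) (F0 : F 0 = 0) (Fmono : {homo F : u v / u <= v})
  (r0 : 0 <= r) (L0 : 0 <= L) (c0 : 0 <= c)
  (fD : forall t : R, is_derive t 1 f (f' t)) (cf' : continuous f')
  (fc : forall t, 0 <= t <= T -> `|f t| <= c)
  (f'c : forall t, 0 <= t <= T -> `|f' t| <= c).

Definition comp (t : R) : R := F t - r * cum lam t.

(** The integral of f against dM over ]0, T] after integration by parts, for a path with M(0) = 0.
    In this form it is a linear function of M, and of the pair (f, f'). *)
Definition Jint (M : R -> R) : R := f T * M T - \int[leb]_(t in `[0, T]) (f' t * M t).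

Let mcomp : measurable_fun setT (comp : TR -> R).
Proof.
apply: measurable_funB; first exact: (nondecreasing_measurable measurableT Fmono).
by apply: measurable_funM => //; exact: (nondecreasing_measurable measurableT cum_homo).
Qed.

Let mf' : measurable_fun setT (f' : TR -> R).
Proof. exact: continuous_measurable_fun. Qed.

Lemma comp0 : comp 0 = 0.
Proof. by rewrite /comp F0 cum0 mulr0 subrr. Qed.

Lemma comp_incr u v w : 0 <= u -> u <= w -> w <= v -> v <= T ->
  `|comp v - comp w| <= (F v - F u) + r * L * (v - u).
Proof.
move=> u0 uw wv vT.
have h1 : 0 <= F v - F w by rewrite subr_ge0 Fmono.
have h2 : F v - F w <= F v - F u by rewrite lerD2l lerN2 Fmono.
have h3 : 0 <= r * (cum lam v - cum lam w) by rewrite mulr_ge0// subr_ge0 cum_homo.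
have h4 : r * (cum lam v - cum lam w) <= r * L * (v - u).
  rewrite -mulrA ler_wpM2l// (le_trans (cum_lip (le_trans u0 uw) wv vT))//.
  by rewrite ler_wpM2l// lerD2l lerN2.
have -> : comp v - comp w = (F v - F w) - r * (cum lam v - cum lam w) by rewrite /comp; ring.
by rewrite ler_norml; apply/andP; split; lra.
Qed.

Lemma f'comp_integrable a b : 0 <= a -> b <= T ->
  leb.-integrable `[a, b] (EFin \o (fun t => f' t * comp t)).
Proof.
move=> a0 bT; apply: (@itv_bounded_integrable _ a b (c * ((F T - F 0) + r * L * (T - 0)))).
  by apply: measurable_funTS; exact: measurable_funM.
move=> t /andP[at_ tb]; have tT : 0 <= t <= T by rewrite (le_trans a0 at_) (le_trans tb bT).
have /andP[t0 tT'] := tT.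
rewrite normrM ler_pM ?f'c//.
have := @comp_incr 0 t 0 (lexx 0) (lexx 0) t0 tT'; rewrite comp0 subr0 => h.
apply: (le_trans h); apply: lerD; first by rewrite lerD2r Fmono.
by rewrite ler_wpM2l ?mulr_ge0// lerD2r.
Qed.

Lemma f_lip a b : 0 <= a -> a <= b -> b <= T -> `|f b - f a| <= c * (b - a).
Proof.
move=> a0 ab bT; rewrite -(RFTC2 ab fD cf'); apply: Rintegral_itv_bound => //.
  exact: measurable_funTS.
by move=> t /andP[at_ tb]; apply: f'c; rewrite (le_trans a0 at_) (le_trans tb bT).
Qed.

(** Once f is frozen at the left end point, the error is the integral of f'(t) (M(b) - M(t)) over
    [a, b], for the compensated path M. *)
Lemma path_piece a b : 0 <= a -> a <= b -> b <= T ->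
  `|(f b * comp b - f a * comp a - \int[leb]_(t in `[a, b]) (f' t * comp t)) -
    f a * (comp b - comp a)| <= c * (b - a) * ((F b - F a) + r * L * (b - a)).
Proof.
move=> a0 ab bT.
have mab : measurable (`[a, b]%classic : set TR) by exact: measurable_itv.
have i1 : leb.-integrable `[a, b] (EFin \o (fun t => comp b * f' t)).
  apply: (integrable_scale mab (comp b)); exact: continuous_itv_integrable.
have i2 := f'comp_integrable a0 bT.
have -> : f b * comp b - f a * comp a - \int[leb]_(t in `[a, b]) (f' t * comp t) -
    f a * (comp b - comp a) = \int[leb]_(t in `[a, b]) (comp b * f' t - f' t * comp t).
  rewrite (RintegralB mab i1 i2) (Rintegral_scale (comp b) mab); last exact: continuous_itv_integrable.
  by rewrite (RFTC2 ab fD cf'); ring.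
rewrite [leRHS]mulrAC; apply: Rintegral_itv_bound => //.
  apply: measurable_funTS; apply: measurable_funB; exact: measurable_funM.
move=> t /andP[at_ tb].
rewrite (_ : _ - _ = f' t * (comp b - comp t)); last by ring.
rewrite normrM ler_pM//; last exact: comp_incr.
by apply: f'c; rewrite (le_trans a0 at_) (le_trans tb bT).
Qed.

Variable n : nat.
Hypothesis n0 : (0 < n)%N.

Definition grid (j : nat) : R := T * j%:R / n%:R.

Let nR0 : 0 < n%:R :> R. Proof. by rewrite ltr0n. Qed.

Lemma grid0 : grid 0 = 0. Proof. by rewrite /grid mulr0 mul0r. Qed.
Lemma gridn : grid n = T. Proof. by rewrite /grid mulfK// gt_eqF. Qed.
Lemma grid_step j : grid j.+1 - grid j = T / n%:R.
Proof. by rewrite /grid -natr1; field; rewrite gt_eqF. Qed.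
Lemma grid_ge0 j : 0 <= grid j.
Proof. by rewrite /grid divr_ge0// mulr_ge0// ltW. Qed.
Lemma grid_homo : {homo grid : i j / (i <= j)%N >-> i <= j}.
Proof.
by move=> i j ij; rewrite /grid ler_pM2r ?invr_gt0// ler_pM2l// ler_nat.
Qed.
Lemma grid_le j : (j <= n)%N -> grid j <= T.
Proof. by move=> jn; rewrite -gridn grid_homo. Qed.

Lemma path_grid : `|Jint comp - \sum_(j < n) f (grid j) * (comp (grid j.+1) - comp (grid j))|
  <= c * (T / n%:R) * (F T + r * L * T).
Proof.
suff H m : (m <= n)%N ->
    `|(f (grid m) * comp (grid m) - \int[leb]_(t in `[0, grid m]) (f' t * comp t)) -
     \sum_(j < m) f (grid j) * (comp (grid j.+1) - comp (grid j))| <=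
    c * (T / n%:R) * (F (grid m) + r * L * grid m).
  by have := H n (leqnn n); rewrite gridn.
elim: m => [_|m ih mn].
  rewrite big_ord0 grid0 comp0 set_itv1 Rintegral_set1 mulr0 !subr0 normr0 F0 mulr0 addr0.
  by rewrite mulr0.
have mn' := ltnW mn.
rewrite big_ord_recr/= (@Rintegral_itv_split _ 0 (grid m) (grid m.+1)) ?grid_ge0 ?grid_homo//; last first.
  exact: f'comp_integrable (grid_le mn).
have h1 := ih mn'.
have h2 := path_piece (grid_ge0 m) (grid_homo (leqnSn m)) (grid_le mn).
rewrite grid_step in h2.
rewrite (_ : _ - _ - _ = (f (grid m) * comp (grid m) -
     \int[leb]_(t in `[0, grid m]) (f' t * comp t) -
     \sum_(j < m) f (grid j) * (comp (grid j.+1) - comp (grid j))) +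
  (f (grid m.+1) * comp (grid m.+1) - f (grid m) * comp (grid m) -
        \int[leb]_(t in `[grid m, grid m.+1]) (f' t * comp t) -
        f (grid m) * (comp (grid m.+1) - comp (grid m)))); last by ring.
rewrite (le_trans (ler_normD _ _))// (le_trans (lerD h1 h2))//.
rewrite -mulrDr ler_wpM2l//; first by rewrite mulr_ge0// divr_ge0// ltW.
have := grid_step m; move=> /eqP; rewrite subr_eq => /eqP ->.
by rewrite le_eqVlt; apply/orP; left; apply/eqP; ring.
Qed.

(** Summation by parts moves the increments onto f, where they are of order 1/n; what is left is a
    mean of the absolute values of the path over the grid, the quantity in [fluct]. *)
Lemma abel_bound : `|\sum_(j < n) f (grid j) * (comp (grid j.+1) - comp (grid j))| <=
  c * (`|comp T| + T * (n%:R^-1 * \sum_(j < n) `|comp (grid j.+1)|)).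
Proof.
have H m : \sum_(j < m) f (grid j) * (comp (grid j.+1) - comp (grid j)) =
  f (grid m) * comp (grid m) - \sum_(j < m) (f (grid j.+1) - f (grid j)) * comp (grid j.+1).
  elim: m => [|m ih]; first by rewrite !big_ord0 grid0 comp0 mulr0 subrr.
  by rewrite !big_ord_recr/= ih; ring.
rewrite H gridn.
apply: (le_trans (ler_normB _ _)); rewrite [leRHS]mulrDr; apply: lerD.
  by rewrite normrM ler_wpM2r// fc// lexx ltW.
rewrite (le_trans (ler_norm_sum _ _ _))// !mulr_sumr ler_sum// => j _.
rewrite normrM !mulrA ler_wpM2r//.
rewrite (le_trans (f_lip (grid_ge0 j) (grid_homo (leqnSn j)) (grid_le (ltn_ord j))))//.
by rewrite grid_step mulrA.
Qed.

End cum.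
End paths.

(** * Fluctuations and the central limit bound *)

Section elementary.
Context {R : realType}.

Lemma expR_quad (x : R) : expR x - 1 - x <= x ^+ 2 * expR `|x|.
Proof.
have [x0|x0] := leP 0 x.
  rewrite ger0_norm//.
  have h : expR x - 1 <= x * expR x.
    have := expR_ge1Dx (- x) => h.
    have e : expR x * expR (- x) = 1 by rewrite -expRD subrr expR0.
    have := ler_wpM2l (expR_ge0 x) h; rewrite e; lra.
  have h2 : x * (expR x - 1) <= x * (x * expR x) by rewrite ler_wpM2l.
  have h3 : x * 1 <= x * expR x by rewrite ler_wpM2l// -expR0 ler_expR.
  have h4 : x ^+ 2 * expR x = x * (x * expR x) by rewrite expr2 mulrA.
  lra.
rewrite ltr0_norm//; have y0 : 0 < - x by rewrite oppr_gt0.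
have h := expR_ge1Dx (- x).
have e : expR x * expR (- x) = 1 by rewrite -expRD subrr expR0.
have h1 : expR x * (1 - x) <= 1 by have := ler_wpM2l (expR_ge0 x) h; rewrite e.
have h2 : expR x - 1 - x <= x ^+ 2.
  rewrite -(@ler_pM2r _ (1 - x)); last by rewrite subr_gt0 (lt_trans x0).
  have : x ^+ 2 * (- x) >= 0 by rewrite mulr_ge0 ?sqr_ge0// ltW.
  nra.
rewrite (le_trans h2)// -[leLHS]mulr1 ler_wpM2l ?sqr_ge0// -expR0 ler_expR ltW//.
Qed.

(** The exponential lies above its tangent at the mean. *)
Lemma expR_jensen (I : finType) (a x : I -> R) : (forall i, 0 <= a i) -> \sum_i a i = 1 ->
  expR (\sum_i a i * x i) <= \sum_i a i * expR (x i).
Proof.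
move=> a0 a1; set m := \sum_i _.
apply: (@le_trans _ _ (\sum_i a i * (expR m * (1 + (x i - m))))).
  rewrite (eq_bigr (fun i => expR m * a i + expR m * (a i * x i) - expR m * m * a i)); last first.
    by move=> i _; ring.
  rewrite sumrB big_split /= -!mulr_sumr a1 -/m; lra.
apply: ler_sum => i _; rewrite ler_wpM2l//.
have -> : expR (x i) = expR m * expR (x i - m) by rewrite -expRD addrC subrK.
rewrite ler_wpM2l ?expR_ge0//.
exact: expR_ge1Dx.
Qed.

Lemma sinB_bound (x : R) : `|sin x - x| <= `|x| ^+ 3.
Proof.
wlog x0 : x / 0 <= x => [h|].
  have [x0|x0] := leP 0 x; first exact: h.
  by have := h (- x); rewrite sinN oppr_ge0 -opprD !normrN; apply; exact: ltW.
rewrite (ger0_norm x0).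
have c1 y : 0 <= y -> y <= x -> cos y <= 1 by move=> _ _; exact: cos_le1.
have s1 (y : R) : 0 <= y -> y <= x -> sin y <= y.
  move=> y0 yx; have D (z : R) : 0 <= z -> z <= y -> is_derive z 1 (fun z => z - sin z) (1 - cos z * 1).
    by move=> _ _; exact: Dadd (Did z) (Dopp (Dsin (Did z))).
  have Pp (z : R) : 0 <= z -> z <= y -> 0 <= 1 - cos z * 1.
    by move=> _ _; rewrite mulr1 subr_ge0 cos_le1.
  by have := derive_ge0_le y0 D Pp; rewrite sin0 subr0 subr_ge0.
have c2 (y : R) : 0 <= y -> y <= x -> 1 - y ^+ 2 <= cos y.
  move=> y0 yx; have D (z : R) : 0 <= z -> z <= y ->
      is_derive z 1 (fun z => cos z + z ^+ 2) (- sin z * 1 + 2%:R * z ^+ 1 * 1).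
    by move=> _ _; exact: Dadd (Dcos (Did z)) (Dexpn 2 (Did z)).
  have Pp (z : R) : 0 <= z -> z <= y -> 0 <= - sin z * 1 + 2%:R * z ^+ 1 * 1.
    by move=> z0 zy; rewrite expr1; have := s1 z z0 (le_trans zy yx); lra.
  by have := derive_ge0_le y0 D Pp; rewrite cos0 expr0n/= addr0; lra.
have s2 : x - x ^+ 3 <= sin x.
  have D (z : R) : 0 <= z -> z <= x ->
      is_derive z 1 (fun z => sin z + z ^+ 3 - z) (cos z * 1 + 3%:R * z ^+ 2 * 1 - 1).
    by move=> _ _; exact: Dadd (Dadd (Dsin (Did z)) (Dexpn 3 (Did z))) (Dopp (Did z)).
  have Pp (z : R) : 0 <= z -> z <= x -> 0 <= cos z * 1 + 3%:R * z ^+ 2 * 1 - 1.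
    by move=> z0 zx; have := c2 z z0 zx; have := sqr_ge0 z; lra.
  by have := derive_ge0_le x0 D Pp; rewrite sin0 expr0n/= !addr0 subr0; lra.
have := s1 x x0 (lexx x); have x30 : 0 <= x ^+ 3 by rewrite exprn_ge0.
by rewrite ler_norml => ?; apply/andP; split; lra.
Qed.

Lemma cosB_bound (x : R) : `|cos x - 1 + x ^+ 2 / 2| <= x ^+ 4.
Proof.
wlog x0 : x / 0 <= x => [h|].
  have [x0|x0] := leP 0 x; first exact: h.
  have := h (- x); rewrite cosN oppr_ge0 sqrrN.
  by rewrite (_ : (- x) ^+ 4 = x ^+ 4); [apply; exact: ltW|ring].
have s1 (y : R) : 0 <= y -> `|sin y - y| <= y ^+ 3.
  by move=> y0; have := sinB_bound y; rewrite (ger0_norm y0).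
have c1 : 1 - x ^+ 2 / 2 <= cos x + x ^+ 4.
  have D (z : R) : 0 <= z -> z <= x -> is_derive z 1 (fun z => cos z + z ^+ 2 * 2^-1 + z ^+ 4)
      (- sin z * 1 + (2%:R * z ^+ 1 * 1 * 2^-1 + z ^+ 2 * 0) + 4%:R * z ^+ 3 * 1).
    by move=> _ _; exact: Dadd (Dadd (Dcos (Did z)) (Dmul (Dexpn 2 (Did z)) (Dcst z _))) (Dexpn 4 (Did z)).
  have Pp (z : R) : 0 <= z -> z <= x ->
      0 <= - sin z * 1 + (2%:R * z ^+ 1 * 1 * 2^-1 + z ^+ 2 * 0) + 4%:R * z ^+ 3 * 1.
    move=> z0 zx; have := s1 z z0; rewrite ler_norml expr1 => /andP[_].
    have : 0 <= z ^+ 3 by rewrite exprn_ge0.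
    lra.
  by have := derive_ge0_le x0 D Pp; rewrite cos0 !expr0n/= mul0r !addr0; lra.
have c2 : cos x <= 1 - x ^+ 2 / 2 + x ^+ 4.
  have D (z : R) : 0 <= z -> z <= x -> is_derive z 1 (fun z => z ^+ 4 - (cos z + z ^+ 2 * 2^-1))
      (4%:R * z ^+ 3 * 1 - (- sin z * 1 + (2%:R * z ^+ 1 * 1 * 2^-1 + z ^+ 2 * 0))).
    by move=> _ _; exact: Dadd (Dexpn 4 (Did z)) (Dopp (Dadd (Dcos (Did z)) (Dmul (Dexpn 2 (Did z)) (Dcst z _)))).
  have Pp (z : R) : 0 <= z -> z <= x ->
      0 <= 4%:R * z ^+ 3 * 1 - (- sin z * 1 + (2%:R * z ^+ 1 * 1 * 2^-1 + z ^+ 2 * 0)).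
    move=> z0 zx; have := s1 z z0; rewrite ler_norml expr1 => /andP[? ?].
    have : 0 <= z ^+ 3 by rewrite exprn_ge0.
    lra.
  by have := derive_ge0_le x0 D Pp; rewrite cos0 !expr0n/= mul0r; lra.
by rewrite ler_norml; apply/andP; split; lra.
Qed.

Lemma cos_lip (a b : R) : `|cos a - cos b| <= `|a - b|.
Proof.
wlog ab : a b / b <= a => [h|].
  have [/h//|/ltW/h] := leP b a; by rewrite distrC [leRHS]distrC.
have D1 (z : R) : b <= z -> z <= a -> is_derive z 1 (fun z => z + cos z) (1 + - sin z * 1).
  by move=> _ _; exact: Dadd (Did z) (Dcos (Did z)).
have P1 (z : R) : b <= z -> z <= a -> 0 <= 1 + - sin z * 1.
  by move=> _ _; have := sin_le1 z; lra.
have D2 (z : R) : b <= z -> z <= a -> is_derive z 1 (fun z => z - cos z) (1 - (- sin z * 1)).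
  by move=> _ _; exact: Dadd (Did z) (Dopp (Dcos (Did z))).
have P2 (z : R) : b <= z -> z <= a -> 0 <= 1 - (- sin z * 1).
  by move=> _ _; have := sin_geN1 z; lra.
have h1 := derive_ge0_le ab D1 P1; have h2 := derive_ge0_le ab D2 P2.
by rewrite [leRHS]ger0_norm ?subr_ge0// ler_norml; apply/andP; split; lra.
Qed.

End elementary.

Section nonnegative_integrals.
Context d (Om : measurableType d) (R : realType) (P : {measure set Om -> \bar R}).
Implicit Types f g : Om -> R.
Local Open Scope ereal_scope.

Lemma pint_scale (k : R) f : measurable_fun setT f -> (0 <= k)%R -> (forall x, 0 <= f x)%R ->
  \int[P]_x (k * f x)%:E = k%:E * \int[P]_x (f x)%:E.
Proof.
move=> mf k0 f0; under eq_integral do rewrite EFinM.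
by rewrite ge0_integralZl//; [exact/measurable_EFinP|move=> x _; rewrite lee_fin].
Qed.

Lemma pint_add f g : measurable_fun setT f -> measurable_fun setT g ->
  (forall x, 0 <= f x)%R -> (forall x, 0 <= g x)%R ->
  \int[P]_x (f x + g x)%:E = \int[P]_x (f x)%:E + \int[P]_x (g x)%:E.
Proof.
move=> mf mg f0 g0; under eq_integral do rewrite EFinD.
by apply: ge0_integralD => //; [move=> x _; rewrite lee_fin|exact/measurable_EFinP|
  move=> x _; rewrite lee_fin|exact/measurable_EFinP].
Qed.

Lemma pint_le f g : measurable_fun setT f -> measurable_fun setT g ->
  (forall x, 0 <= f x)%R -> (forall x, f x <= g x)%R ->
  \int[P]_x (f x)%:E <= \int[P]_x (g x)%:E.
Proof.
move=> mf mg f0 fg; apply: ge0_le_integral => //.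
- by move=> x _; rewrite lee_fin.
- exact/measurable_EFinP.
- exact/measurable_EFinP.
- by move=> x _; rewrite lee_fin.
Qed.

Lemma pint_sum (I : finType) (f : I -> Om -> R) : (forall i, measurable_fun setT (f i)) ->
  (forall i x, 0 <= f i x)%R ->
  \int[P]_x (\sum_i f i x)%:E = \sum_i \int[P]_x (f i x)%:E.
Proof.
move=> mf f0; under eq_integral do rewrite -sumEFin.
apply: ge0_integral_sum => // [i|i x _]; first exact/measurable_EFinP.
by rewrite lee_fin.
Qed.

End nonnegative_integrals.

Lemma Rintegral_itv_scale (R : realType) (k : R) (f : R -> R) (a b : R) : continuous f ->
  \int[@lebesgue_measure R]_(t in `[a, b]) (k * f t) =
  k * \int[@lebesgue_measure R]_(t in `[a, b]) f t.
Proof.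
move=> cf; apply: (@Rintegral_scale _ _ (measurableTypeR R)); first exact: measurable_itv.
exact: continuous_itv_integrable.
Qed.

Lemma Rintegral_grid (R : realType) (T : R) (n : nat) (f : R -> R) : 0 < T -> (0 < n)%N ->
  continuous f -> \int[@lebesgue_measure R]_(t in `[0, T]) f t =
  \sum_(j < n) \int[@lebesgue_measure R]_(t in `[grid T n j, grid T n j.+1]) f t.
Proof.
move=> T0 n0 cf; rewrite -{1}(gridn T n0).
have H m : \int[@lebesgue_measure R]_(t in `[0, grid T n m]) f t =
  \sum_(j < m) \int[@lebesgue_measure R]_(t in `[grid T n j, grid T n j.+1]) f t.
  elim: m => [|m ih]; first by rewrite grid0 set_itv1 Rintegral_set1 big_ord0.
  rewrite big_ord_recr/= -ih; apply: Rintegral_itv_split.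
  - exact: grid_ge0.
  - exact: grid_homo.
  - exact: continuous_itv_integrable.
exact: H.
Qed.

(** * Stochastic integrals of the observed paths *)

Section observed.
Context (R : realType) (K : nat) d (Om : measurableType d) (P : probability Om R).
Variables (T L : R) (lam : 'I_K -> R -> R) (X : 'I_K -> Om -> cumulative R R) (n : nat).
Hypotheses (K0 : (0 < K)%N) (T0 : 0 < T) (L0 : 0 <= L) (n0 : (0 < n)%N)
  (clam : forall k, continuous (lam k)) (lam0 : forall k t, 0 <= lam k t)
  (lamL : forall k t, 0 <= t <= T -> lam k t <= L)
  (pp : forall k, poisson_process P T (fun t => n%:R * lam k t) (X k))
  (ind : independent_processes P T X).

Local Notation g := (grid T n).
Local Notation M k om := (comp (lam k) (X k om) n%:R).
Local Notation sn := (Num.sqrt (n%:R : R)).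

Let nR0 : 0 < n%:R :> R. Proof. by rewrite ltr0n. Qed.
Let n1 : 1 <= n%:R :> R. Proof. by rewrite ler1n. Qed.
Let sn0 : 0 < sn. Proof. by rewrite sqrtr_gt0. Qed.
Let sn1 : 1 <= sn. Proof. by rewrite -[leLHS]sqrtr1 ler_sqrt. Qed.
Let snsn : sn * sn = n%:R. Proof. by rewrite -expr2 sqr_sqrtr// ltW. Qed.
Let gT j : (j <= n)%N -> 0 <= g j <= T.
Proof. by move=> jn; rewrite (grid_ge0 T0)//= grid_le. Qed.

Lemma X0 k om : X k om 0 = 0. Proof. by have [/(_ om)[]] := pp k. Qed.
Lemma Xmono k om : {homo (X k om : R -> R) : u v / u <= v}.
Proof. exact: cumulative_is_nondecreasing. Qed.
Lemma Xmeas k t : 0 <= t <= T -> measurable_fun setT (fun om => X k om t : R).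
Proof. by move=> tT; have [_ /(_ t tT)] := pp k. Qed.
Lemma Mmeas k t : 0 <= t <= T -> measurable_fun setT (fun om => M k om t : R).
Proof. by move=> tT; apply: measurable_funB => //; exact: Xmeas. Qed.

Lemma increment_nat k u v om : 0 <= u -> u <= v -> v <= T -> X k om v - X k om u \is a Num.nat.
Proof.
move=> u0 uv vT; have [/(_ om)[_ h] _ _ _] := pp k.
have /natrP[a aE] : X k om v \is a Num.nat by apply: h; rewrite (le_trans u0 uv) vT.
have /natrP[b bE] : X k om u \is a Num.nat by apply: h; rewrite u0 (le_trans uv vT).
have := Xmono k om uv; rewrite aE bE ler_nat => ba; apply/natrP; exists (a - b)%N.
by rewrite natrB.
Qed.

Lemma increment_law k u v (j : nat) : 0 <= u -> u <= v -> v <= T ->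
  P [set om | X k om v - X k om u = j%:R] =
  (pois (n%:R * (cum (lam k) v - cum (lam k) u)) j)%:E.
Proof.
move=> u0 uv vT; have [_ _ /(_ u v j u0 uv vT) h _] := pp k.
rewrite h (cum_diff (@clam k))//.
rewrite -(Rintegral_itv_scale _ _ _ (@clam k)).
rewrite poisson_probE// Rintegral_ge0// => x _; exact: mulr_ge0.
Qed.

(* A discretization of the integrals of |M_k|: it dominates every stochastic
   integral below and its exponential moments are bounded uniformly in n. *)
Definition fluct (om : Om) : R := 1 + \sum_(k < K)
  (`|M k om T| + n%:R^-1 * \sum_(j < n) `|M k om (g j.+1)|) / sn.

Lemma fluct_measurable : measurable_fun setT fluct.
Proof.
apply: measurable_funD => //; apply: measurable_sum => k.
apply: measurable_funM => //; apply: measurable_funD.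
  by apply: measurableT_comp => //; apply: Mmeas; rewrite lexx ltW.
apply: measurable_funM => //; apply: measurable_sum => j.
by apply: measurableT_comp => //; apply: Mmeas; apply: gT.
Qed.

Lemma fluct_term_ge0 k om : 0 <= (`|M k om T| + n%:R^-1 * \sum_(j < n) `|M k om (g j.+1)|) / sn.
Proof. by rewrite divr_ge0 ?(ltW sn0)// addr_ge0// mulr_ge0// ?invr_ge0 ?(ltW nR0)// sumr_ge0. Qed.

Lemma fluct_ge1 om : 1 <= fluct om.
Proof. by rewrite lerDl; apply: sumr_ge0 => k _; exact: fluct_term_ge0. Qed.

Lemma fluct_term k om : `|M k om T| + n%:R^-1 * \sum_(j < n) `|M k om (g j.+1)| <= sn * fluct om.
Proof.
rewrite -ler_pdivrMl// mulrC /fluct (bigD1 k)//= addrCA lerDl addr_ge0// sumr_ge0// => i _.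
exact: fluct_term_ge0.
Qed.

Let cumT k : 0 <= cum (lam k) T <= L * T.
Proof.
have := @cum_lip _ (lam k) T L (@clam k) (lam0 k) (lamL k) 0 T (lexx _) (ltW T0) (lexx _).
rewrite cum0 !subr0 => ->; rewrite andbT.
by have := cum_homo (@clam k) (lam0 k) (ltW T0); rewrite cum0.
Qed.

Lemma X_le k om : X k om T <= `|M k om T| + n%:R * (L * T).
Proof.
have /andP[c0 c1] := cumT k.
have : n%:R * cum (lam k) T <= n%:R * (L * T) by rewrite ler_wpM2l// ltW.
have := ler_norm (M k om T); rewrite /comp; lra.
Qed.

Section integrands.
Variables (f f' : 'I_K -> R -> R) (c : R).
Hypotheses (c0 : 0 <= c) (fD : forall k (t : R), is_derive t 1 (f k) (f' k t))
  (cf' : forall k, continuous (f' k))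
  (fc : forall k t, 0 <= t <= T -> `|f k t| <= c)
  (f'c : forall k t, 0 <= t <= T -> `|f' k t| <= c).

Definition Dsum (om : Om) : R := \sum_(k < K) \sum_(j < n)
  f k (g j) * (M k om (g j.+1) - M k om (g j)) / sn.

Lemma Dsum_measurable : measurable_fun setT Dsum.
Proof.
apply: measurable_sum => k; apply: measurable_sum => j.
apply: measurable_funM => //; apply: measurable_funM => //.
by apply: measurable_funB; apply: Mmeas; apply: gT => //; exact: ltnW.
Qed.

(** X_k(T) is of order n and the mesh of order 1/n, so discretization costs a multiple of W, a
    factor n^(1/2) below the size of the integral itself in [Jint_bound]. *)
Let grid_err k om :
  `|Jint T (f k) (f' k) (M k om) - \sum_(j < n) f k (g j) * (M k om (g j.+1) - M k om (g j))|
  <= c * (T + 2 * L * T ^+ 2) * fluct om.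
Proof.
have h := path_grid (@clam k) (lam0 k) (lamL k) T0 (X0 k om) (@Xmono k om) (ltW nR0) L0 c0
  (fD k) (@cf' k) (f'c k) n0.
apply: (le_trans h).
rewrite (_ : c * (T / n%:R) * (X k om T + n%:R * L * T) =
  c * (T / n%:R * (X k om T + n%:R * (L * T)))); last by ring.
rewrite -[leRHS]mulrA ler_wpM2l//.
have hX := X_le k om; have hM := fluct_term k om.
have s0 : 0 <= n%:R^-1 * \sum_(j < n) `|M k om (g j.+1)|.
  by rewrite mulr_ge0 ?invr_ge0 ?(ltW nR0)// sumr_ge0.
have w1 := fluct_ge1 om.
have hM2 : `|M k om T| <= n%:R * fluct om.
  have e : n%:R * fluct om = sn * (sn * fluct om) by rewrite mulrA snsn.
  rewrite e (@le_trans _ _ (sn * fluct om))//; first by lra.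
  by rewrite ler_wpM2l ?(ltW sn0)// ler_peMl// (le_trans ler01).
apply: (@le_trans _ _ (T / n%:R * (n%:R * (fluct om + 2 * L * T)))).
  rewrite ler_wpM2l ?divr_ge0 ?(ltW T0) ?(ltW nR0)//; lra.
rewrite mulrA divfK ?gt_eqF// expr2.
have : L * T <= L * T * fluct om by rewrite ler_peMr// mulr_ge0// ltW.
have T0' := ltW T0; have LT0 : 0 <= L * T by exact: mulr_ge0.
nra.
Qed.

Lemma Jint_bound k om : `|Jint T (f k) (f' k) (M k om)| <=
  c * (1 + 2 * T + 2 * L * T ^+ 2) * (sn * fluct om).
Proof.
have h1 := grid_err k om.
have h2 := @abel_bound R (lam k) T (X k om) n%:R c (f k) (f' k) T0 (X0 k om)
  (fD k) (@cf' k) (fc k) (f'c k) n n0.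
have hM := fluct_term k om; have w1 := fluct_ge1 om.
set S := \sum_(j < n) f k _ * _ in h1 h2.
have s0 : 0 <= n%:R^-1 * \sum_(j < n) `|M k om (g j.+1)|.
  by rewrite mulr_ge0 ?invr_ge0 ?(ltW nR0)// sumr_ge0.
have a0 : 0 <= `|M k om T| by [].
have W0 : 0 <= sn * fluct om by rewrite mulr_ge0 ?(ltW sn0)// (le_trans ler01).
have wW : fluct om <= sn * fluct om by rewrite ler_peMl// (le_trans ler01).
have h3 : `|S| <= c * ((1 + T) * (sn * fluct om)).
  apply: (le_trans h2); rewrite ler_wpM2l//.
  have := ltW T0; nra.
have h4 : c * (T + 2 * L * T ^+ 2) * fluct om <= c * (T + 2 * L * T ^+ 2) * (sn * fluct om).
  have T0' := ltW T0.
  by rewrite ler_wpM2l// mulr_ge0// addr_ge0// mulr_ge0 ?sqr_ge0// mulr_ge0.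
have : `|Jint T (f k) (f' k) (M k om)| <= `|Jint T (f k) (f' k) (M k om) - S| + `|S|.
  by rewrite -{1}(subrK S (Jint T _ _ _)) ler_normD.
lra.
Qed.

Lemma Dsum_err om : `|\sum_(k < K) Jint T (f k) (f' k) (M k om) / sn - Dsum om| <=
  K%:R * c * (T + 2 * L * T ^+ 2) * (fluct om / sn).
Proof.
rewrite /Dsum -sumrB (le_trans (ler_norm_sum _ _ _))//.
apply: (@le_trans _ _ (\sum_(k < K) c * (T + 2 * L * T ^+ 2) * fluct om / sn)).
  apply: ler_sum => k _; rewrite -mulr_suml -mulrBl normrM [`|sn^-1|]ger0_norm ?invr_ge0 ?(ltW sn0)//.
  by rewrite ler_wpM2r ?invr_ge0 ?(ltW sn0)// grid_err.
rewrite sumr_const card_ord -[_ *+ K]mulr_natl le_eqVlt; apply/orP; left; apply/eqP; ring.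
Qed.

End integrands.

(** With u = s / n^(1/2) the exponent is mu (exp u - 1 - u), where mu <= n L T; the bracket is
    quadratic in u and cancels n. *)
Lemma comp_mgf k t s : 0 <= t <= T ->
  (\int[P]_om (expR (s * (M k om t / sn)))%:E <= (expR (L * T * s ^+ 2 * expR `|s|))%:E)%E.
Proof.
move=> tT; have /andP[t0 tT'] := tT.
pose mu := n%:R * cum (lam k) t.
have cum0t : 0 <= cum (lam k) t by have := cum_homo (@clam k) (lam0 k) t0; rewrite cum0.
have mu0 : 0 <= mu by rewrite mulr_ge0// ltW.
have muL : mu <= n%:R * (L * T).
  rewrite ler_wpM2l ?(ltW nR0)//.
  have := cum_lip (@clam k) (lam0 k) (lamL k) (lexx 0) t0 tT'; rewrite cum0 !subr0 => h.
  by rewrite (le_trans h)// ler_wpM2l.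
have mX : measurable_fun setT (fun om => X k om t : R) by exact: Xmeas.
have natX om : (X k om t : R) \is a Num.nat by have [/(_ om)[_ h] _ _ _] := pp k; exact: h.
have lawX (j : nat) : P [set om | (X k om t : R) = j%:R] = (pois mu j)%:E.
  have := @increment_law k 0 t j (lexx 0) t0 tT'; rewrite cum0 subr0 => <-.
  by congr (P _); apply/seteqP; split => om /=; rewrite X0 subr0.
have h := poisson_mgf (s / sn) mu0 mX natX lawX.
have -> : (\int[P]_om (expR (s * (M k om t / sn)))%:E =
    \int[P]_om (expR (- (s * mu / sn)) * expR (s / sn * X k om t))%:E)%E.
  by apply: eq_integral => om _; rewrite -expRD /comp -/mu; congr (expR _)%:E; ring.
rewrite pint_scale ?expR_ge0//; last first.
  by apply: measurableT_comp => //; exact: measurable_funM.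
apply: (@le_trans _ _ ((expR (- (s * mu / sn)))%:E * (expR (mu * (expR (s / sn) - 1)))%:E)%E).
  by rewrite lee_pmul2l// lte_fin expR_gt0.
rewrite -EFinM lee_fin -expRD ler_expR.
have q := expR_quad (s / sn).
have a0 : `|s / sn| <= `|s|.
  by rewrite normrM ler_piMr// ger0_norm ?invr_ge0 ?(ltW sn0)// invf_le1.
have q2 : (s / sn) ^+ 2 * expR `|s / sn| <= s ^+ 2 / n%:R * expR `|s|.
  rewrite exprMn exprVn expr2 [sn ^+ 2]expr2 snsn.
  by rewrite ler_wpM2l ?ler_expR// divr_ge0 ?(ltW nR0)// -expr2 sqr_ge0.
rewrite (_ : _ + _ = mu * (expR (s / sn) - 1 - s / sn)); last by ring.
apply: (@le_trans _ _ (mu * (s ^+ 2 / n%:R * expR `|s|))).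
  by rewrite ler_wpM2l// (le_trans q).
apply: (@le_trans _ _ (n%:R * (L * T) * (s ^+ 2 / n%:R * expR `|s|))).
  by rewrite ler_wpM2r// mulr_ge0 ?expR_ge0// divr_ge0 ?sqr_ge0 ?(ltW nR0).
by rewrite le_eqVlt; apply/orP; left; apply/eqP; field; rewrite gt_eqF.
Qed.

Definition fluct_bound : R := expR 1 * (2 * expR (L * T * (2 * K%:R) ^+ 2 * expR (2 * K%:R))).

Let expR_norm (x : R) : expR `|x| <= expR x + expR (- x).
Proof.
have [x0|x0] := leP 0 x; first by rewrite ger0_norm// lerDl expR_ge0.
by rewrite ltr0_norm// lerDr expR_ge0.
Qed.

(** [fluct - 1] is the mean over the K n pairs (k, j) of K (|M_k(T)| + |M_k(g_(j+1))|) / n^(1/2), so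
    Jensen reduces its exponential to single times. The arithmetic-geometric inequality then
    separates the two terms and doubles the exponent, hence the 2 K in [fluct_bound]; exp |x| <= exp
    x + exp(-x) accounts for the factor 2 there. *)
Lemma fluct_exp : (\int[P]_om (expR (fluct om))%:E <= fluct_bound%:E)%E.
Proof.
pose s : R := 2 * K%:R.
have KR0 : 0 < K%:R :> R by rewrite ltr0n.
pose E2 x : R := expR (s * x) + expR (- s * x).
pose a : R := (K%:R * n%:R)^-1.
have a0 : 0 <= a by rewrite invr_ge0 mulr_ge0// ltW.
pose H om := \sum_(i : 'I_K * 'I_n) expR 1 * (a * 2^-1) *
  (E2 (M i.1 om T / sn) + E2 (M i.1 om (g i.2.+1) / sn)).
have E20 x : 0 <= E2 x by rewrite addr_ge0 ?expR_ge0.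
have mE2 k t : 0 <= t <= T -> measurable_fun setT (fun om => E2 (M k om t / sn)).
  move=> tT; apply: measurable_funD; apply: measurableT_comp => //;
    by apply: measurable_funM => //; apply: measurable_funM => //; exact: Mmeas.
have TT : 0 <= T <= T by rewrite lexx ltW.
have iE2 k t : 0 <= t <= T ->
    (\int[P]_om (E2 (M k om t / sn))%:E <= (2 * expR (L * T * s ^+ 2 * expR s))%:E)%E.
  move=> tT; rewrite /E2.
  have mm (r : R) : measurable_fun setT (fun om => expR (r * (M k om t / sn))).
    apply: measurableT_comp => //.
    by apply: measurable_funM => //; apply: measurable_funM => //; exact: Mmeas.
  rewrite (pint_add P (mm s) (mm (- s)) (fun=> expR_ge0 _) (fun=> expR_ge0 _)).
  rewrite mulr2n mulrDl mul1r EFinD leeD//.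
    have s0 : 0 <= s by rewrite mulr_ge0.
    by have := @comp_mgf k t s tT; rewrite ger0_norm.
  have s0 : 0 <= s by rewrite mulr_ge0.
  by have := @comp_mgf k t (- s) tT; rewrite normrN ger0_norm// sqrrN.
have WH om : expR (fluct om) <= H om.
  have -> : H om = expR 1 * \sum_(i : 'I_K * 'I_n) a * (2^-1 *
    (E2 (M i.1 om T / sn) + E2 (M i.1 om (g i.2.+1) / sn))).
    by rewrite /H mulr_sumr; apply: eq_bigr => i _; rewrite -[LHS]mulrA -[X in _ * X = _]mulrA.
  rewrite /fluct expRD ler_wpM2l ?expR_ge0//.
  pose x (i : 'I_K * 'I_n) := K%:R * (`|M i.1 om T / sn| + `|M i.1 om (g i.2.+1) / sn|).
  have -> : \sum_(k < K) (`|M k om T| + n%:R^-1 * \sum_(j < n) `|M k om (g j.+1)|) / sn =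
      \sum_i a * x i.
    rewrite -(pair_bigA _ (fun k j => a * x (k, j)))/=; apply: eq_bigr => k _.
    rewrite /x /= -mulr_sumr -mulr_sumr big_split/= sumr_const card_ord.
    have nm (y : R) : `|y / sn| = `|y| / sn by rewrite normrM [`|sn^-1|]ger0_norm// invr_ge0 ltW.
    have e : \sum_(i < n) `|M k om (g i.+1) / sn| = (\sum_(i < n) `|M k om (g i.+1)|) / sn.
      by rewrite mulr_suml; apply: eq_bigr => i _; exact: nm.
    rewrite e nm -[_ *+ n]mulr_natr /a; field.
    by rewrite mul1r !gt_eqF.
  have a1 : \sum_(i : 'I_K * 'I_n) a = 1.
    rewrite sumr_const card_prod !card_ord -[_ *+ _]mulr_natr natrM /a mulVf//.
    by rewrite gt_eqF// mulr_gt0.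
  apply: (le_trans (expR_jensen x (fun=> a0) a1)); apply: ler_sum => i _.
  rewrite ler_wpM2l// /x.
  set u := `|_ / sn|; set v := `|_ / sn|.
  have -> : K%:R * (u + v) = s * u / 2 + s * v / 2 by rewrite /s; field.
  have am : expR (s * u / 2 + s * v / 2) <= 2^-1 * (expR (s * u) + expR (s * v)).
    rewrite expRD; set p := expR (s * u / 2); set q := expR (s * v / 2).
    have -> : expR (s * u) = p ^+ 2 by rewrite /p expr2 -expRD; congr expR; field.
    have -> : expR (s * v) = q ^+ 2 by rewrite /q expr2 -expRD; congr expR; field.
    have := sqr_ge0 (p - q); rewrite sqrrB; lra.
  apply: (le_trans am); rewrite ler_wpM2l// lerD//.
    have -> : s * u = `|s * (M i.1 om T / sn)| by rewrite normrM [`|s|]ger0_norm// mulr_ge0// ltW.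
    by rewrite /E2 mulNr expR_norm.
  have -> : s * v = `|s * (M i.1 om (g i.2.+1) / sn)| by rewrite normrM [`|s|]ger0_norm// mulr_ge0// ltW.
  by rewrite /E2 mulNr expR_norm.
have c0 : 0 <= expR 1 * (a * 2^-1) by rewrite mulr_ge0 ?expR_ge0// mulr_ge0.
have mterm (i : 'I_K * 'I_n) : measurable_fun setT (fun om => expR 1 * (a * 2^-1) *
  (E2 (M i.1 om T / sn) + E2 (M i.1 om (g i.2.+1) / sn))).
  apply: measurable_funM => //; apply: measurable_funD; apply: mE2 => //; exact: gT.
apply: (@le_trans _ _ (\int[P]_om (H om)%:E)%E).
  apply: pint_le WH => //; last exact: measurable_sum.
  by apply: measurableT_comp => //; exact: fluct_measurable.
rewrite /H (pint_sum P mterm); last by move=> i om; rewrite mulr_ge0// addr_ge0.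
apply: (@le_trans _ _ (\sum_(i : 'I_K * 'I_n) (a * fluct_bound)%:E)%E).
  apply: lee_sum => i _.
  have m1 : measurable_fun setT (fun om => E2 (M i.1 om T / sn)) by exact: mE2.
  have m2 : measurable_fun setT (fun om => E2 (M i.1 om (g i.2.+1) / sn)) by apply: mE2; exact: gT.
  rewrite (pint_scale P (measurable_funD m1 m2) c0) => [|om]; last exact: addr_ge0.
  rewrite (pint_add P m1 m2) => [|om|om]; [|exact: E20|exact: E20].
  apply: (@le_trans _ _ ((expR 1 * (a * 2^-1))%:E *
     ((2 * expR (L * T * s ^+ 2 * expR s))%:E + (2 * expR (L * T * s ^+ 2 * expR s))%:E))%E).
    rewrite lee_pmul2l//; last first.
      by rewrite lte_fin !mulr_gt0 ?expR_gt0// invr_gt0 mulr_gt0.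
    by apply: leeD; apply: iE2 => //; exact: gT.
  by rewrite -EFinD -EFinM lee_fin /fluct_bound -/s le_eqVlt; apply/orP; left; apply/eqP; field.
rewrite sumEFin lee_fin sumr_const card_prod !card_ord -[_ *+ _]mulr_natr natrM /a.
rewrite le_eqVlt; apply/orP; left; apply/eqP; field.
by rewrite gt_eqF// gt_eqF.
Qed.

(** The events of one detector are gathered into a single event of its trajectory: independence
    between detectors applies to these, independence of increments inside each. *)
Lemma increments_independent (B : 'I_K * 'I_n -> set R) : (forall i, measurable (B i)) ->
  P (\bigcap_(i in setT) [set om | B i (X i.1 om (g i.2.+1) - X i.1 om (g i.2))]) =
  (\prod_i P [set om | B i (X i.1 om (g i.2.+1) - X i.1 om (g i.2))%R])%E.
Proof.
move=> mB.
pose A k := \bigcap_(j in [set: 'I_n]) [set om | B (k, j) (X k om (g j.+1) - X k om (g j))].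
rewrite (_ : \bigcap_(i in setT) _ = \bigcap_(k in [set: 'I_K]) A k); last first.
  apply/seteqP; split => om h; first by move=> k _ j _; exact: (h (k, j) Logic.I).
  by move=> [k j] _; exact: (h k Logic.I j Logic.I).
rewrite ind => [|k].
  transitivity (\prod_(k < K) \prod_(j < n)
      P [set om | B (k, j) (X k om (g j.+1) - X k om (g j))%R])%E; last first.
    by rewrite pair_bigA; apply: eq_bigr => -[].
  apply: eq_bigr => k _; have [_ _ _ h] := pp k.
  apply: (h n (grid T n) (fun j => B (k, j))) => [|||j].
  - by rewrite grid0.
  - by rewrite gridn.
  - exact: grid_homo.
  - exact: mB.
pose G := [set A0 | exists (t : R) (B0 : set R),
        [/\ 0 <= t <= T, measurable B0 & A0 = [set om | B0 (X k om t)]]].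
have mX t : 0 <= t <= T -> measurable_fun [set: g_sigma_algebraType G] (fun om => X k om t : R).
  move=> tT _ B0 mB0; rewrite setTI; apply: sub_sigma_algebra; by exists t, B0.
have : measurable (A k : set (g_sigma_algebraType G)).
  apply: fin_bigcap_measurable => [|j _]; first exact: finite_finset.
  have mD : measurable_fun [set: g_sigma_algebraType G] (fun om => X k om (g j.+1) - X k om (g j) : R).
    by apply: measurable_funB; apply: mX; apply: gT => //; exact: ltnW.
  by have := mD measurableT _ (mB (k, j)); rewrite setTI.
exact.
Qed.

(** The compensator is deterministic, so centring the increments only shifts the phase, and turns
    sin b into sin b - b. *)
Lemma Dsum_charfun (f : 'I_K -> R -> R) beta :
  \int[P]_om cos (beta + Dsum f om) =
  expR (\sum_(i : 'I_K * 'I_n) (n%:R * (cum (lam i.1) (g i.2.+1) - cum (lam i.1) (g i.2))) *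
     (cos (f i.1 (g i.2) / sn) - 1)) *
  cos (beta + \sum_(i : 'I_K * 'I_n) (n%:R * (cum (lam i.1) (g i.2.+1) - cum (lam i.1) (g i.2))) *
     (sin (f i.1 (g i.2) / sn) - f i.1 (g i.2) / sn)).
Proof.
pose N (i : 'I_K * 'I_n) om : R := X i.1 om (g i.2.+1) - X i.1 om (g i.2).
pose mu (i : 'I_K * 'I_n) := n%:R * (cum (lam i.1) (g i.2.+1) - cum (lam i.1) (g i.2)).
have gg (i : 'I_n) : [/\ 0 <= g i, g i <= g i.+1 & g i.+1 <= T].
  by split; [exact: grid_ge0|exact: grid_homo|exact: grid_le].
have mu0 i : 0 <= mu i.
  by have [? ? ?] := gg i.2; rewrite mulr_ge0 ?(ltW nR0)// subr_ge0 (cum_homo (@clam i.1)).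
have mN i : measurable_fun setT (N i).
  by apply: measurable_funB; apply: Xmeas; apply: gT => //; exact: ltnW.
have natN i om : N i om \is a Num.nat by have [? ? ?] := gg i.2; exact: increment_nat.
have pN i (j : nat) : P [set om | N i om = j%:R] = (pois (mu i) j)%:E.
  by have [? ? ?] := gg i.2; exact: increment_law.
have h := poisson_charfun mu0 mN natN pN increments_independent
  (fun i => f i.1 (g i.2) / sn) (beta - \sum_(i : 'I_K * 'I_n) mu i * (f i.1 (g i.2) / sn)).
transitivity (\int[P]_om cos (beta - \sum_(i : 'I_K * 'I_n) mu i * (f i.1 (g i.2) / sn) +
    \sum_(i : 'I_K * 'I_n) (f i.1 (g i.2) / sn) * N i om)).
  apply: eq_Rintegral => om _; congr cos; rewrite -addrA; congr (_ + _).
  rewrite /Dsum (pair_bigA _ (fun k (j : 'I_n) => f k (g j) * (M k om (g j.+1) - M k om (g j)) / sn))/=.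
  rewrite -sumrN -big_split/=; apply: eq_bigr => i _; rewrite /N /mu /comp; ring.
rewrite h; congr (_ * cos _); rewrite -addrA; congr (_ + _).
by rewrite -sumrN -big_split/=; apply: eq_bigr => i _; rewrite /mu; ring.
Qed.

(** Each of the K n cells has mean mu <= L T and angle |b| <= c / n^(1/2). The cubic error of the
    sine sums to order n^(-1/2); the quartic error of the cosine and the Riemann error of the
    variance sum to order 1/n and are weakened to n^(-1/2). *)
Lemma clt_bound (f f' : 'I_K -> R -> R) (c beta : R) : 0 <= c ->
  (forall k (t : R), is_derive t 1 (f k) (f' k t)) -> (forall k, continuous (f' k)) ->
  (forall k t, 0 <= t <= T -> `|f k t| <= c) -> (forall k t, 0 <= t <= T -> `|f' k t| <= c) ->
  `|\int[P]_om cos (beta + Dsum f om) -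
    expR (- ((\sum_(k < K) \int[@lebesgue_measure R]_(t in `[0, T]) (f k t ^+ 2 * lam k t)) / 2)) * cos beta|
  <= K%:R * (L * T) * (2 + T) * (1 + c) ^+ 4 / sn.
Proof.
move=> c0 fD cf' fc f'c; rewrite Dsum_charfun.
pose mu (i : 'I_K * 'I_n) := n%:R * (cum (lam i.1) (g i.2.+1) - cum (lam i.1) (g i.2)).
pose b (i : 'I_K * 'I_n) := f i.1 (g i.2) / sn.
rewrite -/mu -/b.
set q := \sum_(k < K) _.
have gg (i : 'I_n) : [/\ 0 <= g i, g i <= g i.+1 & g i.+1 <= T].
  by split; [exact: grid_ge0|exact: grid_homo|exact: grid_le].
have mu0 i : 0 <= mu i.
  by have [? ? ?] := gg i.2; rewrite mulr_ge0 ?(ltW nR0)// subr_ge0 (cum_homo (@clam i.1)).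
have mu1 i : mu i <= L * T.
  have [h1 h2 h3] := gg i.2; have := cum_lip (@clam i.1) (lam0 i.1) (lamL i.1) h1 h2 h3.
  rewrite (grid_step T n0) => h; rewrite (@le_trans _ _ (n%:R * (L * (T / n%:R))))//.
    by rewrite ler_wpM2l ?(ltW nR0).
  by rewrite le_eqVlt; apply/orP; left; apply/eqP; field; rewrite gt_eqF.
have bc i : `|b i| <= c / sn.
  by rewrite normrM [`|sn^-1|]ger0_norm ?invr_ge0 ?(ltW sn0)// ler_wpM2r ?invr_ge0 ?(ltW sn0)// fc// gT// ltnW.
have csn0 : 0 <= c / sn by rewrite divr_ge0// ltW.
have sumc (F : 'I_K * 'I_n -> R) z : (forall i, `|F i| <= z) ->
    `|\sum_i F i| <= K%:R * n%:R * z.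
  move=> Fz; rewrite (le_trans (ler_norm_sum _ _ _))//.
  rewrite (@le_trans _ _ (\sum_(i : 'I_K * 'I_n) z))//; first exact: ler_sum.
  by rewrite sumr_const card_prod !card_ord -[_ *+ _]mulr_natl natrM.
have LT0 : 0 <= L * T by rewrite mulr_ge0// ltW.
have n_sn (z : R) : 0 <= z -> z / n%:R <= z / sn.
  have h : sn <= n%:R by rewrite -[leRHS]snsn ler_peMl// ltW.
  by move=> z0; rewrite ler_wpM2l// lef_pV2 ?posrE.
have sinp : `|\sum_i mu i * (sin (b i) - b i)| <= K%:R * (L * T) * c ^+ 3 / sn.
  apply: (le_trans (sumc _ (L * T * (c / sn) ^+ 3) _)) => [i|].
    rewrite normrM (ger0_norm (mu0 i)) ler_pM// (le_trans (sinB_bound _))//.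
    by rewrite lerXn2r ?nnegrE.
  rewrite (_ : K%:R * n%:R * (L * T * (c / sn) ^+ 3) =
    K%:R * (L * T) * c ^+ 3 * (n%:R / (sn * sn)) / sn); last first.
    by field; rewrite gt_eqF.
  by rewrite snsn divff ?gt_eqF// mulr1.
have cosp : `|\sum_i mu i * (cos (b i) - 1) + (\sum_i mu i * b i ^+ 2) / 2| <= K%:R * (L * T) * c ^+ 4 / sn.
  rewrite mulr_suml -big_split/=.
  apply: (le_trans (sumc _ (L * T * (c / sn) ^+ 4) _)) => [i|].
    rewrite (_ : _ + _ = mu i * (cos (b i) - 1 + b i ^+ 2 / 2)); last by ring.
    rewrite normrM (ger0_norm (mu0 i)) ler_pM// (le_trans (cosB_bound _))//.
    rewrite -[b i ^+ 4]ger0_norm; last by rewrite (_ : b i ^+ 4 = (b i ^+ 2) ^+ 2) ?sqr_ge0// -exprM.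
    by rewrite normrX lerXn2r ?nnegrE.
  apply: le_trans _ (n_sn (K%:R * (L * T) * c ^+ 4) _); last by rewrite mulr_ge0 ?exprn_ge0// mulr_ge0.
  rewrite (_ : K%:R * n%:R * _ = K%:R * (L * T) * c ^+ 4 * (n%:R / (sn * sn)) / (sn * sn)); last first.
    by field; rewrite gt_eqF.
  by rewrite snsn divff ?gt_eqF// mulr1.
have qp : `|\sum_i mu i * b i ^+ 2 - q| <= 2 * (K%:R * (L * T) * T * c ^+ 2 / sn).
  have cf k : continuous (f k) by exact: is_derive_continuous (fD k).
  have cfl k : continuous (fun t => f k t ^+ 2 * lam k t).
    apply: continuousM => //; under eq_fun do rewrite expr2; exact: continuousM.
  have qE : q = \sum_(i : 'I_K * 'I_n) \int[@lebesgue_measure R]_(t in `[g i.2, g i.2.+1])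
      (f i.1 t ^+ 2 * lam i.1 t).
    rewrite -(pair_bigA _ (fun k (j : 'I_n) => \int[@lebesgue_measure R]_(t in `[g j, g j.+1])
      (f k t ^+ 2 * lam k t)))/=; apply: eq_bigr => k _.
    exact: Rintegral_grid.
  rewrite qE -sumrB.
  apply: (le_trans (sumc _ (2 * c ^+ 2 * (T / n%:R) * L * (T / n%:R)) _)) => [i|].
    have [h1 h2 h3] := gg i.2.
    have -> : mu i * b i ^+ 2 = \int[@lebesgue_measure R]_(t in `[g i.2, g i.2.+1])
       (f i.1 (g i.2) ^+ 2 * lam i.1 t).
      rewrite (Rintegral_itv_scale _ _ _ (@clam i.1)).
      rewrite -cum_diff// /mu /b exprMn exprVn [sn ^+ 2]expr2 snsn; field.
      by rewrite gt_eqF.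
    have i1 : (@lebesgue_measure R).-integrable `[g i.2, g i.2.+1]
        (EFin \o (fun t => f i.1 (g i.2) ^+ 2 * lam i.1 t)).
      apply: continuous_itv_integrable; apply: continuousM; [exact: continuousC|exact: clam].
    rewrite -RintegralB//; last exact: continuous_itv_integrable.
    rewrite -[X in _ * X](grid_step T n0 i.2).
    apply: Rintegral_itv_bound => //.
      apply: measurable_funTS; apply: continuous_measurable_fun.
      apply: continuousD; last by apply: continuousN; exact: cfl.
      by apply: continuousM; [exact: continuousC|exact: clam].
    move=> t /andP[gt tg].
    have tT : 0 <= t <= T by rewrite (le_trans h1 gt) (le_trans tg h3).
    have giT : 0 <= g i.2 <= T by apply: gT; exact: ltnW.
    rewrite -mulrBl normrM [`|lam _ _|]ger0_norm// ler_pM//; last exact: lamL.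
    rewrite subr_sqr normrM.
    have d1 : `|f i.1 (g i.2) - f i.1 t| <= c * (T / n%:R).
      have tT' : t <= T by case/andP: tT.
      rewrite distrC (le_trans (f_lip (fD i.1) (@cf' i.1) (f'c i.1) h1 gt tT'))//.
      by rewrite ler_wpM2l// -(grid_step T n0 i.2) lerD2r.
    have d2 : `|f i.1 (g i.2) + f i.1 t| <= 2 * c.
      by rewrite (le_trans (ler_normD _ _))// mulr2n mulrDl mul1r lerD// fc.
    rewrite (_ : 2 * c ^+ 2 * _ = (c * (T / n%:R)) * (2 * c)); last by ring.
    exact: ler_pM.
  rewrite (_ : K%:R * n%:R * _ = 2 * (K%:R * (L * T) * T * c ^+ 2 / n%:R)); last first.
    by field; rewrite gt_eqF.
  rewrite ler_wpM2l// n_sn// !mulr_ge0 ?exprn_ge0// ltW//.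
have q0 : 0 <= q.
  by apply: sumr_ge0 => k _; apply: Rintegral_ge0 => t _; rewrite mulr_ge0 ?sqr_ge0.
set A := \sum_i mu i * (cos (b i) - 1) in cosp *.
set Q2 := \sum_i mu i * b i ^+ 2 in cosp qp.
set S := \sum_i mu i * (sin (b i) - b i) in sinp *.
have A0 : A <= 0.
  by apply: sumr_le0 => i _; rewrite mulr_ge0_le0// subr_le0 cos_le1.
have e1 : `|expR A - expR (- (q / 2))| <= `|A + q / 2|.
  have := @expR_lip R (- A) (q / 2); rewrite opprK -opprD normrN oppr_ge0; apply => //.
  by rewrite divr_ge0.
have e2 := cos_lip (beta + S) beta.
have e3 : `|expR A * cos (beta + S) - expR (- (q / 2)) * cos beta| <= `|A + q / 2| + `|S|.
  rewrite (_ : _ - _ = (expR A - expR (- (q / 2))) * cos (beta + S) +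
     expR (- (q / 2)) * (cos (beta + S) - cos beta)); last by ring.
  rewrite (le_trans (ler_normD _ _))// !normrM lerD//.
    rewrite -[leRHS]mulr1 ler_pM// ler_norml cos_geN1 cos_le1//.
  rewrite -[leRHS]mul1r ler_pM//.
    by rewrite ger0_norm ?expR_ge0// -expR0 ler_expR oppr_le0 divr_ge0.
  by rewrite (le_trans e2)// addrAC subrr add0r.
apply: (le_trans e3).
have e4 : `|A + q / 2| <= `|A + Q2 / 2| + `|Q2 - q| / 2.
  rewrite (_ : A + q / 2 = (A + Q2 / 2) - (Q2 - q) / 2); last by ring.
  by rewrite (le_trans (ler_normB _ _))// lerD2l normrM [`|2^-1|]ger0_norm.
have KL : 0 <= K%:R * (L * T) / sn by rewrite divr_ge0 ?mulr_ge0// ltW.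
have c3 : c ^+ 3 <= (1 + c) ^+ 4.
  rewrite (le_trans (_ : _ <= (1 + c) ^+ 3))//; first by rewrite lerXn2r ?nnegrE ?addr_ge0// lerDr.
  by rewrite ler_weXn2l// lerDl.
have c4 : c ^+ 4 <= (1 + c) ^+ 4 by rewrite lerXn2r ?nnegrE ?addr_ge0// lerDr.
have c2 : c ^+ 2 <= (1 + c) ^+ 4.
  rewrite (le_trans (_ : _ <= (1 + c) ^+ 2))//; first by rewrite lerXn2r ?nnegrE ?addr_ge0// lerDr.
  by rewrite ler_weXn2l// lerDl.
have h3 := ler_wpM2l KL c3; have h4 := ler_wpM2l KL c4.
have h2 := ler_wpM2l (mulr_ge0 KL (ltW T0)) c2.
lra.
Qed.

End observed.

(** * Families that are smooth in the parameter *)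

(** Only x is taken in the compact set, at whose points f is continuous; y may lie outside. *)
Lemma compact_unif (R : realType) (V : normedModType R) (K : set V) (f : V -> R) :
  compact K -> (forall x, K x -> {for x, continuous f}) -> forall e, 0 < e ->
  exists2 del, 0 < del & forall x y, K x -> `|x - y| < del -> `|f x - f y| <= e.
Proof.
move=> cK cf e e0; move: cK => /compact_near_coveringP nK.
pose P (del : R) (x : V) := forall y, `|x - y| < del -> `|f x - f y| <= e.
have h : \forall del \near 0^'+, K `<=` P del.
  apply: nK => x Kx.
  have e2 : 0 < e / 2 by rewrite divr_gt0.
  have /cvgrPdist_lt/(_ _ e2)/nbhs_ballP[d0 /= d00 dx] := cf x Kx.
  near=> z del => y zy.
  have xz : ball x (d0 / 2) z by near: z; apply: nbhsx_ballx; rewrite divr_gt0.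
  have ed : del <= d0 / 2.
    by near: del; apply: nbhs_right_le; rewrite divr_gt0.
  have xz' : `|x - z| < d0 / 2 by move: xz; rewrite -ball_normE.
  have h1 : `|f x - f z| < e / 2.
    by apply: dx; rewrite -ball_normE/= (lt_trans xz')// ltr_pdivrMr// ltr_pMr// ltr1n.
  have h2 : `|f x - f y| < e / 2.
    apply: dx; rewrite -ball_normE/= -(subrK z x) -addrA.
    rewrite (le_lt_trans (ler_normD _ _))// [ltRHS]splitr ltrD//.
    exact: lt_le_trans zy ed.
  rewrite (_ : f z - f y = (f x - f y) - (f x - f z)); last by ring.
  rewrite (le_trans (ler_normB _ _))// [leRHS]splitr lerD// ltW//.
near (0 : R)^'+ => del; exists del; first by near: del; exact: nbhs_right_gt.
move=> x y Kx; have : K `<=` P del by near: del.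
by move=> /(_ x Kx); exact.
Unshelve. all: by end_near.
Qed.

Lemma compact_lower_bound (R : realType) (V : normedModType R) (K : set V) (f : V -> R) :
  compact K -> (forall x, K x -> {for x, continuous f}) -> (forall x, K x -> 0 < f x) ->
  exists2 rho, 0 < rho & forall x, K x -> rho <= f x.
Proof.
move=> /compact_near_coveringP nK cf f0.
have h : \forall rho \near 0^'+, K `<=` (fun x => rho <= f x).
  apply: nK => x Kx.
  have f2 : 0 < f x / 2 by rewrite divr_gt0// f0.
  have /cvgrPdist_lt/(_ _ f2) dx := cf x Kx.
  near=> z del.
  have e1 : `|f x - f z| < f x / 2 by near: z.
  have e2 : del <= f x / 2 by near: del; exact: nbhs_right_le.
  by move: e1; rewrite ltr_norml /= => /andP[_]; lra.
near (0 : R)^'+ => del; exists del; first by near: del; exact: nbhs_right_gt.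
by near: del.
Unshelve. all: by end_near.
Qed.

(** * Euclidean norm and functions of class C^1 *)

Section euclid.
Context {R : realType} {n : nat}.
Implicit Types x y h : 'rV[R]_n.+1.

Lemma enorm_ge0 x : 0 <= enorm x. Proof. exact: sqrtr_ge0. Qed.

Lemma enorm0_eq0 x : enorm x = 0 -> x = 0.
Proof.
move=> x0; apply/eqP; rewrite -normr_le0 -x0; exact: norm_le_enorm.
Qed.

Lemma enormN x : enorm (- x) = enorm x.
Proof. by rewrite /enorm; congr Num.sqrt; apply: eq_bigr => i _; rewrite mxE sqrrN. Qed.

Lemma cauchy_schwarz x y : `|dotv x y| <= enorm x * enorm y.
Proof.
wlog xy0 : x / 0 <= dotv x y => [h|].
  have [/h//|xy0] := leP 0 (dotv x y).
  by have := h (- x); rewrite dotvNl oppr_ge0 normrN enormN; apply; exact: ltW.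
rewrite ger0_norm//; set a := enorm x; set b := enorm y.
have dot0 (z : 'rV[R]_n.+1) : dotv 0 z = 0 by rewrite /dotv mul0mx mxE.
have [/enorm0_eq0 ->|a0] := eqVneq a 0; first by rewrite dot0 mulr_ge0 ?enorm_ge0.
have [/enorm0_eq0 ->|b0] := eqVneq b 0; first by rewrite dotvC dot0 mulr_ge0 ?enorm_ge0.
have ap : 0 < a by rewrite lt_def a0 enorm_ge0.
have bp : 0 < b by rewrite lt_def b0 enorm_ge0.
have h : 0 <= dotv (b *: x - a *: y) (b *: x - a *: y) by rewrite -enorm_sq sqr_ge0.
have e : dotv (b *: x - a *: y) (b *: x - a *: y) = 2 * (a * b) * (a * b - dotv x y).
  rewrite dotvDl dotvNl !dotvDr !dotvNr !dotvZl !dotvZr -!enorm_sq -/a -/b (dotvC y x); ring.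
by rewrite e pmulr_rge0 ?mulr_gt0// subr_ge0 in h.
Qed.

Lemma enorm_triangle x y : enorm (x + y) <= enorm x + enorm y.
Proof.
rewrite -(@ler_pXn2r _ 2)// ?nnegrE ?addr_ge0 ?enorm_ge0// enorm_sq dotvDl !dotvDr -!enorm_sq.
by have := le_trans (ler_norm _) (cauchy_schwarz x y); rewrite (dotvC y x) sqrrD; lra.
Qed.

Lemma enorm_lip x y : `|enorm x - enorm y| <= enorm (x - y).
Proof.
have h1 := enorm_triangle (x - y) y; have h2 := enorm_triangle (y - x) x.
have e : enorm (y - x) = enorm (x - y) by rewrite -enormN opprB.
rewrite subrK in h1; rewrite subrK e in h2.
by rewrite ler_norml; apply/andP; split; lra.
Qed.

(** After multiplication by |x|: Cauchy-Schwarz for x and x + h gives the lower bound, and 2 |x| |x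
    + h| <= |x|^2 + |x + h|^2 the upper one. *)
Lemma enorm_expansion x h : x != 0 ->
  `|enorm (x + h) - enorm x - dotv x h / enorm x| <= enorm h ^+ 2 / enorm x.
Proof.
move=> x0; set r := enorm x.
have r0 : 0 < r.
  by rewrite lt_def enorm_ge0 andbT; apply: contraNneq x0 => /enorm0_eq0 ->.
have xh : dotv x (x + h) = r ^+ 2 + dotv x h by rewrite dotvDr -enorm_sq.
have e2 : enorm (x + h) ^+ 2 = r ^+ 2 + 2 * dotv x h + enorm h ^+ 2.
  by rewrite enorm_sq dotvDl !dotvDr -!enorm_sq (dotvC h x) -/r; ring.
have cs := le_trans (ler_norm _) (cauchy_schwarz x (x + h)).
rewrite xh -/r in cs.
have -> : enorm (x + h) - r - dotv x h / r = (r * enorm (x + h) - r ^+ 2 - dotv x h) / r.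
  by field; rewrite gt_eqF.
rewrite normrM [`|r^-1|]ger0_norm ?invr_ge0 ?(ltW r0)// ler_wpM2r ?invr_ge0 ?(ltW r0)//.
have am : 0 <= (enorm (x + h) - r) ^+ 2 by exact: sqr_ge0.
have eh : 0 <= enorm h ^+ 2 by exact: sqr_ge0.
rewrite sqrrB e2 in am.
by rewrite ler_norml; apply/andP; split; nra.
Qed.

End euclid.

Section real_C1.
Context {R : realType}.

Lemma derive_norm_le (f f' : R -> R) (a b M : R) : a <= b ->
  (forall y, a <= y -> y <= b -> is_derive y 1 f (f' y)) ->
  (forall y, a <= y -> y <= b -> `|f' y| <= M) -> `|f b - f a| <= M * (b - a).
Proof.
move=> ab fD fM.
have D1 (y : R) : a <= y -> y <= b -> is_derive y 1 (fun y => M * y - f y) ((0 * y + M * 1) - f' y).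
  by move=> ay yb; exact: Dadd (Dmul (Dcst y M) (Did y)) (Dopp (fD y ay yb)).
have P1 (y : R) : a <= y -> y <= b -> 0 <= (0 * y + M * 1) - f' y.
  by move=> ay yb; have := fM y ay yb; rewrite ler_norml => /andP[]; lra.
have D2 (y : R) : a <= y -> y <= b -> is_derive y 1 (fun y => M * y + f y) ((0 * y + M * 1) + f' y).
  by move=> ay yb; exact: Dadd (Dmul (Dcst y M) (Did y)) (fD y ay yb).
have P2 (y : R) : a <= y -> y <= b -> 0 <= (0 * y + M * 1) + f' y.
  by move=> ay yb; have := fM y ay yb; rewrite ler_norml => /andP[]; lra.
have h1 := derive_ge0_le ab D1 P1; have h2 := derive_ge0_le ab D2 P2.
by rewrite ler_norml; apply/andP; split; lra.
Qed.

(* The derivative is only required to the right of [lo]: this covers functions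
   such as ln and the inverse. *)
Definition C1_from (lo : R) (phi phi' : R -> R) :=
  forall x, lo <= x -> is_derive x 1 phi (phi' x) /\ {for x, continuous phi'}.

Lemma C1_bounded lo b phi phi' : C1_from lo phi phi' ->
  exists2 M, 0 <= M & forall x, lo <= x <= b -> `|phi' x| <= M.
Proof.
move=> C1; have [lb|bl] := leP lo b; last first.
  by exists 0 => // t /andP[at_ tb]; have := le_trans at_ tb; rewrite leNgt bl.
have cnf : {within `[lo, b], continuous (fun t => `|phi' t|)}.
  apply: continuous_in_subspaceT => t; rewrite inE/= in_itv/= => /andP[lt _].
  by apply: cvg_norm; exact: (C1 t lt).2.
have [c _ cmax] := EVT_max lb cnf; by exists `|phi' c|.
Qed.

Lemma C1_lip lo b phi phi' : C1_from lo phi phi' ->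
  exists2 M, 0 <= M & forall x y, lo <= x <= b -> lo <= y <= b -> `|phi x - phi y| <= M * `|x - y|.
Proof.
move=> C1; have [M M0 phiM] := C1_bounded b C1; exists M => // x y.
wlog xy : x y / y <= x => [h hx hy|/andP[lx xb] /andP[ly yb]].
  have [/h|/ltW/h] := leP y x; first exact.
  by rewrite distrC [X in M * X]distrC; exact.
rewrite [X in M * X]ger0_norm ?subr_ge0//; apply: (derive_norm_le xy) => z yz zx.
  exact: (C1 z (le_trans ly yz)).1.
by apply: phiM; rewrite (le_trans ly yz) (le_trans zx xb).
Qed.

Lemma C1_expansion lo b phi phi' : C1_from lo phi phi' -> forall e, 0 < e ->
  exists2 del, 0 < del & forall x y, lo <= x <= b -> lo <= y <= b -> `|x - y| < del ->
    `|phi y - phi x - phi' x * (y - x)| <= e * `|y - x|.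
Proof.
move=> C1 e e0.
have [||del d0 dP] := @compact_unif R R^o `[lo, b] phi' _ _ e e0.
- exact: segment_compact.
- by move=> x /=; rewrite in_itv/= => /andP[lx _]; exact: (C1 x lx).2.
exists del => // x y /andP[lx xb] /andP[ly yb] xyd.
have key (u v : R) : lo <= u -> v <= b -> u <= v -> (forall z, u <= z -> z <= v -> `|x - z| < del) ->
    `|phi v - phi u - phi' x * (v - u)| <= e * `|v - u|.
  move=> lu vb uv xz.
  have D (z : R) : u <= z -> z <= v ->
      is_derive z 1 (fun z => phi z - phi' x * z) (phi' z - (0 * z + phi' x * 1)).
    move=> uz zv; apply: Dadd; first exact: (C1 z (le_trans lu uz)).1.
    exact: Dopp (Dmul (Dcst z _) (Did z)).
  have Pb (z : R) : u <= z -> z <= v -> `|phi' z - (0 * z + phi' x * 1)| <= e.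
    move=> uz zv; rewrite mul0r add0r mulr1 distrC; apply: dP; last exact: xz.
    rewrite /= in_itv/= lx xb//.
  rewrite (_ : `|v - u| = v - u); last by rewrite ger0_norm// subr_ge0.
  have := derive_norm_le uv D Pb.
  by rewrite (_ : phi v - phi' x * v - (phi u - phi' x * u) = phi v - phi u - phi' x * (v - u)); last by ring.
have [xy|/ltW yx] := leP x y.
  apply: key => // z xz zy; rewrite distrC ger0_norm ?subr_ge0//.
  by move: xyd; rewrite distrC ger0_norm ?subr_ge0//; lra.
have h := key y x ly xb yx.
rewrite (_ : phi y - phi x - phi' x * (y - x) = - (phi x - phi y - phi' x * (x - y))); last by ring.
rewrite normrN [X in e * X]distrC.
apply: h => z yz zx; rewrite ger0_norm ?subr_ge0//.
by move: xyd; rewrite ger0_norm ?subr_ge0//; lra.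
Qed.

Lemma C1_inv (lo : R) : 0 < lo -> C1_from lo (fun x => x^-1) (fun x => - (x ^+ 2)^-1).
Proof.
move=> lo0 x lx; have x0 : x != 0 by rewrite gt_eqF// (lt_le_trans lo0).
split.
  by apply: (Deq (is_deriveV x0 (Did x))); rewrite /GRing.scale/= mulr1.
apply: cvgN; apply: cvgV; first by rewrite expf_neq0.
exact: exprn_continuous.
Qed.

Lemma C1_ln (lo : R) : 0 < lo -> C1_from lo (@ln R) (fun x => x^-1).
Proof.
move=> lo0 x lx; have x0 : 0 < x by exact: lt_le_trans lo0 lx.
by split; [exact: is_derive1_ln|apply: cvgV; [rewrite gt_eqF|exact: cvg_id]].
Qed.

End real_C1.

(** * Lipschitz and differentiable families in the parameter *)

Section families.
Context {R : realType}.
Variables (T B : R) (KK : set 'rV[R]_4).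
Hypothesis KB : forall th, KK th -> `|th| + 1 <= B.
Implicit Types (F G : 'rV[R]_4 -> R -> R) (A : 'rV[R]_4 -> R -> 'rV[R]_4).

(** On the whole ball of radius B, positions of the detectors included: a distance is Lipschitz
    everywhere, and only [diff] has to stay away from its singularity. *)
Definition lipf F := exists2 C, 0 <= C & forall th th' t, `|th| <= B -> `|th'| <= B -> 0 <= t <= T ->
  `|F th t| <= C /\ `|F th t - F th' t| <= C * `|th - th'|.

Lemma lipf_add F G : lipf F -> lipf G -> lipf (fun th t => F th t + G th t).
Proof.
move=> [C C0 CF] [D D0 DG]; exists (C + D); first exact: addr_ge0.
move=> th th' t h1 h2 h3; have [a1 a2] := CF _ _ _ h1 h2 h3; have [b1 b2] := DG _ _ _ h1 h2 h3.
split; first by rewrite (le_trans (ler_normD _ _))// lerD.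
rewrite (_ : _ - _ = (F th t - F th' t) + (G th t - G th' t)); last by ring.
by rewrite (le_trans (ler_normD _ _))// mulrDl lerD.
Qed.

Lemma lipf_cst (c : R -> R) M : (forall t, 0 <= t <= T -> `|c t| <= M) -> lipf (fun _ t => c t).
Proof.
move=> cM; exists `|M| => // th th' t _ _ tT; split; first by rewrite (le_trans (cM t tT))// ler_norm.
by rewrite subrr normr0 mulr_ge0.
Qed.

Lemma lipf_mul F G : lipf F -> lipf G -> lipf (fun th t => F th t * G th t).
Proof.
move=> [C C0 CF] [D D0 DG]; exists (2 * C * D + C * D).
  by rewrite addr_ge0 ?mulr_ge0.
move=> th th' t h1 h2 h3; have [a1 a2] := CF _ _ _ h1 h2 h3; have [b1 b2] := DG _ _ _ h1 h2 h3.
have [_ _] := CF _ _ _ h2 h1 h3; have [a3 _] := CF _ _ _ h2 h1 h3.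
split.
  rewrite normrM (le_trans (ler_pM _ _ a1 b1))//.
  by rewrite lerDr !mulr_ge0.
rewrite (_ : _ - _ = (F th t - F th' t) * G th t + F th' t * (G th t - G th' t)); last by ring.
rewrite (le_trans (ler_normD _ _))// !normrM.
have x0 : 0 <= `|th - th'| by [].
have e1 := ler_pM (normr_ge0 _) (normr_ge0 _) a2 b1.
have e2 := ler_pM (normr_ge0 _) (normr_ge0 _) a3 b2.
have CD : 0 <= C * D * `|th - th'| by rewrite !mulr_ge0.
lra.
Qed.

Lemma lipf_comp F phi phi' lo : C1_from lo phi phi' ->
  (forall th t, `|th| <= B -> 0 <= t <= T -> lo <= F th t) ->
  lipf F -> lipf (fun th t => phi (F th t)).
Proof.
move=> C1 Flo [C C0 CF].
have [M M0 phiM] := C1_lip C C1.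
pose x0 := lo.
exists (M * C + `|phi lo| + M * (C + `|lo|)).
  by rewrite !addr_ge0 ?mulr_ge0 ?addr_ge0.
move=> th th' t h1 h2 h3; have [a1 a2] := CF _ _ _ h1 h2 h3; have [a3 _] := CF _ _ _ h2 h1 h3.
have r1 : lo <= F th t <= C by rewrite Flo//= (le_trans (ler_norm _) a1).
have r2 : lo <= F th' t <= C by rewrite Flo//= (le_trans (ler_norm _) a3).
have r0 : lo <= lo <= C by have /andP[x1 x2] := r1; rewrite lexx (le_trans x1 x2).
split.
  have h := phiM _ _ r1 r0.
  have : `|phi (F th t)| <= `|phi (F th t) - phi lo| + `|phi lo|.
    by rewrite -{1}(subrK (phi lo) (phi (F th t))) ler_normD.
  have h5 : `|F th t - lo| <= C + `|lo| by rewrite (le_trans (ler_normB _ _))// lerD2r.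
  have := ler_wpM2l M0 h5; have : 0 <= M * C by rewrite mulr_ge0.
  lra.
rewrite (le_trans (phiM _ _ r1 r2))//.
have := ler_wpM2l M0 a2; have x1 : 0 <= `|th - th'| by [].
have : 0 <= (`|phi lo| + M * (C + `|lo|)) * `|th - th'| by rewrite mulr_ge0 ?addr_ge0 ?mulr_ge0 ?addr_ge0.
lra.
Qed.

(** Differentiability uniform in t and in the base point. The base point stays in [KK], which keeps
    it off the detectors; [th + h] is free, and by [KB] lies in the ball of [lipf] when |h| <= 1. *)
Definition diff F A :=
  (exists2 C, 0 <= C & forall th t, KK th -> 0 <= t <= T -> `|A th t| <= C) /\
  forall e, 0 < e -> exists2 del, 0 < del & forall th t h, KK th -> 0 <= t <= T -> `|h| <= del ->
    `|F (th + h) t - F th t - dotv (A th t) h| <= e * `|h|.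

Lemma diff_add F G A A' : diff F A -> diff G A' ->
  diff (fun th t => F th t + G th t) (fun th t => A th t + A' th t).
Proof.
move=> [[C C0 CA] FA] [[D D0 DA] GA]; split.
  exists (C + D); first exact: addr_ge0.
  by move=> th t Kt tT; rewrite (le_trans (ler_normD _ _))// lerD// ?CA ?DA.
move=> e e0; have e2 : 0 < e / 2 by rewrite divr_gt0.
have [d1 d10 P1] := FA _ e2; have [d2 d20 P2] := GA _ e2.
exists (Num.min d1 d2); first by rewrite lt_min d10.
move=> th t h Kt tT; rewrite le_min => /andP[hd1 hd2].
rewrite dotvDl (_ : _ - _ - _ = (F (th + h) t - F th t - dotv (A th t) h) +
  (G (th + h) t - G th t - dotv (A' th t) h)); last by ring.
rewrite (le_trans (ler_normD _ _))// [e]splitr mulrDl lerD//; [exact: P1|exact: P2].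
Qed.

Lemma diff_cst (c : R -> R) : diff (fun _ t => c t) (fun _ _ => 0).
Proof.
split; first by exists 0 => // th t _ _; rewrite normr0.
move=> e e0; exists 1 => // th t h _ _ _.
by rewrite subrr /dotv mul0mx mxE subr0 normr0 mulr_ge0// ltW.
Qed.

Lemma ball_in th h : KK th -> `|h| <= 1 -> `|th + h| <= B.
Proof. by move=> Kt h1; rewrite (le_trans _ (KB Kt))// (le_trans (ler_normD _ _))// lerD2l. Qed.

Lemma in_ball th : KK th -> `|th| <= B.
Proof. by move=> Kt; rewrite (le_trans _ (KB Kt))// lerDl. Qed.

Lemma diff_mul F G A A' : lipf F -> lipf G -> diff F A -> diff G A' ->
  diff (fun th t => F th t * G th t) (fun th t => G th t *: A th t + F th t *: A' th t).
Proof.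
move=> [MF MF0 lF] [MG MG0 lG] [[C C0 CA] FA] [[D D0 DA] GA]; split.
  exists (MG * C + MF * D); first by rewrite addr_ge0 ?mulr_ge0.
  move=> th t Kt tT; have b := in_ball Kt.
  have [f1 _] := lF _ _ _ b b tT; have [g1 _] := lG _ _ _ b b tT.
  by rewrite (le_trans (ler_normD _ _))// !normrZ lerD// ler_pM// ?CA ?DA.
(* [e1] pays for the two first-order remainders, [d3] for the product of the two increments. *)
move=> e e0; pose e1 := e / (2 * (MF + MG + 1)).
have S0 : 0 < MF + MG + 1 by rewrite ltr_wpDl// addr_ge0.
have e10 : 0 < e1 by rewrite divr_gt0// mulr_gt0.
have [d1 d10 P1] := FA _ e10; have [d2 d20 P2] := GA _ e10.
pose d3 := e / (2 * (MF * MG + 1)).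
have Q0 : 0 < MF * MG + 1 by rewrite ltr_wpDl// mulr_ge0.
have d30 : 0 < d3 by rewrite divr_gt0// mulr_gt0.
exists (Num.min (Num.min d1 d2) (Num.min d3 1)); first by rewrite !lt_min d10 d20 d30 ltr01.
move=> th t h Kt tT; rewrite !le_min => /andP[/andP[hd1 hd2] /andP[hd3 h1]].
have b := in_ball Kt; have b' := ball_in Kt h1.
have [f1 f2] := lF _ _ _ b b' tT; have [g1 g2] := lG _ _ _ b b' tT.
have eh : `|th - (th + h)| = `|h| by rewrite opprD addrA subrr sub0r normrN.
rewrite distrC eh in f2; rewrite distrC eh in g2.
have p1 := P1 th t h Kt tT hd1; have p2 := P2 th t h Kt tT hd2.
rewrite dotvDl !dotvZl.
rewrite (_ : _ - _ - _ = (F (th + h) t - F th t - dotv (A th t) h) * G th t +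
  F th t * (G (th + h) t - G th t - dotv (A' th t) h) +
  (F (th + h) t - F th t) * (G (th + h) t - G th t)); last by ring.
have h0 : 0 <= `|h| by [].
have t1 : `|(F (th + h) t - F th t - dotv (A th t) h) * G th t| <= e1 * `|h| * MG.
  by rewrite normrM ler_pM.
have t2 : `|F th t * (G (th + h) t - G th t - dotv (A' th t) h)| <= MF * (e1 * `|h|).
  by rewrite normrM ler_pM.
have t3 : `|(F (th + h) t - F th t) * (G (th + h) t - G th t)| <= (MF * d3) * (MG * `|h|).
  rewrite normrM ler_pM// (le_trans f2)// ler_wpM2l//.
rewrite (le_trans (ler_normD _ _))//.
apply: (@le_trans _ _ (e1 * `|h| * MG + MF * (e1 * `|h|) + (MF * d3) * (MG * `|h|))).
  by rewrite lerD// (le_trans (ler_normD _ _))// lerD.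
have a1 : e1 * (MF + MG) <= e / 2.
  have -> : e / 2 = e1 * (MF + MG + 1) by rewrite /e1; field; rewrite gt_eqF.
  by rewrite ler_wpM2l ?(ltW e10)// lerDl.
have a2 : d3 * (MF * MG) <= e / 2.
  have -> : e / 2 = d3 * (MF * MG + 1) by rewrite /d3; field; rewrite gt_eqF.
  by rewrite ler_wpM2l ?(ltW d30)// lerDl.
move: (ler_wpM2r h0 a1) (ler_wpM2r h0 a2) t1; clear; lra.
Qed.

Lemma diff_comp F A phi phi' lo : C1_from lo phi phi' ->
  (forall th t, `|th| <= B -> 0 <= t <= T -> lo <= F th t) ->
  lipf F -> diff F A ->
  diff (fun th t => phi (F th t)) (fun th t => phi' (F th t) *: A th t).
Proof.
move=> C1 Flo [MF MF0 lF] [[C C0 CA] FA].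
have [M M0 phiM] := C1_bounded MF C1.
have rng th t : `|th| <= B -> 0 <= t <= T -> lo <= F th t <= MF.
  move=> b tT; have [f1 _] := lF _ _ _ b b tT.
  by rewrite Flo//= (le_trans (ler_norm _) f1).
split.
  exists (M * C); first exact: mulr_ge0.
  move=> th t Kt tT; rewrite normrZ ler_pM// ?CA// phiM// rng// in_ball//.
move=> e e0; pose e1 := e / (2 * (MF + 1)); pose e2 := e / (2 * (M + 1)).
have S0 : 0 < MF + 1 by rewrite ltr_wpDl.
have S1 : 0 < M + 1 by rewrite ltr_wpDl.
have e10 : 0 < e1 by rewrite divr_gt0// mulr_gt0.
have e20 : 0 < e2 by rewrite divr_gt0// mulr_gt0.
have [d1 d10 P1] := FA _ e20; have [d2 d20 P2] := C1_expansion MF C1 e10.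
pose d3 := d2 / (2 * (MF + 1)).
have d30 : 0 < d3 by rewrite divr_gt0// mulr_gt0.
exists (Num.min (Num.min d1 1) d3); first by rewrite !lt_min d10 d30 ltr01.
move=> th t h Kt tT; rewrite !le_min => /andP[/andP[hd1 h1] hd3].
have b := in_ball Kt; have b' := ball_in Kt h1.
have [f1 f2] := lF _ _ _ b' b tT.
rewrite [th + h]addrC addrK [h + th]addrC in f2.
have h0 : 0 <= `|h| by [].
have fd : `|F th t - F (th + h) t| < d2.
  rewrite distrC (le_lt_trans f2)// (@le_lt_trans _ _ ((MF + 1) * d3))//.
    by rewrite ler_pM// lerDl.
  rewrite (_ : (MF + 1) * d3 = d2 / 2); last by rewrite /d3; field; rewrite gt_eqF.
  by rewrite ltr_pdivrMr// ltr_pMr// ltr1n.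
have p2 := P2 _ _ (rng _ _ b tT) (rng _ _ b' tT) fd.
have p1 := P1 th t h Kt tT hd1.
rewrite dotvZl.
set y := F (th + h) t in p1 p2 f2 *; set x := F th t in p1 p2 f2 *.
rewrite (_ : _ - _ - _ = (phi y - phi x - phi' x * (y - x)) + phi' x * (y - x - dotv (A th t) h)); last by ring.
rewrite (le_trans (ler_normD _ _))//.
have t2 : `|phi' x * (y - x - dotv (A th t) h)| <= M * (e2 * `|h|).
  by rewrite normrM ler_pM// phiM// rng.
have t1 : e1 * `|y - x| <= e1 * (MF * `|h|) by rewrite ler_wpM2l// ltW.
have a1 : e1 * MF <= e / 2.
  have -> : e / 2 = e1 * (MF + 1) by rewrite /e1; field; rewrite gt_eqF.
  by rewrite ler_wpM2l ?(ltW e10)// lerDl.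
have a2 : e2 * M <= e / 2.
  have -> : e / 2 = e2 * (M + 1) by rewrite /e2; field; rewrite gt_eqF.
  by rewrite ler_wpM2l ?(ltW e20)// lerDl.
move: (ler_wpM2r h0 a1) (ler_wpM2r h0 a2) t1 t2 p2; clear; lra.
Qed.

Lemma diff_eqA F A A' : (forall th t, KK th -> A th t = A' th t) -> diff F A -> diff F A'.
Proof.
move=> e [[C C0 CA] FA]; split; first by exists C => // th t Kt tT; rewrite -e// CA.
move=> ep ep0; have [d d0 P] := FA ep ep0; exists d => // th t h Kt tT hd.
by rewrite -e//; exact: P.
Qed.

End families.

(** * Intensities and scores of the network *)

Lemma le_coord_norm (R : realType) n (x : 'rV[R]_n.+1) (c : R) : (forall i, `|x ord0 i| <= c) -> `|x| <= c.
Proof.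
move=> h; rewrite [`|x|]mx_normrE; apply/bigmax_leP; split=> [|[i j] _ /=].
  exact: le_trans (normr_ge0 _) (h ord0).
by rewrite (ord1 i).
Qed.

Lemma enorm_le_norm (R : realType) n (x : 'rV[R]_n.+1) : enorm x <= n.+1%:R * `|x|.
Proof.
rewrite -(@ler_pXn2r _ 2)// ?nnegrE ?enorm_ge0 ?mulr_ge0// enorm_sq.
rewrite (le_trans (le_trans (ler_norm _) (dotv_bound x x)))// exprMn expr2 ler_wpM2r ?mulr_ge0//.
by rewrite ler_peMl// ler1n.
Qed.

Lemma lip_continuous (R : realType) (V : normedModType R) (f : V -> R) (C : R) : 0 < C ->
  (forall x y, `|f x - f y| <= C * `|x - y|) -> continuous f.
Proof.
move=> C0 fl x; apply/cvgrPdist_le => e e0.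
have eC : 0 < e / C by rewrite divr_gt0.
have h : \forall y \near x, `|x - y| < e / C by exact: (@cvgr_dist_lt _ _ _ (nbhs x) _ id x cvg_id _ eC).
apply: filterS h => y h; by rewrite (le_trans (fl _ _))// mulrC -ler_pdivlMr// ltW.
Qed.

Lemma Dbigsum (R : realType) m (F F' : 'I_m -> R -> R) (t : R) :
  (forall i, is_derive t 1 (F i) (F' i t)) ->
  is_derive t 1 (fun u => \sum_(i < m) F i u) (\sum_(i < m) F' i t).
Proof.
move=> D; rewrite (_ : (fun u => _) = \sum_(i < m) F i); first exact: is_derive_sum.
by apply/funext => u; rewrite fct_sumE.
Qed.

Section source.
Context {R : realType}.
Implicit Types (h th : 'rV[R]_4) (y : 'rV[R]_2).

Definition extend (i : 'I_2) y : 'rV[R]_4 :=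
  if i == ord0 then row_mx y 0 : 'rV[R]_(2 + 2) else row_mx 0 y : 'rV[R]_(2 + 2).

Lemma sourceD th h i : source (th + h) i = source th i + source h i.
Proof. by rewrite /source; case: ifP => _; rewrite linearD. Qed.

Lemma sourceN h i : source (- h) i = - source h i.
Proof. by rewrite /source; case: ifP => _; rewrite linearN. Qed.

Lemma norm_source h i : `|source h i| <= `|h|.
Proof.
apply: le_coord_norm => j; rewrite /source; case: ifP => _; rewrite mxE; exact: ge_coord_norm.
Qed.

Lemma norm_extend i y : `|extend i y| <= `|y|.
Proof.
rewrite /extend; case: ifP => _; apply: (@le_coord_norm _ 3) => j.
  rewrite [X in `|X|]mxE; case: fintype.split => a; first exact: ge_coord_norm.
  by rewrite mxE normr0.
rewrite [X in `|X|]mxE; case: fintype.split => a; last exact: ge_coord_norm.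
by rewrite mxE normr0.
Qed.

Lemma dotv_extend i y h : dotv (extend i y) h = dotv y (source h i).
Proof.
rewrite /extend /source /dotv -[h in LHS](@hsubmxK _ 1 2 2).
case: ifP => _; rewrite (@tr_row_mx _ 1 2 2) (@mul_row_col _ 1 2 2 1) mul0mx.
  by rewrite addr0.
by rewrite add0r.
Qed.
End source.

Section families_sum.
Context {R : realType}.
Variables (T B : R) (KK : set 'rV[R]_4).

Lemma lipf_sum m (F : 'I_m -> 'rV[R]_4 -> R -> R) : (forall i, lipf T B (F i)) ->
  lipf T B (fun th t => \sum_(i < m) F i th t).
Proof.
elim: m F => [|m IH] F lF.
  exists 0 => // th th' t _ _ _; rewrite !big_ord0 subrr normr0 mul0r//.
have [C C0 P] := lipf_add (IH _ (fun i => lF (widen_ord (leqnSn m) i))) (lF ord_max).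
by exists C => // th th' t; rewrite !big_ord_recr; exact: P.
Qed.

Lemma diff_sum m (F : 'I_m -> 'rV[R]_4 -> R -> R) (A : 'I_m -> 'rV[R]_4 -> R -> 'rV[R]_4) :
  (forall i, diff T KK (F i) (A i)) ->
  diff T KK (fun th t => \sum_(i < m) F i th t) (fun th t => \sum_(i < m) A i th t).
Proof.
elim: m F A => [|m IH] F A lF.
  split; first by exists 0 => // th t _ _; rewrite big_ord0 normr0.
  move=> e e0; exists 1 => // th t h _ _ _; rewrite !big_ord0.
  by rewrite subrr /dotv mul0mx mxE subr0 normr0 mulr_ge0// ltW.
have [[C C0 P] Q] := diff_add (IH _ _ (fun i => lF (widen_ord (leqnSn m) i))) (lF ord_max).
split; first by exists C => // th t; rewrite !big_ord_recr; exact: P.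
move=> e e0; have [del d0 D] := Q e e0.
by exists del => // th t h; rewrite !big_ord_recr; exact: D.
Qed.

End families_sum.

Section model.
Context {R : realType} {K : nat}.
Variables (N : network R K) (B : R) (KK : set 'rV[R]_4)
  (s' s'' : 'I_2 -> 'I_K -> R -> R).
Hypotheses (speed_gt0 : 0 < speed N) (horizon_gt0 : 0 < horizon N) (noise_gt0 : 0 < noise N)
  (front_ge0 : forall (i : 'I_2) (k : 'I_K) (t : R), 0 <= front N i k t)
  (frontD : forall (i : 'I_2) (k : 'I_K) (t : R), is_derive t 1 (front N i k) (s' i k t))
  (front'D : forall (i : 'I_2) (k : 'I_K) (t : R), is_derive t 1 (s' i k) (s'' i k t))
  (cfront'' : forall (i : 'I_2) (k : 'I_K), continuous (s'' i k))
  (cKK : compact KK) (KB : forall th, KK th -> `|th| + 1 <= B)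
  (source_detector : forall th, KK th -> forall (i : 'I_2) (k : 'I_K), source th i <> detector N k).

Local Notation T := (horizon N).
Let cfront' i k : continuous (s' i k). Proof. exact: is_derive_continuous (@front'D i k). Qed.

Definition delay (i : 'I_2) (k : 'I_K) (th : 'rV[R]_4) (t : R) : R := t - arrival N k (source th i).

(** Gradient of t - |D_k - x| / nu in the position x of source i, extended by 0 to the other source;
    the two minus signs cancel. *)
Definition delay_grad i k (th : 'rV[R]_4) : 'rV[R]_4 :=
  extend i (((speed N)^-1 / enorm (detector N k - source th i)) *: (detector N k - source th i)).

Lemma arrival_lip i k th th' :
  `|arrival N k (source th i) - arrival N k (source th' i)| <= (speed N)^-1 * 2 * `|th - th'|.
Proof.
have v0 : 0 <= (speed N)^-1 by rewrite invr_ge0 ltW.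
rewrite /arrival -mulrBr normrM ger0_norm// -mulrA ler_wpM2l//.
rewrite (le_trans (enorm_lip _ _))//.
rewrite (_ : _ - _ - _ = - source (th - th') i); last first.
  by rewrite sourceD sourceN opprB addrC addrA subrK opprB addrC.
by rewrite enormN (le_trans (enorm_le_norm _))// ler_wpM2l// norm_source.
Qed.

Lemma lipf_delay i k : lipf T B (delay i k).
Proof.
have v0 : 0 <= (speed N)^-1 by rewrite invr_ge0 ltW.
exists (T + (`|arrival N k (source 0 i)| + (speed N)^-1 * 2 * `|B|) + (speed N)^-1 * 2).
  by rewrite !addr_ge0 ?mulr_ge0// ltW.
move=> th th' t b b' /andP[t0 tT]; split.
  have h := arrival_lip i k th 0; rewrite subr0 in h.
  have h2 : `|th| <= `|B| by rewrite (le_trans b)// ler_norm.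
  have h3 : `|arrival N k (source th i)| <= `|arrival N k (source th i) - arrival N k (source 0 i)| + `|arrival N k (source 0 i)|.
    by rewrite -{1}(subrK (arrival N k (source 0 i)) (arrival N k (source th i))) ler_normD.
  have h4 : (speed N)^-1 * 2 * `|th| <= (speed N)^-1 * 2 * `|B| by rewrite ler_wpM2l// mulr_ge0.
  have h5 : 0 <= (speed N)^-1 * 2 by rewrite mulr_ge0.
  rewrite /delay (le_trans (ler_normB _ _))// ger0_norm//; lra.
rewrite /delay (_ : _ - _ - _ = - (arrival N k (source th i) - arrival N k (source th' i))); last by ring.
rewrite normrN (le_trans (arrival_lip i k th th'))// ler_wpM2r//.
by rewrite lerDr !addr_ge0 ?mulr_ge0// ltW.
Qed.

Let dist_lower i k : exists2 rho, 0 < rho &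
  forall th, KK th -> rho <= enorm (detector N k - source th i).
Proof.
apply: (@compact_lower_bound _ _ KK (fun th => enorm (detector N k - source th i))) => //.
  move=> th _; apply: (@lip_continuous _ _ _ 2) => // x y.
  rewrite (le_trans (enorm_lip _ _))//.
  rewrite (_ : _ - _ - _ = - source (x - y) i); last first.
    by rewrite sourceD sourceN opprB addrC addrA subrK opprB addrC.
  by rewrite enormN (le_trans (enorm_le_norm _))// ler_wpM2l// norm_source.
move=> th Kt; rewrite lt_def enorm_ge0 andbT; apply/eqP => /enorm0_eq0/eqP.
by rewrite subr_eq0 => /eqP e; have := @source_detector _ Kt i k; rewrite -e.
Qed.

(** By [enorm_expansion] the remainder is quadratic in h, divided by the distance to the detector,
    and this distance is bounded below on the compact set. *)
Lemma diff_delay i k : diff T KK (delay i k) (fun th _ => delay_grad i k th).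
Proof.
have v0 : 0 < (speed N)^-1 by rewrite invr_gt0.
have [rho rho0 rhoP] := dist_lower i k.
split.
  exists (speed N)^-1; first exact: ltW.
  move=> th t Kt _; rewrite (le_trans (norm_extend _ _))// normrZ.
  have r0 : 0 < enorm (detector N k - source th i) by rewrite (lt_le_trans rho0)// rhoP.
  rewrite ger0_norm ?divr_ge0 ?(ltW v0) ?(ltW r0)//.
  rewrite -mulrA ler_piMr ?(ltW v0)// ler_pdivrMl// mulr1 norm_le_enorm//.
move=> e e0; exists (e * rho / ((speed N)^-1 * 4)); first by rewrite divr_gt0 ?mulr_gt0.
move=> th t h Kt _ hd; set x := detector N k - source th i.
have r0 : 0 < enorm x by rewrite (lt_le_trans rho0)// rhoP.
have x0 : x != 0.
  apply/eqP => x0; move: r0; rewrite x0.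
  by rewrite -(scale0r (0 : 'rV[R]_2)) /enorm big1 ?sqrtr0 ?ltxx// => j _; rewrite !mxE mulr0 expr0n.
have ex := enorm_expansion (- source h i) x0.
rewrite /delay_grad -/x dotv_extend dotvZl /delay /arrival sourceD opprD addrA -/x.
rewrite (_ : _ - _ - _ = - (speed N)^-1 * (enorm (x - source h i) - enorm x - dotv x (- source h i) / enorm x)); last first.
  by rewrite dotvNr; ring.
rewrite normrM normrN [`|(speed N)^-1|]ger0_norm ?(ltW v0)//.
have h4 : enorm (- source h i) ^+ 2 / enorm x <= 4 * `|h| ^+ 2 / rho.
  rewrite enormN ler_pM ?sqr_ge0 ?invr_ge0 ?(ltW r0)//; last by rewrite lef_pV2 ?posrE// rhoP.
  rewrite (_ : 4 * `|h| ^+ 2 = (2 * `|h|) ^+ 2); last by rewrite exprMn -natrX.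
  rewrite ler_pXn2r ?nnegrE ?enorm_ge0 ?mulr_ge0//.
  by rewrite (le_trans (enorm_le_norm _))// ler_wpM2l// norm_source.
have h5 := ler_wpM2l (ltW v0) (le_trans ex h4).
rewrite (le_trans h5)//.
have h0 : 0 <= `|h| by [].
have := ler_wpM2l h0 hd.
rewrite (_ : `|h| * (e * rho / ((speed N)^-1 * 4)) = `|h| * (e * rho) / ((speed N)^-1 * 4)); last by rewrite mulrA.
rewrite ler_pdivlMr ?mulr_gt0// => h6; rewrite -(ler_pM2r rho0).
rewrite (_ : (speed N)^-1 * (4 * `|h| ^+ 2 / rho) * rho = `|h| * `|h| * ((speed N)^-1 * 4)).
  by rewrite (le_trans h6)// mulrCA mulrA.
by field; rewrite (gt_eqF rho0) (gt_eqF speed_gt0).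
Qed.

Definition lam' (k : 'I_K) (th : 'rV[R]_4) (t : R) : R := \sum_(i < 2) s' i k (delay i k th t).
Definition lam_grad (k : 'I_K) (th : 'rV[R]_4) (t : R) : 'rV[R]_4 := \sum_(i < 2) s' i k (delay i k th t) *: delay_grad i k th.
Definition lam'_grad (k : 'I_K) (th : 'rV[R]_4) (t : R) : 'rV[R]_4 := \sum_(i < 2) s'' i k (delay i k th t) *: delay_grad i k th.
Definition score (k : 'I_K) (th : 'rV[R]_4) (t : R) : 'rV[R]_4 := (intensity N k th t)^-1 *: lam_grad k th t.
(** One formula in two roles: the time derivative of [score] (in [scoreD]) and the gradient in th of
    [loglam'] (in [diff_loglam']). The second derivative of the fronts enters here. *)
Definition score' (k : 'I_K) (th : 'rV[R]_4) (t : R) : 'rV[R]_4 := (intensity N k th t)^-1 *: lam'_grad k th t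
  + lam' k th t *: (- (intensity N k th t ^+ 2)^-1 *: lam_grad k th t).
Definition loglam' (k : 'I_K) (th : 'rV[R]_4) (t : R) : R := lam' k th t * (intensity N k th t)^-1.

Let C1_from_all (phi phi' : R -> R) b : (forall t : R, is_derive t 1 phi (phi' t)) -> continuous phi' ->
  C1_from b phi phi'.
Proof. by move=> D c x _; split; [exact: D|exact: c]. Qed.

Let delay_lo i k : exists b : R, forall (th : 'rV[R]_4) (t : R), `|th| <= B -> 0 <= t <= T -> b <= delay i k th t.
Proof.
have [C C0 P] := lipf_delay i k; exists (- C) => th t b tT.
by have [] := P th th t b b tT; rewrite ler_norml => /andP[].
Qed.

Lemma intensity_ge (k : 'I_K) (th : 'rV[R]_4) (t : R) : noise N <= intensity N k th t.
Proof. by rewrite /intensity lerDr sumr_ge0. Qed.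

Lemma intensity_gt0 (k : 'I_K) (th : 'rV[R]_4) (t : R) : 0 < intensity N k th t.
Proof. exact: lt_le_trans noise_gt0 (intensity_ge k th t). Qed.

Lemma lipf_intensity k : lipf T B (intensity N k).
Proof.
apply: lipf_add; last exact: (@lipf_cst _ _ _ (fun _ => noise N) `|noise N|).
apply: lipf_sum => i; have [b bP] := delay_lo i k.
exact: (lipf_comp (C1_from_all (@frontD i k) (@cfront' i k)) bP (lipf_delay i k)).
Qed.

Lemma diff_intensity k : diff T KK (intensity N k) (lam_grad k).
Proof.
apply: (@diff_eqA _ _ _ _ (fun th t => lam_grad k th t + 0)).
  by move=> th t _; rewrite addr0.
apply: diff_add; last exact: diff_cst.
apply: diff_sum => i; have [b bP] := delay_lo i k.
exact: (diff_comp KB (C1_from_all (@frontD i k) (@cfront' i k)) bP (lipf_delay i k) (diff_delay i k)).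
Qed.

Lemma lipf_lam' k : lipf T B (lam' k).
Proof.
apply: lipf_sum => i; have [b bP] := delay_lo i k.
exact: (lipf_comp (C1_from_all (@front'D i k) (@cfront'' i k)) bP (lipf_delay i k)).
Qed.

Lemma diff_lam' k : diff T KK (lam' k) (lam'_grad k).
Proof.
apply: diff_sum => i; have [b bP] := delay_lo i k.
exact: (diff_comp KB (C1_from_all (@front'D i k) (@cfront'' i k)) bP (lipf_delay i k) (diff_delay i k)).
Qed.

Let noise_le (k : 'I_K) (th : 'rV[R]_4) (t : R) : `|th| <= B -> 0 <= t <= T -> noise N <= intensity N k th t.
Proof. by move=> _ _; exact: intensity_ge. Qed.

Lemma lipf_loglam k : lipf T B (fun th t => ln (intensity N k th t)).
Proof. exact: (lipf_comp (C1_ln noise_gt0) (@noise_le k) (lipf_intensity k)). Qed.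

Lemma diff_loglam k : diff T KK (fun th t => ln (intensity N k th t)) (score k).
Proof. exact: (diff_comp KB (C1_ln noise_gt0) (@noise_le k) (lipf_intensity k) (diff_intensity k)). Qed.

Let lipf_inv k : lipf T B (fun th t => (intensity N k th t)^-1).
Proof. exact: (lipf_comp (C1_inv noise_gt0) (@noise_le k) (lipf_intensity k)). Qed.

Lemma lipf_loglam' k : lipf T B (loglam' k).
Proof. exact: lipf_mul (lipf_lam' k) (lipf_inv k). Qed.

Lemma diff_loglam' k : diff T KK (loglam' k) (score' k).
Proof.
apply: (diff_mul KB (lipf_lam' k) (lipf_inv k) (diff_lam' k)).
exact: (diff_comp KB (C1_inv noise_gt0) (@noise_le k) (lipf_intensity k) (diff_intensity k)).
Qed.

Let delayD (i : 'I_2) (k : 'I_K) (th : 'rV[R]_4) (t : R) : is_derive t 1 (delay i k th) 1.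
Proof. by apply: (Deq (Dadd (Did t) (Dcst t _))); rewrite addr0. Qed.

Let frontcD (i : 'I_2) (k : 'I_K) (th : 'rV[R]_4) (t : R) : is_derive t 1 (fun t => front N i k (delay i k th t)) (s' i k (delay i k th t)).
Proof. by apply: (Deq (Dcomp (frontD i k _) (delayD i k th t))); rewrite mulr1. Qed.
Let front'cD (i : 'I_2) (k : 'I_K) (th : 'rV[R]_4) (t : R) : is_derive t 1 (fun t => s' i k (delay i k th t)) (s'' i k (delay i k th t)).
Proof. by apply: (Deq (Dcomp (front'D i k _) (delayD i k th t))); rewrite mulr1. Qed.

Let cdelay i k th : continuous (delay i k th).
Proof. exact: is_derive_continuous (@delayD i k th). Qed.

Lemma intensityD (k : 'I_K) (th : 'rV[R]_4) (t : R) : is_derive t 1 (intensity N k th) (lam' k th t).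
Proof.
have D := @Dbigsum _ _ (fun i u => front N i k (delay i k th u)) (fun i u => s' i k (delay i k th u)) t
  (fun i => frontcD i k th t).
by apply: (Deq (Dadd D (Dcst t (noise N)))); rewrite addr0.
Qed.

Lemma continuous_intensity k th : continuous (intensity N k th).
Proof. exact: is_derive_continuous (@intensityD k th). Qed.

Lemma continuous_lam' k th : continuous (lam' k th).
Proof.
apply: continuous_sum => i t.
by apply: continuous_comp; [exact: cdelay|exact: cfront'].
Qed.

Let continuous_inv k th : continuous (fun t => (intensity N k th t)^-1).
Proof. by move=> t; apply: cvgV; [rewrite gt_eqF// intensity_gt0|exact: continuous_intensity]. Qed.

Lemma loglamD (k : 'I_K) (th : 'rV[R]_4) (t : R) : is_derive t 1 (fun t => ln (intensity N k th t)) (loglam' k th t).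
Proof.
apply: (Deq (Dcomp (is_derive1_ln (intensity_gt0 k th t)) (intensityD k th t))).
by rewrite mulrC.
Qed.

Lemma continuous_loglam' k th : continuous (loglam' k th).
Proof. by move=> t; apply: cvgM; [exact: continuous_lam'|exact: continuous_inv]. Qed.

Lemma dotv_lam_grad (k : 'I_K) (th : 'rV[R]_4) (t : R) (h : 'rV[R]_4) :
  dotv (lam_grad k th t) h = \sum_(i < 2) s' i k (delay i k th t) * dotv (delay_grad i k th) h.
Proof. by rewrite /lam_grad !big_ord_recl !big_ord0 !addr0 dotvDl !dotvZl. Qed.

Lemma dotv_lam'_grad (k : 'I_K) (th : 'rV[R]_4) (t : R) (h : 'rV[R]_4) :
  dotv (lam'_grad k th t) h = \sum_(i < 2) s'' i k (delay i k th t) * dotv (delay_grad i k th) h.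
Proof. by rewrite /lam'_grad !big_ord_recl !big_ord0 !addr0 dotvDl !dotvZl. Qed.

Let lam_gradD (k : 'I_K) (th h : 'rV[R]_4) (t : R) : is_derive t 1 (fun t => dotv (lam_grad k th t) h) (dotv (lam'_grad k th t) h).
Proof.
rewrite (_ : (fun t => _) = fun t => \sum_(i < 2) s' i k (delay i k th t) * dotv (delay_grad i k th) h); last first.
  by apply/funext => u; rewrite dotv_lam_grad.
rewrite dotv_lam'_grad.
apply: (@Dbigsum _ _ _ (fun i t => s'' i k (delay i k th t) * dotv (delay_grad i k th) h)) => i.
by apply: (Deq (Dmul (front'cD i k th t) (Dcst t _))); rewrite mulr0 addr0.
Qed.

Lemma continuous_lam_grad k th h : continuous (fun t => dotv (lam_grad k th t) h).
Proof. exact: is_derive_continuous (@lam_gradD k th h). Qed.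

Let continuous_lam'_grad k th h : continuous (fun t => dotv (lam'_grad k th t) h).
Proof.
rewrite (_ : (fun t => _) = fun t => \sum_(i < 2) s'' i k (delay i k th t) * dotv (delay_grad i k th) h); last first.
  by apply/funext => u; rewrite dotv_lam'_grad.
apply: continuous_sum => i t.
apply: cvgM; last exact: cvg_cst.
by apply: continuous_comp; [exact: cdelay|exact: cfront''].
Qed.

Lemma scoreD (k : 'I_K) (th h : 'rV[R]_4) (t : R) : is_derive t 1 (fun t => dotv (score k th t) h) (dotv (score' k th t) h).
Proof.
rewrite (_ : (fun t => _) = fun t => (intensity N k th t)^-1 * dotv (lam_grad k th t) h); last first.
  by apply/funext => u; rewrite /score dotvZl.
have x0 : intensity N k th t != 0 by rewrite gt_eqF// intensity_gt0.
have I1 := (is_deriveV x0 (intensityD k th t)).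
apply: (Deq (Dmul I1 (lam_gradD k th h t))).
by rewrite /score' dotvDl !dotvZl /GRing.scale/=; ring.
Qed.

Lemma continuous_score' k th h : continuous (fun t => dotv (score' k th t) h).
Proof.
rewrite (_ : (fun t => _) = fun t => (intensity N k th t)^-1 * dotv (lam'_grad k th t) h -
   lam' k th t * ((intensity N k th t)^-1 * (intensity N k th t)^-1 * dotv (lam_grad k th t) h)); last first.
  by apply/funext => u; rewrite /score' dotvDl !dotvZl -exprVn; ring.
move=> t; apply: cvgB; apply: cvgM.
- exact: continuous_inv.
- exact: continuous_lam'_grad.
- exact: continuous_lam'.
- apply: cvgM; last exact: continuous_lam_grad.
  by apply: cvgM; exact: continuous_inv.
Qed.

Lemma grad_intensityE (k : 'I_K) (th : 'rV[R]_4) (t : R) : KK th -> 0 <= t <= T -> grad_intensity N k th t = lam_grad k th t.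
Proof.
move=> Kt tT; have [_ D] := diff_intensity k.
apply/rowP => a; rewrite mxE.
have nd : `|(delta_mx ord0 a : 'rV[R]_4)| <= 1.
  by apply: le_coord_norm => j; rewrite mxE eqxx /=; case: (j == a); rewrite ?normr1 ?normr0.
have <- : dotv (lam_grad k th t) (delta_mx ord0 a) = lam_grad k th t ord0 a.
  rewrite dotvE (bigD1 a)//= mxE !eqxx mulr1 big1 ?addr0// => j ja.
  by rewrite mxE (negbTE ja) andbF mulr0.
apply/cvg_lim => //; apply/cvgrPdist_le => e e0.
have [del del0 P] := D e e0.
near=> u; rewrite distrC.
have u0 : u != 0 by near: u; exact: nbhs_dnbhs_neq.
have ud : `|u| <= del.
  near: u; apply: dnbhs0_le => //.
have := P th t (u *: delta_mx ord0 a) Kt tT.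
rewrite normrZ => /(_ _)/wrap[|h]; first by rewrite (le_trans _ ud)// ler_piMr.
rewrite dotvZr in h.
rewrite (_ : _ - _ = u^-1 * (intensity N k (th + u *: delta_mx ord0 a) t - intensity N k th t -
   u * dotv (lam_grad k th t) (delta_mx ord0 a))); last first.
  rewrite /GRing.scale/= [in RHS]mulrBr mulKf// [u *: _ + th]addrC//.
rewrite normrM normfV ler_pdivrMl ?normr_gt0// (le_trans h)//.
by rewrite mulrCA ler_wpM2l// ler_piMr// ltW.
Unshelve. all: by end_near.
Qed.

End model.

(** * Kullback divergence *)

Lemma common_bound (R : realType) (K : nat) (P : 'I_K -> R -> Prop) :
  (forall k C D, C <= D -> P k C -> P k D) -> (forall k, exists2 C, 0 <= C & P k C) ->
  exists2 C, 0 < C & forall k, P k C.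
Proof.
move=> mP hP.
have h (k : 'I_K) : exists C, 0 <= C /\ P k C by have [C C0 PC] := hP k; exists C.
have [f fP] := fin_all_exists h; exists (\sum_k f k + 1).
  by rewrite ltr_wpDl// sumr_ge0// => k _; have [] := fP k.
move=> k; have [f0 Pf] := fP k; apply: mP Pf.
rewrite (bigD1 k)//= -addrA lerDl addr_ge0// sumr_ge0// => j _; by have [] := fP j.
Qed.

(** A common small threshold is the inverse of a common large bound. *)
Lemma common_delta (R : realType) (K : nat) (P : 'I_K -> R -> Prop) :
  (forall k C D, D <= C -> P k C -> P k D) -> (forall k, exists2 C, 0 < C & P k C) ->
  exists2 C, 0 < C & forall k, P k C.
Proof.
move=> mP hP.
have [|k|C C0 CP] := @common_bound R K (fun k C => forall D, D * C <= 1 -> P k D).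
- move=> k C D CD h x xD; have [x0|x0] := leP 0 x.
    by apply: h; rewrite (le_trans _ xD)// ler_wpM2l.
  have [d d0 Pd] := hP k; apply: mP Pd; exact: le_trans (ltW x0) (ltW d0).
- have [d d0 Pd] := hP k; exists d^-1; first by rewrite invr_ge0 ltW.
  by move=> D; rewrite ler_pdivrMr// mul1r => Dd; exact: mP Pd.
by exists C^-1; [rewrite invr_gt0|move=> k; apply: CP; rewrite mulVf// gt_eqF].
Qed.

Section log_bounds.
Context {R : realType}.
Implicit Types r a x : R.

(** The function inside the absolute value on the left has derivative -(x - 1)^2 / x, at most (r -
    1)^2 / a in absolute value between 1 and r. *)
Lemma log_quad a r : 0 < a -> a <= 1 -> a <= r ->
  `|r - 1 - ln r - (r - 1) ^+ 2 / 2| <= `|r - 1| ^+ 3 / a.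
Proof.
move=> a0 a1 ar.
pose f x := x - 1 - ln x - (x - 1) ^+ 2 / 2.
have fD x : a <= x -> is_derive x 1 f (- ((x - 1) ^+ 2 / x)).
  move=> ax; have x0 : 0 < x by exact: lt_le_trans ax.
  have D1 : is_derive x 1 (fun y : R => y - 1) (1 - 0) by exact: Dadd (Did x) (Dopp (Dcst x 1)).
  apply: (Deq (Dadd (Dadd D1 (Dopp (is_derive1_ln x0))) (Dopp (Dmul (Dexpn 2 D1) (Dcst x 2^-1))))).
  by field; rewrite gt_eqF.
have f1 : f 1 = 0 by rewrite /f ln1 subrr expr0n/= mul0r !subr0.
have key u v M : a <= u -> u <= v -> (forall y, u <= y -> y <= v -> (y - 1) ^+ 2 <= M) -> `|f v - f u| <= M / a * (v - u).
  move=> au uv hM; apply: (@derive_norm_le _ f (fun x => - ((x - 1) ^+ 2 / x)) u v (M / a) uv) => [y uy yv|y uy yv].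
    by exact: (fD y (le_trans au uy)).
  have y0 : 0 < y by rewrite (lt_le_trans a0)// (le_trans au).
  rewrite normrN ger0_norm ?divr_ge0 ?sqr_ge0 ?(ltW y0)// ler_pM ?sqr_ge0 ?invr_ge0 ?(ltW y0) ?hM//.
  by rewrite lef_pV2 ?posrE// (le_trans au).
have [r1|/ltW r1] := leP 1 r.
  have := key 1 r ((r - 1) ^+ 2) a1 r1; rewrite f1 subr0 => h.
  rewrite [`|r - 1|]ger0_norm ?subr_ge0// (_ : _ / a = (r - 1) ^+ 2 / a * (r - 1)); last by ring.
  by apply: h => y y1 yr; rewrite ler_pXn2r ?nnegrE ?subr_ge0// lerD2r.
have := key r 1 ((1 - r) ^+ 2) ar r1; rewrite f1 sub0r normrN => h.
rewrite [`|r - 1|]distrC [`|1 - r|]ger0_norm ?subr_ge0// (_ : _ / a = (1 - r) ^+ 2 / a * (1 - r)); last by ring.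
apply: h => y y1 yr; rewrite -sqrrN opprB ler_pXn2r ?nnegrE ?subr_ge0// lerD2l lerN2//.
Qed.

(* With [x] the square root of [r], the inequality [ln x <= x - 1] gives [(x - 1)^2 <= r - 1 - ln r]. *)
Lemma log_low r : 0 < r -> (r - 1) ^+ 2 / (2 * (r + 1)) <= r - 1 - ln r.
Proof.
move=> r0; pose x := Num.sqrt r; have x0 : 0 < x by rewrite sqrtr_gt0.
have rx : r = x ^+ 2 by rewrite sqr_sqrtr// ltW.
have lx : ln r = ln x * 2 by rewrite rx lnXn// mulr_natr.
have h : (x - 1) ^+ 2 <= r - 1 - ln r.
  have l1 : ln x <= x - 1.
    have x1 : -1 < x - 1 by lra.
    by have := le_ln1Dx x1; rewrite addrC subrK.
  rewrite lx rx.
  rewrite [leLHS](_ : _ = x ^+ 2 - 1 - (x - 1) * 2); last by ring.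
  by rewrite lerD2l lerN2 ler_wpM2r.
apply: le_trans h; rewrite ler_pdivrMr; last by rewrite mulr_gt0// ltr_wpDl// ltW.
rewrite rx (_ : (x ^+ 2 - 1) ^+ 2 = (x - 1) ^+ 2 * (x + 1) ^+ 2); last by ring.
rewrite ler_wpM2l ?sqr_ge0//.
by have := sqr_ge0 (x - 1); rewrite !expr2; lra.
Qed.
End log_bounds.

Section sint.
Context {R : realType} {K : nat}.
Variable (T : R).
Hypothesis (T0 : 0 < T).
Implicit Types f g : 'I_K -> R -> R.

Definition sint f : R := \sum_(k < K) \int[@lebesgue_measure R]_(t in `[0, T]) f k t.

Lemma sint_add f g : (forall k, continuous (f k)) -> (forall k, continuous (g k)) ->
  sint (fun k t => f k t + g k t) = sint f + sint g.
Proof.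
move=> cf cg; rewrite /sint -big_split/=; apply: eq_bigr => k _.
by rewrite RintegralD//; exact: continuous_itv_integrable.
Qed.

Lemma sint_scale c f : (forall k, continuous (f k)) ->
  sint (fun k t => c * f k t) = c * sint f.
Proof.
move=> cf; rewrite /sint mulr_sumr; apply: eq_bigr => k _.
by rewrite Rintegral_itv_scale//; exact: cf.
Qed.

Lemma sint_sub f g : (forall k, continuous (f k)) -> (forall k, continuous (g k)) ->
  sint (fun k t => f k t - g k t) = sint f - sint g.
Proof.
move=> cf cg; rewrite /sint -sumrB; apply: eq_bigr => k _.
by rewrite RintegralB//; exact: continuous_itv_integrable.
Qed.

Lemma sint_bound f c : (forall k, continuous (f k)) ->
  (forall k t, 0 <= t <= T -> `|f k t| <= c) -> `|sint f| <= K%:R * T * c.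
Proof.
move=> cf fc; rewrite (le_trans (ler_norm_sum _ _ _))//.
rewrite -mulrA -[X in _ <= X%:R * _]card_ord mulr_natl -sumr_const ler_sum// => k _.
rewrite mulrC -[X in c * X]subr0 Rintegral_itv_bound ?(ltW T0)//; last exact: fc.
by apply: measurable_funTS; exact: continuous_measurable_fun.
Qed.

Lemma sint_le f g : (forall k, continuous (f k)) -> (forall k, continuous (g k)) ->
  (forall k t, 0 <= t <= T -> f k t <= g k t) -> sint f <= sint g.
Proof.
move=> cf cg fg; rewrite /sint; apply: ler_sum => k _; apply: le_Rintegral => //.
- exact: continuous_itv_integrable.
- exact: continuous_itv_integrable.
- by move=> t /=; rewrite in_itv/=; exact: fg.
Qed.

Lemma sint_cst c : sint (fun _ _ => c) = K%:R * T * c.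
Proof.
rewrite /sint sumr_const card_ord -[LHS]mulr_natl -[RHS]mulrA; congr (K%:R * _ : R).
by rewrite Rintegral_cst//= lebesgue_measure_itv/= lte_fin T0 sube0 mulrC.
Qed.

End sint.

(** * Separation, divergence and information of a smooth family *)

Section smooth_family.
Context {R : realType} {K : nat}.
Variables (T B nu : R) (KK TH : set 'rV[R]_4).
Variables (lam : 'I_K -> 'rV[R]_4 -> R -> R) (A : 'I_K -> 'rV[R]_4 -> R -> 'rV[R]_4).
Hypotheses (T0 : 0 < T) (nu0 : 0 < nu) (KB : forall th, KK th -> `|th| + 1 <= B)
  (THB : forall th, TH th -> `|th| <= B)
  (lam_nu : forall k th t, nu <= lam k th t)
  (clam : forall k th, continuous (lam k th))
  (cA : forall k th h, continuous (fun t => dotv (A k th t) h))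
  (llam : forall k, lipf T B (lam k)) (dlam : forall k, diff T KK (lam k) (A k)).

Let lam0 k th t : 0 < lam k th t. Proof. exact: lt_le_trans (lam_nu k th t). Qed.

Definition infob (th x y : 'rV[R]_4) : R :=
  sint T (fun k t => dotv (A k th t) x * dotv (A k th t) y / lam k th t).

(** The Kullback divergence between the Poisson laws at th0 and at th for n = 1, the expectation
    being under th0. *)
Definition kl (th0 th : 'rV[R]_4) : R :=
  sint T (fun k t => lam k th t - lam k th0 t - lam k th0 t * (ln (lam k th t) - ln (lam k th0 t))).

Definition sep (th0 th : 'rV[R]_4) : R := sint T (fun k t => (lam k th t - lam k th0 t) ^+ 2).

Lemma lam_bound : exists2 C, 0 < C & forall k th th' t, `|th| <= B -> `|th'| <= B -> 0 <= t <= T ->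
  `|lam k th t| <= C /\ `|lam k th t - lam k th' t| <= C * `|th - th'|.
Proof.
apply: common_bound => [k C D CD P th th' t b b' tT|k]; last exact: llam.
have [p1 p2] := P th th' t b b' tT; split; first exact: le_trans CD.
by rewrite (le_trans p2)// ler_wpM2r.
Qed.

Lemma A_bound : exists2 C, 0 < C & forall k th t, KK th -> 0 <= t <= T -> `|A k th t| <= C.
Proof.
apply: common_bound => [k C D CD P th t Kt tT|k]; last by have [] := dlam k.
exact: le_trans (P th t Kt tT) CD.
Qed.

Lemma lam_expansion e : 0 < e -> exists2 del, 0 < del & forall k th t h, KK th -> 0 <= t <= T ->
  `|h| <= del -> `|lam k (th + h) t - lam k th t - dotv (A k th t) h| <= e * `|h|.
Proof.
move=> e0; apply: common_delta => [k C D DC P th t h Kt tT hD|k]; last by have [_ /(_ e e0)] := dlam k.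
exact: P (le_trans hD DC).
Qed.

Let ball th h : KK th -> `|h| <= 1 -> `|th + h| <= B. Proof. by move=> Kt h1; exact: (ball_in KB). Qed.
Let KB' th : KK th -> `|th| <= B. Proof. exact: (in_ball KB). Qed.

Let cinv k th : continuous (fun t => (lam k th t)^-1).
Proof. by move=> t; apply: cvgV; [rewrite gt_eqF|exact: clam]. Qed.

Let cln k th : continuous (fun t => ln (lam k th t)).
Proof.
move=> t; apply: (@continuous_comp _ _ _ (lam k th) (@ln R)); first exact: clam.
exact: continuous_ln.
Qed.

Let ckl k th0 th : continuous (fun t => lam k th t - lam k th0 t - lam k th0 t * (ln (lam k th t) - ln (lam k th0 t))).
Proof.
move=> t; apply: cvgB; first by apply: cvgB; exact: clam.
by apply: cvgM; [exact: clam|apply: cvgB; exact: cln].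
Qed.

Let csep k th0 th : continuous (fun t => (lam k th t - lam k th0 t) ^+ 2).
Proof. by move=> t; apply: cvgM; apply: cvgB; exact: clam. Qed.

Let cinfo k th x y : continuous (fun t => dotv (A k th t) x * dotv (A k th t) y / lam k th t).
Proof. by move=> t; apply: cvgM; [apply: cvgM; exact: cA|exact: cinv]. Qed.

(** [log_low] at the ratio r = l / l0, multiplied by l0, bounds the integrand below by (l - l0)^2 /
    (2 (l + l0)). *)
Lemma kl_sep : exists2 c, 0 < c & forall th0 th, `|th0| <= B -> `|th| <= B -> c * sep th0 th <= kl th0 th.
Proof.
have [C C0 CP] := lam_bound; exists (4 * C)^-1; first by rewrite invr_gt0 mulr_gt0.
move=> th0 th b0 b; rewrite /sep -sint_scale; last by move=> k; exact: csep.
apply: sint_le => [k t|k|k t tT]; first by apply: cvgM; [exact: cvg_cst|exact: csep].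
  exact: ckl.
set l0 := lam k th0 t; set l := lam k th t.
have l00 : 0 < l0 by exact: lam0. have l1 : 0 < l by exact: lam0.
have r0 : 0 < l / l0 by rewrite divr_gt0.
have := log_low r0; rewrite ln_div ?posrE// => h.
have hC : l + l0 <= 2 * C.
  have [c1 _] := CP k th th t b b tT; have [c2 _] := CP k th0 th0 t b0 b0 tT.
  have := le_trans (ler_norm _) c1; have := le_trans (ler_norm _) c2; rewrite -/l -/l0; lra.
have := ler_wpM2l (ltW l00) h.
rewrite (_ : l0 * (l / l0 - 1 - _) = l - l0 - l0 * (ln l - ln l0)); last by field; rewrite gt_eqF.
apply: le_trans.
rewrite (_ : l0 * _ = (2 * (l + l0))^-1 * (l - l0) ^+ 2); last first.
  by field; rewrite !gt_eqF// addr_gt0.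
rewrite ler_wpM2r ?sqr_ge0// lef_pV2 ?posrE ?mulr_gt0 ?addr_gt0//; lra.
Qed.

Variable (c3 : R).
Hypotheses (c30 : 0 < c3) (r3 : forall th h, KK th -> c3 * `|h| ^+ 2 <= infob th h h)
  (r4 : forall eps, 0 < eps -> exists2 kap, 0 < kap & forall th0 th, KK th0 -> TH th ->
    eps < enorm (th - th0) -> kap <= sep th0 th).

(** With a the differential and u the increment of the intensity, u^2 >= a^2/2 - (u - a)^2. The
    integral of a^2 is at least nu times the information form, hence at least nu c3 |h|^2, and [e]
    is such that the error takes at most half of the first term. *)
Let sep_near : exists2 del, 0 < del & forall th0 h, KK th0 -> `|h| <= del ->
  nu * c3 / 4 * `|h| ^+ 2 <= sep th0 (th0 + h).
Proof.
pose D := 4 * (K%:R * T + 1).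
have KT0 : 0 <= K%:R * T by rewrite mulr_ge0// ltW.
have D0 : 0 < D by rewrite mulr_gt0// ltr_wpDl.
pose e := Num.sqrt (nu * c3 / D).
have e20 : 0 < nu * c3 / D by rewrite divr_gt0// mulr_gt0.
have e0 : 0 < e by rewrite sqrtr_gt0.
have ee : e ^+ 2 = nu * c3 / D by rewrite sqr_sqrtr// ltW.
have [del d0 dP] := lam_expansion e0; exists del => // th0 h K0 hd.
have h1 : sint T (fun k t => nu / 2 * (dotv (A k th0 t) h * dotv (A k th0 t) h / lam k th0 t) - (e * `|h|) ^+ 2)
    <= sep th0 (th0 + h).
  apply: sint_le => [k t|k|k t tT].
  - by apply: cvgB; [apply: cvgM; [exact: cvg_cst|exact: cinfo]|exact: cvg_cst].
  - exact: csep.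
  have := dP k th0 t h K0 tT hd; set a := dotv _ _; set u := _ - lam k th0 t => hu.
  have hu2 : (u - a) ^+ 2 <= (e * `|h|) ^+ 2.
    by rewrite -real_normK ?num_real// ler_pXn2r ?nnegrE// mulr_ge0// ltW.
  have a2 : nu * (a * a / lam k th0 t) <= a * a.
    by rewrite mulrCA ler_piMr -?expr2 ?sqr_ge0// ler_pdivrMr// mul1r.
  have := sqr_ge0 (2 * u - a); rewrite !expr2 in hu2 *; lra.
apply: le_trans h1.
rewrite sint_sub; last by move=> k; exact: cst_continuous.
  rewrite sint_scale; last by move=> k; exact: cinfo.
  rewrite sint_cst// exprMn ee.
  have := r3 h K0; rewrite /infob => h3.
  have := ler_wpM2l (ltW nu0) h3.
  have : K%:R * T * (nu * c3 / D * `|h| ^+ 2) <= nu * c3 / 4 * `|h| ^+ 2.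
    rewrite mulrA ler_wpM2r ?sqr_ge0// mulrCA ler_wpM2l ?mulr_ge0 ?(ltW nu0) ?(ltW c30)//.
    by rewrite /D invfM mulrCA ler_piMr// ler_pdivrMr ?mul1r ?lerDl// ltr_wpDl.
  lra.
by move=> k t; apply: cvgM; [exact: cvg_cst|exact: cinfo].
Qed.

Lemma closure_bounded th : closure TH th -> `|th| <= B.
Proof.
move=> cth; rewrite leNgt; apply/negP => Bth; have e0 : 0 < `|th| - B by rewrite subr_gt0.
have [z [Tz]] := cth _ (nbhsx_ballx th _ e0).
rewrite -ball_normE /= => hz.
have := THB Tz; have : `|th| <= `|th - z| + `|z| by rewrite -{1}(subrK z th) ler_normD.
lra.
Qed.

(** R4 speaks of Theta, whereas the estimator lies in its closure. As [sep] is Lipschitz in th,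
    passing to a nearby point of Theta loses at most half of kap. *)
Let sep_far del : 0 < del -> exists2 kap, 0 < kap & forall th0 th, KK th0 -> closure TH th ->
  del <= `|th - th0| -> kap <= sep th0 th.
Proof.
move=> del0; have d2 : 0 < del / 2 by rewrite divr_gt0.
have [kap kap0 kP] := r4 d2.
have [C C0 CP] := lam_bound.
have KT0 : 0 <= K%:R * T by rewrite mulr_ge0// ltW.
pose D := K%:R * T * (4 * C * C) + 1.
have D0 : 0 < D by rewrite ltr_wpDl// !mulr_ge0// ltW.
exists (kap / 2); first by rewrite divr_gt0.
move=> th0 th K0 cth dth.
pose eta := Num.min (del / 2) (kap / (2 * D)).
have eta0 : 0 < eta by rewrite lt_min d2 divr_gt0// mulr_gt0.
have b := closure_bounded cth.
have [th' [Tt]] := cth _ (nbhsx_ballx th _ eta0).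
rewrite -ball_normE /= lt_min => /andP[hz1 hz2].
have far : del / 2 < enorm (th' - th0).
  rewrite (lt_le_trans _ (norm_le_enorm _))//.
  have : `|th - th0| <= `|th - th'| + `|th' - th0|.
    by rewrite (le_trans _ (ler_normD _ _))// addrA subrK.
  lra.
have h := kP _ _ K0 Tt far.
have h2 : sep th0 th' - sep th0 th <= K%:R * T * (4 * C * C * `|th - th'|).
  rewrite /sep -sint_sub; [|by move=> k; exact: csep..].
  apply: le_trans (ler_norm _) _; apply: sint_bound => // [k t|k t tT].
    by apply: cvgB; exact: csep.
  have [p1 p2] := CP k th' th t (THB Tt) b tT.
  have [p3 _] := CP k th th t b b tT; have [p4 _] := CP k th0 th0 t (KB' K0) (KB' K0) tT.
  rewrite subr_sqr normrM.
  rewrite (_ : _ - _ - _ = lam k th' t - lam k th t); last by ring.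
  rewrite [leRHS](_ : _ = C * `|th - th'| * (4 * C)); last by ring.
  rewrite ler_pM//; first by rewrite [`|th - th'|]distrC.
  move: p1 p3 p4; rewrite !ler_norml => /andP[? ?] /andP[? ?] /andP[? ?].
  by apply/andP; split; lra.
have h3 : K%:R * T * (4 * C * C * `|th - th'|) <= kap / 2.
  rewrite mulrA; apply: (@le_trans _ _ (D * (kap / (2 * D)))).
    rewrite ler_pM ?(ltW hz2)// ?lerDl// !mulr_ge0// ltW//.
  by rewrite le_eqVlt; apply/orP; left; apply/eqP; field; rewrite gt_eqF.
lra.
Qed.

Lemma kl_lower : exists2 c, 0 < c & forall th0 th, KK th0 -> closure TH th ->
  c * `|th - th0| ^+ 2 <= kl th0 th.
Proof.
have [c c0 cP] := kl_sep; have [del d0 dP] := sep_near; have [kap kap0 kP] := sep_far d0.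
(* Far from th0 the separation is at least [kap], and |th - th0| <= 2 (|B| + 1) turns this into a
   multiple [b] of the square. *)
pose a := nu * c3 / 4; pose b := kap / (4 * (`|B| + 1) ^+ 2).
have a0 : 0 < a by rewrite divr_gt0// mulr_gt0.
have B0 : 0 < `|B| + 1 by rewrite ltr_wpDl.
have b0 : 0 < b by rewrite divr_gt0// mulr_gt0// exprn_gt0.
exists (c * Num.min a b); first by rewrite mulr_gt0// lt_min a0.
move=> th0 th K0 cth; have bth := closure_bounded cth; have bth0 := KB' K0.
apply: le_trans (cP _ _ bth0 bth); rewrite -mulrA ler_wpM2l ?(ltW c0)//.
have h0 : 0 <= `|th - th0| ^+ 2 by exact: sqr_ge0.
have [hd|/ltW hd] := leP `|th - th0| del.
  have := dP th0 (th - th0) K0 hd; rewrite [th0 + _]addrC subrK; apply: le_trans.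
  by rewrite ler_wpM2r// ge_min lexx.
apply: le_trans (kP _ _ K0 cth hd); apply: (@le_trans _ _ (b * `|th - th0| ^+ 2)).
  by rewrite ler_wpM2r// ge_min lexx orbT.
rewrite /b mulrAC ler_pdivrMr ?mulr_gt0 ?exprn_gt0// ler_wpM2l ?(ltW kap0)//.
rewrite (_ : 4 * _ = (2 * (`|B| + 1)) ^+ 2); last by rewrite exprMn -natrX.
rewrite ler_pXn2r ?nnegrE ?mulr_ge0 ?(ltW B0)// (le_trans (ler_normB _ _))//.
by have := ler_norm B; lra.
Qed.

Let small_factor (D e : R) : 0 <= D -> 0 < e -> exists2 d, 0 < d & d * D <= e.
Proof.
move=> D0 e0; have D1 : 0 < D + 1 by rewrite ltr_wpDl.
exists (e / (D + 1)); first by rewrite divr_gt0.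
by rewrite mulrAC ler_pdivrMr// ler_wpM2l ?(ltW e0)// lerDl.
Qed.

Let KT0 : 0 <= K%:R * T. Proof. by rewrite mulr_ge0// ltW. Qed.

(** Two replacements under the integral: the divergence by (l - l0)^2 / (2 l0), with cubic error,
    then l - l0 by its differential. *)
Lemma kl_expansion e : 0 < e -> exists2 del, 0 < del & forall th0 h, KK th0 -> `|h| <= del ->
  `|kl th0 (th0 + h) - infob th0 h h / 2| <= e * `|h| ^+ 2.
Proof.
move=> e0; have [C C0 CP] := lam_bound; have [CA CA0 CAP] := A_bound.
pose D1 := C ^+ 3 / nu ^+ 2 * ((C + nu) / nu); pose D2 := (C + 4 * CA) / (2 * nu).
have Cn : 0 < C + nu by rewrite addr_gt0.
have D10 : 0 <= D1 by rewrite !mulr_ge0 ?exprn_ge0 ?invr_ge0 ?exprn_ge0 ?(ltW C0) ?(ltW nu0) ?(ltW Cn).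
have D20 : 0 <= D2 by rewrite divr_ge0 ?addr_ge0 ?mulr_ge0 ?(ltW C0) ?(ltW nu0) ?(ltW CA0).
have e2 : 0 < e / 2 by rewrite divr_gt0.
have [e1 e10 e1P] := small_factor (mulr_ge0 KT0 D20) e2.
have [d1 d10 d1P] := small_factor (mulr_ge0 KT0 D10) e2.
have [del d0 dP] := lam_expansion e10.
exists (Num.min (Num.min d1 1) del); first by rewrite !lt_min d10 ltr01.
move=> th0 h K0; rewrite !le_min => /andP[/andP[hd1 h1] hd].
have n0 : 0 <= `|h| by [].
have b0 := KB' K0; have b1 := ball K0 h1.
rewrite /kl /infob mulrC -sint_scale; last by move=> k; exact: cinfo.
rewrite -sint_sub; [|by move=> k; exact: ckl|by move=> k t; apply: cvgM; [exact: cvg_cst|exact: cinfo]].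
apply: (@le_trans _ _ (K%:R * T * ((d1 * D1 + e1 * D2) * `|h| ^+ 2))); last first.
  rewrite mulrA ler_wpM2r ?sqr_ge0// mulrDr [e]splitr.
  by rewrite lerD// mulrCA ?(mulrC _ e1).
apply: sint_bound => // [k t|k t tT].
  apply: cvgB; first exact: ckl.
  by apply: cvgM; [exact: cvg_cst|exact: cinfo].
set l0 := lam k th0 t; set l := lam k (th0 + h) t; set a := dotv _ _.
have l00 : 0 < l0 by exact: lam0. have l10 : 0 < l by exact: lam0.
have nul0 : nu <= l0 by exact: lam_nu. have nul : nu <= l by exact: lam_nu.
have [q1 _] := CP k th0 th0 t b0 b0 tT; have [_ q2] := CP k _ _ t b1 b0 tT.
rewrite (addrC th0 h) addrK (addrC h th0) -/l -/l0 in q1 q2.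
have q3 := dP k th0 t h K0 tT hd; rewrite -/l -/l0 -/a in q3.
have l0C : l0 <= C by exact: le_trans (ler_norm _) q1.
have qa : `|a| <= 4 * CA * `|h|.
  by rewrite (le_trans (dotv_bound _ _))// -mulrA ler_wpM2l// ler_wpM2r// CAP.
(* [log_quad] asks for a number below both 1 and l / l0; nu <= l and l0 <= C yield this one. *)
pose a0 := nu / (C + nu).
have a00 : 0 < a0 by rewrite divr_gt0.
have a01 : a0 <= 1 by rewrite ler_pdivrMr// mul1r lerDr ltW.
have a0r : a0 <= l / l0.
  rewrite ler_pdivlMr// mulrAC ler_pdivrMr// ler_pM ?(ltW nu0) ?(ltW l00)//.
  by rewrite (le_trans l0C)// lerDl ltW.
have q4 := ler_wpM2l (ltW l00) (log_quad a00 a01 a0r).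
rewrite -{1}[l0](ger0_norm (ltW l00)) -normrM in q4.
have eq4 : l0 * (l / l0 - 1 - ln (l / l0) - (l / l0 - 1) ^+ 2 / 2) =
   l - l0 - l0 * (ln l - ln l0) - (l - l0) ^+ 2 / (2 * l0).
  by rewrite ln_div ?posrE//; field; rewrite gt_eqF.
rewrite eq4 in q4.
have eq5 : l0 * (`|l / l0 - 1| ^+ 3 / a0) = `|l - l0| ^+ 3 / l0 ^+ 2 * ((C + nu) / nu).
  rewrite (_ : l / l0 - 1 = (l - l0) / l0); last by field; rewrite gt_eqF.
  rewrite normrM [`|l0^-1|]ger0_norm ?invr_ge0 ?(ltW l00)// /a0.
  by field; rewrite (gt_eqF nu0) (gt_eqF l00) (gt_eqF Cn).
have t1 : `|l - l0 - l0 * (ln l - ln l0) - (l - l0) ^+ 2 / (2 * l0)| <= d1 * D1 * `|h| ^+ 2.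
  rewrite (le_trans q4)// eq5.
  apply: (@le_trans _ _ ((C * `|h|) ^+ 3 / nu ^+ 2 * ((C + nu) / nu))).
    rewrite ler_wpM2r ?divr_ge0 ?(ltW Cn) ?(ltW nu0)//.
    rewrite ler_pM ?exprn_ge0 ?invr_ge0 ?exprn_ge0 ?(ltW l00)//.
      by rewrite ler_pXn2r ?nnegrE ?mulr_ge0 ?(ltW C0).
    by rewrite lef_pV2 ?posrE ?exprn_gt0// ler_pXn2r ?nnegrE ?(ltW nu0) ?(ltW l00).
  rewrite [leLHS](_ : _ = `|h| * (D1 * `|h| ^+ 2)); last by rewrite /D1; ring.
  by rewrite -[leRHS]mulrA ler_wpM2r// mulr_ge0// sqr_ge0.
have t2 : `|(l - l0) ^+ 2 / (2 * l0) - 2^-1 * (a * a / l0)| <= e1 * D2 * `|h| ^+ 2.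
  rewrite (_ : _ - _ = (l - l0 - a) * (l - l0 + a) * (2 * l0)^-1); last by field; rewrite gt_eqF.
  rewrite (_ : e1 * D2 * `|h| ^+ 2 = (e1 * `|h|) * ((C + 4 * CA) * `|h|) * (2 * nu)^-1); last by rewrite /D2; ring.
  rewrite !normrM [`|(2 * l0)^-1|]ger0_norm ?invr_ge0 ?mulr_ge0 ?(ltW l00)//.
  rewrite ler_pM ?mulr_ge0 ?invr_ge0 ?mulr_ge0 ?(ltW l00)//; last first.
    by rewrite lef_pV2 ?posrE ?mulr_gt0// ler_wpM2l.
  rewrite ler_pM//; rewrite (le_trans (ler_normD _ _))// mulrDl lerD//.
rewrite (_ : _ - _ = (l - l0 - l0 * (ln l - ln l0) - (l - l0) ^+ 2 / (2 * l0)) +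
  ((l - l0) ^+ 2 / (2 * l0) - 2^-1 * (a * a / l0))); last by ring.
rewrite (le_trans (ler_normD _ _))// [leRHS]mulrDl; exact: lerD t1 t2.
Qed.

(** Uniform differentiability alone makes the gradient continuous: each coordinate is close to a
    difference quotient of fixed step d', and these quotients are Lipschitz in th. *)
Lemma grad_close e : 0 < e -> exists2 del, 0 < del & forall k th th' t, KK th -> KK th' ->
  0 <= t <= T -> `|th' - th| <= del -> `|A k th' t - A k th t| <= e.
Proof.
move=> e0; have e4 : 0 < e / 4 by rewrite divr_gt0.
have [C C0 CP] := lam_bound; have [d d0 dP] := lam_expansion e4.
pose d' := Num.min d 1; have d'0 : 0 < d' by rewrite lt_min d0 ltr01.
have [del del0 delP] := small_factor (ltW C0) (mulr_gt0 e4 d'0).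
exists del => // k th th' t Kt Kt' tT ht; apply: (@le_coord_norm _ 3) => a.
pose u : 'rV[R]_4 := d' *: delta_mx ord0 a.
have ud' : `|u| <= d'.
  rewrite normrZ ger0_norm ?(ltW d'0)// ler_piMr ?(ltW d'0)//.
  by apply: (@le_coord_norm _ 3) => j; rewrite mxE eqxx /=; case: (j == a); rewrite ?normr1 ?normr0.
have ud : `|u| <= d by rewrite (le_trans ud')// ge_min lexx.
have u1 : `|u| <= 1 by rewrite (le_trans ud')// ge_min lexx orbT.
have dotu v : dotv v u = d' * v ord0 a.
  rewrite dotvZr dotvE (bigD1 a)//= mxE !eqxx mulr1 big1 ?addr0// => j ja.
  by rewrite mxE (negbTE ja) andbF mulr0.
have p1 := dP k th t u Kt tT ud; have p2 := dP k th' t u Kt' tT ud.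
have [_ p3] := CP k _ _ t (ball Kt' u1) (ball Kt u1) tT.
have [_ p4] := CP k _ _ t (KB' Kt') (KB' Kt) tT.
rewrite opprD addrACA subrr addr0 in p3.
rewrite !dotu in p1 p2; rewrite !mxE -(ler_pM2l d'0) -{1}[d'](ger0_norm (ltW d'0)) -normrM.
have q1 : e / 4 * `|u| <= e / 4 * d' by rewrite ler_wpM2l// ltW.
have q2 : C * `|th' - th| <= e / 4 * d' by rewrite (le_trans _ delP)// mulrC ler_wpM2r// ltW.
have := le_trans p1 q1; have := le_trans p2 q1; have := le_trans p3 q2; have := le_trans p4 q2.
rewrite !ler_norml => /andP[? ?] /andP[? ?] /andP[? ?] /andP[? ?].
by apply/andP; split; lra.
Qed.

Lemma infob_upper : exists2 C, 0 < C & forall th h, KK th -> infob th h h <= C * `|h| ^+ 2.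
Proof.
have [CA CA0 CAP] := A_bound; exists (K%:R * T * ((4 * CA) ^+ 2 / nu) + 1).
  by rewrite ltr_wpDl// mulr_ge0// divr_ge0 ?sqr_ge0 ?(ltW nu0).
move=> th h Kt; rewrite mulrDl mul1r -[leLHS]addr0 lerD ?sqr_ge0//.
rewrite /infob (le_trans (ler_norm _))// -[leRHS]mulrA; apply: sint_bound => // k t tT.
have aB : `|dotv (A k th t) h| <= 4 * CA * `|h|.
  by rewrite (le_trans (dotv_bound _ _))// -mulrA ler_wpM2l// ler_wpM2r// CAP.
rewrite normrM [`|_^-1|]ger0_norm ?invr_ge0 ?(ltW (lam0 _ _ _))// mulrAC -exprMn.
rewrite ler_pM ?invr_ge0 ?(ltW (lam0 _ _ _))//; last by rewrite lef_pV2 ?posrE.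
by rewrite normrM expr2 ler_pM.
Qed.

Lemma infob_close e : 0 < e -> exists2 del, 0 < del & forall th th' x y, KK th -> KK th' -> `|th' - th| <= del ->
  `|infob th' x y - infob th x y| <= e * (`|x| * `|y|).
Proof.
move=> e0; have [C C0 CP] := lam_bound; have [CA CA0 CAP] := A_bound.
pose D1 := 2 * (16 * CA / nu); pose D2 := 16 * CA ^+ 2 * (C / nu ^+ 2).
have D10 : 0 <= D1 by rewrite mulr_ge0// divr_ge0 ?mulr_ge0 ?(ltW CA0) ?(ltW nu0).
have D20 : 0 <= D2 by rewrite !mulr_ge0 ?invr_ge0 ?exprn_ge0 ?(ltW CA0) ?(ltW nu0) ?(ltW C0).
have e2 : 0 < e / 2 by rewrite divr_gt0.
have [e1 e10 e1P] := small_factor (mulr_ge0 KT0 D10) e2.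
have [d1 d10 d1P] := small_factor (mulr_ge0 KT0 D20) e2.
have [del del0 delP] := grad_close e10.
exists (Num.min d1 del); first by rewrite lt_min d10.
move=> th th' x y Kt Kt'; rewrite le_min => /andP[hd1 hd].
rewrite /infob -sint_sub; [|by move=> k; exact: cinfo..].
apply: (@le_trans _ _ (K%:R * T * ((e1 * D1 + d1 * D2) * (`|x| * `|y|)))); last first.
  rewrite mulrA ler_wpM2r ?mulr_ge0// mulrDr [e]splitr.
  by rewrite lerD// mulrCA.
apply: sint_bound => // [k t|k t tT]; first by apply: cvgB; exact: cinfo.
have aB z (v : 'rV[R]_4) : KK z -> `|dotv (A k z t) v| <= 4 * CA * `|v|.
  by move=> Kz; rewrite (le_trans (dotv_bound _ _))// -mulrA ler_wpM2l// ler_wpM2r// CAP.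
have aD (v : 'rV[R]_4) : `|dotv (A k th' t) v - dotv (A k th t) v| <= 4 * e1 * `|v|.
  rewrite (_ : _ - _ = dotv (A k th' t - A k th t) v); last by rewrite dotvDl dotvNl.
  by rewrite (le_trans (dotv_bound _ _))// -mulrA ler_wpM2l// ler_wpM2r// delP.
have p'B := aB _ x Kt'; have qB := aB _ y Kt; have q'B := aB _ y Kt'; have pB := aB _ x Kt.
have pD := aD x; have qD := aD y.
have [_ lD] := CP k _ _ t (KB' Kt) (KB' Kt') tT.
set p := dotv (A k th t) x in pB pD *; set p' := dotv _ x in p'B pD *.
set q := dotv (A k th t) y in qB qD *; set q' := dotv _ y in q'B qD *.
set l := lam k th t in lD *; set l' := lam k th' t in lD *.
have l0 : 0 < l by exact: lam0. have l'0 : 0 < l' by exact: lam0.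
have nl : nu <= l by exact: lam_nu. have nl' : nu <= l' by exact: lam_nu.
have il : l^-1 <= nu^-1 by rewrite lef_pV2.
have il' : l'^-1 <= nu^-1 by rewrite lef_pV2.
have iV : `|l'^-1 - l^-1| <= C * d1 / nu ^+ 2.
  rewrite (_ : _ - _ = (l - l') * (l^-1 * l'^-1)); last by field; rewrite (gt_eqF l0) (gt_eqF l'0).
  rewrite normrM ler_pM//.
    by rewrite (le_trans lD)// ler_wpM2l ?(ltW C0)// distrC.
  rewrite ger0_norm ?mulr_ge0 ?invr_ge0 ?(ltW l0) ?(ltW l'0)// expr2 invfM.
  by rewrite ler_pM// invr_ge0 ltW.
have np : 0 <= `|x| by []. have nq : 0 <= `|y| by [].
have il0 : 0 <= l^-1 by rewrite invr_ge0 ltW.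
have inu : 0 <= nu^-1 by rewrite invr_ge0 ltW.
have t1 : `|(p' - p) * q * l^-1| <= 4 * e1 * `|x| * (4 * CA * `|y|) * nu^-1.
  by rewrite !normrM [`|l^-1|]ger0_norm// ler_pM ?mulr_ge0// ler_pM.
have t2 : `|p' * (q' - q) * l^-1| <= 4 * CA * `|x| * (4 * e1 * `|y|) * nu^-1.
  by rewrite !normrM [`|l^-1|]ger0_norm// ler_pM ?mulr_ge0// ler_pM.
have t3 : `|p' * q' * (l'^-1 - l^-1)| <= 4 * CA * `|x| * (4 * CA * `|y|) * (C * d1 / nu ^+ 2).
  by rewrite [X in X <= _]normrM ler_pM// normrM ler_pM.
rewrite (_ : p' * q' / l' - p * q / l = (p' - p) * q * l^-1 + p' * (q' - q) * l^-1 + p' * q' * (l'^-1 - l^-1)); last by ring.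
apply: le_trans (ler_normD _ _) _; apply: le_trans (lerD (le_trans (ler_normD _ _) (lerD t1 t2)) t3) _.
by rewrite le_eqVlt; apply/orP; left; apply/eqP; rewrite /D1 /D2; ring.
Qed.

End smooth_family.

(** * Expansion of the log-likelihood ratio *)

Lemma cum_parts (R : realType) (lam f f' : R -> R) (T : R) : 0 < T -> continuous lam ->
  (forall t : R, is_derive t 1 f (f' t)) -> continuous f' ->
  \int[@lebesgue_measure R]_(t in `[0, T]) (f t * lam t) =
  f T * cum lam T - \int[@lebesgue_measure R]_(t in `[0, T]) (f' t * cum lam t).
Proof.
move=> T0 cl fD cf'.
have il (a b : R) : (@lebesgue_measure R).-integrable `[a, b] (EFin \o lam) by exact: continuous_itv_integrable.
have D (x : R) : x \in `]0, T[ -> derivable (cum lam) x 1 /\ derive1 (cum lam) x = lam x.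
  rewrite in_itv/= => /andP[x0 xT]; apply: (@continuous_FTC1_closed _ lam 0 x T) => //; exact: cl.
rewrite (@Rintegration_by_parts _ f (cum lam) f' lam 0 T)//.
- by rewrite cum0 mulr0 subr0.
- exact: continuous_subspaceT.
- exact: is_derive_oo_LR fD.
- by move=> t _; rewrite derive1E; have [] := fD t.
- exact: continuous_subspaceT.
- split; first by move=> x xT; have [] := D x xT.
    rewrite cum0; apply: cvg_at_right_filter; exact: parameterized_integral_cvg_left T0 (il 0 T).
  exact: parameterized_integral_cvg_at_left T0 (il 0 T).
- by move=> x xT; have [] := D x xT.
Qed.

Section controlled.
Context {R : realType} {K : nat}.
Variables (T : R).
Local Notation leb := (@lebesgue_measure R).

(* [controlled] collects what is used of the compensated paths: [s] is [sqrt n] and [W] measures their size. *)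
Definition controlled (CJ s W : R) (M : 'I_K -> R -> R) :=
  (forall k (f' : R -> R), continuous f' -> leb.-integrable `[0, T] (EFin \o (fun t => f' t * M k t))) /\
  (forall k (f f' : R -> R) c, 0 <= c -> (forall t : R, is_derive t 1 f (f' t)) -> continuous f' ->
    (forall t, 0 <= t <= T -> `|f t| <= c) -> (forall t, 0 <= t <= T -> `|f' t| <= c) ->
    `|Jint T f f' (M k)| <= c * CJ * (s * W)).

Definition Jsum (M f f' : 'I_K -> R -> R) : R := \sum_(k < K) Jint T (f k) (f' k) (M k).

Variables (CJ s W : R) (M : 'I_K -> R -> R).
Hypothesis (cM : controlled CJ s W M).

Lemma Jsum_sub f f' g g' : (forall k, continuous (f' k)) -> (forall k, continuous (g' k)) ->
  Jsum M (fun k t => f k t - g k t) (fun k t => f' k t - g' k t) = Jsum M f f' - Jsum M g g'.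
Proof.
move=> cf cg; have [iM _] := cM; rewrite /Jsum -sumrB; apply: eq_bigr => k _; rewrite /Jint.
under eq_Rintegral do rewrite mulrBl.
rewrite RintegralB//; [|exact: iM..].
ring.
Qed.

Lemma Jsum_comb m (c : 'I_m -> R) (f f' : 'I_m -> 'I_K -> R -> R) : (forall a k, continuous (f' a k)) ->
  Jsum M (fun k t => \sum_(a < m) c a * f a k t) (fun k t => \sum_(a < m) c a * f' a k t) =
  \sum_(a < m) c a * Jsum M (f a) (f' a).
Proof.
elim: m c f f' => [|m IH] c f f' cf.
  rewrite big_ord0 /Jsum big1// => k _; rewrite /Jint big_ord0 mul0r.
  under eq_Rintegral do rewrite big_ord0 mul0r.
  by rewrite Rintegral_cst ?mul0r ?subr0//; exact: measurable_itv.
rewrite big_ord_recr/= -IH; last by move=> a k; exact: cf.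
have [iM _] := cM; rewrite /Jsum mulr_sumr -big_split/=; apply: eq_bigr => k _.
rewrite /Jint big_ord_recr/= mulrDl.
under eq_Rintegral do rewrite big_ord_recr/= mulrDl.
rewrite RintegralD//; last 2 first.
- apply: iM; apply: continuous_sum => a; apply: continuousM; [exact: continuousC|exact: cf].
- apply: iM; apply: continuousM; [exact: continuousC|exact: cf].
under [X in _ - (_ + X)]eq_Rintegral do rewrite -mulrA.
rewrite Rintegral_scale//; first by ring.
exact: iM.
Qed.

Lemma Jsum_bound f f' c : 0 <= c -> (forall k (t : R), is_derive t 1 (f k) (f' k t)) ->
  (forall k, continuous (f' k)) ->
  (forall k t, 0 <= t <= T -> `|f k t| <= c) -> (forall k t, 0 <= t <= T -> `|f' k t| <= c) ->
  `|Jsum M f f'| <= K%:R * (c * CJ * (s * W)).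
Proof.
move=> c0 fD cf fc f'c; have [_ bM] := cM.
rewrite (le_trans (ler_norm_sum _ _ _))//.
rewrite -[X in _ <= X%:R * _]card_ord mulr_natl -sumr_const ler_sum// => k _.
by apply: bM => //; [exact: fc|exact: f'c].
Qed.

End controlled.

Section log_likelihood.
Context {R : realType} {K : nat}.
Variables (T B nu : R) (KK TH : set 'rV[R]_4).
Variables (lam loglam' : 'I_K -> 'rV[R]_4 -> R -> R) (A score score' : 'I_K -> 'rV[R]_4 -> R -> 'rV[R]_4).
Hypotheses (T0 : 0 < T) (nu0 : 0 < nu) (KB : forall th, KK th -> `|th| + 1 <= B)
  (THB : forall th, TH th -> `|th| <= B)
  (lam_nu : forall k th t, nu <= lam k th t)
  (clam : forall k th, continuous (lam k th))
  (cA : forall k th h, continuous (fun t => dotv (A k th t) h))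
  (llam : forall k, lipf T B (lam k)) (dlam : forall k, diff T KK (lam k) (A k))
  (loglamD : forall k th (t : R), is_derive t 1 (fun t => ln (lam k th t)) (loglam' k th t))
  (cloglam' : forall k th, continuous (loglam' k th))
  (scoreD : forall k th h (t : R), is_derive t 1 (fun t => dotv (score k th t) h) (dotv (score' k th t) h))
  (cscore' : forall k th h, continuous (fun t => dotv (score' k th t) h))
  (lloglam : forall k, lipf T B (fun th t => ln (lam k th t))) (lloglam' : forall k, lipf T B (loglam' k))
  (dloglam : forall k, diff T KK (fun th t => ln (lam k th t)) (score k))
  (dloglam' : forall k, diff T KK (loglam' k) (score' k)).
Variable (c3 : R).
Hypotheses (c30 : 0 < c3) (r3 : forall th h, KK th -> c3 * `|h| ^+ 2 <= infob T lam A th h h)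
  (r4 : forall eps, 0 < eps -> exists2 kap, 0 < kap & forall th0 th, KK th0 -> TH th ->
    eps < enorm (th - th0) -> kap <= sep T lam th0 th).

Definition llr (th0 : 'rV[R]_4) (s : R) (M : 'I_K -> R -> R) (th : 'rV[R]_4) : R :=
  Jsum T M (fun k t => ln (lam k th t) - ln (lam k th0 t))
           (fun k t => loglam' k th t - loglam' k th0 t) - s ^+ 2 * kl T lam th0 th.

(** Built coordinate by coordinate from real stochastic integrals; [dotv_cscore] restores a single
    integral in a given direction by linearity. *)
Definition cscore (th0 : 'rV[R]_4) (s : R) (M : 'I_K -> R -> R) : 'rV[R]_4 :=
  \row_a (s^-1 * Jsum T M (fun k t => dotv (score k th0 t) (delta_mx ord0 a))
                          (fun k t => dotv (score' k th0 t) (delta_mx ord0 a))).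

Variable CJ : R.
Hypothesis CJ0 : 0 <= CJ.

Let KC0 : 0 <= K%:R * CJ. Proof. by rewrite mulr_ge0. Qed.

Lemma dotv_cscore th0 s W M h : controlled T CJ s W M ->
  dotv (cscore th0 s M) h =
  s^-1 * Jsum T M (fun k t => dotv (score k th0 t) h) (fun k t => dotv (score' k th0 t) h).
Proof.
move=> cM; have hE : h = \sum_a h ord0 a *: delta_mx ord0 a :> 'rV[R]_4 by exact: row_sum_delta.
have e (v : 'rV[R]_4) : dotv v h = \sum_(a < 4) h ord0 a * dotv v (delta_mx ord0 a).
  rewrite dotvE; apply: eq_bigr => a _; rewrite mulrC; congr (_ * _).
  rewrite dotvE (bigD1 a)//= mxE !eqxx mulr1 big1 ?addr0// => j ja.
  by rewrite mxE (negbTE ja) andbF mulr0.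
rewrite (_ : (fun k t => dotv (score k th0 t) h) = fun k t => \sum_(a < 4) h ord0 a * dotv (score k th0 t) (delta_mx ord0 a)); last first.
  by apply/funext => k; apply/funext => t; exact: e.
rewrite (_ : (fun k t => dotv (score' k th0 t) h) = fun k t => \sum_(a < 4) h ord0 a * dotv (score' k th0 t) (delta_mx ord0 a)); last first.
  by apply/funext => k; apply/funext => t; exact: e.
rewrite (@Jsum_comb _ _ _ _ _ _ _ cM 4 (fun a => h ord0 a) (fun a k t => dotv (score k th0 t) (delta_mx ord0 a))
   (fun a k t => dotv (score' k th0 t) (delta_mx ord0 a))); last by move=> a k; exact: cscore'.
rewrite dotvE mulr_sumr; apply: eq_bigr => a _; rewrite mxE; ring.
Qed.

Lemma score_bound : exists2 C, 0 < C & forall k th h t, KK th -> 0 <= t <= T ->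
  `|dotv (score k th t) h| <= C * `|h| /\ `|dotv (score' k th t) h| <= C * `|h|.
Proof.
have [k C D CD P th h t Kt tT|k|C C0 CP] := @common_bound R K (fun k C => forall th (h : 'rV[R]_4) t, KK th -> 0 <= t <= T ->
  `|dotv (score k th t) h| <= C * `|h| /\ `|dotv (score' k th t) h| <= C * `|h|); last first.
- by exists C.
- have [[C1 C10 P1] _] := dloglam k; have [[C2 C20 P2] _] := dloglam' k.
  exists (4 * C1 + 4 * C2); first by rewrite addr_ge0 ?mulr_ge0.
  move=> th h t Kt tT; split; rewrite (le_trans (dotv_bound _ _))// mulrA ler_wpM2r//.
    by rewrite (@le_trans _ _ (4 * C1)) ?lerDl ?mulr_ge0// ler_wpM2l// P1.
  by rewrite (@le_trans _ _ (4 * C2)) ?lerDr ?mulr_ge0// ler_wpM2l// P2.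
have [p1 p2] := P th h t Kt tT.
by split; [rewrite (le_trans p1)// ler_wpM2r|rewrite (le_trans p2)// ler_wpM2r].
Qed.

Lemma cscore_bound : exists2 C, 0 < C & forall th0 s W M, KK th0 -> 0 < s -> 0 <= W ->
  controlled T CJ s W M -> `|cscore th0 s M| <= C * W.
Proof.
have [C C0 CP] := score_bound; exists (K%:R * CJ * C + 1); first by rewrite ltr_wpDl// mulr_ge0// ltW.
move=> th0 s W M K0 s0 W0 cM; apply: (@le_coord_norm _ 3) => a.
have nd : `|(delta_mx ord0 a : 'rV[R]_4)| <= 1.
  by apply: (@le_coord_norm _ 3) => j; rewrite mxE eqxx /=; case: (j == a); rewrite ?normr1 ?normr0.
rewrite mxE normrM [`|s^-1|]ger0_norm ?invr_ge0 ?(ltW s0)//.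
rewrite ler_pdivrMl//.
apply: (le_trans (Jsum_bound cM (ltW C0) _ _ _ _)).
- by move=> k; exact: cscore'.
- move=> k t tT; have [h _] := CP k th0 (delta_mx ord0 a) t K0 tT.
  by rewrite (le_trans h)// ler_piMr ?(ltW C0).
- move=> k t tT; have [_ h] := CP k th0 (delta_mx ord0 a) t K0 tT.
  by rewrite (le_trans h)// ler_piMr ?(ltW C0).
rewrite [leLHS](_ : _ = s * (K%:R * CJ * C * W)); last by ring.
by rewrite ler_wpM2l ?(ltW s0)// ler_wpM2r// lerDl.
Qed.

(** ln lambda and its time derivative are Lipschitz in th on the ball, so the stochastic part is at
    most a multiple of |th - th0| s W; [kl_lower] supplies the quadratic term. *)
Lemma llr_upper : exists C c, [/\ 0 < C, 0 < c & forall th0 s W M th, KK th0 -> 0 < s -> 0 <= W ->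
  closure TH th -> controlled T CJ s W M ->
  llr th0 s M th <= C * (s * `|th - th0|) * W - c * (s * `|th - th0|) ^+ 2].
Proof.
have [c c0 cP] := kl_lower T0 nu0 KB THB lam_nu clam cA llam dlam c30 r3 r4.
have [k C D CD P th th' t b b' tT|k|C C0 CP] := @common_bound R K (fun k C => forall th th' t, `|th| <= B -> `|th'| <= B -> 0 <= t <= T ->
  `|ln (lam k th t) - ln (lam k th' t)| <= C * `|th - th'| /\ `|loglam' k th t - loglam' k th' t| <= C * `|th - th'|).
- have [p1 p2] := P th th' t b b' tT.
  by split; [rewrite (le_trans p1)// ler_wpM2r|rewrite (le_trans p2)// ler_wpM2r].
- have [C1 C10 P1] := lloglam k; have [C2 C20 P2] := lloglam' k; exists (C1 + C2); first exact: addr_ge0.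
  move=> th th' t b b' tT; have [_ p1] := P1 th th' t b b' tT; have [_ p2] := P2 th th' t b b' tT.
  by split; [rewrite (le_trans p1)// ler_wpM2r// lerDl|rewrite (le_trans p2)// ler_wpM2r// lerDr].
exists (K%:R * CJ * C + 1), c; split => //; first by rewrite ltr_wpDl// mulr_ge0// ltW.
move=> th0 s W M th K0 s0 W0 cth cM.
have b : `|th| <= B := closure_bounded THB cth.
have b0 : `|th0| <= B by exact: (in_ball KB).
have n0 : 0 <= C * `|th - th0| by rewrite mulr_ge0// ltW.
have J : `|Jsum T M (fun k t => ln (lam k th t) - ln (lam k th0 t))
           (fun k t => loglam' k th t - loglam' k th0 t)| <= K%:R * (C * `|th - th0| * CJ * (s * W)).
  apply: (Jsum_bound cM n0).
  - by move=> k t; apply: cvgB; exact: cloglam'.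
  - by move=> k t tT; have [] := CP k th th0 t b b0 tT.
  - by move=> k t tT; have [] := CP k th th0 t b b0 tT.
rewrite /llr; apply: lerD.
  rewrite (le_trans (ler_norm _))// (le_trans J)//.
  rewrite [leLHS](_ : _ = K%:R * CJ * C * (s * `|th - th0| * W)); last by ring.
  by rewrite -[leRHS]mulrA ler_wpM2r ?lerDl// !mulr_ge0// ltW.
rewrite lerN2 exprMn mulrCA ler_wpM2l ?sqr_ge0// cP//.
Qed.

(** The stochastic part of the error is [Jsum] of the Taylor remainder of ln lambda in th. The C^1
    bound on [Jsum] asks that the time derivative of this remainder be small as well, whence the
    expansion of [loglam']. *)
Lemma llr_expansion e : 0 < e -> exists2 del, 0 < del & forall th0 s W M h, KK th0 -> 0 < s -> 0 <= W ->
  `|h| <= del -> controlled T CJ s W M ->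
  `|llr th0 s M (th0 + h) - (s * dotv (cscore th0 s M) h - s ^+ 2 / 2 * infob T lam A th0 h h)|
  <= e * (s * `|h| * W + (s * `|h|) ^+ 2).
Proof.
move=> e0; have [d1 d10 P1] := kl_expansion T0 nu0 KB lam_nu clam cA llam dlam e0.
pose e1 := e / (K%:R * CJ + 1).
have D0 : 0 < K%:R * CJ + 1 by rewrite ltr_wpDl.
have e10 : 0 < e1 by rewrite divr_gt0.
have [k C D DC P th t h Kt tT hD|k|d2 d20 P2] := @common_delta R K (fun k d => forall th t (h : 'rV[R]_4), KK th -> 0 <= t <= T -> `|h| <= d ->
  `|ln (lam k (th + h) t) - ln (lam k th t) - dotv (score k th t) h| <= e1 * `|h| /\
  `|loglam' k (th + h) t - loglam' k th t - dotv (score' k th t) h| <= e1 * `|h|).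
- exact: P (le_trans hD DC).
- have [_ /(_ e1 e10)[a1 a10 Q1]] := dloglam k; have [_ /(_ e1 e10)[a2 a20 Q2]] := dloglam' k.
  exists (Num.min a1 a2); first by rewrite lt_min a10.
  by move=> th t h Kt tT; rewrite le_min => /andP[h1 h2]; split; [exact: Q1|exact: Q2].
exists (Num.min d1 d2); first by rewrite lt_min d10.
move=> th0 s W M h K0 s0 W0; rewrite le_min => /andP[hd1 hd2] cM.
rewrite (dotv_cscore _ _ cM) mulVKf ?gt_eqF// /llr.
set J1 := Jsum _ _ _ _; set J2 := Jsum _ _ _ _; set k1 := kl _ _ _ _; set i1 := infob _ _ _ _ _ _.
have hk : `|k1 - i1 / 2| <= e * `|h| ^+ 2 by exact: P1.
have hJ : `|J1 - J2| <= K%:R * (e1 * `|h| * CJ * (s * W)).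
  rewrite /J1 /J2 -(Jsum_sub cM); last 2 first.
  - by move=> k t; apply: cvgB; exact: cloglam'.
  - by move=> k; exact: cscore'.
  apply: (Jsum_bound cM).
  - by rewrite mulr_ge0// ltW.
  - by move=> k t; apply: cvgB; [apply: cvgB; exact: cloglam'|exact: cscore'].
  - by move=> k t tT; have [] := P2 k th0 t h K0 tT hd2.
  - by move=> k t tT; have [] := P2 k th0 t h K0 tT hd2.
rewrite (_ : J1 - _ - _ = (J1 - J2) - s ^+ 2 * (k1 - i1 / 2)); last by field.
rewrite (le_trans (ler_normB _ _))// [leRHS]mulrDr; apply: lerD.
  rewrite (le_trans hJ)// [leLHS](_ : _ = e1 * (K%:R * CJ) * (s * `|h| * W)); last by ring.
  rewrite ler_wpM2r ?mulr_ge0 ?(ltW s0)//.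
  by rewrite /e1 mulrAC ler_pdivrMr// ler_wpM2l ?(ltW e0)// lerDl.
rewrite normrM ger0_norm ?sqr_ge0// exprMn mulrCA ler_wpM2l ?sqr_ge0//.
Qed.

End log_likelihood.

Lemma observed_controlled (R : realType) (K : nat) d (Om : measurableType d) (P : probability Om R)
    (T L : R) (lam : 'I_K -> R -> R) (X : 'I_K -> Om -> cumulative R R) (n : nat) (om : Om) :
  0 < T -> 0 <= L -> (0 < n)%N -> (forall k, continuous (lam k)) -> (forall k t, 0 <= lam k t) ->
  (forall k t, 0 <= t <= T -> lam k t <= L) ->
  (forall k, poisson_process P T (fun t => n%:R * lam k t) (X k)) ->
  controlled T (1 + 2 * T + 2 * L * T ^+ 2) (Num.sqrt n%:R) (fluct T lam X n om)
    (fun k => comp (lam k) (X k om) n%:R).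
Proof.
move=> T0 L0 n0 cl l0 lL pp; split.
  move=> k f' cf'; have [b b0 bP] := @continuous_itv_bounded R f' 0 T cf'.
  have Xm : {homo (X k om : R -> R) : u v / u <= v} by exact: cumulative_is_nondecreasing.
  have X0 : X k om 0 = 0 by have [/(_ om)[]] := pp k.
  exact: (@f'comp_integrable _ (lam k) T L (@cl k) (l0 k) (lL k) (X k om) n%:R b f' X0 Xm (ler0n _ _) L0 cf' bP 0 T (lexx _) (lexx _)).
move=> k f f' c c0 fD cf' fc f'c.
exact: (@Jint_bound _ _ _ _ P T L lam X n T0 L0 n0 cl l0 lL pp (fun _ => f) (fun _ => f') c c0
  (fun _ => fD) (fun _ => cf') (fun _ => fc) (fun _ => f'c) k om).
Qed.

(** * The network as a smooth family *)

Lemma ereal_inf_gt0 (R : realType) (A : set (\bar R)) : (0 < ereal_inf A)%E ->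
  exists2 c : R, 0 < c & forall x, A x -> (c%:E <= x)%E.
Proof.
move=> h; case e : (ereal_inf A) h => [c| |] // h.
  by exists c => // x Ax; rewrite -e; exact: ereal_inf_lbound.
exists 1 => // x Ax; have := ereal_inf_lbound Ax; rewrite e leye_eq => /eqP ->.
exact: leey.
Qed.

Lemma nondecreasing_product_integrable (R : realType) (f' F : R -> R) (T : R) : continuous f' ->
  F 0 = 0 -> {homo F : u v / u <= v} ->
  (@lebesgue_measure R).-integrable `[0, T] (EFin \o (fun t => f' t * F t)).
Proof.
move=> cf F0 Fm; have [b b0 bP] := @continuous_itv_bounded R f' 0 T cf.
apply: (@itv_bounded_integrable _ _ 0 T (b * F T)).
  apply: measurable_funTS; apply: measurable_funM; first exact: continuous_measurable_fun.
  exact: (nondecreasing_measurable measurableT Fm).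
move=> t /andP[t0 tT]; rewrite normrM ler_pM//; first by rewrite bP// t0.
by rewrite ger0_norm; [exact: Fm|rewrite -F0; exact: Fm].
Qed.

Lemma sint_comb (R : realType) (K : nat) (T : R) m (c : 'I_m -> R) (f : 'I_m -> 'I_K -> R -> R) :
  (forall a k, continuous (f a k)) ->
  sint T (fun k t => \sum_(a < m) c a * f a k t) = \sum_(a < m) c a * sint T (f a).
Proof.
elim: m c f => [|m IH] c f cf.
  rewrite big_ord0 /sint big1// => k _; under eq_Rintegral do rewrite big_ord0.
  by rewrite Rintegral_cst ?mul0r//; exact: measurable_itv.
rewrite big_ord_recr/= -IH; last by move=> a k; exact: cf.
rewrite -sint_scale; last by move=> k; exact: cf.
rewrite -sint_add//.
- by congr sint; apply/funext => k; apply/funext => t; rewrite big_ord_recr.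
- by move=> k; apply: continuous_sum => a; apply: continuousM; [exact: continuousC|exact: cf].
- by move=> k; apply: continuousM; [exact: continuousC|exact: cf].
Qed.

Lemma dotv_sum_delta (R : realType) n (v h : 'rV[R]_n) :
  dotv v h = \sum_a h ord0 a * dotv v (delta_mx ord0 a).
Proof.
rewrite dotvE; apply: eq_bigr => a _; rewrite mulrC; congr (_ * _).
rewrite dotvE (bigD1 a)//= mxE !eqxx mulr1 big1 ?addr0// => j ja.
by rewrite mxE (negbTE ja) andbF mulr0.
Qed.

Lemma enormZ (R : realType) n (a : R) (x : 'rV[R]_n) : enorm (a *: x) = `|a| * enorm x.
Proof.
rewrite /enorm -sqrtr_sqr -sqrtrM ?sqr_ge0//; congr Num.sqrt.
by rewrite mulr_sumr; apply: eq_bigr => i _; rewrite mxE exprMn.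
Qed.

Lemma local_lip_continuous (R : realType) (V : normedModType R) (f : V -> R) (x : V) (M : R) : 0 < M ->
  (forall y, `|x - y| <= 1 -> `|f x - f y| <= M * `|x - y|) -> {for x, continuous f}.
Proof.
move=> M0 key; apply/cvgrPdist_le => e e0.
have h : \forall y \near x, `|x - y| < Num.min 1 (e / M).
  by apply: (@cvgr_dist_lt _ _ _ (nbhs x) _ id x cvg_id); rewrite lt_min ltr01 divr_gt0.
apply: filterS h => y; rewrite lt_min => /andP[h1 h2].
by rewrite (le_trans (key _ (ltW h1)))// mulrC -ler_pdivlMr// ltW.
Qed.

Lemma compact_open_margin (R : realType) (V : normedModType R) (A O : set V) :
  compact A -> open O -> A `<=` O ->
  exists2 rho, 0 < rho & forall x h, A x -> `|h| <= rho -> O (x + h).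
Proof.
move=> /compact_near_coveringP nA oO AO.
pose P (del : R) (x : V) := forall h, `|h| <= del -> O (x + h).
have h : \forall del \near 0^'+, A `<=` P del.
  apply: nA => x Ax.
  have /nbhs_ballP[d0 /= d00 dO] := open_nbhs_nbhs (conj oO (AO x Ax)).
  near=> z del => h hd.
  have xz : ball x (d0 / 2) z by near: z; apply: nbhsx_ballx; rewrite divr_gt0.
  have ed : del < d0 / 2.
    by near: del; apply: nbhs_right_lt; rewrite divr_gt0.
  move: xz; rewrite -ball_normE /= => xz.
  apply: dO; rewrite -ball_normE /= opprD addrA (le_lt_trans (ler_normB _ _))//.
  by rewrite [ltRHS]splitr ltrD// (le_lt_trans hd).
near (0 : R)^'+ => del; exists del; first by near: del; exact: nbhs_right_gt.
have hP : A `<=` P del by near: del.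
by move=> x h' Ax; exact: hP.
Unshelve. all: by end_near.
Qed.

(* A deterministic form of local asymptotic normality for a log-likelihood ratio [Q]: [s] is [sqrt n],
   [D] the score, [J] the information, [W] the size of the noise and [mod] a modulus, all uniform in the base point. *)
Definition lan (R : realType) (C c : R) (mod : R -> R) (TH : set 'rV[R]_4) (s W : R)
    (th0 D : 'rV[R]_4) (J : 'M[R]_4) (Q : 'rV[R]_4 -> R) : Prop :=
  [/\ `|D| <= C * W,
      J^T = J /\ (forall x, c * `|x| ^+ 2 <= bil J x x <= C * `|x| ^+ 2),
      forall th, closure TH th -> Q th <= C * (s * `|th - th0|) * W - c * (s * `|th - th0|) ^+ 2 &
      forall e h, 0 < e -> `|h| <= mod e ->
        `|Q (th0 + h) - (s * dotv D h - s ^+ 2 / 2 * bil J h h)| <= e * (s * `|h| * W + (s * `|h|) ^+ 2)].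

Section network.
Context {R : realType} {K : nat}.
Variables (N : network R K).
Hypotheses (speed_gt0 : 0 < speed N) (horizon_gt0 : 0 < horizon N) (noise_gt0 : 0 < noise N)
  (front_ge0 : forall (i : 'I_2) (k : 'I_K) (t : R), 0 <= front N i k t)
  (source_detector : forall th : 'rV[R]_4, param N th ->
       forall (i : 'I_2) (k : 'I_K), source th i <> detector N k)
  (r2 : cond_R2 N) (r3 : cond_R3 N) (r4 : cond_R4 N).

Local Notation T := (horizon N).
Local Notation lam := (intensity N).

Definition front' (i : 'I_2) (k : 'I_K) : R -> R := derive1 (front N i k).
Definition front'' (i : 'I_2) (k : 'I_K) : R -> R := derive1 (front' i k).

Let fD (i : 'I_2) (k : 'I_K) (t : R) : is_derive t 1 (front N i k) (front' i k t).
Proof.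
have [/(_ i k)[h _ _] _ _ _] := r2; apply: DeriveDef; first exact: h.
by rewrite /front' derive1E.
Qed.
Let f'D (i : 'I_2) (k : 'I_K) (t : R) : is_derive t 1 (front' i k) (front'' i k t).
Proof.
have [/(_ i k)[_ h _] _ _ _] := r2; apply: DeriveDef; first exact: h.
by rewrite /front'' derive1E.
Qed.
Let cf'' (i : 'I_2) (k : 'I_K) : continuous (front'' i k).
Proof. by have [/(_ i k)[_ _ h] _ _ _] := r2. Qed.

Definition nscore := score N front'.
Definition nscore' := score' N front' front''.
Definition nll' := loglam' N front'.
Let A := lam_grad N front'.

Let clam k th : continuous (lam k th) := @continuous_intensity _ _ _ _ fD k th.
Let cA k th h : continuous (fun t => dotv (A k th t) h) := @continuous_lam_grad _ _ _ _ _ f'D k th h.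
Let lam_nu k th t : noise N <= lam k th t := intensity_ge front_ge0 k th t.
Let lam0 k th t : 0 < lam k th t := intensity_gt0 noise_gt0 front_ge0 k th t.
Let llD := loglamD noise_gt0 front_ge0 fD.
Lemma continuous_nll' k th : continuous (nll' k th).
Proof. exact: (continuous_loglam' noise_gt0 front_ge0 fD f'D). Qed.
Let cll' := continuous_nll'.

Lemma nscoreD k th h (t : R) : is_derive t 1 (fun t => dotv (nscore k th t) h) (dotv (nscore' k th t) h).
Proof. exact: (scoreD noise_gt0 front_ge0 fD f'D). Qed.

Lemma continuous_nscore' k th h : continuous (fun t => dotv (nscore' k th t) h).
Proof. exact: (continuous_score' noise_gt0 front_ge0 fD f'D cf''). Qed.

Definition npath n (X : 'I_K -> cumulative R R) (th0 : 'rV[R]_4) (k : 'I_K) : R -> R :=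
  comp (lam k th0) (X k) n%:R.

Definition nllr n (X : 'I_K -> cumulative R R) (th0 : 'rV[R]_4) : 'rV[R]_4 -> R :=
  llr T lam nll' th0 (Num.sqrt n%:R) (npath n X th0).

Definition ncscore n (X : 'I_K -> cumulative R R) (th0 : 'rV[R]_4) : 'rV[R]_4 :=
  cscore T nscore nscore' th0 (Num.sqrt n%:R) (npath n X th0).

Let ic (f : R -> R) : continuous f -> (@lebesgue_measure R).-integrable `[0, T] (EFin \o f).
Proof. by move=> cf; exact: continuous_itv_integrable. Qed.

Lemma likelihood_parts n (X : 'I_K -> cumulative R R) th : (0 < n)%N -> (forall k, X k 0 = 0) ->
  likelihood N n X th = expR (\sum_(k < K) ((ln (lam k th T) - ln (noise N)) * X k T -
    \int[@lebesgue_measure R]_(t in `[0, T]) (nll' k th t * X k t) -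
    (n%:R * \int[@lebesgue_measure R]_(t in `[0, T]) lam k th t -
     \int[@lebesgue_measure R]_(t in `[0, T]) (n%:R * noise N)))).
Proof.
move=> n0 X0; have nR : 0 < n%:R :> R by rewrite ltr0n.
rewrite /likelihood -sumrB; congr expR; apply: eq_bigr => k _; congr (_ - _).
  have D (t : R) : is_derive t 1 (fun t => ln (lam k th t) - ln (noise N)) (nll' k th t).
    by apply: (Deq (Dadd (llD k th t) (Dopp (Dcst t _)))); rewrite oppr0 addr0.
  have := stieltjes_parts (X0 k) (ltW horizon_gt0) D (@cll' k th).
  move=> <-; apply: eq_Rintegral => t _; have l0 := lam0 k th t.
  rewrite ln_div ?posrE ?mulr_gt0// !lnM ?posrE//; ring.
rewrite RintegralB//; last 2 first.
- by apply: ic; apply: continuousM; [exact: continuousC|exact: clam].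
- by apply: ic; exact: continuousC.
by rewrite Rintegral_itv_scale//; exact: clam.
Qed.

(** Compensating the path adds and subtracts n times the integral of ln (lambda th / lambda th0)
    against lambda th0; together with the deterministic part of the likelihood this makes - n
    [kl]. *)
Lemma likelihood_nllr n (X : 'I_K -> cumulative R R) th0 th : (0 < n)%N -> (forall k, X k 0 = 0) ->
  likelihood N n X th = likelihood N n X th0 * expR (nllr n X th0 th).
Proof.
move=> n0 X0; have nR : 0 < n%:R :> R by rewrite ltr0n.
have Xm k : {homo (X k : R -> R) : u v / u <= v} by exact: cumulative_is_nondecreasing.
rewrite !likelihood_parts// -expRD; congr expR.
rewrite /nllr /llr /Jsum /kl /sint sqr_sqrtr ?(ltW nR)// mulr_sumr.
rewrite -sumrB -big_split/=; apply: eq_bigr => k _.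
have cf : continuous (fun t => ln (lam k th t) - ln (lam k th0 t)).
  apply: (@is_derive_continuous _ _ (fun t => nll' k th t - nll' k th0 t)) => t.
  by apply: Dadd; [exact: llD|apply: Dopp; exact: llD].
have cf' : continuous (fun t => nll' k th t - nll' k th0 t).
  by move=> t; apply: cvgB; exact: cll'.
have cm : {homo cum (lam k th0) : u v / u <= v}.
  by apply: cum_homo; [exact: clam|move=> t; exact: ltW].
have J : Jint T (fun t => ln (lam k th t) - ln (lam k th0 t)) (fun t => nll' k th t - nll' k th0 t)
    (npath n X th0 k) =
  (ln (lam k th T) - ln (lam k th0 T)) * X k T -
  (\int[@lebesgue_measure R]_(t in `[0, T]) (nll' k th t * X k t) - \int[@lebesgue_measure R]_(t in `[0, T]) (nll' k th0 t * X k t))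
  - n%:R * \int[@lebesgue_measure R]_(t in `[0, T]) ((ln (lam k th t) - ln (lam k th0 t)) * lam k th0 t).
  have dD (t : R) : is_derive t 1 (fun t => ln (lam k th t) - ln (lam k th0 t)) (nll' k th t - nll' k th0 t).
    by apply: Dadd; [exact: llD|apply: Dopp; exact: llD].
  have cp := cum_parts horizon_gt0 (@clam k th0) dD cf'; rewrite cp.
  rewrite -RintegralB//; last 2 first.
  - exact: (nondecreasing_product_integrable _ (@cll' k th) (X0 k) (@Xm k)).
  - exact: (nondecreasing_product_integrable _ (@cll' k th0) (X0 k) (@Xm k)).
  rewrite /Jint /npath /comp.
  have icum := nondecreasing_product_integrable T cf' (cum0 (lam k th0)) cm.
  have -> : \int[@lebesgue_measure R]_(t in `[0, T]) ((nll' k th t - nll' k th0 t) * (X k t - n%:R * cum (lam k th0) t)) =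
    \int[@lebesgue_measure R]_(t in `[0, T]) ((nll' k th t - nll' k th0 t) * X k t) -
    \int[@lebesgue_measure R]_(t in `[0, T]) (n%:R * ((nll' k th t - nll' k th0 t) * cum (lam k th0) t)).
    rewrite -RintegralB//.
    - by apply: eq_Rintegral => t _; ring.
    - exact: (nondecreasing_product_integrable _ cf' (X0 k) (@Xm k)).
    - by apply: integrable_scale.
  have mT : measurable (`[0, T]%classic : set (measurableTypeR R)) by exact: measurable_itv.
  have -> := @Rintegral_scale _ _ (measurableTypeR R) _ _ n%:R _ mT icum.
  under [X in _ = _ - X - _]eq_Rintegral do rewrite -mulrBl.
  have alg (f x m c a b : R) : f * (x - m * c) - (a - m * b) = f * x - a - m * (f * c - b) by ring.
  exact: alg.
rewrite J.
have -> : \int[@lebesgue_measure R]_(t in `[0, T]) (lam k th t - lam k th0 t - lam k th0 t * (ln (lam k th t) - ln (lam k th0 t))) =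
  \int[@lebesgue_measure R]_(t in `[0, T]) lam k th t - \int[@lebesgue_measure R]_(t in `[0, T]) lam k th0 t -
  \int[@lebesgue_measure R]_(t in `[0, T]) ((ln (lam k th t) - ln (lam k th0 t)) * lam k th0 t).
  have -> : \int[@lebesgue_measure R]_(t in `[0, T]) ((ln (lam k th t) - ln (lam k th0 t)) * lam k th0 t) =
    \int[@lebesgue_measure R]_(t in `[0, T]) (lam k th0 t * (ln (lam k th t) - ln (lam k th0 t))).
    by apply: eq_Rintegral => t _; rewrite mulrC.
  rewrite RintegralB//; last 2 first.
  - by apply: ic; move=> t; apply: cvgB; exact: clam.
  - by apply: ic; move=> t; apply: cvgM; [exact: clam|exact: cf].
  by rewrite RintegralB//; apply: ic; exact: clam.
have alg (l l0 nu x a a0 p p0 q b m : R) : (l - nu) * x - a - (m * p - b) =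
    (l0 - nu) * x - a0 - (m * p0 - b) + ((l - l0) * x - (a - a0) - m * q - m * (p - p0 - q)) by ring.
exact: alg.
Qed.

(** Locally Lipschitz on all of R^4, not only on Theta: the measurability of the posterior integrals
    rests on it. The stochastic part is [Jsum] of a difference at two points of a common ball. *)
Lemma continuous_nllr n (X : 'I_K -> cumulative R R) th0 CJ W : 0 <= CJ -> 0 <= W ->
  controlled T CJ (Num.sqrt n%:R) W (npath n X th0) -> continuous (nllr n X th0).
Proof.
move=> CJ0 W0 cM x; pose B := `|x| + `|th0| + 1.
have [C C0 CP] := lam_bound (lipf_intensity B speed_gt0 horizon_gt0 fD f'D).
have ll := lipf_loglam B speed_gt0 horizon_gt0 noise_gt0 front_ge0 fD f'D.
have ll' := lipf_loglam' B speed_gt0 horizon_gt0 noise_gt0 front_ge0 fD f'D cf''.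
have [D D0 DP] := lam_bound ll; have [E E0 EP] := lam_bound ll'.
set s := Num.sqrt n%:R in cM.
have s0 : 0 <= s by exact: sqrtr_ge0.
pose M := K%:R * ((D + E) * CJ * (s * W)) + s ^+ 2 * (K%:R * T * (C + C * D)) + 1.
have DE0 : 0 <= D + E by rewrite addr_ge0// ltW.
have M1 : 0 <= K%:R * ((D + E) * CJ * (s * W)) by rewrite !mulr_ge0.
have M2 : 0 <= s ^+ 2 * (K%:R * T * (C + C * D)).
  have CD0 : 0 <= C + C * D by rewrite addr_ge0 ?mulr_ge0 ?(ltW C0) ?(ltW D0).
  have KT0 : 0 <= K%:R * T by rewrite mulr_ge0 ?(ltW horizon_gt0).
  exact: mulr_ge0 (sqr_ge0 s) (mulr_ge0 KT0 CD0).
have M0 : 0 < M by rewrite ltr_wpDl// addr_ge0.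
have xB : `|x| <= B by rewrite /B -addrA lerDl addr_ge0.
have tB : `|th0| <= B by rewrite /B addrAC lerDr addr_ge0.
have key y : `|x - y| <= 1 -> `|nllr n X th0 x - nllr n X th0 y| <= M * `|x - y|.
  move=> xy; have yB : `|y| <= B.
    have : `|y| <= `|x| + `|x - y| by rewrite -{1}(subKr x y) ler_normB.
    by move=> t; rewrite (le_trans t)// /B -addrA lerD2l (le_trans xy)// lerDr.
  have h0 : 0 <= `|x - y| by [].
  rewrite /nllr /llr -/s.
  have sub3 (a b c : R) : a - c - (b - c) = a - b by ring.
  set J1 := Jsum _ _ _ _; set J2 := Jsum _ _ _ _.
  have hJ : `|J1 - J2| <= K%:R * ((D + E) * `|x - y| * CJ * (s * W)).
    rewrite /J1 /J2 -(Jsum_sub cM); last 2 first.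
    - by move=> k t; apply: cvgB; exact: cll'.
    - by move=> k t; apply: cvgB; exact: cll'.
    rewrite (_ : (fun k t => _ - _) = fun k t => ln (lam k x t) - ln (lam k y t)); last first.
      by apply/funext => k; apply/funext => t; exact: sub3.
    rewrite (_ : (fun k t => nll' k x t - _ - _) = fun k t => nll' k x t - nll' k y t); last first.
      by apply/funext => k; apply/funext => t; exact: sub3.
    apply: (Jsum_bound cM); first by rewrite mulr_ge0.
    - by move=> k t; apply: Dadd; [exact: llD|apply: Dopp; exact: llD].
    - by move=> k t; apply: cvgB; exact: cll'.
    - move=> k t tT; have [_ h] := DP k x y t xB yB tT; rewrite (le_trans h)// ler_wpM2r// lerDl ltW//.
    - move=> k t tT; have [_ h] := EP k x y t xB yB tT; rewrite (le_trans h)// ler_wpM2r// lerDr ltW//.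
  have cln k th : continuous (fun t => ln (lam k th t)) by exact: is_derive_continuous (@llD k th).
  have ck k th : continuous (fun t => lam k th t - lam k th0 t - lam k th0 t * (ln (lam k th t) - ln (lam k th0 t))).
    move=> t; apply: cvgB; first by apply: cvgB; exact: clam.
    by apply: cvgM; [exact: clam|apply: cvgB; exact: cln].
  have sub_affine (a b c u v w : R) : a - c - c * (u - w) - (b - c - c * (v - w)) = (a - b) - c * (u - v) by ring.
  have hk : `|kl T lam th0 x - kl T lam th0 y| <= K%:R * T * ((C + C * D) * `|x - y|).
    rewrite /kl -sint_sub; [|by move=> k; exact: ck..].
    apply: sint_bound => // [k t|k t tT]; first by apply: cvgB; exact: ck.
    have [_ h1] := CP k x y t xB yB tT; have [_ h2] := DP k x y t xB yB tT.
    have [h3 _] := CP k th0 th0 t tB tB tT.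
    rewrite sub_affine.
    rewrite (le_trans (ler_normB _ _))// [leRHS]mulrDl lerD// normrM -mulrA ler_pM//.
  move: hk; set k1 := kl T lam th0 x; set k2 := kl T lam th0 y => hk.
  have alg (a b u v r : R) : a - r * u - (b - r * v) = (a - b) - r * (u - v) by ring.
  rewrite alg (le_trans (ler_normB _ _))// normrM [`|s ^+ 2|]ger0_norm ?sqr_ge0//.
  apply: (le_trans (lerD hJ (ler_wpM2l (sqr_ge0 s) hk))).
  have alg2 (a b u v w r : R) : a * (u * r * v * b) + w * (K%:R * T * (C + C * D) * r) =
    (a * (u * v * b) + w * (K%:R * T * (C + C * D))) * r by ring.
  by rewrite [X in s ^+ 2 * X]mulrA alg2 /M ler_wpM2r// lerDl ler01.
exact: local_lip_continuous M0 key.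
Qed.

Section compact.
Variables (KK : set 'rV[R]_4).
Hypotheses (cKK : compact KK) (KP : KK `<=` param N).

Let sd th : KK th -> forall (i : 'I_2) (k : 'I_K), source th i <> detector N k.
Proof. by move=> /KP; exact: source_detector. Qed.

Let bounded : exists B, (forall th, param N th -> `|th| <= B) /\ (forall th, KK th -> `|th| + 1 <= B).
Proof.
have [_ _ [M [_ hM]] _] := r2.
have hB th : param N th -> `|th| <= M + 1 by apply: hM; rewrite ltrDl.
exists (M + 2); split => th; first by move=> /hB h; lra.
by move=> /KP/hB; lra.
Qed.

Let gradE k th t : KK th -> 0 <= t <= T -> grad_intensity N k th t = A k th t.
Proof.
have [B [_ KB]] := bounded.
exact: (grad_intensityE speed_gt0 horizon_gt0 fD f'D cKK KB sd).
Qed.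

Let cinfo k th x y : continuous (fun t => dotv (A k th t) x * dotv (A k th t) y / lam k th t).
Proof.
move=> t; apply: cvgM; [apply: cvgM; exact: cA|].
by apply: cvgV; [rewrite gt_eqF|exact: clam].
Qed.

Lemma bil_fisher th x y : KK th -> bil (fisher N th) x y = infob T lam A th x y.
Proof.
move=> Kt.
have entry a b : fisher N th a b = infob T lam A th (delta_mx ord0 a) (delta_mx ord0 b).
  rewrite mxE; apply: eq_bigr => k _; apply: eq_Rintegral => t; rewrite inE/= in_itv/= => tT.
  rewrite gradE// mxE big_ord1 !mxE.
  have d v c : dotv v (delta_mx ord0 c) = v ord0 c :> R.
    rewrite dotvE (bigD1 c)//= mxE !eqxx mulr1 big1 ?addr0// => j jc.
    by rewrite mxE (negbTE jc) andbF mulr0.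
  by rewrite !d.
rewrite bilE.
have -> : infob T lam A th x y = \sum_(b < 4) y ord0 b * infob T lam A th x (delta_mx ord0 b).
  rewrite /infob -sint_comb; last by move=> a k; exact: cinfo.
  congr sint; apply/funext => k; apply/funext => t; rewrite (dotv_sum_delta _ y) mulr_sumr mulr_suml.
  by apply: eq_bigr => b _; ring.
apply: eq_bigr => b _; rewrite mulrC; congr (_ * _).
rewrite /infob.
rewrite (_ : (fun k t => _) = fun k t => \sum_(a < 4) x ord0 a * (dotv (A k th t) (delta_mx ord0 a) * dotv (A k th t) (delta_mx ord0 b) / lam k th t)).
  rewrite sint_comb; last by move=> a k; exact: cinfo.
  by apply: eq_bigr => a _; rewrite entry.
apply/funext => k; apply/funext => t; rewrite (dotv_sum_delta _ x) !mulr_suml.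
by apply: eq_bigr => a _; ring.
Qed.

Lemma fisher_sym th : (fisher N th)^T = fisher N th.
Proof.
apply/matrixP => a b; rewrite !mxE; apply: eq_bigr => k _; apply: eq_Rintegral => t _; congr (_ / _).
move: (grad_intensity N k th t) => g; rewrite !mxE; apply: eq_bigr => i _.
by rewrite !mxE mulrC.
Qed.

(** R3 extends from unit vectors by homogeneity; the constant survives the change to the sup norm,
    the smaller of the two. *)
Let info_low : exists2 c, 0 < c & forall th h, KK th -> c * `|h| ^+ 2 <= infob T lam A th h h.
Proof.
have [c c0 cP] := ereal_inf_gt0 r3; exists c => // th h Kt.
rewrite -bil_fisher//.
have [->|h0] := eqVneq h 0; first by rewrite normr0 expr0n mulr0 /bil mul0mx mul0mx mxE.
have e0 : 0 < enorm h by rewrite (lt_le_trans _ (norm_le_enorm h))// normr_gt0.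
have /cP h1 : [set ereal_inf [set ((e *m fisher N th *m e^T) ord0 ord0)%:E | e in [set e : 'rV[R]_4 | enorm e = 1%R]] | th in param N]
   (ereal_inf [set ((e *m fisher N th *m e^T) ord0 ord0)%:E | e in [set e : 'rV[R]_4 | enorm e = 1%R]]).
  by exists th => //; exact: KP.
have h2 : (c%:E <= (bil (fisher N th) ((enorm h)^-1 *: h) ((enorm h)^-1 *: h))%:E)%E.
  apply: (le_trans h1); apply: ereal_inf_lbound; exists ((enorm h)^-1 *: h) => //=.
  by rewrite enormZ ger0_norm ?invr_ge0 ?(ltW e0)// mulVf// gt_eqF.
move: h2; rewrite lee_fin bilZl bilZr mulrA -expr2 exprVn.
rewrite mulrC ler_pdivlMr ?exprn_gt0//; apply: le_trans.
rewrite ler_wpM2l ?(ltW c0)// ler_pXn2r ?nnegrE ?(ltW e0)//; exact: norm_le_enorm.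
Qed.

Let sepR4 eps : 0 < eps -> exists2 kap, 0 < kap & forall th0 th, KK th0 -> param N th ->
    eps < enorm (th - th0) -> kap <= sep T lam th0 th.
Proof.
move=> e0; have [c c0 cP] := ereal_inf_gt0 (r4 e0); exists c => // th0 th K0 Pt he.
have := cP _ (ex_intro2 _ _ th0 (KP K0) erefl) => h1.
rewrite -lee_fin; apply: (le_trans h1); apply: ereal_inf_lbound; exists th => //=.
congr (_%:E); apply: eq_bigr => k _; apply: eq_Rintegral => t _; congr (_ ^+ 2).
by rewrite /intensity; ring.
Qed.

Lemma fisher_close e : 0 < e -> exists2 del, 0 < del & forall th th' x y, KK th -> KK th' -> `|th' - th| <= del ->
  `|bil (fisher N th') x y - bil (fisher N th) x y| <= e * (`|x| * `|y|).
Proof.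
move=> e0; have [B [_ KB]] := bounded.
have [del d0 P] := infob_close horizon_gt0 noise_gt0 KB lam_nu clam cA
  (lipf_intensity B speed_gt0 horizon_gt0 fD f'D) (diff_intensity speed_gt0 horizon_gt0 fD f'D cKK KB sd) e0.
exists del; first exact: d0.
move=> th th' x y Kt Kt' h.
have -> : bil (fisher N th') x y - bil (fisher N th) x y = infob T lam A th' x y - infob T lam A th x y.
  by congr (_ - _); exact: bil_fisher.
exact: (P th th' x y Kt Kt' h).
Qed.

(** The variance that [clt_bound] produces for the score is the information. *)
Lemma fisher_score th h : KK th ->
  \sum_(k < K) \int[@lebesgue_measure R]_(t in `[0, T]) (dotv (nscore k th t) h ^+ 2 * lam k th t) =
  bil (fisher N th) h h.
Proof.
move=> Kt; rewrite bil_fisher//; apply: eq_bigr => k _; apply: eq_Rintegral => t _.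
by rewrite /nscore /score dotvZl -/A; field; rewrite gt_eqF.
Qed.

Lemma intensity_le : exists2 L, 0 < L & forall k th t, KK th -> 0 <= t <= T -> lam k th t <= L.
Proof.
have [B [_ KB]] := bounded.
have [L L0 P] := lam_bound (lipf_intensity B speed_gt0 horizon_gt0 fD f'D).
exists L => // k th t Kt tT; have b := in_ball KB Kt.
by have [h _] := P k th th t b b tT; exact: le_trans (ler_norm _) h.
Qed.

Lemma nscore_bound : exists2 C, 0 < C & forall k th h t, KK th -> 0 <= t <= T ->
  `|dotv (nscore k th t) h| <= C * `|h| /\ `|dotv (nscore' k th t) h| <= C * `|h|.
Proof.
have [B [_ KB]] := bounded.
exact: (score_bound (diff_loglam speed_gt0 horizon_gt0 noise_gt0 front_ge0 fD f'D cKK KB sd)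
  (diff_loglam' speed_gt0 horizon_gt0 noise_gt0 front_ge0 fD f'D cf'' cKK KB sd)).
Qed.

Lemma network_lan (CJ : R) : 0 <= CJ -> exists C c (mod : R -> R),
  [/\ 0 < C, 0 < c, forall e, 0 < e -> 0 < mod e &
      forall th0 n (X : 'I_K -> cumulative R R) W, KK th0 -> (0 < n)%N -> 0 <= W ->
        controlled T CJ (Num.sqrt n%:R) W (npath n X th0) ->
        lan C c mod (param N) (Num.sqrt n%:R) W th0 (ncscore n X th0) (fisher N th0) (nllr n X th0)].
Proof.
move=> CJ0; have [B [PB KB]] := bounded; have [c3 c30 c3P] := info_low.
have li := lipf_intensity B speed_gt0 horizon_gt0 fD f'D.
have di := diff_intensity speed_gt0 horizon_gt0 fD f'D cKK KB sd.
have ll := lipf_loglam B speed_gt0 horizon_gt0 noise_gt0 front_ge0 fD f'D.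
have ll' := lipf_loglam' B speed_gt0 horizon_gt0 noise_gt0 front_ge0 fD f'D cf''.
have dl := diff_loglam speed_gt0 horizon_gt0 noise_gt0 front_ge0 fD f'D cKK KB sd.
have dl' := diff_loglam' speed_gt0 horizon_gt0 noise_gt0 front_ge0 fD f'D cf'' cKK KB sd.
have [C1 C10 P1] := cscore_bound nscoreD continuous_nscore' dl dl' CJ0.
have [C2 [c2 [C20 c20 P2]]] := llr_upper horizon_gt0 noise_gt0 KB PB lam_nu clam cA li di llD cll' ll ll' c30 c3P sepR4 CJ0.
have [C3 C30 P3] := infob_upper horizon_gt0 noise_gt0 lam_nu clam cA di.
have E e : 0 < e -> _ := llr_expansion horizon_gt0 noise_gt0 KB lam_nu clam cA li di llD cll' nscoreD continuous_nscore' dl dl' CJ0 (e := e).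
(* Choice asks for a statement about every real e; this one is vacuous for e <= 0. *)
pose Pm e del := 0 < e -> 0 < del /\ forall (th0 : 'rV[R]_4) (s W : R) (M : 'I_K -> R -> R) (h : 'rV[R]_4),
  KK th0 -> 0 < s -> 0 <= W -> `|h| <= del -> controlled T CJ s W M ->
  `|llr T lam nll' th0 s M (th0 + h) - (s * dotv (cscore T nscore nscore' th0 s M) h - s ^+ 2 / 2 * infob T lam A th0 h h)|
  <= e * (s * `|h| * W + (s * `|h|) ^+ 2).
have /choice[mod modP] : forall e, exists del, Pm e del.
  move=> e; have [e0|e0] := ltP 0 e; last by exists 0 => h; move: e0; rewrite leNgt h.
  by have [del d0 P] := E e e0; exists del.
exists (Num.max (Num.max C1 C2) C3), (Num.min c3 c2), mod; split.
- by rewrite !lt_max C10.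
- by rewrite lt_min c30.
- by move=> e e0; have [] := modP e e0.
move=> th0 n X W K0 n0 W0 cM; have s0 : 0 < Num.sqrt n%:R :> R by rewrite sqrtr_gt0 ltr0n.
split.
- by rewrite (le_trans (P1 _ _ _ _ K0 s0 W0 cM))// ler_wpM2r// !le_max lexx.
- split; first exact: fisher_sym.
  move=> x; rewrite bil_fisher//; apply/andP; split.
    by rewrite (le_trans _ (c3P _ x K0))// ler_wpM2r ?sqr_ge0// ge_min lexx.
  by rewrite (le_trans (P3 _ x K0))// ler_wpM2r ?sqr_ge0// le_max lexx orbT.
- move=> th cth; rewrite (le_trans (P2 _ _ _ _ _ K0 s0 W0 cth cM))// lerD//.
    by rewrite ler_wpM2r// ler_wpM2r ?mulr_ge0 ?(ltW s0)// !le_max lexx orbT.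
  by rewrite lerN2 ler_wpM2r ?sqr_ge0// ge_min lexx orbT.
move=> e h e0 hm; have [_ P] := modP e e0.
by rewrite bil_fisher//; exact: P.
Qed.

End compact.
End network.

(** * Maximum likelihood and posterior means under a local expansion *)

Section maximum_likelihood.
Context {R : realType}.
Variables (C c : R) (mod : R -> R) (TH : set 'rV[R]_4).
Hypotheses (C0 : 0 < C) (c0 : 0 < c) (mod0 : forall e, 0 < e -> 0 < mod e).

Lemma lan_at s W th0 D J Q : lan C c mod TH s W th0 D J Q -> Q th0 = 0.
Proof.
move=> [_ _ _ /(_ 1 0 ltr01)]; rewrite normr0 => /(_ (ltW (mod0 ltr01))).
rewrite addr0 !bil_dotv dotvC /dotv !mul0mx !mxE !mulr0 mul0r expr0n addr0 !subr0 mulr0.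
by rewrite normr_le0 => /eqP.
Qed.

Section geometry.
Variables (J : 'M[R]_4) (D : 'rV[R]_4).
Hypotheses (sJ : J^T = J) (cJ : forall x, c * `|x| ^+ 2 <= bil J x x).

Lemma quadratic_center x :
  dotv D x - bil J x x / 2 = bil J (D *m invmx J) (D *m invmx J) / 2 -
    bil J (x - D *m invmx J) (x - D *m invmx J) / 2.
Proof.
set u := D *m invmx J.
have uJ : u *m J = D by rewrite /u -mulmxA mulVmx ?mulmx1// (coercive_unit sJ c0 cJ).
have uD y : bil J u y = dotv D y by rewrite bil_dotv uJ.
rewrite bilDl !bilDr !bilNl !bilNr (bilC x u sJ) !uD; lra.
Qed.

Lemma center_bound W : `|D| <= C * W -> `|D *m invmx J| <= 4 / c * (C * W).
Proof.
move=> DW; apply: (le_trans (inverse_bound D sJ c0 cJ)).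
by rewrite ler_wpM2l// divr_ge0// (ltW c0).
Qed.
End geometry.

(** With y = s |est - th0|: 0 = Q(th0) <= Q(est) <= C y W - c y^2. *)
Lemma mle_bound s W th0 D J Q est : lan C c mod TH s W th0 D J Q -> 0 < s -> TH th0 ->
  closure TH est -> (forall th, TH th -> Q th <= Q est) -> s * `|est - th0| <= C / c * W.
Proof.
move=> L s0 T0 cest mx; have Q0 := lan_at L; have [_ _ up _] := L.
have := le_trans (mx _ T0) (up _ cest); rewrite Q0.
have [->|y0] := eqVneq (s * `|est - th0|) 0.
  by move=> _; have [D0 _ _ _] := L; rewrite mulrAC divr_ge0 ?(ltW c0)// (le_trans _ D0).
have y00 : 0 < s * `|est - th0| by rewrite lt_def y0 mulr_ge0// ltW.
set y := s * `|est - th0| in y00 *; move=> h.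
have : y * (c * y) <= y * (C * W) by move: h; rewrite expr2; lra.
by rewrite ler_pM2l// mulrAC ler_pdivlMr// mulrC.
Qed.

(** The maximizer and the centre th0 + s^-1 D J^-1 both lie within R0 / s of th0, where Q is close
    to a quadratic with maximum at that centre. The maximizer does at least as well as the centre,
    so strict concavity bounds their distance. *)
Lemma mle_limit rho : 0 < rho -> forall e w0, 0 < e -> 0 < w0 -> exists S, forall s W th0 D J Q est,
  S <= s -> 0 < s -> 0 <= W <= w0 -> lan C c mod TH s W th0 D J Q ->
  (forall h, `|h| <= rho -> TH (th0 + h)) -> closure TH est ->
  (forall th, TH th -> Q th <= Q est) -> `|s *: (est - th0) - D *m invmx J| <= e.
Proof.
move=> rho0 e w0 e0 w00.
pose R0 := C / c * w0 + 4 / c * (C * w0).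
have R00 : 0 < R0 by rewrite addr_gt0// !mulr_gt0// invr_gt0.
(* The errors at the two points, doubled by the factor 1/2 in front of the form, add up to c e^2. *)
pose e1 := c * e ^+ 2 / (4 * (R0 * w0 + R0 ^+ 2)).
have X0 : 0 < R0 * w0 + R0 ^+ 2 by rewrite addr_gt0 ?mulr_gt0 ?exprn_gt0.
have e10 : 0 < e1 by rewrite divr_gt0 ?mulr_gt0 ?exprn_gt0.
have m0 := mod0 e10.
(* From this s on, the ball of radius R0 / s around th0 lies in the range of the expansion and
   inside Theta. *)
exists (R0 / Num.min (mod e1) rho).
move=> s W th0 D J Q est Ss s0 /andP[W0 Ww] L inT cest mx.
have [DW [sJ cJ'] _ ex] := L.
have cJ x : c * `|x| ^+ 2 <= bil J x x by have /andP[] := cJ' x.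
have T0 : TH th0 by have := inT 0; rewrite normr0 addr0; apply; exact: ltW.
have b1 := mle_bound L s0 T0 cest mx.
have b2 := center_bound sJ cJ DW.
set us := D *m invmx J in b2 *; set u := s *: (est - th0).
have nu : `|u| <= R0.
  rewrite normrZ ger0_norm ?(ltW s0)// (le_trans b1)// (@le_trans _ _ (C / c * w0))//.
    by rewrite ler_wpM2l// divr_ge0// ltW.
  by rewrite lerDl mulr_ge0 ?divr_ge0 ?mulr_ge0// ltW.
have nus : `|us| <= R0.
  rewrite (le_trans b2)// (@le_trans _ _ (4 / c * (C * w0)))//.
    by rewrite ler_wpM2l ?divr_ge0 ?(ltW c0)// ler_wpM2l// ltW.
  by rewrite lerDr mulr_ge0 ?divr_ge0// ltW.
have small (v : 'rV[R]_4) : `|v| <= R0 -> `|s^-1 *: v| <= Num.min (mod e1) rho.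
  move=> vR; rewrite normrZ ger0_norm ?invr_ge0 ?(ltW s0)// ler_pdivrMl// (le_trans vR)//.
  by rewrite -ler_pdivrMr// lt_min m0.
have E (v : 'rV[R]_4) : `|v| <= R0 -> `|Q (th0 + s^-1 *: v) - (dotv D v - bil J v v / 2)| <= e1 * (R0 * w0 + R0 ^+ 2).
  move=> vR; have := small v vR; rewrite le_min => /andP[h1 _].
  have := ex e1 _ e10 h1; rewrite bilZl bilZr dotvZr normrZ ger0_norm ?invr_ge0 ?(ltW s0)//.
  rewrite !mulrA divff ?gt_eqF// mul1r.
  rewrite (_ : s ^+ 2 / 2 / s / s = 2^-1); last by field; rewrite gt_eqF.
  rewrite mul1r [_ * bil J v v]mulrC => h; apply: (le_trans h); rewrite ler_wpM2l ?(ltW e10)//.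
  by rewrite lerD ?ler_pM// ler_pXn2r ?nnegrE// (le_trans _ vR).
have h1 := E u nu; have h2 := E us nus.
have ue : th0 + s^-1 *: u = est by rewrite scalerA mulVf ?gt_eqF// scale1r addrC subrK.
rewrite ue in h1.
have h3 : Q (th0 + s^-1 *: us) <= Q est.
  by apply: mx; apply: inT; have := small us nus; rewrite le_min => /andP[].
rewrite !(quadratic_center _ sJ cJ) -/us subrr in h1 h2.
have z : bil J (0 : 'rV[R]_4) 0 = 0 by rewrite bil_dotv /dotv !mul0mx mxE.
rewrite z mul0r subr0 in h2.
have h4 : bil J (u - us) (u - us) <= 4 * (e1 * (R0 * w0 + R0 ^+ 2)).
  move: h1 h2; rewrite !ler_norml => /andP[? ?] /andP[? ?]; lra.
have h5 : 4 * (e1 * (R0 * w0 + R0 ^+ 2)) = c * e ^+ 2 by rewrite /e1; field; rewrite gt_eqF.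
have := le_trans (cJ _) h4; rewrite h5 ler_pM2l// ler_pXn2r ?nnegrE//; exact: ltW.
Qed.

End maximum_likelihood.

(** * Integrals over R^4 and posterior means *)

Section integral4.
Context {R : realType}.
Implicit Types f g : 'rV[R]_4 -> R.

Definition I4 f : R := \int[@leb4 R]_z f (vec4 z).
Definition meas4 f := measurable_fun setT (fun z : measurableTypeR R * measurableTypeR R * measurableTypeR R * measurableTypeR R => f (vec4 z)).
Definition L1 f := (@leb4 R).-integrable setT (EFin \o (fun z => f (vec4 z))).

Lemma I4_scale k f : L1 f -> I4 (fun x => k * f x) = k * I4 f.
Proof. by move=> lf; exact: (@Rintegral_scale _ _ _ _ _ k _ measurableT lf). Qed.

Lemma I4_add f g : L1 f -> L1 g -> I4 (fun x => f x + g x) = I4 f + I4 g.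
Proof. by move=> lf lg; rewrite /I4 RintegralD. Qed.

Lemma I4_sub f g : L1 f -> L1 g -> I4 (fun x => f x - g x) = I4 f - I4 g.
Proof. by move=> lf lg; rewrite /I4 RintegralB. Qed.

Lemma L1_scale k f : L1 f -> L1 (fun x => k * f x).
Proof. by move=> lf; exact: (integrable_scale measurableT k lf). Qed.

Lemma L1_add f g : L1 f -> L1 g -> L1 (fun x => f x + g x).
Proof. by move=> lf lg; exact: (integrable_add measurableT lf lg). Qed.

Lemma L1_dominated f g : meas4 f -> L1 g -> (forall x, `|f x| <= g x) -> L1 f.
Proof. by move=> mf lg fg; apply: (integrable_dominated measurableT mf lg) => z _; exact: fg. Qed.

Lemma I4_norm_le f g : meas4 f -> L1 g -> (forall x, `|f x| <= g x) -> `|I4 f| <= I4 g.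
Proof. by move=> mf lg fg; apply: Rintegral_norm_le => // z; exact: fg. Qed.

Lemma meas4_continuous f : continuous f -> meas4 f.
Proof. exact: measurable_continuous4. Qed.

Lemma meas4_mul f g : meas4 f -> meas4 g -> meas4 (fun x => f x * g x).
Proof. by move=> mf mg; exact: measurable_funM. Qed.

Lemma meas4_exp f : meas4 f -> meas4 (fun x => expR (f x)).
Proof. by move=> mf; apply: measurableT_comp. Qed.

Lemma L1_gauss k : 0 < k -> L1 (fun x => expR (- k * `|x| ^+ 2)).
Proof.
move=> k0; apply: (@gauss_dominated_integrable _ _ 1 k k0).
  apply: (@meas4_continuous (fun x => expR (- k * `|x| ^+ 2))); apply: continuous1; first exact: continuous_expR.
  apply: continuousM; first exact: continuousC.
  by move=> x; apply: (@continuous_comp _ _ _ (fun x : 'rV[R]_4 => `|x|) (fun y : R => y ^+ 2));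
    [exact: norm_continuous|exact: exprn_continuous].
by move=> x; rewrite mul1r ger0_norm ?expR_ge0.
Qed.

Lemma I4_affine s a f : s != 0 -> L1 f -> L1 (fun x => f (s *: x + a)) /\
  I4 (fun x => f (s *: x + a)) = `|s^-1| ^+ 4 * I4 f.
Proof. exact: leb4_affine_integral. Qed.

(** The cost of replacing (1 + x)^m exp(b x - k x^2) by exp(- k x^2 / 4): half of k absorbs the
    linear term, a quarter the polynomial. *)
Definition absorb (m : nat) (b k : R) : R :=
  m%:R ^+ m * expR (1 + k^-1) * expR (b ^+ 2 / (2 * k)).

Lemma absorb_ge0 m b k : 0 <= absorb m b k.
Proof. by rewrite !mulr_ge0 ?exprn_ge0 ?expR_ge0. Qed.

Lemma absorb_gauss m b k x : 0 < k -> 0 <= x ->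
  (1 + x) ^+ m * expR (b * x - k * x ^+ 2) <= absorb m b k * expR (- (k / 4) * x ^+ 2).
Proof.
move=> k0 x0; have k4 : 0 < k / 4 by rewrite divr_gt0.
have h1 := poly_gauss_le m k4 x0.
rewrite (_ : 4 * (k / 4) = k) in h1; last by field.
have h2 : expR (b * x - k * x ^+ 2) <= expR (b ^+ 2 / (2 * k)) * expR (- (k / 2) * x ^+ 2).
  rewrite -expRD ler_expR -subr_ge0.
  rewrite (_ : _ - _ = (k * x - b) ^+ 2 / (2 * k)); last by field; rewrite gt_eqF.
  by rewrite divr_ge0 ?sqr_ge0// mulr_ge0// ltW.
apply: (le_trans (ler_pM _ _ h1 h2)); rewrite ?expR_ge0 ?exprn_ge0 ?addr_ge0//.
rewrite le_eqVlt; apply/orP; left; apply/eqP.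
rewrite /absorb (_ : - (k / 4) * x ^+ 2 = k / 4 * x ^+ 2 + - (k / 2) * x ^+ 2); last by field.
rewrite (expRD (k / 4 * x ^+ 2)); ring.
Qed.

End integral4.

Lemma half_quadratic_le (R : realFieldType) (d j r m c C : R) : d <= 4 * m -> m <= C * r -> c * r ^+ 2 <= j ->
  d - j / 2 <= 4 * C * r - c / 2 * r ^+ 2.
Proof. lra. Qed.

(* [P exp V] is an unnormalized posterior density in the local coordinate [u = s (th - th0)]: [P] is the
   rescaled prior and [V] the rescaled log-likelihood ratio. *)
Section posterior.
Context {R : realType}.
Variables (C c qmin qmax : R) (mod qm : R -> R).
Hypotheses (C0 : 0 < C) (c0 : 0 < c) (mod0 : forall e, 0 < e -> 0 < mod e)
  (qm0 : forall e, 0 < e -> 0 < qm e) (qmin0 : 0 < qmin).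

(** The mass s^4 of P is the Jacobian of the rescaling applied to a prior of mass one, and
    [P u != 0] stands for the parameter lying in Theta. *)
Definition posterior_like (s W q0 : R) (D : 'rV[R]_4) (J : 'M[R]_4) (P V : 'rV[R]_4 -> R) : Prop :=
  [/\ [/\ 1 <= W, 0 < s, qmin <= q0 <= qmax & `|D| <= C * W],
     J^T = J /\ (forall x, c * `|x| ^+ 2 <= bil J x x <= C * `|x| ^+ 2),
     [/\ meas4 P, meas4 V, L1 P, I4 P = s ^+ 4 & forall u, 0 <= P u],
     forall u, P u != 0 -> V u <= C * `|u| * W - c * `|u| ^+ 2 &
     (forall e u, 0 < e -> `|u| <= s * mod e -> `|V u - (dotv D u - bil J u u / 2)| <= e * (`|u| * W + `|u| ^+ 2)) /\
     (forall e u, 0 < e -> `|u| <= s * qm e -> `|P u - q0| <= e)].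

Let I0 : R := I4 (fun x : 'rV[R]_4 => expR (- (c / 4 / 4) * `|x| ^+ 2)).

Lemma PV_bound s W q0 D J P V : posterior_like s W q0 D J P V ->
  forall m u, (1 + `|u|) ^+ m * (P u * expR (V u)) <= absorb m (C * W) c * P u.
Proof.
move=> [[W1 s0 _ _] _ [_ _ _ _ P0] up _] m u.
have [->|Pu] := eqVneq (P u) 0; first by rewrite mul0r !mulr0.
rewrite mulrCA [leRHS]mulrC ler_wpM2l//.
apply: (@le_trans _ _ ((1 + `|u|) ^+ m * expR (C * W * `|u| - c * `|u| ^+ 2))).
  by rewrite ler_wpM2l ?exprn_ge0 ?addr_ge0// ler_expR [C * W * _]mulrAC up.
rewrite (le_trans (absorb_gauss _ _ c0 _))// ler_piMr ?absorb_ge0//.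
by rewrite -expR0 ler_expR mulNr oppr_le0 mulr_ge0 ?sqr_ge0// divr_ge0// ltW.
Qed.

Lemma PV_L1 s W q0 D J P V f : posterior_like s W q0 D J P V -> meas4 f ->
  (exists2 M, 0 <= M & forall u, `|f u| <= M * (1 + `|u|)) -> L1 (fun u => f u * (P u * expR (V u))).
Proof.
move=> H mf [M M0 fM]; have B := PV_bound H 1.
have [_ _ [mP mV lP _ P0] _ _] := H.
apply: (@L1_dominated _ _ (fun u => M * (absorb 1 (C * W) c * P u))).
- by apply: meas4_mul => //; apply: meas4_mul => //; exact: meas4_exp.
- by apply: L1_scale; exact: L1_scale.
move=> u; have PV : 0 <= P u * expR (V u) by rewrite mulr_ge0 ?expR_ge0.
rewrite normrM [`|P u * _|]ger0_norm// (le_trans (ler_wpM2r PV (fM u)))//.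
by rewrite -mulrA ler_wpM2l// -[X in X * _]expr1.
Qed.

Let box : set (measurableTypeR R * measurableTypeR R * measurableTypeR R * measurableTypeR R) :=
  ((`[0, 1]%classic `*` `[0, 1]%classic) `*` `[0, 1]%classic) `*` `[0, 1]%classic.

Let mbox : measurable box.
Proof. by repeat (apply: measurableX; last exact: measurable_itv); exact: measurable_itv. Qed.

Let box1 : @leb4 R box = 1%E.
Proof.
have h : (@lebesgue_measure R) `[0, 1]%classic = 1%E.
  by rewrite lebesgue_measure_itv/= lte01 sube0.
pose I : set (measurableTypeR R) := `[0, 1]%classic.
have mI : measurable I by exact: measurable_itv.
transitivity (@leb3 R ((I `*` I) `*` I) * (@lebesgue_measure R) I)%E.
  by apply: product_measure1E => //; repeat apply: measurableX.
transitivity (@leb2 R (I `*` I) * (@lebesgue_measure R) I * (@lebesgue_measure R) I)%E.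
  by congr (_ * _)%E; apply: product_measure1E => //; exact: measurableX.
transitivity ((@lebesgue_measure R) I * (@lebesgue_measure R) I * (@lebesgue_measure R) I * (@lebesgue_measure R) I)%E.
  by congr (_ * _ * _)%E; exact: product_measure1E.
by rewrite /I h !mule1.
Qed.

Let box_norm z : box z -> `|vec4 z| <= 1.
Proof.
case: z => [[[x y] w] v] [[[/= hx hy] hw] hv]; move: hx hy hw hv; rewrite !in_itv/=.
move=> /andP[x0 x1] /andP[y0 y1] /andP[w0 w1] /andP[v0 v1]; apply: (@le_coord_norm _ 3) => i.
by rewrite mxE (tnth_nth 0); case: i => [[|[|[|[|//]]]] i4] /=; rewrite ger0_norm.
Qed.

(** For |u| <= 1 the expansion gives V >= - (4 C W + C/2 + W + 1), hence V >= - C5 W because W >=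
    1. *)
Let C5 := 4 * C + C / 2 + 2.

Let PV_integrable s W q0 D J P V : posterior_like s W q0 D J P V -> L1 (fun u => P u * expR (V u)).
Proof.
move=> H; have m1 : meas4 (fun _ : 'rV[R]_4 => 1 : R) by exact: measurable_cst.
have := PV_L1 H m1.
rewrite (_ : (fun u => 1 * _) = fun u => P u * expR (V u)); last by apply/funext => u; rewrite mul1r.
by apply; exists 1 => // u; rewrite normr1 mul1r lerDl.
Qed.

(** It is enough to integrate over the unit cube, of measure one, on which the prior and the
    expansion are both under control once s is large. *)
Lemma PV_lower s W q0 D J P V : posterior_like s W q0 D J P V ->
  1 <= s * mod 1 -> 1 <= s * qm (qmin / 2) -> qmin / 2 * expR (- C5 * W) <= I4 (fun u => P u * expR (V u)).
Proof.
move=> H h1 h2; have L := PV_integrable H.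
have [[W1 s0 /andP[q1 q2] DW] [sJ cJ] [mP mV lP _ P0] up [nV nP]] := H.
pose k := qmin / 2 * expR (- C5 * W).
have q20 : 0 < qmin / 2 by rewrite divr_gt0.
have k0 : 0 <= k by rewrite mulr_ge0 ?expR_ge0// ltW.
have low u : `|u| <= 1 -> k <= P u * expR (V u).
  move=> u1; apply: ler_pM; rewrite ?(ltW q20) ?expR_ge0//.
    have := nP _ u q20 (le_trans u1 h2); rewrite ler_norml => /andP[? _]; lra.
  rewrite ler_expR.
  have := nV 1 u ltr01 (le_trans u1 h1); rewrite mul1r ler_norml => /andP[v1 _].
  have /andP[_ b] := cJ u.
  have d := le_trans (dotv_bound D u) (ler_wpM2l (ler0n _ 4) (ler_pM (normr_ge0 _) (normr_ge0 _) DW u1)).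
  have u2 : `|u| ^+ 2 <= 1 by rewrite exprn_ile1.
  have uW : `|u| * W <= W by rewrite ler_piMl// (le_trans ler01).
  have bC := ler_wpM2l (ltW C0) u2.
  have CW := ler_wpM2l (ltW C0) W1.
  move: d; rewrite ler_norml => /andP[d _]; rewrite /C5; lra.
rewrite -/k.
have -> : k = \int[@leb4 R]_(z in box) k.
  rewrite Rintegral_cst//; transitivity (k * fine (1%E : \bar R)); first by rewrite mulr1.
  by congr (_ * fine _); exact: esym box1.
have ck : (@leb4 R).-integrable box (EFin \o (fun _ => k)).
  have b1 : (@leb4 R box < +oo)%E by rewrite box1 ltry.
  apply: (measurable_bounded_integrable mbox b1) => //.
  by exists `|k|; split => // x xk z _ /=; exact: ltW.
have Lb : (@leb4 R).-integrable box (EFin \o (fun z => P (vec4 z) * expR (V (vec4 z)))) by exact: integrableS L.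
apply: (@le_trans _ _ (\int[@leb4 R]_(z in box) (P (vec4 z) * expR (V (vec4 z))))).
  by apply: le_Rintegral => // z /box_norm; exact: low.
apply: fine_le; [exact: integrable_fin_num|exact: integrable_fin_num|].
apply: ge0_subset_integral => //; first by have /integrableP[] := L.
by move=> z _; rewrite lee_fin mulr_ge0 ?expR_ge0.
Qed.

Let coord_le (u : 'rV[R]_4) a : `|u ord0 a| <= 1 * (1 + `|u|).
Proof. by rewrite mul1r (le_trans (ge_coord_norm _ _))// lerDr. Qed.

Let mcoord a : meas4 (fun u : 'rV[R]_4 => u ord0 a).
Proof. exact: measurable_vec4. Qed.

(** The denominator may be as small as a multiple of exp(- C5 W), yet the bound has to be linear in
    W. The part |u| <= C1 W contributes at most C1 W. Beyond it, half of c |u|^2 beats C |u| W, a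
    quarter yields the factor exp(- C5 W) that offsets the denominator, and the last quarter makes
    |u| integrable. *)
Lemma posterior_bound : exists A S, 0 < A /\ forall s W q0 D J P V, posterior_like s W q0 D J P V -> S <= s ->
  forall a, `|I4 (fun u => u ord0 a * (P u * expR (V u))) / I4 (fun u => P u * expR (V u))| <= A * W.
Proof.
pose C1 := 1 + 2 * C / c + 4 * C5 / c.
have C50 : 0 < C5 by rewrite !addr_gt0 ?divr_gt0 ?mulr_gt0.
have C1a : 2 * C / c <= C1.
  by rewrite /C1 -addrA addrCA lerDl addr_ge0// divr_ge0 ?mulr_ge0 ?(ltW C50) ?(ltW c0).
have C1b : 4 * C5 / c <= C1.
  by rewrite /C1 lerDr addr_ge0// divr_ge0 ?mulr_ge0 ?(ltW C0) ?(ltW c0).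
have C1c : 1 <= C1.
  by rewrite /C1 -addrA lerDl addr_ge0// divr_ge0 ?mulr_ge0 ?(ltW C0) ?(ltW C50) ?(ltW c0).
have c4 : 0 < c / 4 by rewrite divr_gt0.
pose r := qm 1; have r0 : 0 < r by exact: qm0.
pose a1 := absorb 1 0 (c / 4); pose a5 := absorb 5 0 (c / 4).
pose qM := `|qmax| + 1.
(* For |u| <= s r the prior is at most [qM]. Beyond, only its total mass s^4 is available, and the
   factor (s r)^-4 drawn from the Gaussian tail offsets it. *)
pose K2 := qM * (a1 * I0) + r ^- 4 * a5.
have I00 : 0 <= I0 by apply: Rintegral_ge0 => z _; exact: expR_ge0.
have qM0 : 0 <= qM by rewrite addr_ge0.
have K20 : 0 <= K2.
  by rewrite addr_ge0 ?mulr_ge0 ?absorb_ge0 ?invr_ge0 ?exprn_ge0// ltW.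
exists (C1 + 2 * K2 / qmin), ((mod 1)^-1 + (qm (qmin / 2))^-1).
have q20 : 0 < qmin / 2 by rewrite divr_gt0.
split; first by rewrite ltr_wpDr ?divr_ge0 ?mulr_ge0 ?(ltW qmin0)// (lt_le_trans ltr01).
move=> s W q0 D J P V H Ss a.
have [[W1 s0 /andP[q1 q2] DW] [sJ cJ] [mP mV lP IP P0] up [nV nP]] := H.
have h1 : 1 <= s * mod 1.
  rewrite -ler_pdivrMr ?mod0// div1r (le_trans _ Ss)// lerDl invr_ge0 ltW// qm0//.
have h2 : 1 <= s * qm (qmin / 2).
  by rewrite -ler_pdivrMr ?qm0// div1r (le_trans _ Ss)// lerDr invr_ge0 ltW// mod0.
have low := PV_lower H h1 h2; set Dn := I4 _ in low.
have Dn0 : 0 < Dn by rewrite (lt_le_trans _ low)// mulr_gt0 ?expR_gt0.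
pose E := expR (- C5 * W); have E0 : 0 < E by exact: expR_gt0.
have W0 : 0 < W by exact: lt_le_trans W1.
pose gs := fun x : 'rV[R]_4 => expR (- (c / 4 / 4) * `|x| ^+ 2).
pose maj (u : 'rV[R]_4) := C1 * W * (P u * expR (V u)) + E * (qM * a1 * gs u + (s * r) ^- 4 * a5 * P u).
have sr0 : 0 < s * r by rewrite mulr_gt0.
have Pg u : P u * (`|u| * expR (- (c / 4) * `|u| ^+ 2)) <= qM * a1 * gs u + (s * r) ^- 4 * a5 * P u.
  have x0 : 0 <= `|u| by [].
  have g0 : 0 <= gs u by exact: expR_ge0.
  have f1 : 0 <= qM * a1 * gs u by rewrite !mulr_ge0 ?absorb_ge0.
  have f2 : 0 <= (s * r) ^- 4 * a5 * P u by rewrite !mulr_ge0 ?absorb_ge0 ?invr_ge0 ?exprn_ge0 ?(ltW sr0).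
  have ex : expR (- (c / 4) * `|u| ^+ 2) = expR (0 * `|u| - c / 4 * `|u| ^+ 2) by congr expR; ring.
  have [ur|ru] := leP `|u| (s * r).
    rewrite -[leLHS]addr0 lerD// -mulrA ler_pM ?mulr_ge0 ?expR_ge0//.
      have := nP 1 u ltr01 ur; rewrite ler_norml => /andP[_ p1].
      apply: (@le_trans _ _ (q0 + 1)); first by rewrite -lerBlDl.
      by rewrite lerD2r (le_trans q2)// ler_norm.
    rewrite ex (le_trans _ (absorb_gauss 1 0 c4 x0))// expr1 ler_wpM2r ?expR_ge0// lerDr//.
  rewrite -[leLHS]add0r lerD// mulrC ler_wpM2r// -ler_pdivrMl ?invr_gt0 ?exprn_gt0// invrK.
  apply: (@le_trans _ _ ((1 + `|u|) ^+ 5 * expR (0 * `|u| - c / 4 * `|u| ^+ 2))).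
    rewrite -ex mulrA; apply: ler_wpM2r; first exact: expR_ge0.
    have u1 : `|u| <= 1 + `|u| by rewrite lerDr.
    have t4 : (s * r) ^+ 4 <= (1 + `|u|) ^+ 4.
      by rewrite ler_pXn2r ?nnegrE ?(ltW sr0) ?addr_ge0// (le_trans (ltW ru)).
    have t0 : 0 <= (s * r) ^+ 4 by rewrite exprn_ge0// ltW.
    by rewrite [leRHS]exprSr ler_pM.
  rewrite (le_trans (absorb_gauss 5 0 c4 x0))// ler_piMr ?absorb_ge0//.
  by rewrite -expR0 ler_expR mulNr oppr_le0 mulr_ge0 ?sqr_ge0// !divr_ge0// ltW.
have PVm u : `|u| * (P u * expR (V u)) <= maj u.
  have PV0 : 0 <= P u * expR (V u) by rewrite mulr_ge0 ?expR_ge0.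
  have S0 : 0 <= E * (qM * a1 * gs u + (s * r) ^- 4 * a5 * P u).
    by rewrite mulr_ge0 ?(ltW E0)// (le_trans _ (Pg u))// !mulr_ge0 ?expR_ge0.
  have T0 : 0 <= C1 * W * (P u * expR (V u)) by rewrite !mulr_ge0 ?expR_ge0// ?(ltW W0)// (le_trans ler01).
  have [Pu|Pu] := eqVneq (P u) 0; first by rewrite [X in X * expR _]Pu mul0r mulr0 addr_ge0.
  have [uC|Cu] := leP `|u| (C1 * W); first by rewrite -[leLHS]addr0 lerD// ler_wpM2r.
  rewrite -[leLHS]add0r lerD//.
  apply: (@le_trans _ _ (E * (P u * (`|u| * expR (- (c / 4) * `|u| ^+ 2))))); last by rewrite ler_wpM2l ?(ltW E0).
  rewrite mulrCA [E * _]mulrCA ler_wpM2l// [E * _]mulrCA ler_wpM2l//.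
  rewrite /E -expRD ler_expR (le_trans (up u Pu))//.
  have u0 : 0 <= `|u| by [].
  have k1 : C * `|u| * W <= c / 2 * `|u| ^+ 2.
    have : 2 * C / c * W <= `|u| by rewrite (le_trans _ (ltW Cu))// ler_wpM2r// ltW.
    move=> /(ler_wpM2l u0); rewrite -expr2 => t.
    have := ler_wpM2l (ltW c0) t.
    rewrite (_ : c * (`|u| * (2 * C / c * W)) = 2 * (C * `|u| * W)); last by field; rewrite gt_eqF.
    lra.
  have k2 : C5 * W <= c / 4 * `|u| ^+ 2.
    have t1 : 4 * C5 / c * W <= C1 * W by rewrite ler_wpM2r// ltW.
    have t2 : C1 * W <= `|u| ^+ 2.
      have u1 : 1 <= `|u|.
        by rewrite (le_trans _ (ltW Cu))// -[leLHS]mulr1 ler_pM.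
      by rewrite expr2 (le_trans (ltW Cu))// ler_peMl.
    have := ler_wpM2l (ltW c0) (le_trans t1 t2).
    rewrite (_ : c * (4 * C5 / c * W) = 4 * (C5 * W)); last by field; rewrite gt_eqF.
    lra.
  lra.
have Lg : L1 gs by apply: L1_gauss; rewrite !divr_gt0.
have LPV := PV_integrable H.
have Lmaj : L1 maj.
  by apply: L1_add; [exact: L1_scale|apply: L1_scale; apply: L1_add; exact: L1_scale].
have num : `|I4 (fun u => u ord0 a * (P u * expR (V u)))| <= I4 maj.
  apply: I4_norm_le => //.
    by apply: meas4_mul => //; apply: meas4_mul => //; exact: meas4_exp.
  move=> u; have PV0 : 0 <= P u * expR (V u) by rewrite mulr_ge0 ?expR_ge0.
  by rewrite normrM [`|P u * _|]ger0_norm// (le_trans _ (PVm u))// ler_wpM2r// ge_coord_norm.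
have Imaj : I4 maj = C1 * W * Dn + E * K2.
  rewrite I4_add; [|exact: L1_scale|by apply: L1_scale; apply: L1_add; exact: L1_scale].
  rewrite I4_scale// I4_scale; last by apply: L1_add; exact: L1_scale.
  rewrite I4_add; [|exact: L1_scale..]; rewrite I4_scale// I4_scale// IP -/I0 -/Dn.
  have alg (x q b i p y z : R) : y != 0 -> z != 0 ->
    x + E * (q * b * i + (y * z) ^- 4 * p * y ^+ 4) = x + E * (q * (b * i) + z ^- 4 * p).
    by move=> y0 z0; field; rewrite ?y0 ?z0.
  by apply: alg; rewrite gt_eqF.
rewrite normrM [`|Dn^-1|]ger0_norm ?invr_ge0 ?(ltW Dn0)// ler_pdivrMr// (le_trans num)// Imaj.
rewrite (_ : (C1 + 2 * K2 / qmin) * W * Dn = C1 * W * Dn + 2 * K2 / qmin * (W * Dn)); last by ring.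
rewrite lerD//.
have : E * K2 <= 2 * K2 / qmin * (qmin / 2 * E).
  by rewrite le_eqVlt; apply/orP; left; apply/eqP; field; rewrite gt_eqF.
move=> t; apply: (le_trans t).
have Kq : 0 <= 2 * K2 / qmin by rewrite divr_ge0 ?mulr_ge0 ?(ltW qmin0).
by rewrite ler_wpM2l// (le_trans low)// ler_peMl// ltW.
Qed.

(** After translation to v the integrand is odd. *)
Let centered_gauss (J : 'M[R]_4) v a : J^T = J -> (forall x, c * `|x| ^+ 2 <= bil J x x) ->
  L1 (fun u => (u - v) ord0 a * expR (- bil J (u - v) (u - v) / 2)) /\
  I4 (fun u => (u - v) ord0 a * expR (- bil J (u - v) (u - v) / 2)) = 0.
Proof.
move=> sJ cJ; pose f (u : 'rV[R]_4) := u ord0 a * expR (- bil J u u / 2).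
have c2 : 0 < c / 2 by rewrite divr_gt0.
have Lf : L1 f.
  apply: (@L1_dominated _ _ (fun u => absorb 1 0 (c / 2) * expR (- (c / 2 / 4) * `|u| ^+ 2))).
  - by apply: meas4_mul; [exact: mcoord|apply: meas4_continuous; exact: gauss_continuous].
  - by apply: L1_scale; apply: L1_gauss; rewrite !divr_gt0.
  move=> u; rewrite (le_trans _ (absorb_gauss 1 0 c2 _))// normrM ler_pM//.
    by rewrite expr1 -[leRHS]mul1r.
  rewrite ger0_norm ?expR_ge0// (le_trans (bil_lower _ cJ))// ler_expR; lra.
have [L0 E0] := I4_affine (- v) (oner_neq0 R) Lf.
have N0 : -1 != 0 :> R by rewrite oppr_eq0 oner_eq0.
have [_ E1] := @I4_affine _ (-1) 0 f N0 Lf.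
have fN : (fun x : 'rV[R]_4 => f (-1 *: x + 0)) = fun x => -1 * f x.
  by apply/funext => x; rewrite /f addr0 scaleN1r mxE bilNl bilNr opprK mulN1r mulNr.
have f0 : I4 f = 0.
  have : - I4 f = I4 f by rewrite -mulN1r -I4_scale// -fN E1 invrN1 normrN1 expr1n mul1r.
  by move=> /eqP; rewrite -subr_eq0 -opprD oppr_eq0 -mulr2n mulrn_eq0 => /eqP.
have fv : (fun x : 'rV[R]_4 => f (1 *: x - v)) = fun u => (u - v) ord0 a * expR (- bil J (u - v) (u - v) / 2).
  by apply/funext => x; rewrite scale1r.
by rewrite -fv; split; [exact: L0|rewrite E0 f0; exact: mulr0].
Qed.

Let expR_diff_le (a b m : R) : a <= m -> b <= m -> `|expR a - expR b| <= `|a - b| * expR m.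
Proof.
move=> am bm.
have h := @expR_lip R (m - a) (m - b); rewrite !subr_ge0 in h; have := h am bm.
rewrite (_ : m - a - (m - b) = - (a - b)) ?normrN; last by ring.
rewrite !opprB => h2.
rewrite (_ : expR a - expR b = (expR (a - m) - expR (b - m)) * expR m).
  by rewrite normrM [`|expR m|]ger0_norm ?expR_ge0// ler_wpM2r ?expR_ge0.
by rewrite mulrBl -!expRD !subrK.
Qed.

(** P exp V is compared with q0 exp G, whose first moment about v = D J^-1 vanishes: the numerator
    centred at v is the integral of the difference [F]. For |u| <= s r this is of order e1. Beyond,
    the Gaussian part is of order 1/(s r), and the factor (s r)^-5 against the prior mass s^4 also
    leaves order 1/s. The bound on W keeps the denominator above [m0]. *)
Lemma posterior_limit e w0 : 0 < e -> 0 < w0 -> exists S, forall s W q0 D J P V, posterior_like s W q0 D J P V -> S <= s ->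
  W <= w0 -> forall a, `|I4 (fun u => u ord0 a * (P u * expR (V u))) / I4 (fun u => P u * expR (V u)) -
    (D *m invmx J) ord0 a| <= e.
Proof.
move=> e0 w00; pose k := c / 2; have k0 : 0 < k by rewrite divr_gt0.
pose R2 := 4 / c * (C * w0); have R20 : 0 <= R2 by rewrite mulr_ge0 ?divr_ge0 ?mulr_ge0// ltW.
pose b := 4 * (C * w0); have b0 : 0 <= b by rewrite !mulr_ge0// ltW.
pose qM := `|qmax|; have qM0 : 0 <= qM := normr_ge0 _.
pose A1 := (1 + R2) * (1 + qM * (w0 + 1)) * absorb 3 b k.
pose A2 := (1 + R2) * qM * absorb 2 b k.
pose A3 := (1 + R2) * absorb 6 b k.
have R21 : 0 <= 1 + R2 by rewrite addr_ge0.
have wq : 0 <= 1 + qM * (w0 + 1) by rewrite addr_ge0// mulr_ge0// addr_ge0// ltW.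
have A10 : 0 <= A1 by rewrite !mulr_ge0 ?absorb_ge0.
have A20 : 0 <= A2 by rewrite !mulr_ge0 ?absorb_ge0.
have A30 : 0 <= A3 by rewrite mulr_ge0 ?absorb_ge0.
pose gs := fun x : 'rV[R]_4 => expR (- (k / 4) * `|x| ^+ 2).
have Lgs : L1 gs by apply: L1_gauss; rewrite divr_gt0.
pose I1 := I4 gs; have I10 : 0 <= I1 by apply: Rintegral_ge0 => z _; exact: expR_ge0.
pose m0 := qmin / 2 * expR (- C5 * w0).
have q20 : 0 < qmin / 2 by rewrite divr_gt0.
have m00 : 0 < m0 by rewrite mulr_gt0 ?expR_gt0.
have em : 0 < e * m0 / 2 by rewrite divr_gt0// mulr_gt0.
(* The bound by qmin / 2 keeps the prior positive for |u| <= s r, so that the upper bound on V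
   applies there. *)
pose e1 := Num.min (qmin / 2) (e * m0 / 2 / (A1 * I1 + 1)).
have AI : 0 < A1 * I1 + 1 by rewrite ltr_wpDl// mulr_ge0.
have e10 : 0 < e1 by rewrite lt_min q20 divr_gt0.
pose r := Num.min (mod e1) (qm e1); have r0 : 0 < r by rewrite lt_min mod0// qm0.
pose B := A2 * I1 / r + A3 / r ^+ 5.
have B0 : 0 <= B by rewrite addr_ge0// divr_ge0 ?mulr_ge0 ?exprn_ge0// ltW.
exists ((mod 1)^-1 + (qm (qmin / 2))^-1 + B / (e * m0 / 2) + 1).
move=> s W q0 D J P V H Ss Ww a.
have [[W1 s0 /andP[q1 q2] DW] [sJ cJ'] [mP mV lP IP P0] up [nV nP]] := H.
have cJ x : c * `|x| ^+ 2 <= bil J x x by have /andP[] := cJ' x.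
have i1 : 0 <= (mod 1)^-1 by rewrite invr_ge0 ltW// mod0.
have i2 : 0 <= (qm (qmin / 2))^-1 by rewrite invr_ge0 ltW// qm0.
have i3 : 0 <= B / (e * m0 / 2) by rewrite divr_ge0// ltW.
have h1 : 1 <= s * mod 1 by rewrite -ler_pdivrMr ?mod0// div1r; move: Ss i1 i2 i3; clear; lra.
have h2 : 1 <= s * qm (qmin / 2) by rewrite -ler_pdivrMr ?qm0// div1r; move: Ss i1 i2 i3; clear; lra.
have s1 : 1 <= s by move: Ss i1 i2 i3; clear; lra.
have sB : B / s <= e * m0 / 2.
  by rewrite ler_pdivrMr// mulrC -ler_pdivrMr//; move: Ss i1 i2 i3; clear; lra.
have low : m0 <= I4 (fun u => P u * expR (V u)).
  rewrite (le_trans _ (PV_lower H h1 h2))// ler_wpM2l ?(ltW q20)// ler_expR.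
  by rewrite !mulNr lerN2 ler_wpM2l// !addr_ge0 ?mulr_ge0 ?divr_ge0// ltW.
set Dn := I4 _ in low *.
have Dn0 : 0 < Dn by exact: lt_le_trans low.
have W0 : 0 < W by exact: lt_le_trans W1.
set v := D *m invmx J.
have vR : `|v| <= R2.
  rewrite (le_trans (inverse_bound D sJ c0 cJ))// ler_wpM2l ?divr_ge0 ?(ltW c0)//.
  by rewrite (le_trans DW)// ler_wpM2l// ltW.
pose G u := dotv D u - bil J u u / 2.
have Gc u : G u = bil J v v / 2 - bil J (u - v) (u - v) / 2 by exact: (quadratic_center c0 D sJ cJ).
have [Lc Ec] := centered_gauss v a sJ cJ.
have LG : L1 (fun u => (u - v) ord0 a * expR (G u)) /\ I4 (fun u => (u - v) ord0 a * expR (G u)) = 0.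
  rewrite (_ : (fun u => _ * expR (G u)) = fun u => expR (bil J v v / 2) * ((u - v) ord0 a * expR (- bil J (u - v) (u - v) / 2))).
    by split; [exact: L1_scale|rewrite I4_scale// Ec mulr0].
  by apply/funext => u; rewrite Gc expRD mulrCA mulNr.
have [LG1 LG0] := LG.
have cle (u : 'rV[R]_4) : `|(u - v) ord0 a| <= (1 + R2) * (1 + `|u|).
  rewrite (le_trans (ge_coord_norm _ _))// (le_trans (ler_normB _ _))//.
  by rewrite mulrDl mul1r lerD ?lerDr// (le_trans vR)// ler_peMr// lerDl.
have GE (u : 'rV[R]_4) : G u <= b * `|u| - k * `|u| ^+ 2.
  have d1 := le_trans (ler_norm _) (dotv_bound D u).
  have d2 : `|D| * `|u| <= C * w0 * `|u|.
    by rewrite ler_wpM2r// (le_trans DW)// ler_wpM2l// ltW.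
  exact: (half_quadratic_le d1 d2 (cJ u)).
have VE (u : 'rV[R]_4) : P u != 0 -> V u <= b * `|u| - k * `|u| ^+ 2.
  move=> /up t; rewrite (le_trans t)// lerB//.
    rewrite mulrAC ler_wpM2r// /b (le_trans (ler_wpM2l (ltW C0) Ww))//.
    by rewrite ler_peMl ?ler1n// mulr_ge0// ltW.
  by rewrite ler_wpM2r ?sqr_ge0// /k ler_pdivrMr// ler_peMr ?ler1n// ltW.
pose F u := (u - v) ord0 a * (P u * expR (V u)) - q0 * ((u - v) ord0 a * expR (G u)).
have mF1 : meas4 (fun u => (u - v) ord0 a).
  have -> : (fun u : 'rV[R]_4 => (u - v) ord0 a) = fun u => u ord0 a - v ord0 a.
    by apply/funext => u; rewrite !mxE.
  by apply: measurable_funB; [exact: mcoord|exact: measurable_cst].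
have LF1 : L1 (fun u => (u - v) ord0 a * (P u * expR (V u))).
  by apply: (PV_L1 H mF1); exists (1 + R2).
have LF : L1 F by apply: (integrable_sub measurableT LF1); exact: (L1_scale q0 LG1).
have sr0 : 0 < s * r by rewrite mulr_gt0.
have q0M : `|q0| <= qM by rewrite ger0_norm ?(le_trans q2 (ler_norm _))// (le_trans (ltW qmin0)).
pose maj (u : 'rV[R]_4) := (e1 * A1 + (s * r)^-1 * A2) * gs u + (s * r) ^- 5 * A3 * P u.
have Fm u : `|F u| <= maj u.
  have x0 : 0 <= `|u| by [].
  have x1 : 0 <= 1 + `|u| by rewrite addr_ge0.
  have g0 : 0 <= gs u by exact: expR_ge0.
  have f3 : 0 <= (s * r) ^- 5 * A3 * P u by rewrite !mulr_ge0 ?invr_ge0 ?exprn_ge0 ?(ltW sr0).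
  have f2 : 0 <= (s * r)^-1 * A2 * gs u by rewrite !mulr_ge0 ?invr_ge0 ?(ltW sr0).
  have f1 : 0 <= e1 * A1 * gs u by rewrite !mulr_ge0 ?(ltW e10).
  have Ex m : (1 + `|u|) ^+ m * expR (b * `|u| - k * `|u| ^+ 2) <= absorb m b k * gs u.
    exact: absorb_gauss.
  set X := expR (b * `|u| - k * `|u| ^+ 2) in Ex.
  have X0 : 0 <= X by exact: expR_ge0.
  have [ur|ru] := leP `|u| (s * r).
    have ur1 : `|u| <= s * mod e1 by rewrite (le_trans ur)// ler_pM2l// ge_min lexx.
    have ur2 : `|u| <= s * qm e1 by rewrite (le_trans ur)// ler_pM2l// ge_min lexx orbT.
    have p1 := nP e1 u e10 ur2; have p2 := nV e1 u e10 ur1; rewrite -/(G u) in p2.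
    have Pn0 : P u != 0.
      have e1q : e1 <= qmin / 2 by rewrite ge_min lexx.
      apply/eqP => Pu; move: p1; rewrite Pu sub0r normrN leNgt (lt_le_trans _ (ler_norm _))//.
      by rewrite (le_lt_trans e1q)// (lt_le_trans _ q1)// ltr_pdivrMr// ltr_pMr// ltr1n.
    have t0 : expR (V u) <= X by rewrite ler_expR VE.
    have t1 : `|expR (V u) - expR (G u)| <= e1 * (`|u| * w0 + `|u| ^+ 2) * X.
      rewrite (le_trans (expR_diff_le (VE u Pn0) (GE u)))// ler_wpM2r// (le_trans p2)// ler_wpM2l ?(ltW e10)//.
      by rewrite lerD2r ler_wpM2l.
    have t2 : `|P u * expR (V u) - q0 * expR (G u)| <= e1 * (1 + qM * (w0 + 1)) * ((1 + `|u|) ^+ 2 * X).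
      rewrite (_ : _ - _ = (P u - q0) * expR (V u) + q0 * (expR (V u) - expR (G u))); last by ring.
      rewrite (le_trans (ler_normD _ _))// !normrM [`|expR (V u)|]ger0_norm ?expR_ge0//.
      apply: (@le_trans _ _ (e1 * X + qM * (e1 * (`|u| * w0 + `|u| ^+ 2) * X))).
        by rewrite lerD// ler_pM// expR_ge0.
      rewrite -subr_ge0 (_ : _ - _ = e1 * X * (2 * `|u| + `|u| ^+ 2 + qM * (w0 * (1 + `|u| + `|u| ^+ 2) + 1 + 2 * `|u|))); last by ring.
      by rewrite !mulr_ge0 ?(ltW e10)// !addr_ge0 ?mulr_ge0 ?addr_ge0 ?sqr_ge0 ?mulr_ge0 ?addr_ge0 ?sqr_ge0// ltW.
    rewrite /F (_ : _ - _ = (u - v) ord0 a * (P u * expR (V u) - q0 * expR (G u))); last by ring.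
    rewrite normrM (le_trans (ler_pM _ _ (cle u) t2))//.
    rewrite [leLHS](_ : _ = e1 * ((1 + R2) * (1 + qM * (w0 + 1)) * ((1 + `|u|) ^+ 3 * X))); last by ring.
    apply: (@le_trans _ _ (e1 * A1 * gs u)); last by rewrite /maj mulrDl; move: f2 f3; clear; lra.
    by rewrite -[leRHS]mulrA ler_wpM2l ?(ltW e10)// /A1 -[leRHS]mulrA ler_wpM2l ?mulr_ge0.
  have far m : 1 <= ((1 + `|u|) / (s * r)) ^+ m.
    by rewrite exprn_ege1// ler_pdivlMr// mul1r (le_trans (ltW ru))// lerDr.
  have t1 : `|(u - v) ord0 a * (P u * expR (V u))| <= (s * r) ^- 5 * A3 * P u.
    have [->|Pu] := eqVneq (P u) 0; first by rewrite mul0r !mulr0 normr0.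
    rewrite !normrM [`|P u|]ger0_norm// [`|expR _|]ger0_norm ?expR_ge0// mulrCA mulrC ler_wpM2r//.
    have t0 : expR (V u) <= X by rewrite ler_expR VE.
    rewrite (le_trans (ler_pM _ _ (cle u) t0)) ?expR_ge0//.
    have y0 : 0 <= (1 + R2) * (1 + `|u|) * X by rewrite !mulr_ge0.
    rewrite (le_trans (ler_peMr y0 (far 5%N)))//.
    rewrite [leLHS](_ : _ = (s * r) ^- 5 * ((1 + R2) * ((1 + `|u|) ^+ 6 * X))); last first.
      by rewrite expr_div_n; ring.
    rewrite ler_wpM2l ?invr_ge0 ?exprn_ge0 ?(ltW sr0)// ler_wpM2l// (le_trans (Ex 6%N))//.
    rewrite ler_piMr ?absorb_ge0// -expR0 ler_expR mulNr oppr_le0 mulr_ge0 ?sqr_ge0// divr_ge0// ltW//.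
  have t2 : `|q0 * ((u - v) ord0 a * expR (G u))| <= (s * r)^-1 * A2 * gs u.
    rewrite !normrM [`|expR _|]ger0_norm ?expR_ge0//.
    have t0 : expR (G u) <= X by rewrite ler_expR GE.
    have t3 : `|q0| * (`|(u - v) ord0 a| * expR (G u)) <= qM * ((1 + R2) * (1 + `|u|) * X).
      by rewrite ler_pM ?mulr_ge0 ?expR_ge0// ler_pM ?expR_ge0.
    have y0 : 0 <= qM * ((1 + R2) * (1 + `|u|) * X) by rewrite !mulr_ge0.
    rewrite (le_trans t3)// (le_trans (ler_peMr y0 (far 1%N)))//.
    rewrite [leLHS](_ : _ = (s * r)^-1 * ((1 + R2) * qM * ((1 + `|u|) ^+ 2 * X))); last by rewrite expr1; ring.
    rewrite -[leRHS]mulrA ler_wpM2l ?invr_ge0 ?(ltW sr0)// /A2 -[leRHS]mulrA ler_wpM2l ?mulr_ge0//.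
  rewrite /F (le_trans (ler_normB _ _))// /maj mulrDl; move: f1 t1 t2; clear; lra.
have Lmaj : L1 maj by apply: L1_add; exact: L1_scale.
have IF : `|I4 F| <= e * m0.
  apply: (le_trans (I4_norm_le _ Lmaj Fm)).
    have cG : continuous G.
      apply: continuousD; first exact: dotv_continuous.
      by apply: continuousN; apply: continuousM; [exact: bil_continuous|exact: continuousC].
    have mA := meas4_mul mF1 (meas4_mul mP (meas4_exp mV)).
    have mG := meas4_mul mF1 (meas4_exp (meas4_continuous cG)).
    have mq : meas4 (fun _ => q0) by exact: measurable_cst.
    exact: (measurable_funB mA (meas4_mul mq mG)).
  rewrite I4_add; [|exact: L1_scale..]; rewrite I4_scale// I4_scale// IP -/I1.
  have alg (x y z i : R) : x != 0 -> y != 0 ->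
    (e1 * A1 + (x * y)^-1 * z) * i + (x * y) ^- 5 * A3 * x ^+ 4 = e1 * (A1 * i) + (z * i / y + A3 / y ^+ 5) / x.
    by move=> xn yn; field; rewrite ?xn ?yn.
  rewrite alg ?gt_eqF// -/B.
  have t : e1 * (A1 * I1) <= e * m0 / 2.
    apply: (@le_trans _ _ (e * m0 / 2 / (A1 * I1 + 1) * (A1 * I1))).
      by rewrite ler_wpM2r ?mulr_ge0// ge_min lexx orbT.
    by rewrite mulrAC ler_pdivrMr// ler_wpM2l ?(ltW em)// lerDl.
  move: t sB; clear; lra.
have eF : I4 F = I4 (fun u => u ord0 a * (P u * expR (V u))) - v ord0 a * Dn.
  rewrite /F I4_sub//; last exact: L1_scale.
  rewrite (I4_scale q0 LG1) LG0 mulr0 subr0.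
  rewrite (_ : (fun u : 'rV[R]_4 => (u - v) ord0 a * (P u * expR (V u))) = fun u : 'rV[R]_4 => u ord0 a * (P u * expR (V u)) - v ord0 a * (P u * expR (V u))).
    rewrite I4_sub ?I4_scale//.
    - exact: (PV_integrable H).
    - by apply: (PV_L1 H (mcoord a)); exists 1.
    - by apply: L1_scale; exact: (PV_integrable H).
  by apply/funext => u; rewrite !mxE mulrBl.
rewrite (_ : _ / Dn - _ = I4 F / Dn); last by rewrite eF; field; rewrite gt_eqF.
rewrite normrM [`|Dn^-1|]ger0_norm ?invr_ge0 ?(ltW Dn0)// ler_pdivrMr// (le_trans IF)//.
by rewrite ler_pM2l.
Qed.

End posterior.

(** * Measurability of the Bayes estimator *)

Lemma Rintegral_measurable (R : realType) d1 d2 (T1 : measurableType d1) (T2 : measurableType d2)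
    (m2 : {sigma_finite_measure set T2 -> \bar R}) (f : T1 * T2 -> R) :
  measurable_fun setT f -> measurable_fun setT (fun x => \int[m2]_y f (x, y)).
Proof.
move=> mf; have me : measurable_fun setT (EFin \o f) by exact/measurable_EFinP.
rewrite (_ : (fun x => _) = fine \o (fun x => \int[m2]_y (EFin \o f)^\+ (x, y) - \int[m2]_y (EFin \o f)^\- (x, y))%E); last first.
  apply/funext => x; rewrite /Rintegral integralE /=; congr (fine (_ - _)%E); by apply: eq_integral => y _; rewrite ?funeposE ?funenegE.
apply: measurableT_comp; first exact: fine_measurable.
apply: emeasurable_funB.
  apply: (@measurable_fun_fubini_tonelli_F _ _ _ _ _ m2 ((EFin \o f)^\+)%E); last exact: funepos_ge0.
  exact: measurable_funepos.
apply: (@measurable_fun_fubini_tonelli_F _ _ _ _ _ m2 ((EFin \o f)^\-)%E); last exact: funeneg_ge0.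
exact: measurable_funeneg.
Qed.

(** The inverse is continuous off 0, and a single point is measurable. *)
Lemma inv_measurable (R : realType) : measurable_fun setT (fun x : measurableTypeR R => x^-1 : measurableTypeR R).
Proof.
have o : open [set x : R | x != 0].
  rewrite (_ : [set x : R | x != 0] = ~` [set 0]); first by apply: closed_openC; apply: accessible_closed_set1; exact/hausdorff_accessible/Rhausdorff.
  by apply/seteqP; split => x /= /eqP.
rewrite (_ : setT = [set x : measurableTypeR R | x != 0] `|` [set 0]); last first.
  by apply/seteqP; split => x //= _; have [->|x0] := eqVneq x 0; [right|left].
apply/measurable_funU; [|exact: measurable_set1|split].
- exact: open_measurable.
- apply: open_continuous_measurable_fun => // x; rewrite inE/= => x0; exact: inv_continuous.
- exact: measurable_fun_set1.
Qed.

(** * Joint measurability in the trajectory and the parameter *)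

Section clamp.
Context {R : realType}.
Variable T : R.
Hypothesis T0 : 0 <= T.

(** Paths are known to be measurable in om at the times of [0, T] only. Freezing them outside
    preserves right continuity, since this map is nondecreasing and 1-Lipschitz. *)
Definition clamp (t : R) : R := Num.min (Num.max t 0) T.

Lemma clamp_itv t : 0 <= clamp t <= T.
Proof. by rewrite /clamp le_min le_max lexx orbT T0 ge_min lexx orbT. Qed.

Lemma clamp_id t : 0 <= t <= T -> clamp t = t.
Proof. by move=> /andP[t0 tT]; rewrite /clamp max_l// min_l. Qed.

Lemma clamp_incr s t : t <= s -> clamp t <= clamp s <= clamp t + (s - t).
Proof.
move=> ts; rewrite /clamp.
have /andP[m1 m2] : Num.max t 0 <= Num.max s 0 <= Num.max t 0 + (s - t).
  by rewrite !maxEle; case: (leP t 0) => ?; case: (leP s 0) => ?; apply/andP; split; lra.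
set x := Num.max t 0 in m1 m2 *; set y := Num.max s 0 in m1 m2 *.
by rewrite !minEle; case: (leP x T) => ?; case: (leP y T) => ?; apply/andP; split; lra.
Qed.

Lemma right_continuous_clamp (F : R -> R) : right_continuous F ->
  forall t, F (clamp s) @[s --> t^'+] --> F (clamp t).
Proof.
move=> rF t; apply/cvgrPdist_le => e e0.
have /cvgrPdist_le/(_ e e0) := rF (clamp t).
rewrite /at_right !near_withinE => /nbhs_ballP[dl /= d0 dP].
apply/nbhs_ballP; exists dl => // y; rewrite /= /ball/= => ty lty.
have /andP[c1 c2] := clamp_incr (ltW lty).
move: c1; rewrite le_eqVlt => /predU1P[<-|c1]; first by rewrite subrr normr0 ltW.
apply: dP => //=; rewrite /ball/=; move: ty.
rewrite distrC gtr0_norm ?subr_gt0// => ty.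
by rewrite distrC gtr0_norm ?subr_gt0//; lra.
Qed.
End clamp.

Section joint.
Context {R : realType} d (Om : measurableType d).
Local Notation TR := (measurableTypeR R).
Variable (L : Om -> 'rV[R]_4 -> R).
Hypotheses (mL : forall x, measurable_fun setT (L ^~ x)) (cL : forall om, continuous (L om)).

(** One coordinate at a time: those already treated join om as part of the sample point, and
    continuity in the next one gives what [right_continuous_jointly_measurable] asks. *)
Lemma continuous_jointly_measurable :
  measurable_fun [set: Om * (TR * TR * TR * TR)] (fun p => L p.1 (vec4 p.2)).
Proof.
have cont (f : R -> 'rV[R]_4) om : (forall s t, `|f s - f t| <= `|s - t|) ->
    forall t, L om (f s) @[s --> t^'+] --> L om (f t).
  move=> fl t; apply: cvg_at_right_filter; apply: (@continuous_comp _ _ _ f (L om)); last exact: cL.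
  apply/cvgrPdist_le => e e0; apply/nbhs_ballP; exists e => // y; rewrite /ball/= => ty.
  exact: le_trans (fl _ _) (ltW ty).
have vl (g : R -> R * R * R * R) : (forall s t (i : 'I_4), `|vec4 (g s) ord0 i - vec4 (g t) ord0 i| <= `|s - t|) ->
    forall s t, `|vec4 (g s) - vec4 (g t)| <= `|s - t|.
  by move=> h s t; apply: (@le_coord_norm _ 3) => i; rewrite mxE [X in _ + X]mxE.
have m1 b c e : measurable_fun [set: Om * TR] (fun p => L p.1 (vec4 (p.2, b, c, e))).
  apply: (@right_continuous_jointly_measurable _ _ _ (fun om a => L om (vec4 (a, b, c, e)))) => [a|om]; first exact: mL.
  apply: (cont (fun a => vec4 (a, b, c, e))); apply: vl => s t i.
  by rewrite !mxE !(tnth_nth 0); case: i => [[|[|[|[|//]]]] i4] /=; rewrite ?subrr ?normr0.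
have m2 c e : measurable_fun [set: (Om * TR) * TR] (fun p => L p.1.1 (vec4 (p.1.2, p.2, c, e))).
  apply: (@right_continuous_jointly_measurable _ _ _ (fun q b => L q.1 (vec4 (q.2, b, c, e)))) => [b|[om a]]; first exact: m1.
  apply: (cont (fun b => vec4 (a, b, c, e))); apply: vl => s t i.
  by rewrite !mxE !(tnth_nth 0); case: i => [[|[|[|[|//]]]] i4] /=; rewrite ?subrr ?normr0.
have m3 e : measurable_fun [set: (Om * TR) * TR * TR] (fun p => L p.1.1.1 (vec4 (p.1.1.2, p.1.2, p.2, e))).
  apply: (@right_continuous_jointly_measurable _ _ _ (fun q c => L q.1.1 (vec4 (q.1.2, q.2, c, e)))) => [c|[[om a] b]]; first exact: m2.
  apply: (cont (fun c => vec4 (a, b, c, e))); apply: vl => s t i.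
  by rewrite !mxE !(tnth_nth 0); case: i => [[|[|[|[|//]]]] i4] /=; rewrite ?subrr ?normr0.
have m4 : measurable_fun [set: (Om * TR) * TR * TR * TR] (fun p => L p.1.1.1.1 (vec4 (p.1.1.1.2, p.1.1.2, p.1.2, p.2))).
  apply: (@right_continuous_jointly_measurable _ _ _ (fun q e => L q.1.1.1 (vec4 (q.1.1.2, q.1.2, q.2, e)))) => [e|[[[om a] b] c]]; first exact: m3.
  apply: (cont (fun e => vec4 (a, b, c, e))); apply: vl => s t i.
  by rewrite !mxE !(tnth_nth 0); case: i => [[|[|[|[|//]]]] i4] /=; rewrite ?subrr ?normr0.
have mp : measurable_fun [set: Om * (TR * TR * TR * TR)]
    (fun p => ((((p.1, p.2.1.1.1), p.2.1.1.2), p.2.1.2), p.2.2) : (Om * TR) * TR * TR * TR).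
  by repeat apply: measurable_fun_pair => //=; repeat (apply: measurableT_comp => //=).
have := measurableT_comp m4 mp; apply: eq_measurable_fun => p _ /=.
by case: p => om [[[a b] c] e].
Qed.
End joint.

Section bayes_measurable.
Context {R : realType} {K : nat} d (Om : measurableType d).
Variables (N : network R K) (X : 'I_K -> Om -> cumulative R R) (n : nat).
Hypotheses (speed_gt0 : 0 < speed N) (horizon_gt0 : 0 < horizon N) (noise_gt0 : 0 < noise N)
  (front_ge0 : forall (i : 'I_2) (k : 'I_K) (t : R), 0 <= front N i k t)
  (r2 : cond_R2 N) (n0 : (0 < n)%N)
  (X0 : forall k om, X k om 0 = 0)
  (mX : forall k t, 0 <= t <= horizon N -> measurable_fun setT (fun om => X k om t : R))
  (clik : forall om, continuous (likelihood N n (fun k => X k om))).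

Local Notation T := (horizon N).
Local Notation TR := (measurableTypeR R).

Let path_integral k (f : R -> R) : continuous f ->
  measurable_fun setT (fun om => \int[@lebesgue_measure R]_(t in `[0, T]) (f t * X k om t)).
Proof.
move=> cf; have T0 := ltW horizon_gt0.
have jm : measurable_fun [set: Om * TR] (fun p => X k p.1 (clamp T p.2) : R).
  apply: (@right_continuous_jointly_measurable _ _ _ (fun om t => X k om (clamp T t))) => [t|om t].
    by apply: mX; exact: clamp_itv.
  have rc : right_continuous (X k om : R -> R) by move=> x; exact: (cumulative_is_right_continuous (X k om) x).
  exact: (@right_continuous_clamp _ T _ rc).
pose g (p : Om * TR) : R := (f p.2 * \1_(`[0, T]%classic) p.2) * X k p.1 (clamp T p.2).
have mg : measurable_fun setT g.
  apply: measurable_funM => //; apply: measurable_funM.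
    by apply: (measurableT_comp (continuous_measurable_fun cf)); exact: measurable_snd.
  apply: measurableT_comp; last exact: measurable_snd.
  by apply: measurable_indic; exact: measurable_itv.
have := @Rintegral_measurable _ _ _ _ _ (@lebesgue_measure R) _ mg; apply: eq_measurable_fun => om _.
rewrite [RHS]Rintegral_mkcond; apply: eq_Rintegral => t _; rewrite /g /= patchE indicE.
case: ifPn => tT; last by rewrite mulr0 mul0r.
by rewrite mulr1 clamp_id//; move: tT; rewrite inE/= in_itv.
Qed.

Lemma likelihood_measurable th : measurable_fun setT (fun om => likelihood N n (fun k => X k om) th).
Proof.
rewrite (_ : (fun om => _) = fun om => expR (\sum_(k < K) ((ln (intensity N k th T) - ln (noise N)) * X k om T -
    \int[@lebesgue_measure R]_(t in `[0, T]) (nll' N k th t * X k om t) -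
    (n%:R * \int[@lebesgue_measure R]_(t in `[0, T]) intensity N k th t -
     \int[@lebesgue_measure R]_(t in `[0, T]) (n%:R * noise N))))); last first.
  by apply/funext => om; rewrite (likelihood_parts horizon_gt0 noise_gt0 front_ge0 r2).
apply: measurableT_comp => //; apply: measurable_sum => k; apply: measurable_funB => //; apply: measurable_funB.
  by apply: measurable_funM => //; apply: mX; rewrite lexx ltW.
apply: path_integral; exact: (continuous_nll' noise_gt0 front_ge0 r2).
Qed.

Lemma likelihood_jointly_measurable :
  measurable_fun [set: Om * (TR * TR * TR * TR)] (fun p => likelihood N n (fun k => X k p.1) (vec4 p.2)).
Proof.
apply: (@continuous_jointly_measurable _ _ _ (fun om th => likelihood N n (fun k => X k om) th)) => //.
exact: likelihood_measurable.
Qed.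

Lemma bayes_measurable q a : measurable_fun setT (fun z : TR * TR * TR * TR => (q \_ (param N)) (vec4 z)) ->
  measurable_fun setT (fun om => bayes N q n (fun k => X k om) ord0 a).
Proof.
move=> mq.
have int4E (g : 'rV[R]_4 -> R) : int4 (param N) (fun th => g th * q th) =
    \int[@leb4 R]_z (g (vec4 z) * (q \_ (param N)) (vec4 z)).
  rewrite /int4 Rintegral_mkcond; apply: eq_Rintegral => z _; rewrite !patchE.
  have -> : (z \in @vec4 R @^-1` param N) = (vec4 z \in param N) by apply/idP/idP; rewrite !inE.
  by case: ifP => // _; rewrite mulr0.
pose L om th := likelihood N n (fun k => X k om) th.
have mj := likelihood_jointly_measurable.
have mq2 : measurable_fun [set: Om * (TR * TR * TR * TR)] (fun p => (q \_ (param N)) (vec4 p.2)).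
  by apply: (measurableT_comp mq); exact: measurable_snd.
have mv : measurable_fun [set: Om * (TR * TR * TR * TR)] (fun p => vec4 p.2 ord0 a).
  by apply: (measurableT_comp (measurable_vec4 a)); exact: measurable_snd.
rewrite (_ : (fun om => _) = fun om =>
  \int[@leb4 R]_z (vec4 z ord0 a * L om (vec4 z) * (q \_ (param N)) (vec4 z)) *
  (\int[@leb4 R]_z (L om (vec4 z) * (q \_ (param N)) (vec4 z)))^-1); last first.
  apply/funext => om; rewrite mxE -!(int4E (L om)) -(int4E (fun th => th ord0 a * L om th)).
  congr (_ / _); apply: eq_Rintegral => z _; rewrite /L; ring.
apply: measurable_funM.
  apply: (@Rintegral_measurable _ _ _ _ _ (@leb4 R) (fun p => vec4 p.2 ord0 a * L p.1 (vec4 p.2) * (q \_ (param N)) (vec4 p.2))).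
  by apply: measurable_funM => //; apply: measurable_funM.
apply: (measurableT_comp (@inv_measurable R)).
apply: (@Rintegral_measurable _ _ _ _ _ (@leb4 R) (fun p => L p.1 (vec4 p.2) * (q \_ (param N)) (vec4 p.2))).
exact: measurable_funM.
Qed.

End bayes_measurable.

(** * The two estimators *)

Lemma sqrt_nat_ge (R : realType) (S : R) : exists2 n0, (0 < n0)%N & forall n, (n0 <= n)%N -> S <= Num.sqrt n%:R.
Proof.
have [n0 _ H] := nbhs_infty_ger (S ^+ 2); exists n0.+1 => // n hn.
rewrite (le_trans (ler_norm _))// -sqrtr_sqr ler_sqrt//.
by apply: H => /=; exact: ltnW.
Qed.

Section normed.
Context {R : realType} {V : normedModType R}.

Lemma patch_continuous (A : set V) (f : V -> R) x : open A -> A x -> {for x, continuous f} ->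
  {for x, continuous (f \_ A)}.
Proof.
move=> oA Ax cf; have nA : \forall y \near x, A y by exact: open_nbhs_nbhs.
rewrite /prop_for /continuous_at patchE mem_set//; apply: cvg_trans cf; apply: near_eq_cvg.
by near=> y; rewrite patchE mem_set//; near: y.
Unshelve. all: by end_near.
Qed.

Lemma compact_upper_bound (A : set V) (f : V -> R) : compact A -> (forall x, A x -> {for x, continuous f}) ->
  exists M, forall x, A x -> f x <= M.
Proof.
move=> cA cf.
(* A positive lower bound for exp(- f) is an upper bound for f. *)
have [m m0 mP] : exists2 m, 0 < m & forall x, A x -> m <= expR (- f x).
  apply: compact_lower_bound => // x Ax; last exact: expR_gt0.
  apply: continuous_comp; last exact: continuous_expR.
  by apply: cvgN; exact: (cf x Ax).
by exists (- ln m) => x Ax; rewrite lerNr -ler_expR lnK ?mP.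
Qed.

Lemma continuous_exp (f : V -> R) : continuous f -> continuous (fun x => expR (f x)).
Proof. by move=> cf x; apply: continuous_comp; [exact: cf|exact: continuous_expR]. Qed.

Lemma continuous_affine (s : R) (a : V) : continuous (fun u => s *: u + a).
Proof. by move=> u; apply: cvgD; [apply: cvgZr; exact: cvg_id|exact: cvg_cst]. Qed.
End normed.

(** * The prior and its rescaling *)

Section prior.
Context {R : realType}.
Variables (A : set 'rV[R]_4) (q : 'rV[R]_4 -> R).
Hypotheses (oA : open A) (pq : prior_density A q).
Local Notation q1 := (q \_ A).

Lemma prior_ge0 th : 0 <= q1 th.
Proof. by have [q0 _ _] := pq; rewrite patchE; case: ifPn => //; rewrite inE => /q0/ltW. Qed.

Lemma prior_at th : A th -> q1 th = q th.
Proof. by move=> At; rewrite patchE mem_set. Qed.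

Lemma prior_gt0 th : A th -> 0 < q1 th.
Proof. by have [q0 _ _] := pq; move=> At; rewrite prior_at//; exact: q0. Qed.

Lemma prior_out th : q1 th != 0 -> A th.
Proof. by rewrite patchE; case: ifPn; [rewrite inE|rewrite eqxx]. Qed.

Let q_continuous th : A th -> {for th, continuous q}.
Proof.
move=> At; have [_ cq _] := pq; move: cq; rewrite continuous_open_subspace// => cq.
by apply: cq; rewrite inE.
Qed.

Lemma prior_continuous th : A th -> {for th, continuous q1}.
Proof.
by move=> At; exact: (patch_continuous oA At (q_continuous At)).
Qed.

Let mA : measurable (@vec4 R @^-1` A : set (measurableTypeR R * measurableTypeR R * measurableTypeR R * measurableTypeR R)).
Proof. exact: (open_preimage_measurable (@measurable_vec4 R) oA). Qed.

Let preim (z : R * R * R * R) : (z \in @vec4 R @^-1` A) = (vec4 z \in A).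
Proof. by apply/idP/idP; rewrite !inE. Qed.

Lemma patch_vec4 (f : 'rV[R]_4 -> R) : (fun z => (f \_ A) (vec4 z)) = (fun z => f (vec4 z)) \_ (@vec4 R @^-1` A).
Proof. by apply/funext => z; rewrite !patchE preim. Qed.

Lemma prior_measurable : meas4 q1.
Proof.
rewrite /meas4 patch_vec4; apply/(measurable_restrictT _ mA).
exact: (continuous_on_measurable (@measurable_vec4 R) oA q_continuous).
Qed.

Let ege0 : (\int[@leb4 R]_z (q1 (vec4 z))%:E = 1)%E.
Proof.
have [_ _ e1] := pq; rewrite -[RHS]e1 [RHS]integral_mkcond; congr (integral _ _ _).
by apply/funext => z; rewrite !patchE preim; case: ifP.
Qed.

Lemma prior_L1 : L1 q1.
Proof.
apply/integrableP; split; first by apply/measurable_EFinP; exact: prior_measurable.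
under eq_integral do rewrite /= ger0_norm ?prior_ge0//.
by rewrite ege0 ltry.
Qed.

Lemma prior_I4 : I4 q1 = 1.
Proof. by rewrite /I4 /Rintegral ege0. Qed.

End prior.

Lemma leb4E (R : realType) : (@leb4 R : set (R * R * R * R) -> \bar R) = lebesgue4 R.
Proof. by []. Qed.

Lemma int4_patch (R : realType) (A : set 'rV[R]_4) (g : 'rV[R]_4 -> R) : int4 A g = I4 (g \_ A).
Proof.
rewrite /int4 Rintegral_mkcond -(patch_vec4 A g) /I4 /Rintegral; apply: (congr1 (@fine R)).
apply: eq_measure_integral => B mB _.
exact: (congr1 (fun m : set (R * R * R * R) -> \bar R => m B) (esym (leb4E R))).
Qed.

(** In the coordinate u = s (th - th0) the numerator and the denominator acquire the same Jacobian,
    and the factor [L0] is common to both. *)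
Lemma posterior_ratio (R : realType) (s L0 : R) (th0 : 'rV[R]_4) (q Q : 'rV[R]_4 -> R) a
    (h := fun u => q (s^-1 *: u + th0) * expR (Q (s^-1 *: u + th0))) : 0 < s -> 0 < L0 ->
  L1 h -> L1 (fun u => u ord0 a * h u) -> I4 h != 0 ->
  s * (I4 (fun th => th ord0 a * q th * (L0 * expR (Q th))) / I4 (fun th => q th * (L0 * expR (Q th))) - th0 ord0 a) =
  I4 (fun u => u ord0 a * h u) / I4 h.
Proof.
move=> s0 L00 l0 l1 h0; have sn : s != 0 by rewrite gt_eqF.
pose G th := q th * expR (Q th).
have hG th : h (s *: th + - (s *: th0)) = G th.
  by rewrite /h -scalerBr scalerA mulVf// scale1r subrK.
have [lG iG] : L1 G /\ I4 G = `|s^-1| ^+ 4 * I4 h.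
  have [A B] := I4_affine (- (s *: th0)) sn l0.
  by move: A B; rewrite (_ : (fun x => h _) = G)//; apply/funext => x; exact: hG.
pose H (th : 'rV[R]_4) := s * (th ord0 a - th0 ord0 a) * G th.
have [lH iH] : L1 H /\ I4 H = `|s^-1| ^+ 4 * I4 (fun u => u ord0 a * h u).
  have [A B] := I4_affine (- (s *: th0)) sn l1.
  move: A B; rewrite (_ : (fun x => _ * h _) = H)//; apply/funext => x.
  by rewrite hG /H !mxE; ring.
have -> : (fun th : 'rV[R]_4 => th ord0 a * q th * (L0 * expR (Q th))) = (fun th => L0 * s^-1 * H th + L0 * th0 ord0 a * G th).
  by apply/funext => th; rewrite /H /G; field.
have -> : (fun th : 'rV[R]_4 => q th * (L0 * expR (Q th))) = (fun th => L0 * G th).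
  by apply/funext => th; rewrite /G; ring.
rewrite I4_add; [|exact: L1_scale|exact: L1_scale]; rewrite !I4_scale// iG iH.
rewrite ger0_norm ?invr_ge0 ?(ltW s0)//; field.
by rewrite sn h0 gt_eqF.
Qed.

Lemma lan_rescaled (R : realType) C c mod TH s W th0 D J (Q : 'rV[R]_4 -> R) :
  lan C c mod TH s W th0 D J Q -> 0 < s ->
  (forall e u, 0 < e -> `|u| <= s * mod e ->
    `|Q (s^-1 *: u + th0) - (dotv D u - bil J u u / 2)| <= e * (`|u| * W + `|u| ^+ 2)) /\
  (forall u, TH (s^-1 *: u + th0) -> Q (s^-1 *: u + th0) <= C * `|u| * W - c * `|u| ^+ 2).
Proof.
move=> [_ _ up ex] s0; have ns (u : 'rV[R]_4) : s * `|s^-1 *: u| = `|u|.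
  by rewrite normrZ ger0_norm ?invr_ge0 ?(ltW s0)// mulVKf// gt_eqF.
split=> [e u e0 ue|u Tu]; last by have := up _ (@subset_closure _ _ _ Tu); rewrite addrK ns.
have ue' : `|s^-1 *: u| <= mod e by rewrite -(ler_pM2l s0) ns.
have := ex e _ e0 ue'; rewrite ns [th0 + _]addrC bilZl bilZr dotvZr.
rewrite (_ : s * (s^-1 * dotv D u) = dotv D u); last by rewrite mulVKf// gt_eqF.
by rewrite (_ : s ^+ 2 / 2 * (s^-1 * (s^-1 * bil J u u)) = bil J u u / 2)//; field; rewrite gt_eqF.
Qed.

Lemma coordE (R : realType) (s : R) (x y : 'rV[R]_4) a : (s *: (x - y)) ord0 a = s * (x ord0 a - y ord0 a).
Proof. by rewrite !mxE. Qed.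

Lemma le_sup_value (R : realType) (V : Type) (A : set V) (f : V -> R) (y : R) :
  y%:E = ereal_sup [set (f x)%:E | x in A] -> forall x, A x -> f x <= y.
Proof. by move=> yE x Ax; rewrite -lee_fin yE; apply: ereal_sup_ubound; exists x. Qed.

Lemma intensity_continuous (R : realType) (K : nat) (N : network R K) k th :
  cond_R2 N -> continuous (intensity N k th).
Proof.
move=> [C2 _ _ _]; apply: (@continuous_intensity _ _ _ (front' N)) => i j t.
by have [h _ _] := C2 i j; apply: DeriveDef; [exact: h|rewrite /front' derive1E].
Qed.

(** * Linearization of the two estimators *)

Section estimators.
Context {R : realType} {K : nat}.
Variables (N : network R K) (d : nat -> measure_display) (Om : forall n : nat, measurableType (d n))
  (P : forall n : nat, 'rV[R]_4 -> probability (Om n) R)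
  (X : forall n : nat, 'I_K -> Om n -> cumulative R R).
Hypotheses (speed_gt0 : 0 < speed N) (horizon_gt0 : 0 < horizon N) (noise_gt0 : 0 < noise N)
  (front_ge0 : forall (i : 'I_2) (k : 'I_K) (t : R), 0 <= front N i k t)
  (source_detector : forall th : 'rV[R]_4, param N th ->
       forall (i : 'I_2) (k : 'I_K), source th i <> detector N k)
  (obs : forall (n : nat) (th : 'rV[R]_4), (0 < n)%N -> param N th ->
       observation N n th (P n th) (@X n))
  (r2 : cond_R2 N) (r3 : cond_R3 N) (r4 : cond_R4 N).
Variable (KK : set 'rV[R]_4).
Hypotheses (cKK : compact KK) (KP : KK `<=` param N).
Local Notation T := (horizon N).
Local Notation path n om := (fun k => @X n k om).

Definition nfluct n (th0 : 'rV[R]_4) (om : Om n) : R := fluct T (fun k => intensity N k th0) (@X n) n om.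

(* The two bounds hold on every trajectory: the law of the observations enters only through the exponential
   moments of [nfluct] and the limit law of [ncscore]. *)
Definition linearized (est : forall n : nat, Om n -> 'rV[R]_4) : Prop :=
  [/\ forall n th0, (0 < n)%N -> KK th0 -> forall a, measurable_fun setT (fun om => est n om ord0 a),
      exists A n0, (0 < n0)%N /\ forall n th0 om, (n0 <= n)%N -> KK th0 ->
        `|Num.sqrt n%:R *: (est n om - th0)| <= A * nfluct th0 om &
      forall e w0, 0 < e -> 0 < w0 -> exists2 n0, (0 < n0)%N & forall n th0 om, (n0 <= n)%N -> KK th0 -> nfluct th0 om <= w0 ->
        `|Num.sqrt n%:R *: (est n om - th0) - ncscore N n (path n om) th0 *m invmx (fisher N th0)| <= e].

Lemma observed_paths n th0 : (0 < n)%N -> param N th0 ->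
  forall k, poisson_process (P n th0) T (fun t => n%:R * intensity N k th0 t) (@X n k).
Proof. by move=> n0 p0; have [] := obs n0 p0. Qed.

Lemma path0 n th0 k om : (0 < n)%N -> param N th0 -> @X n k om 0 = 0.
Proof. by move=> n0 p0; have [/(_ om)[]] := observed_paths n0 p0 k. Qed.

Lemma nfluct_ge1 n th0 (om : Om n) : (0 < n)%N -> 1 <= nfluct th0 om.
Proof. by move=> n0; exact: (fluct_ge1 T (fun k => intensity N k th0) (@X n) n0 om). Qed.

Lemma path_controlled : exists2 CJ, 0 <= CJ & forall n th0 om, (0 < n)%N -> KK th0 ->
  controlled T CJ (Num.sqrt n%:R) (nfluct th0 om) (npath N n (path n om) th0).
Proof.
have [L L0 LP] := intensity_le speed_gt0 horizon_gt0 r2 KP.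
exists (1 + 2 * T + 2 * L * T ^+ 2).
  by rewrite !addr_ge0 ?mulr_ge0 ?sqr_ge0// ltW.
move=> n th0 om n0 K0; apply: (observed_controlled _ horizon_gt0 (ltW L0) n0 _ _ _ (observed_paths n0 (KP K0))).
- by move=> k; exact: intensity_continuous.
- by move=> k t; apply: ltW; exact: intensity_gt0.
- by move=> k t tT; exact: LP.
Qed.

Lemma observed_lan : exists C c (mod : R -> R),
  [/\ 0 < C, 0 < c, forall e, 0 < e -> 0 < mod e & forall n th0 (om : Om n), KK th0 -> (0 < n)%N ->
        lan C c mod (param N) (Num.sqrt n%:R) (nfluct th0 om) th0 (ncscore N n (path n om) th0)
          (fisher N th0) (nllr N n (path n om) th0)].
Proof.
have [CJ CJ0 CP] := path_controlled.
have [C [c [mod [C0 c0 m0 L]]]] :=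
  network_lan speed_gt0 horizon_gt0 noise_gt0 front_ge0 source_detector r2 r3 r4 cKK KP CJ0.
exists C, c, mod; split => // n th0 om K0 n0; apply: L => //; last exact: CP.
by rewrite (le_trans ler01)// nfluct_ge1.
Qed.

Lemma margin : exists2 rho, 0 < rho & forall th0 h, KK th0 -> `|h| <= rho -> param N (th0 + h).
Proof.
by have [_ oP _ _] := r2; have [rho rho0 H] := compact_open_margin cKK oP KP; exists rho => // th0 h K0; exact: H.
Qed.

Lemma mle_linearized est : (forall n : nat, is_mle N n (@X n) (est n)) -> linearized est.
Proof.
move=> mle; have [C [c [mod [C0 c0 m0 L]]]] := observed_lan.
have s0 n : (0 < n)%N -> 0 < Num.sqrt n%:R :> R by move=> n0; rewrite sqrtr_gt0 ltr0n.
have best n th0 om : (0 < n)%N -> KK th0 -> forall th, param N th ->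
    nllr N n (path n om) th0 th <= nllr N n (path n om) th0 (est n om).
  move=> n0 K0 th pth; have [_ /(_ om)[_ eL]] := mle n.
  have X0 k : @X n k om 0 = 0 by apply: (path0 _ _ n0 (KP K0)).
  have := le_sup_value eL pth.
  have e1 := likelihood_nllr horizon_gt0 noise_gt0 front_ge0 r2 th0 th n0 X0.
  have e2 := likelihood_nllr horizon_gt0 noise_gt0 front_ge0 r2 th0 (est n om) n0 X0.
  rewrite e1 e2 => h; have l0 : 0 < likelihood N n (path n om) th0 by exact: expR_gt0.
  by move: h; rewrite (ler_pM2l l0) ler_expR.
have clo n om : closure (param N) (est n om) by have [_ /(_ om)[]] := mle n.
split.
- by move=> n th0 _ _ a; have [] := mle n.
- exists (C / c), 1%N; split => // n th0 om n0 K0.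
  have := mle_bound c0 m0 (L n th0 om K0 n0) (s0 n n0) (KP K0) (clo n om) (best n th0 om n0 K0).
  by rewrite normrZ ger0_norm// ltW// s0.
have [rho rho0 mg] := margin.
move=> e w0 e0 w00; have [S H] := mle_limit (param N) C0 c0 m0 rho0 e0 w00.
have [n0 n00 n0P] := sqrt_nat_ge S; exists n0 => // n th0 om nn K0 W0.
have ng : (0 < n)%N := leq_trans n00 nn.
apply: (H _ _ _ _ _ _ _ (n0P n nn) (s0 n ng) _ (L n th0 om K0 ng) _ (clo n om) (best n th0 om ng K0)).
- by rewrite W0 andbT (le_trans ler01)// nfluct_ge1.
- by move=> h; exact: mg.
Qed.

Section bayes.
Variables (q : 'rV[R]_4 -> R).
Hypothesis (pq : prior_density (param N) q).
Local Notation q1 := (q \_ (param N)).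

Let oP : open (param N). Proof. by have [] := r2. Qed.

Let prior_range : exists qmin qmax, 0 < qmin /\ forall th, KK th -> qmin <= q1 th <= qmax.
Proof.
have cq th : KK th -> {for th, continuous q1} by move=> /KP; exact: prior_continuous.
have [m m0 mP] := compact_lower_bound cKK cq (fun th K0 => prior_gt0 pq (KP K0)).
have [M MP] := compact_upper_bound cKK cq.
by exists m, M; split => // th K0; rewrite mP//= MP.
Qed.

Let prior_unif : exists qm : R -> R, (forall e, 0 < e -> 0 < qm e) /\
  forall e th h, 0 < e -> KK th -> `|h| <= qm e -> `|q1 (h + th) - q1 th| <= e.
Proof.
have cq th : KK th -> {for th, continuous q1} by move=> /KP; exact: prior_continuous.
pose Pm e del := 0 < e -> 0 < del /\ forall th h, KK th -> `|h| <= del -> `|q1 (h + th) - q1 th| <= e.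
have /choice[qm qmP] : forall e, exists del, Pm e del.
  move=> e; have [e0|e0] := ltP 0 e; last by exists 0 => h; move: e0; rewrite leNgt h.
  have [del d0 D] := compact_unif cKK cq e0; exists (del / 2) => _; split; first by rewrite divr_gt0.
  move=> th h K0 hd; rewrite distrC; apply: D => //.
  by rewrite distrC addrK (le_lt_trans hd)// ltr_pdivrMr// ltr_pMr// ltr1n.
by exists qm; split => [e e0|e th h e0]; have [m0 mP] := qmP e e0 => //; exact: mP.
Qed.

Lemma likelihood_continuous n th0 om : (0 < n)%N -> KK th0 -> continuous (likelihood N n (path n om)).
Proof.
move=> n0 K0; have [CJ CJ0 CP] := path_controlled.
have X0 k : @X n k om 0 = 0 by apply: (path0 _ _ n0 (KP K0)).
have -> : likelihood N n (path n om) = fun th => likelihood N n (path n om) th0 * expR (nllr N n (path n om) th0 th).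
  by apply/funext => th; exact: (likelihood_nllr horizon_gt0 noise_gt0 front_ge0 r2 th0 th n0 X0).
apply: continuousM; first exact: continuousC.
apply: continuous_exp.
have W0 : 0 <= nfluct th0 om by rewrite (le_trans ler01)// nfluct_ge1.
exact: (continuous_nllr speed_gt0 horizon_gt0 noise_gt0 front_ge0 r2 CJ0 W0 (CP n th0 om n0 K0)).
Qed.

Lemma nbayes_measurable n th0 : (0 < n)%N -> KK th0 ->
  forall a, measurable_fun setT (fun om => bayes N q n (path n om) ord0 a).
Proof.
move=> n0 K0 a.
apply: (bayes_measurable horizon_gt0 noise_gt0 front_ge0 r2 n0 (X := @X n)).
- by move=> k om; apply: (path0 _ _ n0 (KP K0)).
- by move=> k t tT; have [_ h _ _] := observed_paths n0 (KP K0) k; exact: h.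
- by move=> om; exact: (@likelihood_continuous n th0 om n0 K0).
exact: prior_measurable.
Qed.

Lemma bayes_posterior : exists C c qmin qmax (mod qm : R -> R),
  [/\ 0 < C, 0 < c, forall e, 0 < e -> 0 < mod e, forall e, 0 < e -> 0 < qm e & 0 < qmin /\
    forall n th0 (om : Om n), (0 < n)%N -> KK th0 ->
      posterior_like C c qmin qmax mod qm (Num.sqrt n%:R) (nfluct th0 om) (q1 th0) (ncscore N n (path n om) th0)
        (fisher N th0) (fun u => q1 ((Num.sqrt n%:R)^-1 *: u + th0))
        (fun u => nllr N n (path n om) th0 ((Num.sqrt n%:R)^-1 *: u + th0))].
Proof.
have [C [c [mod [C0 c0 m0 L]]]] := observed_lan.
have [qmin [qmax [qmin0 qR]]] := prior_range; have [qm [qm0 qmP]] := prior_unif.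
exists C, c, qmin, qmax, mod, qm; split => //; split => // n th0 om n0 K0.
have sn0 m : (0 < m)%N -> 0 < Num.sqrt m%:R :> R by move=> ?; rewrite sqrtr_gt0 ltr0n.
have [DW JP _ _] := L n th0 om K0 n0.
have [ex' up'] := lan_rescaled (L n th0 om K0 n0) (sn0 n n0).
have [CJ CJ0 CP] := path_controlled.
have W1 := nfluct_ge1 th0 om n0.
set s : R := Num.sqrt n%:R in DW ex' up' *; set W := nfluct th0 om in DW ex' up' W1 *.
have s0 : 0 < s by rewrite sqrtr_gt0 ltr0n.
have sn : s^-1 != 0 by rewrite invr_eq0 gt_eqF.
have [lq iq] := I4_affine th0 sn (prior_L1 oP pq).
have caff : continuous (fun u : 'rV[R]_4 => s^-1 *: u + th0).
  exact: continuous_affine.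
split => //.
- by split => //; exact: qR.
- split => //.
  + by apply/measurable_EFinP; exact: measurable_int lq.
  + apply: meas4_continuous => u.
    apply: (@continuous_comp _ _ _ (fun u : 'rV[R]_4 => s^-1 *: u + th0) (nllr N n (path n om) th0)); first exact: caff.
    have W0 : 0 <= nfluct th0 om by exact: le_trans ler01 W1.
    exact: (continuous_nllr speed_gt0 horizon_gt0 noise_gt0 front_ge0 r2 CJ0 W0 (CP n th0 om n0 K0)).
  + by rewrite iq (prior_I4 pq) mulr1 invrK ger0_norm// ltW.
  + by move=> u; exact: (prior_ge0 pq).
- by move=> u /prior_out; exact: up'.
split => // e u e0 ue.
by apply: qmP => //; rewrite normrZ ger0_norm ?invr_ge0 ?(ltW s0)// ler_pdivrMl.
Qed.

Lemma bayes_linearized : linearized (fun n om => bayes N q n (path n om)).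
Proof.
have [C [c [qmin [qmax [mod [qm [C0 c0 m0 qm0 [qmin0 post]]]]]]]] := bayes_posterior.
have s0 n : (0 < n)%N -> 0 < Num.sqrt n%:R :> R by move=> n0; rewrite sqrtr_gt0 ltr0n.
(* From this value of n^(1/2) on, [PV_lower] makes the denominator positive, so that the quotient in
   [bayes] is a genuine one. *)
pose S0 := Num.max (mod 1)^-1 (qm (qmin / 2))^-1.
have ratio n th0 om a : (0 < n)%N -> S0 <= Num.sqrt n%:R -> KK th0 ->
  let P' u := q1 ((Num.sqrt n%:R)^-1 *: u + th0) in
  let V u := nllr N n (path n om) th0 ((Num.sqrt n%:R)^-1 *: u + th0) in
  Num.sqrt n%:R * (bayes N q n (path n om) ord0 a - th0 ord0 a) =
  I4 (fun u => u ord0 a * (P' u * expR (V u))) / I4 (fun u => P' u * expR (V u)).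
  move=> n0 Sn K0 P' V; have po := post n th0 om n0 K0.
  have q20 : 0 < qmin / 2 by rewrite divr_gt0.
  have X0 k : @X n k om 0 = 0 by apply: (path0 _ _ n0 (KP K0)).
  have /andP[S1 S2] : (1 <= Num.sqrt n%:R * mod 1) && (1 <= Num.sqrt n%:R * qm (qmin / 2)).
    move: Sn; rewrite ge_max => /andP[h1 h2].
    by rewrite -!ler_pdivrMr ?m0 ?qm0// !mul1r h1.
  have low := PV_lower C0 c0 qmin0 po S1 S2.
  have I0 : I4 (fun u => P' u * expR (V u)) != 0.
    by rewrite gt_eqF// (lt_le_trans _ low)// mulr_gt0// expR_gt0.
  have l0 : L1 (fun u => P' u * expR (V u)).
    rewrite (_ : (fun u => _) = fun u => 1 * (P' u * expR (V u))); last by apply/funext => u; rewrite mul1r.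
    apply: (PV_L1 c0 po (f := fun=> 1)); first exact: measurable_cst.
    by exists 1 => // u; rewrite normr1 mul1r lerDl.
  have l1 : L1 (fun u => u ord0 a * (P' u * expR (V u))).
    apply: (PV_L1 c0 po (f := fun u => u ord0 a)); first exact: measurable_vec4.
    by exists 1 => // u; rewrite mul1r (le_trans (ge_coord_norm _ _))// lerDr.
  have Lth := fun th => likelihood_nllr horizon_gt0 noise_gt0 front_ge0 r2 th0 th n0 X0.
  have Lp : 0 < likelihood N n (path n om) th0 by exact: expR_gt0.
  rewrite -(posterior_ratio (s0 n n0) Lp l0 l1 I0) /bayes mxE !int4_patch; congr (_ * (_ / _ - _)).
    by congr I4; apply/funext => th; rewrite !patchE Lth; case: ifP => // _; rewrite mulr0 mul0r.
  by congr I4; apply/funext => th; rewrite !patchE Lth; case: ifP => // _; rewrite mul0r.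
split.
- by move=> n th0 n0 K0 a; exact: (nbayes_measurable n0 K0).
- have [A [S [A0 H]]] := posterior_bound qmax C0 c0 m0 qm0 qmin0.
  have [n1 n10 n1P] := sqrt_nat_ge (Num.max S S0).
  exists A, n1; split => // n th0 om nn K0; have n0 := leq_trans n10 nn.
  have := n1P n nn; rewrite ge_max => /andP[h1 h2].
  apply: (@le_coord_norm _ 3) => a.
  rewrite coordE ratio//; exact: (H _ _ _ _ _ _ _ (post n th0 om n0 K0) h1).
move=> e w0 e0 w00; have [S H] := posterior_limit qmax C0 c0 m0 qm0 qmin0 e0 w00.
have [n1 n10 n1P] := sqrt_nat_ge (Num.max S S0).
exists n1 => // n th0 om nn K0 Ww; have n0 := leq_trans n10 nn.
have := n1P n nn; rewrite ge_max => /andP[h1 h2].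
apply: (@le_coord_norm _ 3) => a; set m := ncscore N n (path n om) th0 *m _.
rewrite [X in `|X|]mxE [X in _ + X]mxE coordE ratio//; exact: (H _ _ _ _ _ _ _ (post n th0 om n0 K0) h1 Ww).
Qed.
End bayes.

End estimators.

(** * Limit theorems *)

Section powers.
Context {R : realType}.
Implicit Types (p : R).

(** Truncation at 0 makes the power continuous on the whole line, so that it composes with the
    Euclidean norm. *)
Lemma powR_max_continuous p : 0 < p -> continuous (fun r : R => Num.max r 0 `^ p).
Proof.
move=> p0 r.
have gN (y : R) : y <= 0 -> Num.max y 0 `^ p = 0 by move=> y0; rewrite max_r// powR0 ?gt_eqF.
have gP (y : R) : 0 < y -> Num.max y 0 `^ p = expR (p * ln y) by move=> y0; rewrite max_l ?(ltW y0)// /powR gt_eqF.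
have [r0|r0|->] := ltrgtP r 0.
- rewrite /continuous_at gN ?(ltW r0)//; apply: cvg_near_cst.
  apply/nbhs_ballP; exists (- r); first by rewrite /= oppr_gt0.
  by move=> y; rewrite /ball/= ltr_norml => /andP[h _]; apply: gN; lra.
- rewrite /continuous_at gP//.
  have h : {for r, continuous (fun y : R => expR (p * ln y))}.
    apply: continuous_comp; last exact: continuous_expR.
    by apply: cvgM; [exact: cvg_cst|exact: continuous_ln].
  apply: cvg_trans h; apply: near_eq_cvg.
  apply/nbhs_ballP; exists r => //.
  by move=> y; rewrite /ball/= ltr_norml => /andP[_ h]; rewrite gP//; lra.
rewrite /continuous_at gN//.
apply/cvgrPdist_le => e e0; have /cvgrPdist_le/(_ e e0) := powR_cvg0 p0.
rewrite /at_right near_withinE => /nbhs_ballP[dl /= d0 dP].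
apply/nbhs_ballP; exists dl => // y yb.
have [y0|y0] := leP (y : R) 0; first by rewrite powR0 ?gt_eqF// subrr normr0 ltW.
exact: dP.
Qed.

Lemma enorm_continuous n : continuous (@enorm R n.+1).
Proof.
apply: (@lip_continuous _ _ _ n.+1%:R) => // x y.
by rewrite (le_trans (enorm_lip _ _))// enorm_le_norm.
Qed.

Lemma enorm_powR_continuous p n : 0 < p -> continuous (fun x : 'rV[R]_n.+1 => enorm x `^ p).
Proof.
move=> p0; rewrite (_ : (fun x => _) = fun x : 'rV[R]_n.+1 => Num.max (enorm x) 0 `^ p).
  by apply: (@continuous1 _ _ (fun r : R => Num.max r 0 `^ p)); [exact: powR_max_continuous|exact: enorm_continuous].
by apply/funext => x; rewrite max_l// enorm_ge0.
Qed.

Lemma enorm_powR_growth p : 0 < p -> exists C q, forall x : 'rV[R]_4, `|enorm x `^ p| <= C * (1 + `|x|) ^+ q.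
Proof.
move=> p0; have [q pq] : exists q : nat, p <= q%:R.
  by have [n0 _ H] := nbhs_infty_ger p; exists n0; exact: H (leqnn _).
exists (2 ^+ q), q => x; rewrite ger0_norm ?powR_ge0// -exprMn.
have b1 : 1 <= 2 * (1 + `|x|) by have := normr_ge0 x; lra.
rewrite -powR_mulrn ?(le_trans ler01)//; apply: (@le_trans _ _ ((2 * (1 + `|x|)) `^ p)); last exact: ler_powR.
apply: ge0_ler_powR; rewrite ?nnegrE ?(ltW p0) ?enorm_ge0 ?(le_trans ler01 b1)//.
by rewrite (le_trans (enorm_le _))// ler_pM2l// lerDr.
Qed.

End powers.

Lemma limn_einf_between (R : realType) (u : (\bar R)^nat) (a b : \bar R) n1 :
  (forall n, (n1 <= n)%N -> (a <= u n <= b)%E) -> (a <= limn_einf u <= b)%E.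
Proof.
move=> ab; rewrite limn_einf_lim; have /cvg_lim -> // := @cvg_einfs_sup R u.
apply/andP; split.
  apply: (@le_trans _ _ (einfs u n1)); last by apply: ereal_sup_ubound; exists n1.
  by apply: le_ereal_inf_tmp => _ [k /= n1k <-]; have /andP[] := ab k n1k.
apply: ge_ereal_sup => _ [k _ <-].
apply: (@le_trans _ _ (u (maxn k n1))).
  by apply: ereal_inf_lbound; exists (maxn k n1) => //=; exact: leq_maxl.
by have /andP[] := ab _ (leq_maxr k n1).
Qed.

Lemma cube_compact (R : realType) n (x : 'rV[R]_n) (rho : R) :
  compact [set y : 'rV[R]_n | forall i, x ord0 i - rho <= y ord0 i <= x ord0 i + rho].
Proof.
have := @rV_compact R n (fun i => `[x ord0 i - rho, x ord0 i + rho]%classic) (fun i => @segment_compact R _ _).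
by congr compact; apply/seteqP; split => y /= h i; have := h i; rewrite in_itv.
Qed.

Lemma probability_unit (R : realType) d (T : measurableType d) (p : probability T R) :
  p.-integrable setT (EFin \o (fun=> 1)) /\ \int[p]_t 1 = 1.
Proof.
split; last by rewrite Rintegral_cst// [X in fine X]probability_setT mul1r.
apply: (@bounded_integrable _ _ _ _ _ (fun=> 1) 1) => //; last by move=> ? _; rewrite normr1.
by rewrite [X in (X < _)%E]probability_setT ltry.
Qed.

Lemma dotv_invmx (R : realType) (A : 'M[R]_4) (x y : 'rV[R]_4) : A^T = A ->
  dotv x (y *m invmx A) = dotv y (x *m invmx A).
Proof.
move=> sA; have sI : (invmx A)^T = invmx A by rewrite trmx_inv sA.
by rewrite dotvC -bil_dotv (bilC _ _ sI) bil_dotv dotvC.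
Qed.

(** If W <= w0 the linearization applies; otherwise 2 <= 2 W / w0, as in Markov's inequality.
    Bounding W by exp W leaves a single moment to control. *)
Lemma cos_close (R : realType) (v U u : 'rV[R]_4) (b S e w0 c W : R) : 0 <= e -> 0 < w0 -> 0 <= c -> 1 <= W ->
  `|dotv v u - S| <= c * W -> (W <= w0 -> `|U - u| <= e) ->
  `|cos (dotv v U + b) - cos (b + S)| <= 4 * `|v| * e + (c + 2 / w0) * expR W.
Proof.
move=> e0 w00 c0 W1 uS Ue; have W0 : 0 <= W by exact: le_trans ler01 W1.
have We : W <= expR W by rewrite (le_trans _ (expR_ge1Dx W))// lerDr.
have [Ww|Ww] := leP W w0.
  apply: (le_trans (cos_lip _ _)).
  rewrite (_ : dotv v U + b - (b + S) = dotv v (U - u) + (dotv v u - S)); last first.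
    by rewrite dotvDr dotvNr; ring.
  rewrite (le_trans (ler_normD _ _))// lerD//.
    rewrite (le_trans (dotv_bound _ _))// -mulrA ler_wpM2l// ler_wpM2l//; exact: Ue.
  by rewrite (le_trans uS)// (le_trans (ler_wpM2l c0 We))// ler_wpM2r ?expR_ge0// lerDl divr_ge0// ltW.
apply: (@le_trans _ _ 2).
  by rewrite (le_trans (ler_normB _ _))// (_ : 2 = 1 + 1 :> R)// lerD// cos_max.
apply: (@le_trans _ _ (2 / w0 * expR W)).
  by rewrite mulrAC ler_pdivlMr// ler_wpM2l// (le_trans (ltW Ww)).
by rewrite [(c + _) * _]mulrDl addrA lerDr addr_ge0 ?mulr_ge0 ?expR_ge0.
Qed.

(** The tolerance eta is shared out: a quarter for the linearization error, a quarter for the event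
    W > w0 with w0 = 8 B / eta, and half for the terms of order 1/s. *)
Lemma charfun_budget (R : realType) (a a2 a3 B eta s r : R) : 0 <= a2 -> 0 <= a3 -> 0 <= a -> 0 < B -> 0 < eta -> 0 < s ->
  (a2 * B + a3 * (1 + a) ^+ 4) * 2 / eta <= s -> 0 <= r ->
  4 * r * (eta / 16) + (a2 / s * r + 2 / (8 * B / eta)) * B + a3 * (1 + a * r) ^+ 4 / s <= eta * (1 + r) ^+ 4.
Proof.
move=> a20 a30 a0 B0 eta0 s0 Ss r0.
have r1 : 1 <= 1 + r by rewrite lerDl.
set V := (1 + r) ^+ 4.
have V1 : 1 <= V by rewrite exprn_ege1.
have Vr : r <= V by rewrite (le_trans _ (ler_eXnr _ r1))// lerDr.
have aV : (1 + a * r) ^+ 4 <= (1 + a) ^+ 4 * V.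
  rewrite -exprMn lerXn2r ?nnegrE ?addr_ge0 ?mulr_ge0 ?addr_ge0//; nra.
have h1 : 4 * r * (eta / 16) <= eta / 4 * V by nra.
have h2 : 2 / (8 * B / eta) * B = eta / 4 by field; rewrite !gt_eqF.
have h3 : eta / 4 <= eta / 4 * V by rewrite ler_peMr// divr_ge0// ltW.
have h4 : a2 / s * r * B <= a2 * B / s * V.
  rewrite (_ : a2 / s * r * B = a2 * B / s * r); last by ring.
  by rewrite ler_wpM2l// divr_ge0 ?mulr_ge0// ltW.
have h5 : a3 * (1 + a * r) ^+ 4 / s <= a3 * (1 + a) ^+ 4 / s * V.
  rewrite (_ : a3 * (1 + a) ^+ 4 / s * V = a3 / s * ((1 + a) ^+ 4 * V)); last by ring.
  by rewrite mulrAC ler_wpM2l// divr_ge0// ltW.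
have h6 : (a2 * B + a3 * (1 + a) ^+ 4) / s <= eta / 2.
  rewrite ler_pdivrMr//; move: Ss; rewrite ler_pdivrMr// => h; lra.
have h7 := ler_wpM2r (le_trans ler01 V1) h6.
rewrite (_ : (a2 / s * r + 2 / (8 * B / eta)) * B = a2 / s * r * B + 2 / (8 * B / eta) * B); last by rewrite mulrDl.
rewrite h2; move: h7; rewrite [(_ + _) / s]mulrDl [(_ + _) * V]mulrDl => h7.
move: h1 h3 h4 h5 h7; set y1 := 4 * r * _; set y2 := a2 / s * r * B; set y3 := a3 * _ / s; set y4 := a2 * B / s * V; set y5 := a3 * _ / s * V.
clear; lra.
Qed.

Lemma triangle_between (R : realFieldType) (x y z e : R) : `|x - y| <= e / 2 -> `|y - z| <= e / 2 ->
  z - e <= x <= z + e.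
Proof. by rewrite !ler_norml => /andP[? ?] /andP[? ?]; apply/andP; split; lra. Qed.

(** * Limit law, moments and consistency of a linearized estimator *)

Section limit.
Context {R : realType} {K : nat}.
Variables (N : network R K) (d : nat -> measure_display) (Om : forall n : nat, measurableType (d n))
  (P : forall n : nat, 'rV[R]_4 -> probability (Om n) R)
  (X : forall n : nat, 'I_K -> Om n -> cumulative R R).
Hypotheses (K_gt0 : (0 < K)%N) (speed_gt0 : 0 < speed N) (horizon_gt0 : 0 < horizon N) (noise_gt0 : 0 < noise N)
  (front_ge0 : forall (i : 'I_2) (k : 'I_K) (t : R), 0 <= front N i k t)
  (source_detector : forall th : 'rV[R]_4, param N th ->
       forall (i : 'I_2) (k : 'I_K), source th i <> detector N k)
  (obs : forall (n : nat) (th : 'rV[R]_4), (0 < n)%N -> param N th ->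
       observation N n th (P n th) (@X n))
  (r2 : cond_R2 N) (r3 : cond_R3 N) (r4 : cond_R4 N).
Variable (KK : set 'rV[R]_4).
Hypotheses (cKK : compact KK) (KP : KK `<=` param N).
Local Notation T := (horizon N).
Local Notation path n om := (fun k => @X n k om).
Local Notation W := (nfluct N X).
Local Notation J := (fisher N).

Lemma fisher_bounds : exists C c, [/\ 0 < C, 0 < c & forall th, KK th ->
  forall x, c * `|x| ^+ 2 <= bil (J th) x x /\ bil (J th) x x <= C * `|x| ^+ 2].
Proof.
have [C [c [mod [C0 c0 _ L]]]] := observed_lan speed_gt0 horizon_gt0 noise_gt0 front_ge0 source_detector obs r2 r3 r4 cKK KP.
(* The bounds on the information are part of [lan] for every n and every trajectory: n = 1 and an
   arbitrary point give them. *)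
exists C, c; split => // th Kt x; have [_ [_ /(_ x)/andP[]]] := L 1%N th point Kt isT; by [].
Qed.

Lemma fluct_moment : exists2 B, 0 < B & forall n th, (0 < n)%N -> KK th ->
  (P n th).-integrable setT (EFin \o (fun om => expR (W th om))) /\ \int[P n th]_om expR (W th om) <= B.
Proof.
have [L L0 LP] := intensity_le speed_gt0 horizon_gt0 r2 KP.
exists (Num.max 1 (fluct_bound K T L)); first by rewrite lt_max ltr01.
move=> n th n0 Kt.
have pp := observed_paths obs n0 (KP Kt).
have b : (\int[P n th]_om (expR (W th om))%:E <= (fluct_bound K T L)%:E)%E.
  apply: (fluct_exp K_gt0 horizon_gt0 (ltW L0) n0 _ _ _ pp).
  - by move=> k; exact: intensity_continuous.
  - by move=> k t; apply: ltW; exact: intensity_gt0.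
  - by move=> k t; exact: LP.
have m : measurable_fun setT (fun om : Om n => expR (W th om)).
  by apply: measurableT_comp => //; exact: (fluct_measurable horizon_gt0 n0 pp).
split.
  apply/integrableP; split; first exact/measurable_EFinP.
  under eq_integral do rewrite /= ger0_norm ?expR_ge0//.
  by apply: (le_lt_trans b); rewrite ltry.
rewrite le_max; apply/orP; right; rewrite -lee_fin /Rintegral fineK//.
rewrite ge0_fin_numE; first by apply: (le_lt_trans b); rewrite ltry.
by apply: integral_ge0 => om _; rewrite lee_fin expR_ge0.
Qed.

Variable est : forall n : nat, Om n -> 'rV[R]_4.
Hypothesis lin : linearized N X KK est.

Definition rescaled n (th : 'rV[R]_4) (om : Om n) : 'rV[R]_4 := Num.sqrt n%:R *: (est om - th).
Local Notation U := rescaled.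

Lemma est_measurable n th (f : 'rV[R]_4 -> R) : (0 < n)%N -> KK th -> continuous f ->
  measurable_fun setT (fun om : Om n => f (est om - th)).
Proof.
move=> n0 Kt cf; have [m _ _] := lin.
apply: (@continuous_measurable_comp _ _ _ _ (fun om => est om - th)) => // i.
rewrite (_ : (fun om => _) = fun om => est om ord0 i - th ord0 i); last by apply/funext => om; rewrite !mxE.
by apply: measurable_funB => //; exact: (m n th).
Qed.

Lemma est_law n th : (0 < n)%N -> KK th -> is_law (P n th) (fun=> 1) (@U n th).
Proof.
move=> n0 Kt; have [i1 e1] := probability_unit (P n th); split => //.
move=> i; rewrite (_ : (fun om => _) = fun om : Om n => (Num.sqrt n%:R *: (est om - th)) ord0 i)//.
apply: (@est_measurable n th (fun x => (Num.sqrt n%:R *: x) ord0 i)) => //.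
rewrite (_ : (fun x => _) = fun x : 'rV[R]_4 => Num.sqrt n%:R * x ord0 i); last by apply/funext => x; rewrite mxE.
by apply: continuousM; [exact: continuousC|exact: coord_continuous].
Qed.

Lemma est_moments q : exists B n0, (0 < n0)%N /\ forall n th, (n0 <= n)%N -> KK th ->
  moment_bound (P n th) (fun=> 1) (@U n th) q B.
Proof.
have [B B0 BP] := fluct_moment; have [_ [A [n0 [n00 AP]]] _] := lin.
pose C := (1 + `|A|) ^+ q * q%:R ^+ q.
have C0 : 0 <= C by rewrite mulr_ge0 ?exprn_ge0.
exists (C * B), n0; split => // n th nn Kt; have ng := leq_trans n00 nn.
have [iW bW] := BP n th ng Kt.
have dom (om : Om n) : `|1 * (1 + `|U th om|) ^+ q| <= C * expR (W th om).
  have W1 := nfluct_ge1 N X th om ng.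
  rewrite mul1r ger0_norm ?exprn_ge0//.
  apply: (@le_trans _ _ (((1 + `|A|) * W th om) ^+ q)).
    rewrite lerXn2r ?nnegrE ?mulr_ge0// ?(le_trans ler01)//.
    rewrite mulrDl mul1r lerD// (le_trans (AP n th om nn Kt))// ler_wpM2r ?ler_norm//.
    exact: le_trans ler01 W1.
  rewrite exprMn /C -mulrA ler_wpM2l ?exprn_ge0// expr_le_expR//.
  exact: le_trans ler01 W1.
have cf : continuous (fun x : 'rV[R]_4 => (1 + `|x|) ^+ q). by exact: poly_continuous.
have mf := law_measurable (est_law ng Kt) cf.
split.
  by apply: (integrable_dominated measurableT mf (integrable_scale measurableT C iW)) => om _; exact: dom.
apply: (le_trans (ler_norm _)); apply: (@le_trans _ _ (\int[P n th]_om (C * expR (W th om)))).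
  by apply: Rintegral_norm_le => //; exact: (integrable_scale measurableT C iW).
by rewrite (Rintegral_scale _ measurableT iW) ler_wpM2l.
Qed.

(** For the normalized score D, the product of v with D J^-1 is the score in the direction w = v
    J^-1. Its variance [bil J w w] equals [bil (invmx J) v v], the quadratic form in the
    characteristic function of the Gaussian limit. *)
Lemma est_charfun eta : 0 < eta -> exists2 n0, (0 < n0)%N & forall n th, (n0 <= n)%N -> KK th ->
  charfun_close (P n th) (fun=> 1) (@U n th) (@leb4 R) (gdens (J th)) (@vec4 R) eta.
Proof.
move=> eta0.
have [L L0 LP] := intensity_le speed_gt0 horizon_gt0 r2 KP.
have [C1 C10 C1P] := nscore_bound speed_gt0 horizon_gt0 noise_gt0 front_ge0 source_detector r2 cKK KP.
have [CJ CJ0 CJP] := path_controlled speed_gt0 horizon_gt0 noise_gt0 front_ge0 obs r2 KP.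
have [C [c [C0 c0 JP]]] := fisher_bounds.
have [B B0 BP] := fluct_moment.
have [_ _ lim] := lin.
(* The score in the direction w is at most C1 |w| <= a |v|. *)
pose a := C1 * (4 / c).
have a0 : 0 < a by rewrite mulr_gt0// divr_gt0.
pose a2 := K%:R * a * (T + 2 * L * T ^+ 2).
have T0 := ltW horizon_gt0; have L0' := ltW L0; have a0' := ltW a0.
have a20 : 0 <= a2 by apply: mulr_ge0; [exact: mulr_ge0|apply: addr_ge0 => //; rewrite mulr_ge0 ?sqr_ge0 ?mulr_ge0].
pose a3 := K%:R * (L * T) * (2 + T).
have a30 : 0 <= a3 by apply: mulr_ge0; [apply: mulr_ge0 => //; exact: mulr_ge0|exact: addr_ge0].
pose S := (a2 * B + a3 * (1 + a) ^+ 4) * 2 / eta.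
have e0 : 0 < eta / 16 by rewrite divr_gt0.
have w00 : 0 < 8 * B / eta by rewrite divr_gt0// mulr_gt0.
have [n1 n10 n1P] := lim _ _ e0 w00.
have [n2 n20 n2P] := sqrt_nat_ge S.
exists (maxn n1 n2) => [|n th nn Kt v b]; first by rewrite leq_max n10.
move: nn; rewrite geq_max => /andP[nn1 nn2].
have n0 := leq_trans n10 nn1.
have s0 : 0 < Num.sqrt n%:R :> R by rewrite sqrtr_gt0 ltr0n.
have pp := observed_paths obs n0 (KP Kt).
have [iW bW] := BP n th n0 Kt.
have sJ := fisher_sym N th; have cJ x : c * `|x| ^+ 2 <= bil (J th) x x by have [] := JP th Kt x.
pose w := v *m invmx (J th).
have wv : `|w| <= 4 / c * `|v| by exact: inverse_bound.
pose f k t := dotv (nscore N k th t) w; pose f' k t := dotv (nscore' N k th t) w.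
have c10 : 0 <= a * `|v| by rewrite mulr_ge0// ltW.
have fC k (t : R) : 0 <= t <= T -> `|f k t| <= a * `|v| /\ `|f' k t| <= a * `|v|.
  move=> tT; have [h1 h2] := C1P k th w t Kt tT.
  by rewrite /a -mulrA; split; [apply: (le_trans h1)|apply: (le_trans h2)]; rewrite ler_wpM2l// ltW.
have fD k (t : R) : is_derive t 1 (f k) (f' k t) by exact: nscoreD.
have cf' k : continuous (f' k) by exact: continuous_nscore'.
have clam k : continuous (intensity N k th) by exact: intensity_continuous.
have lam0 k t : 0 <= intensity N k th t by apply: ltW; exact: intensity_gt0.
have lamL k t : 0 <= t <= T -> intensity N k th t <= L by move=> tT; exact: LP.
pose D := Dsum T (fun k => intensity N k th) (@X n) n f.
have DE (om : Om n) : `|dotv v (ncscore N n (path n om) th *m invmx (J th)) - D om| <= a2 / Num.sqrt n%:R * `|v| * W th om.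
  rewrite dotv_invmx// (@dotv_cscore _ _ _ _ _ (continuous_nscore' noise_gt0 front_ge0 r2) _ _ _ _ _ _ (CJP n th om n0 Kt)).
  have := Dsum_err horizon_gt0 (ltW L0) n0 clam lam0 lamL pp c10 fD cf' (fun k t tT => (fC k t tT).2) om.
  rewrite -mulr_suml mulrC -/D => h; apply: (le_trans h).
  by rewrite /a2 /nfluct le_eqVlt; apply/orP; left; apply/eqP; field; rewrite gt_eqF.
have dom (om : Om n) : `|1 * cos (dotv v (U th om) + b) - cos (b + D om)| <=
    4 * `|v| * (eta / 16) + (a2 / Num.sqrt n%:R * `|v| + 2 / (8 * B / eta)) * expR (W th om).
  rewrite mul1r; apply: (cos_close _ (ltW e0) w00 _ (nfluct_ge1 N X th om n0) (DE om)).
    by rewrite mulr_ge0// divr_ge0// ltW.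
  by move=> Ww; exact: n1P.
have [iu eu] := probability_unit (P n th).
have cc : continuous (fun x : 'rV[R]_4 => cos (dotv v x + b)).
  apply: (continuous1 (h := fun y => cos (y + b))) => [y|]; last exact: dotv_continuous.
  apply: (@continuous_comp _ _ _ (fun y : R => y + b) (@cos R)); last exact: continuous_cos.
  by apply: cvgD; [exact: cvg_id|exact: cvg_cst].
have i1 := law_integrable (est_law n0 Kt) cc (fun x => cos_max _).
have mD : measurable_fun setT (fun om : Om n => cos (b + D om)).
  apply: (measurableT_comp (continuous_measurable_fun (@continuous_cos R))); apply: measurable_funD => //.
  exact: (Dsum_measurable horizon_gt0 n0 pp).
have i2 : (P n th).-integrable setT (EFin \o (fun om : Om n => cos (b + D om))).
  have := integrable_dominated measurableT mD iu; apply => om _; exact: cos_max.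
set k1 := 4 * `|v| * (eta / 16) in dom; set k2 := a2 / _ * `|v| + _ in dom.
have k20 : 0 <= k2 by apply: addr_ge0; [apply: mulr_ge0 => //; exact: divr_ge0 a20 (ltW s0)|exact: divr_ge0 _ (ltW w00)].
have h1 : `|mean (P n th) (fun=> 1) (@U n th) (fun x => cos (dotv v x + b)) - \int[P n th]_om cos (b + D om)| <= k1 + k2 * B.
  rewrite /mean -(RintegralB measurableT i1 i2).
  have i3 := integrable_scale measurableT k1 iu; have i4 := integrable_scale measurableT k2 iW.
  have i34 := integrable_add measurableT i3 i4.
  apply: (@le_trans _ _ (\int[P n th]_om (k1 * 1 + k2 * expR (W th om)))).
    apply: Rintegral_norm_le => //; last by move=> om; rewrite mulr1; exact: dom.
    by apply/measurable_EFinP; have /integrableP[] := integrable_sub measurableT i1 i2.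
  rewrite (RintegralD measurableT i3 i4) (Rintegral_scale _ measurableT iu) (Rintegral_scale _ measurableT iW) eu mulr1.
  by rewrite lerD2l ler_wpM2l.
have h2 := clt_bound horizon_gt0 (ltW L0) n0 clam lam0 lamL pp (obs n0 (KP Kt)).2 b c10 fD cf' (fun k t tT => (fC k t tT).1) (fun k t tT => (fC k t tT).2).
rewrite -/D -/a3 in h2.
have e3 : \sum_(k < K) \int[@lebesgue_measure R]_(t in `[0, T]) (f k t ^+ 2 * intensity N k th t) = bil (invmx (J th)) v v.
  rewrite (fisher_score speed_gt0 horizon_gt0 noise_gt0 front_ge0 source_detector r2 cKK KP)//.
  by rewrite !bil_dotv -/w /w -mulmxA mulVmx ?mulmx1 ?(coercive_unit sJ c0 cJ)// dotvC.
rewrite e3 in h2.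
rewrite (gauss_charfun sJ c0 cJ) mulNr.
rewrite (_ : mean _ _ _ _ - _ = (mean (P n th) (fun=> 1) (@U n th) (fun x => cos (dotv v x + b)) - \int[P n th]_om cos (b + D om)) +
  (\int[P n th]_om cos (b + D om) - expR (- (bil (invmx (J th)) v v / 2)) * cos b)); last by ring.
apply: (le_trans (ler_normD _ _)); apply: (le_trans (lerD h1 h2)).
exact: (charfun_budget a20 a30 a0' B0 eta0 s0 (n2P n nn2)).
Qed.

Lemma est_limit f C q : continuous f -> (forall x, `|f x| <= C * (1 + `|x|) ^+ q) -> forall e, 0 < e ->
  exists2 n0, (0 < n0)%N & forall n th, (n0 <= n)%N -> KK th ->
    (P n th).-integrable setT (EFin \o (fun om => f (U th om))) /\
    `|\int[P n th]_om f (U th om) - mean (@leb4 R) (gdens (J th)) (@vec4 R) f| <= e.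
Proof.
move=> cf fC e e0; have [C' [c [C0 c0 JP]]] := fisher_bounds.
have [B [n1 [n10 BP]]] := est_moments q.+1; have [B' BP'] := gauss_moments q.+1 c0 C0.
have mB n th : (n1 <= n)%N -> KK th -> moment_bound (P n th) (fun=> 1) (@U n th) q.+1 (Num.max B B').
  by move=> nn Kt; have [i b] := BP n th nn Kt; split => //; rewrite le_max b.
have [eta eta0 H] := weak_poly cf fC (Num.max B B') e0.
have [n2 n20 CF] := est_charfun eta0.
exists (maxn n1 n2) => [|n th]; first by rewrite leq_max n10.
rewrite geq_max => /andP[nn1 nn2] Kt; have n0 := leq_trans n10 nn1.
have sJ := fisher_sym N th; have cJ x : c * `|x| ^+ 2 <= bil (J th) x x by have [] := JP th Kt x.
have CJ x : bil (J th) x x <= C' * `|x| ^+ 2 by have [] := JP th Kt x.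
have L1 := est_law n0 Kt.
have fC' x : `|f x| <= `|C| * (1 + `|x|) ^+ q.+1.
  rewrite (le_trans (fC x))// (@le_trans _ _ (`|C| * (1 + `|x|) ^+ q))//.
    by rewrite ler_wpM2r ?ler_norm// exprn_ge0// addr_ge0.
  by rewrite ler_wpM2l// ler_weXn2l// lerDl.
split.
  have := law_integrable_poly L1 (mB n th nn1 Kt) cf fC'.
  by congr (integrable _ _ _); apply/funext => om /=; rewrite mul1r.
rewrite (_ : \int[P n th]_om f (U th om) = mean (P n th) (fun=> 1) (@U n th) f); last first.
  by apply: eq_Rintegral => om _; rewrite mul1r.
apply: H => //.
- exact: (gauss_is_law sJ c0 cJ).
- exact: mB.
- by have [i b] := BP' _ sJ cJ CJ; split => //; rewrite le_max b orbT.
exact: CF.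
Qed.

Lemma est_limit_ereal f C q : continuous f -> (forall x, `|f x| <= C * (1 + `|x|) ^+ q) -> forall e, 0 < e ->
  \forall n \near \oo, forall th, KK th ->
    (`|\int[P n th]_om (f (U th om))%:E - gauss_mean (invmx (J th)) f| < e%:E)%E.
Proof.
move=> cf fC e e0; have e20 : 0 < e / 2 by rewrite divr_gt0.
have [n0 n00 H] := est_limit cf fC e20; have [C' [c [C0 c0 JP]]] := fisher_bounds.
exists n0 => // n /= nn th Kt; have [i b] := H n th nn Kt.
have sJ := fisher_sym N th; have cJ x : c * `|x| ^+ 2 <= bil (J th) x x by have [] := JP th Kt x.
rewrite (gauss_meanE sJ c0 cJ cf fC) -(fineK (integrable_fin_num _ i))//.
by rewrite -EFinB lte_fin (le_lt_trans b)// ltr_pdivrMr// ltr_pMr// ltr1n.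
Qed.

Lemma est_normal : asymptotically_normal_on N P est KK.
Proof.
move=> f cf [M fM] e e0; apply: (@est_limit_ereal f M 0) => // x.
by rewrite expr0 mulr1.
Qed.

Lemma scaled_mean (g : 'rV[R]_4 -> R) (k : R) n th : continuous g -> (forall x, 0 <= g x) -> 0 <= k ->
  (forall x, k * g x = g (Num.sqrt n%:R *: x)) -> (0 < n)%N -> KK th ->
  (k%:E * \int[P n th]_om (g (est om - th))%:E = \int[P n th]_om (g (U th om))%:E)%E.
Proof.
move=> cg g0 k0 kg n0 Kt; rewrite -ge0_integralZl//.
- by apply: eq_integral => om _; rewrite -EFinM kg.
- by apply/measurable_EFinP; exact: est_measurable.
- by move=> om _; rewrite lee_fin.
Qed.

Lemma est_moments_converge p : 0 < p -> moments_converge_on N P est p KK.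
Proof.
move=> p0 e e0; have cf := @enorm_powR_continuous R p 3 p0; have [C [q fC]] := enorm_powR_growth p0.
have [n0 _ H] := est_limit_ereal cf fC e0.
exists (maxn n0 1) => // n /=; rewrite geq_max => /andP[nn n1] th Kt.
rewrite (@scaled_mean (fun x => enorm x `^ p))//; last 2 first.
- by move=> x; exact: powR_ge0.
- move=> x; rewrite enormZ ger0_norm ?sqrtr_ge0// powRM ?sqrtr_ge0 ?enorm_ge0// -powR12_sqrt// -powRrM.
  by rewrite [p / 2]mulrC.
exact: (H n nn th Kt).
Qed.

(** Markov's inequality for the first moment of 1 + |U|, divided by n^(1/2). *)
Lemma est_consistent : consistent_on P est KK.
Proof.
move=> del eps del0 eps0; have [B [n0 [n00 BP]]] := est_moments 1.
have [n1 n10 n1P] := sqrt_nat_ge (2 * (`|B| + 1) * 2 / (del * eps)).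
exists (maxn n0 n1) => // n /=; rewrite geq_max => /andP[nn nn1] th Kt.
have ng := leq_trans n00 nn; have [i b] := BP n th nn Kt.
have s0 : 0 < Num.sqrt n%:R :> R by rewrite sqrtr_gt0 ltr0n.
have cn : continuous (fun x : 'rV[R]_4 => enorm x) by exact: enorm_continuous.
pose A := [set om : Om n | del < enorm (est om - th)].
have mA : measurable A.
  rewrite (_ : A = (fun om : Om n => enorm (est om - th)) @^-1` `]del, +oo[%classic).
    by rewrite -[X in measurable X]setTI; apply: (est_measurable ng Kt cn) => //; exact: measurable_itv.
  by apply/seteqP; split => om; rewrite /A /= in_itv/= andbT.
pose k := 2 / (del * Num.sqrt n%:R); have k0 : 0 <= k by rewrite divr_ge0 ?mulr_ge0 ?(ltW del0) ?(ltW s0).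
have ik := integrable_scale measurableT k i.
rewrite -[X in P n th X]setIT -integral_indic//.
apply: (@le_lt_trans _ _ (\int[P n th]_om (k * (1 * (1 + `|U th om|) ^+ 1))%:E)%E).
  apply: ge0_le_integral => //.
  - by apply/measurable_EFinP; exact: measurable_indic.
  - by apply/measurable_EFinP; have /integrableP[/measurable_EFinP] := ik.
  move=> om _; rewrite lee_fin indicE expr1 mul1r.
  have kU : 0 <= k * (1 + `|U th om|) by rewrite mulr_ge0// addr_ge0.
  have [|_] := boolP (om \in A); last by rewrite kU.
  rewrite inE /A /= => h; have := lt_le_trans h (enorm_le _) => h'.
  rewrite /k mulrAC ler_pdivlMr ?mulr_gt0// mul1r /rescaled normrZ (ger0_norm (ltW s0)).
  have := ler_wpM2l (ltW s0) (ltW h'); lra.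
rewrite -(fineK (integrable_fin_num _ ik))// lte_fin.
have e1 := Rintegral_scale k measurableT i; rewrite [X in X < _]e1.
apply: (@le_lt_trans _ _ (k * `|B|)); first by rewrite ler_wpM2l// (le_trans b)// ler_norm.
have := n1P n nn1; rewrite ler_pdivrMr ?mulr_gt0// => h.
rewrite /k mulrAC ltr_pdivrMr ?mulr_gt0//.
have := normr_ge0 B; rewrite (_ : eps * (del * Num.sqrt n%:R) = Num.sqrt n%:R * (del * eps)); last by ring.
lra.
Qed.

(** [weak_poly] once more, now between two Gaussian laws, whose characteristic functions are close
    when their informations are. *)
Lemma gauss_mean_close f C q : continuous f -> (forall x, `|f x| <= C * (1 + `|x|) ^+ q) -> forall e, 0 < e ->
  exists2 del, 0 < del & forall th th', KK th -> KK th' -> `|th' - th| <= del ->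
    `|mean (@leb4 R) (gdens (J th')) (@vec4 R) f - mean (@leb4 R) (gdens (J th)) (@vec4 R) f| <= e.
Proof.
move=> cf fC e e0; have [C' [c [C0 c0 JP]]] := fisher_bounds.
have [B BP] := gauss_moments q.+1 c0 C0.
have [eta eta0 H] := weak_poly cf fC B e0.
have e10 : 0 < eta / (4 / c) ^+ 2 by rewrite divr_gt0// exprn_gt0// divr_gt0.
have [del del0 D] := fisher_close speed_gt0 horizon_gt0 noise_gt0 front_ge0 source_detector r2 cKK KP e10.
exists del => // th th' Kt Kt' tt.
have cJ u : KK u -> forall x, c * `|x| ^+ 2 <= bil (J u) x x by move=> Ku x; have [] := JP u Ku x.
have CJ u : KK u -> forall x, bil (J u) x x <= C' * `|x| ^+ 2 by move=> Ku x; have [] := JP u Ku x.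
have sJ := fisher_sym N; apply: H.
- exact: (gauss_is_law (sJ th') c0 (cJ th' Kt')).
- exact: (gauss_is_law (sJ th) c0 (cJ th Kt)).
- exact: BP (sJ th') (cJ th' Kt') (CJ th' Kt').
- exact: BP (sJ th) (cJ th Kt) (CJ th Kt).
rewrite (_ : eta = eta / (4 / c) ^+ 2 * (4 / c) ^+ 2); last by rewrite divfK// gt_eqF// exprn_gt0// divr_gt0.
by apply: (gauss_charfun_close (sJ th') (sJ th) c0 (cJ th' Kt') (cJ th Kt)); [exact: ltW|move=> x y; exact: D].
Qed.

Let sq_continuous : continuous (fun x : 'rV[R]_4 => enorm x ^+ 2).
Proof.
apply: (continuous1 (h := fun y => y ^+ 2)); first by move=> x; exact: exprn_continuous.
exact: enorm_continuous.
Qed.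

Let sq_growth (x : 'rV[R]_4) : `|enorm x ^+ 2| <= 4 * (1 + `|x|) ^+ 2.
Proof.
rewrite ger0_norm ?sqr_ge0// (_ : 4 = 2 ^+ 2 :> R); last by ring.
rewrite -exprMn lerXn2r ?nnegrE ?enorm_ge0 ?mulr_ge0 ?addr_ge0//.
by rewrite (le_trans (enorm_le _))// ler_pM2l// lerDr.
Qed.

(** The uniform convergence of the risk on [KK] and the continuity of the Gaussian mean at th0 share
    the error e. *)
Lemma local_risk th0 : KK th0 -> exists2 g, gauss_mean (invmx (J th0)) (fun x => enorm x ^+ 2) = g%:E &
  forall e, 0 < e -> exists del n0, 0 < del /\ forall n th, (n0 <= n)%N -> KK th -> `|th - th0| <= del ->
    ((g - e)%:E <= n%:R%:E * \int[P n th]_om (enorm (est om - th) ^+ 2)%:E <= (g + e)%:E)%E.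
Proof.
move=> K0; have [C' [c [C0 c0 JP]]] := fisher_bounds.
have cJ x : c * `|x| ^+ 2 <= bil (J th0) x x by have [] := JP th0 K0 x.
exists (mean (@leb4 R) (gdens (J th0)) (@vec4 R) (fun x => enorm x ^+ 2)).
  exact: (gauss_meanE (fisher_sym N th0) c0 cJ sq_continuous sq_growth).
move=> e e0; have e20 : 0 < e / 2 by rewrite divr_gt0.
have [del del0 D] := gauss_mean_close sq_continuous sq_growth e20.
have [n0 n00 H] := est_limit sq_continuous sq_growth e20.
exists del, n0; split => // n th nn Kt tt; have [i b] := H n th nn Kt.
have n1 := leq_trans n00 nn.
rewrite (@scaled_mean (fun x => enorm x ^+ 2))//; last 2 first.
- by move=> x; exact: sqr_ge0.
- by move=> x; rewrite enormZ ger0_norm ?sqrtr_ge0// exprMn; congr (_ * _); exact: (esym (sqr_sqrtr (ler0n _ _))).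
rewrite -(fineK (integrable_fin_num _ i))// !lee_fin.
exact: (triangle_between b (D th0 th K0 Kt tt)).
Qed.

End limit.

(** * Efficiency and conclusion *)

Section theorem.
Context {R : realType} {K : nat}.
Variables (N : network R K) (d : nat -> measure_display) (Om : forall n : nat, measurableType (d n))
  (P : forall n : nat, 'rV[R]_4 -> probability (Om n) R)
  (X : forall n : nat, 'I_K -> Om n -> cumulative R R).
Hypotheses (K_gt0 : (0 < K)%N) (speed_gt0 : 0 < speed N) (horizon_gt0 : 0 < horizon N) (noise_gt0 : 0 < noise N)
  (front_ge0 : forall (i : 'I_2) (k : 'I_K) (t : R), 0 <= front N i k t)
  (source_detector : forall th : 'rV[R]_4, param N th ->
       forall (i : 'I_2) (k : 'I_K), source th i <> detector N k)
  (obs : forall (n : nat) (th : 'rV[R]_4), (0 < n)%N -> param N th ->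
       observation N n th (P n th) (@X n))
  (r2 : cond_R2 N) (r3 : cond_R3 N) (r4 : cond_R4 N).
Variable est : forall n : nat, Om n -> 'rV[R]_4.
Hypothesis lin : forall KK, compact KK -> KK `<=` param N -> linearized N X KK est.

(** For large n all risks on a small ball are within e of the Gaussian one, hence so are their
    supremum and its lower limit; the point th0 itself supplies the lower estimate. *)
Lemma linearized_efficient : asymptotically_efficient N P est.
Proof.
move=> th0 p0; have [_ oP _ _] := r2.
have sub1 : [set th0] `<=` param N by move=> x ->.
have [rho rho0 rhoP] := compact_open_margin (@compact_set1 _ th0) oP sub1.
(* A compact cube in Theta that contains the parameters within rho of th0, to which the uniform
   statements apply. *)
pose KK := [set y : 'rV[R]_4 | forall i, th0 ord0 i - rho <= y ord0 i <= th0 ord0 i + rho].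
have cKK : compact KK by exact: cube_compact.
have near_KK y : `|y - th0| <= rho -> KK y.
  move=> yr i; have := le_trans (ge_coord_norm (y - th0) i) yr.
  by rewrite !mxE ler_norml => /andP[? ?]; apply/andP; split; lra.
have KP : KK `<=` param N.
  move=> y Ky; rewrite (_ : y = th0 + (y - th0)); last by rewrite addrC subrK.
  apply: rhoP => //; apply: (@le_coord_norm _ 3) => i; have /andP[? ?] := Ky i.
  by rewrite !mxE ler_norml; apply/andP; split; lra.
have K0 : KK th0 by apply: near_KK; rewrite subrr normr0 ltW.
have [g gE gP] := local_risk K_gt0 speed_gt0 horizon_gt0 noise_gt0 front_ge0 source_detector obs r2 r3 r4 cKK KP (lin cKK KP) K0.
rewrite gE.
set F := (X in X @ _ --> _).
have FP e : 0 < e -> \forall eps \near 0^'+, ((g - e)%:E <= F eps <= (g + e)%:E)%E.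
  move=> e0; have [del [n0 [del0 H]]] := gP e e0.
  near=> eps; rewrite /F; apply: (@limn_einf_between _ _ _ _ n0) => n nn.
  have eps0 : 0 <= eps by apply: ltW; near: eps; exact: nbhs_right_gt.
  have epsd : eps <= Num.min rho del by near: eps; apply: nbhs_right_le; rewrite lt_min rho0.
  have bd th : enorm (th - th0) <= eps ->
      ((g - e)%:E <= n%:R%:E * \int[P n th]_om (enorm (est om - th) ^+ 2)%:E <= (g + e)%:E)%E.
    move=> te; have := le_trans (le_trans (norm_le_enorm _) te) epsd; rewrite le_min => /andP[h1 h2].
    by apply: H => //; exact: near_KK.
  have e00 : enorm (th0 - th0) <= eps by rewrite subrr /enorm big1 ?sqrtr0// => i _; rewrite mxE expr0n.
  apply/andP; split.
    have /andP[h _] := bd th0 e00; apply: (le_trans h); apply: ereal_sup_ubound.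
    by exists th0.
  by apply: ge_ereal_sup => _ [th [_ te] <-]; have /andP[] := bd th te.
have fin : \forall eps \near 0^'+, F eps \is a fin_num.
  have := FP 1 ltr01; apply: filterS => eps /andP[h1 h2].
  by rewrite fin_numE; apply/andP; split; apply/eqP => E; rewrite E in h1 h2.
apply/fine_cvgP; split; first exact: fin.
apply/cvgrPdist_le => e e0; have := FP e e0; move: fin.
apply: filterS2 => eps Ff /andP[]; rewrite -(fineK Ff) !lee_fin => h1 h2.
by rewrite distrC ler_norml /=; apply/andP; split; lra.
Unshelve. all: by end_near.
Qed.

Lemma linearized_properties : asymptotic_properties N P est.
Proof.
split; last exact: linearized_efficient.
move=> KK cKK KP; have l := lin cKK KP; split.
- exact: (est_consistent K_gt0 speed_gt0 horizon_gt0 noise_gt0 front_ge0 obs r2 KP l).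
- exact: (est_normal K_gt0 speed_gt0 horizon_gt0 noise_gt0 front_ge0 source_detector obs r2 r3 r4 cKK KP l).
move=> p p0.
exact: (est_moments_converge K_gt0 speed_gt0 horizon_gt0 noise_gt0 front_ge0 source_detector obs r2 r3 r4 cKK KP l p0).
Qed.

End theorem.

Theorem theorem1 (R : realType) (K : nat) (N : network R K)
    (d : nat -> measure_display) (Om : forall n : nat, measurableType (d n))
    (P : forall n : nat, 'rV[R]_4 -> probability (Om n) R)
    (X : forall n : nat, 'I_K -> Om n -> cumulative R R)
    (K_ge4 : (4 <= K)%N)
    (detector_inj : injective (detector N))
    (speed_gt0 : 0 < speed N)
    (horizon_gt0 : 0 < horizon N)
    (noise_gt0 : 0 < noise N)
    (front_ge0 : forall (i : 'I_2) (k : 'I_K) (t : R), 0 <= front N i k t)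
    (source_detector : forall th : 'rV[R]_4, param N th ->
       forall (i : 'I_2) (k : 'I_K), source th i <> detector N k)
    (obs : forall (n : nat) (th : 'rV[R]_4), (0 < n)%N -> param N th ->
       observation N n th (P n th) (X n))
    (r1 : cond_R1 N) (r2 : cond_R2 N) (r3 : cond_R3 N) (r4 : cond_R4 N) :
  (forall est : forall n : nat, Om n -> 'rV[R]_4,
     (forall n : nat, is_mle N n (X n) (est n)) ->
     asymptotic_properties N P est) /\
  (forall q : 'rV[R]_4 -> R, prior_density (param N) q ->
     asymptotic_properties N P
       (fun n om => bayes N q n (fun k => X n k om))).
Proof.
have K_gt0 : (0 < K)%N by exact: leq_trans K_ge4.
split=> [est mle|q pq].
  apply: (@linearized_properties _ _ _ _ _ P X) => // KK cKK KP.
  exact: (mle_linearized speed_gt0 horizon_gt0 noise_gt0 front_ge0 source_detector obs r2 r3 r4 cKK KP mle).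
apply: (@linearized_properties _ _ _ _ _ P X) => // KK cKK KP.
exact: (bayes_linearized speed_gt0 horizon_gt0 noise_gt0 front_ge0 source_detector obs r2 r3 r4 cKK KP pq).
Qed.
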